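(* Let $\sigma:\mathbb{R}\to\mathbb{R}$ be a function for which there exists a constant $\mathcal{D}\ge 0$ such that $|\sigma(u)-\sigma(v)|\le \mathcal{D}|u-v|$ for all $u,v\in\mathbb{R}$, and assume $\sigma(0)\neq 0$. Let $u(t,x)$, $t\ge 0$, $x\in[0,1]$, be the mild solution of the stochastic heat equation $$\partial_t u(t,x)=\tfrac12\,\partial_x^2 u(t,x)+\sigma(u(t,x))\,\dot W(t,x),\qquad u(0,x)=u_0(x)\equiv 0,$$ on the circle $[0,1]$ with endpoints identified, where $\dot W$ is space-time white noise. Then there exists a non-degenerate (non-random) constant $\kappa\in(0,\infty)$ such that, almost surely, $$\liminf_{r\to 0^+}\ \sup_{\substack{0\le t\le r^4\\ x\in[0,r^2]}}\frac{|u(t,x)|}{f(r)}=\kappa,$$ where $f(r):=r\left[\log\log\left(\frac1r\right)\right]^{-\frac16}$ (defined for all sufficiently small $r>0$).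
   Context: $\dot W$ denotes space-time white noise on $\mathbb{R}_+\times[0,1]$, where $[0,1]$ is regarded as a circle with endpoints identified, and $W(dy\,ds)$ denotes stochastic integration against it in the sense of Walsh. $G:\mathbb{R}_+\times[0,1]\to\mathbb{R}$ is the fundamental solution of the heat equation on this circle, $\partial_t G(t,x)=\frac12\partial_x^2 G(t,x)$, $G(0,x)=\delta_0(x)$; explicitly, $G(t,x)=\sum_{k\in\mathbb{Z}}(2\pi t)^{-1/2}\exp\left(-\frac{(x+k)^2}{2t}\right)$ for $t>0$, extended $1$-periodically in $x$. The mild solution (in the sense of Walsh) with initial condition $u_0$ is the (unique, up to modification) random field $u$, adapted to the filtration of the white noise and with $\sup_{0\le t\le T,\,x\in[0,1]}E[|u(t,x)|^2]<\infty$ for every $T>0$, satisfying for all $(t,x)$, almost surely, $$u(t,x)=\int_0^1 G(t,x-y)u_0(y)\,dy+\int_0^t\int_0^1 G(t-s,x-y)\,\sigma(u(s,y))\,W(dy\,ds).$$ Here $u_0\equiv 0$, so the first term vanishes. As usual, $u$ denotes the version with continuous sample paths in $(t,x)$. *)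

(* Defs.v *)
From mathcomp Require Import all_boot all_order all_algebra.
From mathcomp Require Import all_classical all_reals all_analysis.

Set Implicit Arguments.
Unset Strict Implicit.
Unset Printing Implicit Defensive.

Import Order.TTheory GRing.Theory Num.Theory.
Import numFieldNormedType.Exports.

Local Open Scope classical_set_scope.
Local Open Scope ring_scope.

(* The circle is represented by [0, 1]; the points 0 and 1 are identified only
   through the 1-periodicity of the heat kernel in its space variable. *)

Definition area (R : realType) : set (R * R) -> \bar R :=
  (@lebesgue_measure R \x @lebesgue_measure R)%E.

Definition strip (R : realType) : set (R * R) := `[0, +oo[ `*` `[0, 1].

Definition finite_area_set (R : realType) (A : set (R * R)) : Prop :=
  [/\ measurable A, A `<=` @strip R & (area A < +oo)%E].

(* N(0, v); the library's [normal_prob 0 0] is not the point mass at 0. *)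
Definition centered_normal (R : realType) (v : R) (B : set R) : \bar R :=
  if v == 0 then \d_(0 : R) B else normal_prob 0 (Num.sqrt v) B.

(* Centered Gaussian process indexed by the Borel sets of finite area, with
   covariance E[W(A) W(B)] = |A `&` B|. *)
Definition white_noise (R : realType) (d : measure_display)
    (Omega : measurableType d) (P : probability Omega R)
    (W : set (R * R) -> Omega -> R) : Prop :=
  (forall A, finite_area_set A -> measurable_fun setT (W A)) /\
  (forall (n : nat) (A : 'I_n -> set (R * R)) (c : 'I_n -> R),
     (forall i, finite_area_set (A i)) ->
     forall B : set R, measurable B ->
       P [set w | B (\sum_(i < n) c i * W (A i) w)] =
       centered_normal
         (\sum_(i < n) \sum_(j < n) c i * c j * fine (area (A i `&` A j))) B).

(* The P-null events are included, since stochastic integrals are only defined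
   up to null events. *)
Definition noise_filtration (R : realType) (d : measure_display)
    (Omega : measurableType d) (P : probability Omega R)
    (W : set (R * R) -> Omega -> R) (t : R) : set (set Omega) :=
  <<s [set E | exists A B, [/\ finite_area_set A, A `<=` `[0, t] `*` `[0, 1],
                               measurable (B : set R) & E = W A @^-1` B]]
      `|` [set N | measurable N /\ P N = 0%E] >>.

Definition measurable_wrt (R : realType) (Omega : Type)
    (F : set (set Omega)) (X : Omega -> R) : Prop :=
  forall B : set R, measurable B -> F (X @^-1` B).

(* The process X(w) 1_]a, b](s) 1_A(y). *)
Record elementary (R : realType) (Omega : Type) := Elementary {
  el_left : R;
  el_right : R;
  el_space : set R;
  el_coef : Omega -> R }.

Definition valid_elementary (R : realType) (d : measure_display)
    (Omega : measurableType d) (P : probability Omega R)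
    (W : set (R * R) -> Omega -> R) (e : elementary R Omega) : Prop :=
  [/\ 0 <= el_left e <= el_right e,
      measurable (el_space e) /\ el_space e `<=` `[0, 1],
      exists M : R, forall w, `|el_coef e w| <= M
    & measurable_wrt (noise_filtration P W (el_left e)) (el_coef e)].

Record simple (R : realType) (Omega : Type) := Simple {
  simple_size : nat;
  simple_term : 'I_simple_size -> elementary R Omega }.

Definition valid_simple (R : realType) (d : measure_display)
    (Omega : measurableType d) (P : probability Omega R)
    (W : set (R * R) -> Omega -> R) (phi : simple R Omega) : Prop :=
  forall i : 'I_(simple_size phi), valid_elementary P W (simple_term i).

Definition simple_process (R : realType) (Omega : Type)
    (phi : simple R Omega) (s y : R) (w : Omega) : R :=
  \sum_(i < simple_size phi) let e := simple_term i in
     el_coef e w *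
     \1_(`]el_left e, el_right e]%classic `*` el_space e) (s, y).

Definition simple_integral (R : realType) (Omega : Type)
    (W : set (R * R) -> Omega -> R) (phi : simple R Omega) (w : Omega) : R :=
  \sum_(i < simple_size phi) let e := simple_term i in
     el_coef e w * W (`]el_left e, el_right e]%classic `*` el_space e) w.

(* [walsh_integral P W f I]: f is Walsh integrable over the strip, and I is a
   version of its integral.  The domain is the L^2(ds dy dP) closure of the
   simple processes, i.e. the square integrable processes that agree almost
   everywhere with a predictable one; the integral is extended to it by
   L^2-continuity.  Measurability of f is explicit because the library's
   integral of a non-measurable function is only a lower integral. *)
Definition walsh_integral (R : realType) (d : measure_display)
    (Omega : measurableType d) (P : probability Omega R)
    (W : set (R * R) -> Omega -> R) (f : R -> R -> Omega -> R)
    (I : Omega -> R) : Prop :=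
  [/\ measurable_fun setT (fun p : R * R * Omega => f p.1.1 p.1.2 p.2),
      measurable_fun setT I
    & exists phi : nat -> simple R Omega,
      [/\ forall n, valid_simple P W (phi n),
          (\int[(@lebesgue_measure R \x @lebesgue_measure R) \x P]_p
             ((simple_process (phi n) p.1.1 p.1.2 p.2
               - f p.1.1 p.1.2 p.2) ^+ 2)%:E)%E @[n --> \oo] --> 0%E
        & (\int[P]_w ((simple_integral W (phi n) w - I w) ^+ 2)%:E)%E
             @[n --> \oo] --> 0%E]].

Definition heat_kernel (R : realType) (t x : R) : R :=
  fine (\esum_(k in [set: int])
    (expR (- (x + k%:~R) ^+ 2 / (2 * t)) / Num.sqrt (2 * pi * t))%:E)%E.

(* The case t = 0 accounts for the kernel being the Dirac mass at time 0. *)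
Definition heat_flow (R : realType) (u0 : R -> R) (t x : R) : R :=
  if t == 0 then u0 x
  else \int[@lebesgue_measure R]_(y in `[0, 1]) (heat_kernel t (x - y) * u0 y).

(* The integrand of the stochastic term, cut off to ]0, t[ x [0, 1]. *)
Definition mild_integrand (R : realType) (Omega : Type) (sigma : R -> R)
    (u : R -> R -> Omega -> R) (t x : R) (s y : R) (w : Omega) : R :=
  \1_(`]0, t[%classic `*` `[0, 1]%classic) (s, y) *
  (heat_kernel (t - s) (x - y) * sigma (u s y w)).

Definition mild_solution (R : realType) (d : measure_display)
    (Omega : measurableType d) (P : probability Omega R)
    (W : set (R * R) -> Omega -> R) (sigma u0 : R -> R)
    (u : R -> R -> Omega -> R) : Prop :=
  [/\ forall t x, 0 <= t -> 0 <= x <= 1 ->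
        measurable_wrt (noise_filtration P W t) (u t x),
      forall T : R, 0 < T -> exists M : R, forall t x,
        0 <= t <= T -> 0 <= x <= 1 ->
        (\int[P]_w (`|u t x w| ^+ 2)%:E <= M%:E)%E
    & forall t x, 0 <= t -> 0 <= x <= 1 ->
        walsh_integral P W (mild_integrand sigma u t x)
          (fun w => u t x w - heat_flow u0 t x)].

Definition continuous_paths (R : realType) (d : measure_display)
    (Omega : measurableType d) (P : probability Omega R)
    (u : R -> R -> Omega -> R) : Prop :=
  {ae P, forall w, {within @strip R, continuous (fun p => u p.1 p.2 w)}}.

Definition chung_gauge (R : realType) (r : R) : R :=
  r * ln (ln (1 / r)) `^ (- (1 / 6)).

Definition scaled_sup (R : realType) (Omega : Type)
    (u : R -> R -> Omega -> R) (w : Omega) (r : R) : \bar R :=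
  ereal_sup [set (`|u p.1 p.2 w| / chung_gauge r)%:E
            | p in `[0, r ^+ 4] `*` `[0, r ^+ 2]].

(* Main.v *)
(* The events that the supremum over the box [0, r^4] x [0, r^2] exceeds c f(r)
   for all small r belong to the noise filtration at every positive
   time.  A zero-one law for the germ field of the noise makes their
   probabilities 0 or 1, so the liminf is a constant, and for each of the two
   bounds it is enough to work on a set of positive probability on which |u| <= 1
   near time 0.  On such a set an exponential martingale (Bernstein) inequality
   for Walsh integrals replaces u by the Gaussian field with kernel sigma(0) G and
   controls the increments of u along a grid of scales 4^-j.

   Lower bound, along r = 4^-n.  Take K space points and about K^2 times in the
   box, with K^3 of order log n.  Each time step brings fresh noise in windows
   around the K points; the covariances with these windows are diagonally
   dominant, so the probability that the field stays small at all points gains a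
   factor 2^-K per time step.  The resulting bounds are summable.

   Upper bound, along r = 4^-(n^2).  Dyadic chaining together with a weak form of
   Sidak's inequality bounds the small ball probability from below by 1/(4n).
   The weak inequality comes from coding the rounded Gaussian vector: by Kraft's
   inequality some code word is shared by two independent copies with the
   required probability, and the difference of the copies is again Gaussian with
   twice the covariance.  The part of the field driven by the noise of one time
   slab gives independent events, and the second Borel-Cantelli lemma applies. *)
From HB Require Import structures.
From mathcomp Require Import all_boot all_order all_algebra.
From mathcomp Require Import all_classical all_reals all_analysis.
From mathcomp Require Import measurable_realfun ring lra zify.
Require Import Defs.
Set Implicit Arguments.
Unset Strict Implicit.
Unset Printing Implicit Defensive.
Import Order.TTheory GRing.Theory Num.Theory.
Import numFieldNormedType.Exports.
Local Open Scope classical_set_scope.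
Local Open Scope ring_scope.

(** * The Cramer-Wold device *)

(** The exponent 1/6 comes from counting. With K points in space at distances of order r^2/K and
    about K^2 times at steps of order (r^2/K)^2, each of the K^3 values carries fresh noise of
    standard deviation about r/sqrt(K). Confining all of them to that size costs exp(-c K^3), and
    K^3 of order log n turns r/sqrt(K) into r (log n)^(-1/6). On r = 4^-n and on r = 4^-(n^2), log
    log (1/r) is comparable to log n, so the estimates are stated in sixth powers times ln n and the
    gauge enters only at the end. The upper bound needs the sparser scales: the noise before the
    slab of scale n is then smaller than the field by a factor of order 4^(-2n).

    The noise is given only through the laws of its single linear combinations. Joint laws,
    independence, even additivity over sets have to be derived from these; hence the Cramer-Wold
    device, built from cosines by explicit integrals.

    Bernstein tails are used only on an event where u is bounded near time 0, which makes the energy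
    of every increment deterministic. No stopping time and no truncation of [sigma] is needed. *)

Section calculus.
Context {R : realType}.
Notation leb := (@lebesgue_measure R).
Implicit Types (a b t x : R).

Lemma measurable_continuous (f : R -> R) : continuous f -> measurable_fun setT f.
Proof. exact: measurable_realfun.continuous_measurable_fun. Qed.

Lemma FTC_global (F f : R -> R) a b : a <= b ->
  (forall x, is_derive x 1 F (f x)) -> continuous f ->
  (\int[leb]_(x in `[a, b]) (f x)%:E = (F b - F a)%:E)%E.
Proof.
rewrite le_eqVlt => /predU1P[<-|ab] dF cf.
  by rewrite set_itv1 integral_set1 subrr.
have cF : continuous F.
  by move=> x; apply: differentiable_continuous; apply/derivable1_diffP; case: (dF x).
rewrite EFinB; apply: continuous_FTC2 => //.
- exact/continuous_subspaceT/cf.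
- split; [by move=> x _; case: (dF x)| |].
  + exact/cvg_at_right_filter/cF.
  + exact/cvg_at_left_filter/cF.
- by move=> x _; rewrite derive1E; case: (dF x) => _.
Qed.

Lemma Rintegral_FTC_global (F f : R -> R) a b : a <= b ->
  (forall x, is_derive x 1 F (f x)) -> continuous f ->
  (\int[leb]_(x in `[a, b]) f x = F b - F a).
Proof. by move=> ab dF cf; rewrite /Rintegral (FTC_global ab dF cf). Qed.

(** As [T] grows the right side tends to the Cauchy profile 1/(1+z^2). This presents that profile as
    a limit of mixtures of cosines, the first stage of the inversion below. *)
Lemma int_expcos (T z : R) : 0 <= T ->
  \int[leb]_(t in `[0, T]) (expR (- t) * cos (t * z)) =
  (1 + z ^+ 2)^-1 * (1 + expR (- T) * (z * sin (T * z) - cos (T * z))).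
Proof.
move=> T0.
have z1 : 1 + z ^+ 2 != 0 by rewrite gt_eqF// ltr_pwDl// sqr_ge0.
pose F t := (1 + z ^+ 2)^-1 * (expR (- t) * (z * sin (t * z) - cos (t * z))).
have dF t : is_derive t 1 F (expR (- t) * cos (t * z)).
  by apply: is_derive_eq; rewrite /GRing.scale/=; field.
rewrite (Rintegral_FTC_global T0 dF).
  by rewrite /F !(mul0r, oppr0, expR0, sin0, cos0, mulr0, sub0r, mul1r); ring.
move=> t; apply: cvgM.
  apply: continuous_comp; [exact: opp_continuous|exact: continuous_expR].
apply: continuous_comp; [exact: mulrr_continuous|exact: continuous_cos].
Qed.

End calculus.

(** * From cosines to intervals in one variable *)

Section cramer_wold.
Context {R : realType}.
Notation leb := (@lebesgue_measure R).

Lemma continuous_inv1sqr : continuous (fun z : R => (1 + z ^+ 2)^-1).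
Proof.
move=> z; apply: cvgV; first by rewrite gt_eqF// ltr_pwDl// sqr_ge0.
by apply: cvgD; [exact: cvg_cst|exact: exprn_continuous].
Qed.

Lemma bounded_integrable d (T : measurableType d) (P : probability T R)
    (f : T -> R) (M : R) : measurable_fun setT f -> (forall x, `|f x| <= M) ->
  P.-integrable setT (EFin \o f).
Proof.
move=> mf fM; apply: measurable_bounded_integrable => //.
  exact: fin_num_fun_lty.
by exists M; split; [exact: num_real|move=> x /ltW Mx y _; apply: le_trans Mx; exact: fM].
Qed.

Lemma bounded_itv_integrable (f : R -> R) (a b M : R) :
  measurable_fun setT f -> (forall x, `|f x| <= M) ->
  leb.-integrable `[a, b] (EFin \o f).
Proof.
move=> mf fM; apply: measurable_bounded_integrable => //.
- by rewrite /= lebesgue_measure_itv/=; case: ifP => // _; rewrite -EFinB ltry.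
- exact: measurable_funTS.
- by exists M; split; [exact: num_real|move=> x /ltW Mx y _; apply: le_trans Mx; exact: fM].
Qed.

Lemma swap_int d (T : measurableType d) (P : probability T R)
    (f : T * R -> R) (a b M : R) :
  measurable_fun setT f -> (forall z, `|f z| <= M) ->
  (\int[P]_w (\int[leb]_(t in `[a, b]) f (w, t))%:E =
   \int[leb]_(t in `[a, b]) \int[P]_w (f (w, t))%:E)%E.
Proof.
move=> mf fM.
pose h (z : T * R) := f z * \1_`[a, b] z.2.
have mh : measurable_fun setT h.
  apply: measurable_funM => //; apply: measurableT_comp => //.
have hM z : `|h z| <= M * \1_`[a, b] z.2.
  by rewrite normrM ler_pM// ger0_norm// ?indicE.
have M0 : 0 <= M.
  by apply: le_trans (fM (point, 0)) => //.
have ih : (P \x leb)%E.-integrable setT (EFin \o h).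
  apply/integrable12ltyP; first exact/measurable_EFinP.
  apply: (@le_lt_trans _ _ (\int[P]_x \int[leb]_y (M * \1_`[a, b] y)%:E)%E).
    apply: ge0_le_integral => //=.
    - by move=> x _; apply: integral_ge0.
    - apply: (@measurable_fun_fubini_tonelli_F _ _ _ _ _ leb (fun z => `|(h z)%:E|%E)) => //.
      by apply: measurableT_comp => //; exact/measurable_EFinP.
    - move=> x _; apply: ge0_le_integral => //=.
      + apply/measurable_EFinP; apply: measurableT_comp => //.
        exact: (measurableT_comp mh (pair1_measurable x)).
      + by apply/measurable_EFinP; apply: measurable_funM.
      + by move=> y _; rewrite lee_fin.
  have K : (\int[leb]_y (M * \1_`[a, b] y)%:E < +oo)%E.
    under eq_integral do rewrite EFinM.
    rewrite integralZl//; last exact: integrable_indic_itv.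
    rewrite integral_indic//= setIT lebesgue_measure_itv/=.
    by case: ifP => _; rewrite ?mule0// -EFinB -EFinM ltry.
  by rewrite integral_cst//= probability_setT mule1.
transitivity (\int[P]_w \int[leb]_t (EFin \o h) (w, t))%E.
  apply: eq_integral => w _.
  rewrite /Rintegral fineK; last first.
    apply: integrable_fin_num => //; apply: (@bounded_itv_integrable (fun t => f (w, t)) a b M) => //.
    exact: (measurableT_comp mf (pair1_measurable w)).
  rewrite integral_mkcond; apply: eq_integral => t _; rewrite patchE /h/= indicE.
  by case: (t \in _); rewrite ?mulr1 ?mulr0.
rewrite (integral12_prod_meas1 ih) -(integral21_prod_meas1 ih) [RHS]integral_mkcond.
apply: eq_integral => t _; rewrite patchE /fubini_G /h/= indicE.
case: (t \in _) => /=; first by apply: eq_integral => w _; rewrite mulr1.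
by under eq_integral do rewrite mulr0; rewrite integral0.
Qed.

Section one_dim.
Context d1 (T1 : measurableType d1) (P1 : probability T1 R).
Context d2 (T2 : measurableType d2) (P2 : probability T2 R).
Variables (u1 : T1 -> R) (u2 : T2 -> R) (X1 : T1 -> R) (X2 : T2 -> R) (M : R).
Hypotheses (mu1 : measurable_fun setT u1) (mu2 : measurable_fun setT u2).
Hypotheses (mX1 : measurable_fun setT X1) (mX2 : measurable_fun setT X2).
Hypotheses (u1M : forall w, `|u1 w| <= M) (u2M : forall w, `|u2 w| <= M).

(** The bounded weights [u1], [u2] may change sign. They make the one-variable result iterate: in
    several variables they hold the cosines and indicators of the other coordinates. The class of
    admissible [g] grows from cosines to Cauchy profiles, then to differences of arctangents, then
    to indicators of intervals. *)
Let same (g : R -> R) :=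
  (\int[P1]_w (u1 w * g (X1 w))%:E = \int[P2]_w (u2 w * g (X2 w))%:E)%E.

Let same_int (g : R * R -> R) (a b N : R) :
  measurable_fun setT g -> (forall z, `|g z| <= N) ->
  (forall t, same (fun x => g (x, t))) ->
  same (fun x => \int[leb]_(t in `[a, b]) g (x, t)).
Proof.
move=> mg gN H; rewrite /same.
have E d (T : measurableType d) (P : probability T R) (u X : T -> R) :
    measurable_fun setT u -> measurable_fun setT X -> (forall w, `|u w| <= M) ->
    (\int[P]_w (u w * \int[leb]_(t in `[a, b]) g (X w, t))%:E =
     \int[leb]_(t in `[a, b]) \int[P]_w (u w * g (X w, t))%:E)%E.
  move=> mu mX uM.
  have M0 : 0 <= M by apply: le_trans (uM point).
  rewrite -(@swap_int _ _ P (fun z => u z.1 * g (X z.1, z.2)) a b (M * N)).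
  - apply: eq_integral => w _; congr EFin; rewrite -RintegralZl//.
    apply: (@bounded_itv_integrable (fun t => g (X w, t)) a b N) => //.
    exact: (measurableT_comp mg (pair1_measurable (X w))).
  - apply: measurable_funM; first exact: measurableT_comp.
    apply: measurableT_comp => //; apply: measurable_fun_pair => //.
    exact: (measurableT_comp mX measurable_fst).
  - by move=> z; rewrite normrM ler_pM.
rewrite !E//; apply: eq_integral => t _; exact: H.
Qed.

Let same_lim (g_ : nat -> R -> R) (g : R -> R) (N : R) :
  (forall n, measurable_fun setT (g_ n)) ->
  (forall n x, `|g_ n x| <= N) ->
  (forall x, g_ n x @[n --> \oo] --> g x) ->
  (forall n, same (g_ n)) -> same g.
Proof.
move=> mg gN gc H; rewrite /same.
have mgl : measurable_fun setT g.
  by apply: (@measurable_fun_cvg _ _ _ _ g_) => // x _; exact: gc.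
have E d (T : measurableType d) (P : probability T R) (u X : T -> R) :
    measurable_fun setT u -> measurable_fun setT X -> (forall w, `|u w| <= M) ->
    (\int[P]_w (u w * g_ n (X w))%:E @[n --> \oo] --> \int[P]_w (u w * g (X w))%:E)%E.
  move=> mu mX uM.
  have M0 : 0 <= M by apply: le_trans (uM point).
  have [] := @dominated_convergence _ _ _ P setT measurableT
    (fun n w => (u w * g_ n (X w))%:E) (fun w => (u w * g (X w))%:E) (cst (M * N)%:E) => //.
  - move=> n; apply/measurable_EFinP; apply: measurable_funM => //; exact: measurableT_comp.
  - apply/measurable_EFinP; apply: measurable_funM => //; exact: measurableT_comp.
  - apply: aeW => w _; apply: cvg_EFin; first exact: nearW.
    by apply: cvgMr; exact: gc.
  - exact: finite_measure_integrable_cst.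
  - by apply: aeW => w n _; rewrite /= lee_fin normrM ler_pM.
have C1 := E _ _ P1 _ _ mu1 mX1 u1M.
have C2 := E _ _ P2 _ _ mu2 mX2 u2M.
have EQ : (fun n => \int[P1]_w (u1 w * g_ n (X1 w))%:E)%E =
          (fun n => \int[P2]_w (u2 w * g_ n (X2 w))%:E)%E.
  by apply/funext => n; exact: H.
rewrite EQ in C1; exact: (cvg_unique _ C1 C2).
Qed.

Let same_scale (g : R -> R) (c N : R) : measurable_fun setT g ->
  (forall x, `|g x| <= N) -> same g -> same (fun x => c * g x).
Proof.
move=> mg gN H; rewrite /same.
have E d (T : measurableType d) (P : probability T R) (u X : T -> R) :
    measurable_fun setT u -> measurable_fun setT X -> (forall w, `|u w| <= M) ->
    (\int[P]_w (u w * (c * g (X w)))%:E = c%:E * \int[P]_w (u w * g (X w))%:E)%E.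
  move=> mu mX uM; have M0 : 0 <= M by apply: le_trans (uM point).
  rewrite -integralZl//.
    by apply: eq_integral => w _; rewrite -EFinM mulrCA.
  apply: (@bounded_integrable _ _ P (fun w => u w * g (X w)) (M * N)).
    apply: measurable_funM => //; exact: measurableT_comp.
  by move=> w; rewrite normrM ler_pM.
by rewrite !E// H.
Qed.

Hypothesis same_cos : forall xi theta, same (fun x => cos (xi * x + theta)).

(** The cosines are averaged against exp(-t) over [[0, n]] and n tends to infinity. The closed form
    of [int_expcos] supplies both the uniform bound 3 and an error of order exp(-n). *)
Let same_cauchy (k y : R) : same (fun x => (1 + (k * (y - x)) ^+ 2)^-1).
Proof.
pose g (z : R * R) := expR (- `|z.2|) * cos (z.2 * (k * (y - z.1))).
have mg : measurable_fun setT g.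
  apply: measurable_funM.
    apply: measurableT_comp => //; apply: measurableT_comp => //.
    exact: (measurableT_comp (@normr_measurable _ _)).
  apply: (measurableT_comp (measurable_continuous (@continuous_cos R))).
  apply: measurable_funM => //; apply: measurable_funM => //.
  exact: measurable_funB.
have gN z : `|g z| <= 1.
  have e1 : expR (- `|z.2|) <= 1 by rewrite -expR0 ler_expR oppr_le0.
  have c1 : `|cos (z.2 * (k * (y - z.1)))| <= 1 by rewrite ler_norml cos_geN1 cos_le1.
  by rewrite normrM (ger0_norm (expR_ge0 _)); apply: mulr_ile1 => //; apply: expR_ge0.
have Hg t : same (fun x => g (x, t)).
  rewrite (_ : (fun x => _) = (fun x => expR (- `|t|) * cos ((- (t * k)) * x + t * k * y))).
    apply: (@same_scale _ _ 1) => //.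
    - apply: (measurableT_comp (measurable_continuous (@continuous_cos R))).
      by apply: measurable_funD => //; exact: measurable_funM.
    - by move=> x; rewrite ler_norml cos_geN1 cos_le1.
  by apply/funext => x; rewrite /g/=; congr (_ * cos _); ring.
have bd (z s c : R) : `|s| <= 1 -> `|c| <= 1 ->
    `|(1 + z ^+ 2)^-1 * (z * s - c)| <= 2.
  rewrite !ler_norml => /andP[s1 s2] /andP[c1 c2].
  have z1 : 0 < 1 + z ^+ 2 by rewrite ltr_pwDl// sqr_ge0.
  have h1 : 0 <= (z - s) ^+ 2 := sqr_ge0 _.
  have h2 : 0 <= (z + s) ^+ 2 := sqr_ge0 _.
  have h3 : s ^+ 2 <= 1 by nra.
  have h4 : 0 <= z ^+ 2 := sqr_ge0 _.
  by rewrite ler_pdivlMl// ler_pdivrMl//; apply/andP; split; lra.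
have sc1 (z : R) : `|sin z| <= 1 /\ `|cos z| <= 1.
  by rewrite !ler_norml sin_geN1 sin_le1 cos_geN1 cos_le1.
pose b (n : nat) x : R := let z := k * (y - x) in
  (1 + z ^+ 2)^-1 * (z * sin (n%:R * z) - cos (n%:R * z)).
pose h (n : nat) x : R := (1 + (k * (y - x)) ^+ 2)^-1 + expR (- n%:R) * b n x.
have b2 n x : `|b n x| <= 2 by apply: bd; case: (sc1 (n%:R * (k * (y - x)))).
have mz : measurable_fun setT (fun x : R => k * (y - x)).
  by apply: measurable_funM => //; exact: measurable_funB.
have mV : measurable_fun setT (fun x : R => (1 + (k * (y - x)) ^+ 2)^-1).
  by apply: (measurableT_comp (measurable_continuous continuous_inv1sqr)).
apply: (@same_lim h _ 3).
- move=> n; apply: measurable_funD => //; apply: measurable_funM => //.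
  apply: measurable_funM => //; apply: measurable_funB.
    apply: measurable_funM => //.
    apply: (measurableT_comp (measurable_continuous (@continuous_sin R))).
    exact: measurable_funM.
  apply: (measurableT_comp (measurable_continuous (@continuous_cos R))).
  exact: measurable_funM.
- move=> n x; apply: (le_trans (ler_normD _ _)).
  rewrite (_ : 3 = 1 + 1 * 2 :> R); last by ring.
  apply: lerD.
    by rewrite ger0_norm ?invr_ge0 ?addr_ge0 ?sqr_ge0// invf_le1 ?lerDl ?sqr_ge0// ltr_pwDl// sqr_ge0.
  rewrite normrM; apply: ler_pM => //.
  by rewrite ger0_norm ?expR_ge0// -expR0 ler_expR oppr_le0.
- move=> x; rewrite -[X in _ --> X]addr0; apply: cvgD; first exact: cvg_cst.
  have e0 : expR (- n%:R) @[n --> \oo] --> (0 : R).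
    by apply: (cvg_comp _ _ _ (@cvgr_expR R)); exact: cvgr_idn.
  have e1 : 2 * expR (- n%:R) @[n --> \oo] --> (0 : R).
    by rewrite -[X in _ --> X](mulr0 2); apply: cvgM e0; exact: cvg_cst.
  have e2 : - (2 * expR (- n%:R)) @[n --> \oo] --> (0 : R).
    by rewrite -[X in _ --> X]oppr0; exact: cvgN.
  apply: (squeeze_cvgr _ e2 e1); apply: nearW => n.
  by rewrite -ler_norml normrM ger0_norm ?expR_ge0// mulrC ler_wpM2r// expR_ge0.
- move=> n; rewrite (_ : h n = (fun x => \int[leb]_(t in `[0, n%:R]) g (x, t))).
    exact: (same_int 0 n%:R mg gN Hg).
  apply/funext => x; rewrite /h /b /=.
  transitivity (\int[leb]_(t in `[0, n%:R]) (expR (- t) * cos (t * (k * (y - x))))).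
    by rewrite int_expcos//; ring.
  apply: eq_Rintegral => t; rewrite inE/= in_itv/= => /andP[t0 _].
  by rewrite /g/= ger0_norm.
Qed.

(** The Cauchy profile is integrated in its centre over [[a, b]]; [k] is the steepness of the
    smoothed indicator that results. *)
Let same_atan (k a b : R) : 0 < k -> a <= b ->
  same (fun x => atan (k * (b - x)) - atan (k * (a - x))).
Proof.
move=> k0 ab.
pose g (z : R * R) := k * (1 + (k * (z.2 - z.1)) ^+ 2)^-1.
have gp z : 0 < 1 + (k * (z.2 - z.1)) ^+ 2 :> R.
  by rewrite ltr_pwDl// sqr_ge0.
have cg (x : R) : continuous (fun y => g (x, y)).
  move=> y; apply: cvgM; first exact: cvg_cst.
  apply: (@continuous_comp _ _ _ (fun y : R => k * (y - x)) (fun z : R => (1 + z ^+ 2)^-1)).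
    by apply: cvgM; [exact: cvg_cst|apply: cvgB; [exact: cvg_id|exact: cvg_cst]].
  exact: continuous_inv1sqr.
have E x : atan (k * (b - x)) - atan (k * (a - x)) =
    \int[leb]_(y in `[a, b]) g (x, y).
  have dF (y : R) : is_derive y 1 (fun y : R => atan (k * (y - x))) (g (x, y)).
    by apply: is_derive_eq; rewrite /GRing.scale/= /g/=; ring.
  by rewrite (Rintegral_FTC_global ab dF).
rewrite (_ : (fun x => _) = (fun x => \int[leb]_(y in `[a, b]) g (x, y))); last first.
  by apply/funext => x; exact: E.
apply: (@same_int g a b k).
- apply: measurable_funM => //.
  apply: (measurableT_comp (measurable_continuous continuous_inv1sqr)).
  by apply: measurable_funM => //; exact: measurable_funB.
- move=> z; rewrite /g ger0_norm; last by rewrite mulr_ge0 ?invr_ge0 ?(ltW k0)// ltW.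
  by rewrite ler_piMr ?(ltW k0)// invf_le1 ?gp// lerDl sqr_ge0.
- move=> t; apply: (@same_scale _ _ 1) => //.
  + apply: (measurableT_comp (measurable_continuous continuous_inv1sqr)).
    by rewrite /=; apply: measurable_funM => //; exact: measurable_funB.
  + move=> x; have p := gp (x, t); rewrite /= in p.
    by rewrite ger0_norm ?invr_ge0 ?(ltW p)// invf_le1// lerDl sqr_ge0.
  + exact: same_cauchy.
Qed.

(** The shift 1/(n+1) moves the jump just to the right of [c], while the slope (n+1)^2 still sends
    the argument to infinity at x = c. Hence the limit at [c] itself is pi/2, and half-open
    intervals come out exactly even if the law has atoms. *)
Let atan_lim (c x : R) :
  (atan (n.+1%:R ^+ 2 * (c + n.+1%:R^-1 - x)) @[n --> \oo] -->
   (if x <= c then pi / 2 else - (pi / 2) : R)).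
Proof.
have hN : (n.+1%:R : R) @[n --> \oo] --> +oo.
  apply/cvgryPge => A; near=> n; apply: (@le_trans _ _ n%:R); last by rewrite ler_nat.
  by near: n; exact: nbhs_infty_ger.
have h1 : (atan (n.+1%:R : R) @[n --> \oo] --> pi / 2).
  by apply: cvg_comp hN _; exact: cvgy_atan.
case: ifPn => [xc|]; last rewrite -ltNge => cx.
  apply: (squeeze_cvgr _ h1 (cvg_cst (pi / 2))).
  apply: nearW => n; rewrite [X in _ && X]ltW ?atan_ltpi2// andbT.
  apply: le_atan; rewrite -[leLHS](@mulfK _ n.+1%:R) ?pnatr_eq0// -expr2.
  by rewrite ler_pM2l ?exprn_gt0 ?ltr0n// addrAC -addrC lerDl subr_ge0.
have h2 : (- atan (n.+1%:R : R) @[n --> \oo] --> - (pi / 2)) by exact: cvgN h1.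
apply: (squeeze_cvgr _ (cvg_cst (- (pi / 2))) h2).
near=> n; rewrite [X in X && _]ltW ?atan_gtNpi2//= -atanN.
  apply: le_atan.
  have n0 : 0 < n.+1%:R :> R by rewrite ltr0n.
  have hn : 2 / (x - c) <= n.+1%:R :> R by near: n; move/cvgryPge : hN; exact.
  move: n0 hn; set N := n.+1%:R => n0; rewrite ler_pdivrMr ?subr_gt0// => h.
  have N0 : N != 0 by rewrite gt_eqF.
  rewrite (_ : N ^+ 2 * _ = N - N * (N * (x - c))); last by field.
  by nra.
Unshelve. all: by end_near.
Qed.

Lemma same_itv (a b : R) : same \1_`]a, b].
Proof.
have [ba|ab] := leP b a.
  rewrite (_ : `]a, b]%classic = set0) ?indic0/same; last first.
    by rewrite set_itv_ge// bnd_simp -leNgt.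
  by under eq_integral do rewrite mulr0; under [RHS]eq_integral do rewrite mulr0; rewrite !integral0.
pose g n x : R := pi^-1 * (atan (n.+1%:R ^+ 2 * (b + n.+1%:R^-1 - x)) - atan (n.+1%:R ^+ 2 * (a + n.+1%:R^-1 - x))).
have mh (k c : R) : measurable_fun setT (fun x : R => atan (k * (c - x))).
  apply: (measurableT_comp (measurable_continuous (@continuous_atan R))).
  by apply: measurable_funM => //; exact: measurable_funB.
have ap (x y : R) : `|atan x - atan y| <= pi.
  have := atan_ltpi2 x; have := atan_gtNpi2 x; have := atan_ltpi2 y; have := atan_gtNpi2 y.
  by rewrite ler_norml => *; lra.
apply: (@same_lim g _ 1).
- by move=> n; apply: measurable_funM => //; exact: measurable_funB.
- by move=> n x; rewrite normrM gtr0_norm ?invr_gt0 ?pi_gt0// ler_pdivrMl ?pi_gt0// mulr1.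
- move=> x; rewrite (_ : \1_`]a, b] x = pi^-1 * ((if x <= b then pi / 2 else - (pi / 2)) -
     (if x <= a then pi / 2 else - (pi / 2)))).
    by apply: cvgM; [exact: cvg_cst|apply: cvgB; exact: atan_lim].
  have p0 : pi != 0 :> R by rewrite gt_eqF// pi_gt0.
  rewrite indicE; have [xa|ax] := leP x a; rewrite mem_setE in_itv/=.
    by rewrite (le_trans xa (ltW ab)) ltNge xa/= subrr mulr0.
  by rewrite ax; case: ifP => _ /=; [rewrite opprK -splitr mulVf|rewrite subrr mulr0].
- move=> n; apply: (same_scale _ _ (fun x => ap _ _)); first exact: measurable_funB.
  by apply: same_atan; [rewrite exprn_gt0|rewrite lerD2r ltW].
Qed.

End one_dim.
End cramer_wold.

(** * The weighted Cramer-Wold device in several variables *)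

Section cramer_wold_multi.
Context {R : realType} (I : finType).
Context d1 (T1 : measurableType d1) (P1 : probability T1 R).
Context d2 (T2 : measurableType d2) (P2 : probability T2 R).
Variables (X1 : I -> T1 -> R) (X2 : I -> T2 -> R) (a b : I -> R).
Hypotheses (mX1 : forall i, measurable_fun setT (X1 i)).
Hypotheses (mX2 : forall i, measurable_fun setT (X2 i)).

Definition lin (T : Type) (X : I -> T -> R) (r : seq I) (c : I -> R) w :=
  \sum_(i <- r) c i * X i w.
Definition boxf (T : Type) (X : I -> T -> R) (r : seq I) w : R :=
  \prod_(i <- r) \1_`]a i, b i] (X i w).

Lemma measurable_lin d (T : measurableType d) (X : I -> T -> R) r c :
  (forall i, measurable_fun setT (X i)) -> measurable_fun setT (lin X r c).
Proof. by move=> mX; apply: measurable_sum => i; exact: measurable_funM. Qed.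

Lemma measurable_cosf d (T : measurableType d) (f : T -> R) :
  measurable_fun setT f -> measurable_fun setT (fun w => cos (f w)).
Proof. exact: (measurableT_comp (measurable_continuous (@continuous_cos R))). Qed.

(** Induction on the coordinates: the indicator of the head is absorbed into the weight. That the
    new weights still agree on the cosines of the tail follows from [same_itv] applied to the head,
    with the tail cosine as weight, because a product of two cosines is a sum of cosines of linear
    combinations. *)
Lemma cramer_wold_seq (r : seq I) : uniq r ->
  forall (u1 : T1 -> R) (u2 : T2 -> R) (M : R),
  measurable_fun setT u1 -> measurable_fun setT u2 ->
  (forall w, `|u1 w| <= M) -> (forall w, `|u2 w| <= M) ->
  (forall c theta,
     (\int[P1]_w (u1 w * cos (lin X1 r c w + theta))%:E =
      \int[P2]_w (u2 w * cos (lin X2 r c w + theta))%:E)%E) ->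
  (\int[P1]_w (u1 w * boxf X1 r w)%:E = \int[P2]_w (u2 w * boxf X2 r w)%:E)%E.
Proof.
elim: r => [_ u1 u2 M _ _ _ _ H|i r IH /= /andP[ir ur] u1 u2 M mu1 mu2 u1M u2M H].
  have := H (fun=> 0) 0.
  under eq_integral do rewrite /lin big_nil addr0 cos0 mulr1.
  under [in RHS]eq_integral do rewrite /lin big_nil addr0 cos0 mulr1.
  by move=> E; under eq_integral do rewrite /boxf big_nil mulr1;
    under [in RHS]eq_integral do rewrite /boxf big_nil mulr1.
pose v (T : Type) (X : I -> T -> R) (u : T -> R) w := u w * \1_`]a i, b i] (X i w).
have mv d (T : measurableType d) (X : I -> T -> R) u :
    measurable_fun setT (X i) -> measurable_fun setT u -> measurable_fun setT (v T X u).
  by move=> mX mu; apply: measurable_funM => //; exact: measurableT_comp.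
have vM (T : Type) (X : I -> T -> R) u w : `|u w| <= M -> `|v T X u w| <= M.
  move=> uM; rewrite /v normrM -[leRHS]mulr1; apply: ler_pM => //.
  by rewrite indicE; case: (_ \in _); rewrite ?normr1 ?normr0.
have E (T : Type) (X : I -> T -> R) u w : u w * boxf X (i :: r) w = v T X u w * boxf X r w.
  by rewrite /boxf big_cons mulrA.
under eq_integral do rewrite E; under [RHS]eq_integral do rewrite E.
apply: (IH ur (v _ X1 u1) (v _ X2 u2) M (mv _ _ _ _ (mX1 i) mu1) (mv _ _ _ _ (mX2 i) mu2)
  (fun w => vM _ _ _ w (u1M w)) (fun w => vM _ _ _ w (u2M w))).
move=> c theta; rewrite /v.
have cb (x : R) : `|cos x| <= 1 by rewrite ler_norml cos_geN1 cos_le1.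
have mc d (T : measurableType d) (X : I -> T -> R) s c' th :
    (forall i, measurable_fun setT (X i)) ->
    measurable_fun setT (fun w => cos (lin X s c' w + th)).
  by move=> mX; apply: measurable_cosf; apply: measurable_funD => //; exact: measurable_lin.
have mp d (T : measurableType d) (X : I -> T -> R) (u : T -> R) :
    (forall i, measurable_fun setT (X i)) -> measurable_fun setT u ->
    measurable_fun setT (fun w => u w * cos (lin X r c w + theta)).
  by move=> mX mu; apply: measurable_funM => //; exact: mc.
have bp (T : Type) (X : I -> T -> R) u w : `|u w| <= M -> `|u w * cos (lin X r c w + theta)| <= M.
  by move=> uM; rewrite normrM -[leRHS]mulr1; apply: ler_pM.
under eq_integral do rewrite mulrAC; under [RHS]eq_integral do rewrite mulrAC.
apply: (same_itv (mp _ _ _ _ mX1 mu1) (mp _ _ _ _ mX2 mu2) (mX1 i) (mX2 i)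
  (fun w => bp _ X1 _ w (u1M w)) (fun w => bp _ X2 _ w (u2M w))) => xi th.
pose c1 j := if j == i then xi else c j.
pose c2 j := if j == i then xi else - c j.
have E2 d (T : measurableType d) (P : probability T R) (X : I -> T -> R) (u : T -> R) :
    (forall i, measurable_fun setT (X i)) -> measurable_fun setT u ->
    (forall w, `|u w| <= M) ->
    (\int[P]_w (u w * cos (lin X r c w + theta) * cos (xi * X i w + th))%:E =
     2^-1%:E * (\int[P]_w (u w * cos (lin X (i :: r) c1 w + (th + theta)))%:E +
      \int[P]_w (u w * cos (lin X (i :: r) c2 w + (th - theta)))%:E))%E.
  move=> mX mu uM.
  have int s c' t : P.-integrable setT (fun w => (u w * cos (lin X s c' w + t))%:E).
    apply: (bounded_integrable P (M := M)).
      by apply: measurable_funM => //; exact: mc.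
    by move=> w; rewrite normrM -[leRHS]mulr1; apply: ler_pM.
  rewrite -integralD//.
  rewrite -integralZl//; last by apply: integrableD => //.
  apply: eq_integral => w _; rewrite -EFinM; congr EFin.
  have L1 : lin X (i :: r) c1 w = xi * X i w + lin X r c w.
    rewrite /lin big_cons /c1 eqxx; congr (_ + _); apply: eq_big_seq => j jr.
    by rewrite (_ : j == i = false)//; apply/negbTE; apply: contraNN ir => /eqP <-.
  have L2 : lin X (i :: r) c2 w = xi * X i w - lin X r c w.
    rewrite /lin big_cons /c2 eqxx -sumrN; congr (_ + _); apply: eq_big_seq => j jr.
    rewrite (_ : j == i = false) ?mulNr//.
    by apply/negbTE; apply: contraNN ir => /eqP <-.
  rewrite L1 L2 (_ : _ + (th + theta) = (xi * X i w + th) + (lin X r c w + theta)); last by ring.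
  rewrite (_ : _ + (th - theta) = (xi * X i w + th) - (lin X r c w + theta)); last by ring.
  by move: (xi * X i w + th) (lin X r c w + theta) => A B; rewrite cosB cosD; field.
by rewrite !E2// !H.
Qed.

(** The weights are kept in this final form for the zero-one law, where they are the indicator of a
    germ event and its probability. *)
Lemma cramer_wold (u1 : T1 -> R) (u2 : T2 -> R) (M : R) :
  measurable_fun setT u1 -> measurable_fun setT u2 ->
  (forall w, `|u1 w| <= M) -> (forall w, `|u2 w| <= M) ->
  (forall c theta,
     (\int[P1]_w (u1 w * cos (\sum_i c i * X1 i w + theta))%:E =
      \int[P2]_w (u2 w * cos (\sum_i c i * X2 i w + theta))%:E)%E) ->
  (\int[P1]_w (u1 w * \1_[set w | forall i, a i < X1 i w <= b i] w)%:E =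
   \int[P2]_w (u2 w * \1_[set w | forall i, a i < X2 i w <= b i] w)%:E)%E.
Proof.
move=> mu1 mu2 u1M u2M H.
have E (T : Type) (X : I -> T -> R) w :
    \1_[set w | forall i, a i < X i w <= b i] w = boxf X (index_enum I) w.
  rewrite /boxf indicE; have [/set_mem/= h|h] := boolP (w \in _).
    by rewrite big1// => i _; rewrite indicE mem_set//= in_itv/= h.
  have [i hi] : exists i, ~~ (a i < X i w <= b i).
    apply/existsP; rewrite -negb_forall; apply: contra h => /forallP h.
    exact/mem_set.
  rewrite (bigD1 i)//= indicE memNset ?mul0r//= in_itv/=; exact/negP.
under eq_integral do rewrite E; under [RHS]eq_integral do rewrite E.
apply: (@cramer_wold_seq _ _ _ _ M) => //; exact: index_enum_uniq.
Qed.

Lemma measurable_box d (T : measurableType d) (X : I -> T -> R) :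
  (forall i, measurable_fun setT (X i)) ->
  measurable [set w | forall i, a i < X i w <= b i].
Proof.
move=> mX; rewrite (_ : [set w | _] = \bigcap_(i in [set: I]) (X i @^-1` `]a i, b i])).
  apply: fin_bigcap_measurable => // i _; rewrite -[X in measurable X]setTI; exact: mX.
apply/seteqP; split => [w h i _|w h i]; first by rewrite /= in_itv/=.
by have := h i Logic.I; rewrite /= in_itv.
Qed.

Lemma cramer_wold_prob :
  (forall c theta,
     (\int[P1]_w (cos (\sum_i c i * X1 i w + theta))%:E =
      \int[P2]_w (cos (\sum_i c i * X2 i w + theta))%:E)%E) ->
  P1 [set w | forall i, a i < X1 i w <= b i] =
  P2 [set w | forall i, a i < X2 i w <= b i].
Proof.
move=> H; have := @cramer_wold (cst 1) (cst 1) 1 _ _ _ _ _.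
have m1 := measurable_box mX1; have m2 := measurable_box mX2.
under eq_integral do rewrite mul1r; under [in RHS]eq_integral do rewrite mul1r.
rewrite !integral_indic// !setIT; apply => //; try by move=> ?; rewrite normr1.
by move=> c theta; under eq_integral do rewrite mul1r; under [RHS]eq_integral do rewrite mul1r.
Qed.

End cramer_wold_multi.

(** * Normal densities: shift, convolution, change of measure *)

Section normal_facts.
Context {R : realType}.
Notation leb := (@lebesgue_measure R).
Implicit Types (a b v x y z c : R).

Lemma measurable_shift c : measurable_fun setT (fun x : R => x + c).
Proof. exact: measurable_funD. Qed.

Lemma leb_shift c (A : set R) : measurable A ->
  pushforward leb ((fun x : R => x + c) : _ -> measurableTypeR R) A = leb A.
Proof.
move=> mA; apply/esym/lebesgue_measure_unique => //=; first exact: measurable_shift.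
move=> _ _ [[a b]] /= _ <-.
rewrite /pushforward (_ : _ @^-1` _ = `]a - c, b - c]%classic); last first.
  by apply/seteqP; split => x /=; rewrite !in_itv/= ltrBlDr lerBrDr.
rewrite !lebesgue_measure_itv/= !lte_fin ltrD2r; case: ifP => // _.
by rewrite -!EFinB; congr EFin; ring.
Qed.

Lemma ge0_integral_shift c (f : R -> \bar R) : measurable_fun setT f ->
  (forall x, 0 <= f x)%E ->
  (\int[leb]_x f (x + c)%R = \int[leb]_x f x)%E.
Proof.
move=> mf f0.
have := @ge0_integral_pushforward _ _ (measurableTypeR R) (measurableTypeR R) R
  ((fun x : R => x + c) : _ -> measurableTypeR R) (measurable_shift c) leb setT f measurableT mf (fun x _ => f0 x).
rewrite preimage_setT /comp => <-.
apply: eq_measure_integral; first exact: measurable_shift.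
by move=> ? A mA _; exact: (leb_shift c mA).
Qed.

Lemma normal_pdf_exp v x : 0 < v ->
  expR x * normal_pdf 0 (Num.sqrt v) x = expR (v / 2) * normal_pdf v (Num.sqrt v) x.
Proof.
move=> v0; have s0 : Num.sqrt v != 0 by rewrite gt_eqF// sqrtr_gt0.
rewrite !normal_pdfE// /normal_fun !sqr_sqrtr ?ltW//.
rewrite mulrCA [RHS]mulrCA; congr (_ * _); rewrite -!expRD; congr expR.
by field; rewrite gt_eqF.
Qed.

(** Completing the square: the joint density of two independent centred normals factors into the
    density of the sum and the conditional density of the first given the sum. *)
Lemma normal_pdf_conv a b x z : 0 < a -> 0 < b ->
  normal_pdf 0 (Num.sqrt a) x * normal_pdf 0 (Num.sqrt b) (z - x) =
  normal_pdf 0 (Num.sqrt (a + b)) z *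
  normal_pdf (a * z / (a + b)) (Num.sqrt (a * b / (a + b))) x.
Proof.
move=> a0 b0; have ab0 : 0 < a + b by rewrite addr_gt0.
have c0 : 0 < a * b / (a + b) by rewrite divr_gt0// mulr_gt0.
rewrite !normal_pdfE ?gt_eqF ?sqrtr_gt0// /normal_fun /normal_peak.
rewrite !sqr_sqrtr ?ltW// mulrACA [RHS]mulrACA -!expRD -!invfM; congr (_^-1 * expR _).
  rewrite -!sqrtrM ?mulrn_wge0 ?mulr_ge0 ?pi_ge0 ?ltW//; congr Num.sqrt.
  by field; rewrite gt_eqF.
by field; rewrite !gt_eqF.
Qed.

Lemma normal_sum_law (g : R -> R) a b : 0 < a -> 0 < b ->
  measurable_fun setT g -> (forall x, 0 <= g x) ->
  (\int[leb]_x \int[leb]_y (g (x + y) * (normal_pdf 0 (Num.sqrt a) x *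
      normal_pdf 0 (Num.sqrt b) y))%:E =
   \int[leb]_z (g z * normal_pdf 0 (Num.sqrt (a + b)) z)%:E)%E.
Proof.
move=> a0 b0 mg g0.
pose ga := normal_pdf 0 (Num.sqrt a); pose gb := normal_pdf 0 (Num.sqrt b).
have mga : measurable_fun setT ga by exact: measurable_normal_pdf.
have mgb : measurable_fun setT gb by exact: measurable_normal_pdf.
have ga0 x : 0 <= ga x by exact: normal_pdf_ge0.
have gb0 x : 0 <= gb x by exact: normal_pdf_ge0.
pose h (p : R * R) := (g p.2 * (ga p.1 * gb (p.2 - p.1)))%:E.
have mh : measurable_fun setT h.
  apply/measurable_EFinP; apply: measurable_funM; first exact: measurableT_comp.
  apply: measurable_funM; first exact: measurableT_comp.
  by apply: measurableT_comp => //; exact: measurable_funB.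
have h0 p : (0 <= h p)%E by rewrite lee_fin !mulr_ge0.
transitivity (\int[leb]_x \int[leb]_z h (x, z))%E.
  apply: eq_integral => x _.
  rewrite -(@ge0_integral_shift x (fun z => h (x, z)))//; last first.
    exact: (measurableT_comp mh (pair1_measurable x)).
  by apply: eq_integral => y _; rewrite /h/= addrK addrC.
rewrite (@fubini_tonelli _ _ _ _ _ leb leb h mh h0).
apply: eq_integral => z _.
pose c := Num.sqrt (a * b / (a + b)).
transitivity (\int[leb]_x ((g z * normal_pdf 0 (Num.sqrt (a + b)) z)%:E *
    (normal_pdf (a * z / (a + b)) c x)%:E))%E.
  by apply: eq_integral => x _; rewrite /h/= normal_pdf_conv// EFinM -EFinM mulrA.
rewrite ge0_integralZl//.
- by rewrite integral_normal_pdf mule1.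
- by apply/measurable_EFinP; exact: measurable_normal_pdf.
- by move=> x _; rewrite lee_fin normal_pdf_ge0.
- by rewrite lee_fin mulr_ge0// normal_pdf_ge0.
Qed.

End normal_facts.

Section density.
Context d (T : measurableType d) (R : realType).
Variables (mu nu : {measure set T -> \bar R}) (h : T -> R).
Hypotheses (mh : measurable_fun setT h) (h0 : forall x, 0 <= h x).
Hypothesis nuE : forall A, measurable A -> (nu A = \int[mu]_(x in A) (h x)%:E)%E.
Local Open Scope ereal_scope.
Import HBNNSimple.

Let density_nnsfun (f : {nnsfun T >-> R}) :
  \int[nu]_x (f x)%:E = \int[mu]_x (f x * h x)%R%:E.
Proof.
under [LHS]eq_integral do rewrite fimfunE -fsumEFin//.
rewrite [LHS]ge0_integral_fsum//; last 2 first.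
  - by move=> r; exact/measurable_EFinP/measurableT_comp.
  - by move=> n x _; rewrite EFinM nnfun_muleindic_ge0.
under [RHS]eq_integral.
  move=> x xD; rewrite EFinM muleC fimfunE -fsumEFin// ge0_mule_fsumr; last first.
    by move=> r; rewrite EFinM nnfun_muleindic_ge0.
  over.
rewrite [RHS]ge0_integral_fsum//; last 2 first.
  - move=> r; apply: emeasurable_funM; first exact/measurable_EFinP.
    exact/measurable_EFinP/measurableT_comp.
  - move=> n x _; apply: mule_ge0; first by rewrite lee_fin.
    by rewrite EFinM nnfun_muleindic_ge0.
apply: eq_fsbigr => r _.
rewrite integralZl_indic_nnsfun// integral_indic// setIT nuE//.
have [r0|r0] := ltP r 0%R.
  rewrite (preimage_nnfun0 f r0) integral_set0 mule0.
  by under eq_integral do rewrite indic0 mulr0 mule0; rewrite integral0.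
rewrite -ge0_integralZl//; last 2 first.
  - exact/measurable_EFinP/measurable_funTS.
  - by move=> x _; rewrite lee_fin.
rewrite integral_mkcond; apply: eq_integral => x _; rewrite patchE indicE.
by case: (x \in _); rewrite ?mulr1 ?mulr0 ?mule0// muleC.
Qed.

(** Extends a density formula known on sets to integrands, as needed for the law of a combination of
    noise values, which [white_noise] describes on sets. *)
Lemma ge0_integral_density (f : T -> \bar R) :
  measurable_fun setT f -> (forall x, 0 <= f x) ->
  \int[nu]_x f x = \int[mu]_x (f x * (h x)%:E).
Proof.
move=> mf f0.
pose f_ := nnsfun_approx measurableT mf.
transitivity (lim (\int[nu]_x (f_ n x)%:E @[n --> \oo])).
  rewrite -monotone_convergence//=.
  - apply: eq_integral => ? /[!inE] xD; apply/esym/cvg_lim => //=.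
    exact: cvg_nnsfun_approx.
  - by move=> n; exact/measurable_EFinP/measurable_funTS.
  - by move=> n ? _; rewrite lee_fin.
  - by move=> ? _ ? ? mn; rewrite lee_fin; exact/lefP/nd_nnsfun_approx.
under eq_fun do rewrite density_nnsfun.
rewrite -monotone_convergence//=.
- apply: eq_integral => x _; apply/cvg_lim => //=.
  under eq_fun do rewrite EFinM.
  by apply: cvgeZr => //; exact: cvg_nnsfun_approx.
- by move=> n; apply/measurable_EFinP/measurable_funM => //.
- by move=> n ? _; rewrite lee_fin mulr_ge0.
- by move=> x _ ? ? mn; rewrite lee_fin ler_wpM2r//; exact/lefP/nd_nnsfun_approx.
Qed.

End density.

(** * Gaussian variables of the noise *)

Section steps.
Context {R : realType}.
Notation leb := (@lebesgue_measure R).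
Notation mu2 := (leb \x leb)%E.
Implicit Types (l : seq (R * set (R * R))).

Definition step_ok l := forall p, p \in l -> finite_area_set p.2.
Definition stepf l (z : R * R) : R := \sum_(p <- l) p.1 * \1_p.2 z.
(** The covariance that [white_noise] prescribes for the two coded combinations;
    [stepf_prod_integral] identifies it with an L^2 inner product. Lists are convenient because sums
    become concatenations. *)
Definition step_cov l l' : R :=
  \sum_(p <- l) \sum_(q <- l') p.1 * q.1 * fine (area (p.2 `&` q.2)).
Definition step_scale (c : R) l := [seq (c * p.1, p.2) | p <- l].

Lemma step_ok_cat l l' : step_ok l -> step_ok l' -> step_ok (l ++ l').
Proof. by move=> h h' p; rewrite mem_cat => /orP[/h|/h']. Qed.

Lemma step_ok_scale c l : step_ok l -> step_ok (step_scale c l).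
Proof. by move=> h p /mapP[q /h hq ->]. Qed.

Lemma stepf_cat l l' z : stepf (l ++ l') z = stepf l z + stepf l' z.
Proof. by rewrite /stepf big_cat. Qed.

Lemma stepf_scale c l z : stepf (step_scale c l) z = c * stepf l z.
Proof. by rewrite /stepf big_map mulr_sumr; apply: eq_bigr => p _ /=; rewrite mulrA. Qed.

Lemma finite_area_setI (A B : set (R * R)) :
  finite_area_set A -> finite_area_set B -> finite_area_set (A `&` B).
Proof.
move=> [mA sA fA] [mB sB fB]; split.
- exact: measurableI.
- by move=> z [/sA].
- by apply: le_lt_trans fA; apply: le_measure => //; rewrite ?inE//; exact: measurableI.
Qed.

Lemma measurable_stepf l : step_ok l -> measurable_fun setT (stepf l).
Proof.
move=> ok; rewrite /stepf.
rewrite (_ : (fun z => _) = (fun z => \sum_(p <- l) (p.1 * \1_(if p \in l then p.2 else set0) z))).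
  apply: measurable_sum => p; apply: measurable_funM => //; apply: measurable_indic.
  by case: ifPn => // /ok[].
apply/funext => z; apply: eq_big_seq => p pl.
by rewrite pl.
Qed.

Lemma stepf_prod_integral l l' : step_ok l -> step_ok l' ->
  (mu2).-integrable setT (fun z => (stepf l z * stepf l' z)%:E) /\
  (\int[mu2]_z (stepf l z * stepf l' z)%:E = (step_cov l l')%:E)%E.
Proof.
move=> ok ok'.
(* Entries outside the list are sent to the empty set, so that finite area holds for every index and
   the sums can be integrated termwise. *)
pose A p := if p \in l then p.2 else set0 : set (R * R).
pose B p := if p \in l' then p.2 else set0 : set (R * R).
have fin0 : finite_area_set (set0 : set (R * R)).
  by split => //; rewrite /area measure0.
have fA p : finite_area_set (A p) by rewrite /A; case: ifPn => // /ok.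
have fB p : finite_area_set (B p) by rewrite /B; case: ifPn => // /ok'.
have base (p q : R * set (R * R)) :
    (mu2).-integrable setT (fun z => (p.1 * q.1 * \1_(A p `&` B q) z)%:E) /\
    (\int[mu2]_z (p.1 * q.1 * \1_(A p `&` B q) z)%:E =
     (p.1 * q.1 * fine (area (A p `&` B q)))%:E)%E.
  have [mI _ fI] := finite_area_setI (fA p) (fB q).
  have iI : (mu2).-integrable setT (fun z => (\1_(A p `&` B q) z)%:E).
    apply/integrableP; split; first exact/measurable_EFinP/measurable_indic.
    under eq_integral do rewrite /= ger0_norm//.
    by rewrite integral_indic// setIT.
  split; first by under eq_fun do rewrite EFinM; exact: integrableZl.
  under eq_integral do rewrite EFinM.
  rewrite integralZl// integral_indic// setIT [RHS]EFinM fineK//.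
  by rewrite ge0_fin_numE.
have E z : (stepf l z * stepf l' z)%:E =
    (\sum_(p <- l) \sum_(q <- l') (p.1 * q.1 * \1_(A p `&` B q) z)%:E)%E.
  rewrite /stepf mulr_suml -sumEFin; apply: eq_big_seq => p pl.
  rewrite mulr_sumr -sumEFin; apply: eq_big_seq => q ql.
  by rewrite /A pl /B ql indicI /= mulrACA.
split.
  under eq_fun do rewrite E.
  apply: integrable_sum => // p pl; apply: integrable_sum => // q ql.
  by case: (base p q).
under eq_integral do rewrite E.
rewrite integral_sum//; last first.
  by move=> p; apply: integrable_sum => // q ql; case: (base p q).
rewrite /step_cov -sumEFin; apply: eq_big_seq => p pl.
rewrite integral_sum//; last by move=> q; case: (base p q).
rewrite -sumEFin; apply: eq_big_seq => q ql.
by case: (base p q) => _ ->; rewrite /A pl /B ql.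
Qed.

Definition step_var l := step_cov l l.

Lemma step_varE l : step_ok l -> (\int[mu2]_z ((stepf l z) ^+ 2)%:E = (step_var l)%:E)%E.
Proof. by move=> ok; have [_ <-] := stepf_prod_integral ok ok. Qed.

Lemma step_var_ge0 l : step_ok l -> 0 <= step_var l.
Proof.
move=> ok; rewrite -lee_fin -step_varE//; apply: integral_ge0 => z _.
by rewrite lee_fin sqr_ge0.
Qed.

Lemma step_covC l l' : step_cov l l' = step_cov l' l.
Proof.
rewrite /step_cov exchange_big; apply: eq_bigr => p _; apply: eq_bigr => q _.
by rewrite setIC (mulrC p.1).
Qed.

Lemma step_cov_catl l1 l2 l : step_cov (l1 ++ l2) l = step_cov l1 l + step_cov l2 l.
Proof. by rewrite /step_cov big_cat. Qed.

Lemma step_cov_catr l1 l2 l : step_cov l (l1 ++ l2) = step_cov l l1 + step_cov l l2.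
Proof. by rewrite !(step_covC l) step_cov_catl. Qed.

Lemma step_cov_scalel c l l' : step_cov (step_scale c l) l' = c * step_cov l l'.
Proof.
rewrite /step_cov big_map mulr_sumr; apply: eq_bigr => p _; rewrite mulr_sumr.
by apply: eq_bigr => q _ /=; rewrite !mulrA.
Qed.

Lemma step_cov_scaler c l l' : step_cov l (step_scale c l') = c * step_cov l l'.
Proof. by rewrite !(step_covC l) step_cov_scalel. Qed.

Lemma step_var_cat l l' : step_var (l ++ l') = step_var l + step_var l' + 2 * step_cov l l'.
Proof.
rewrite /step_var step_cov_catl !step_cov_catr (step_covC l' l).
by rewrite mulr2n mulrDl !mul1r; ring.
Qed.

Lemma step_var_scale c l : step_var (step_scale c l) = c ^+ 2 * step_var l.
Proof. by rewrite /step_var step_cov_scalel step_cov_scaler expr2 mulrA. Qed.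

Definition step_lin (I : finType) (c : I -> R) (L : I -> seq (R * set (R * R))) :=
  flatten [seq step_scale (c i) (L i) | i <- index_enum I].

End steps.

(** * Laws of linear combinations of the noise *)

Section noise.
Context {R : realType} {d : measure_display} {Omega : measurableType d}.
Context (P : probability Omega R) (W : set (R * R) -> Omega -> R).
Hypothesis hW : white_noise P W.
Notation leb := (@lebesgue_measure R).
Implicit Types (l : seq (R * set (R * R))).

Definition wsum l (w : Omega) : R := \sum_(p <- l) p.1 * W p.2 w.

Lemma wsum_cat l l' w : wsum (l ++ l') w = wsum l w + wsum l' w.
Proof. by rewrite /wsum big_cat. Qed.

Lemma wsum_scale c l w : wsum (step_scale c l) w = c * wsum l w.
Proof. by rewrite /wsum big_map mulr_sumr; apply: eq_bigr => p _ /=; rewrite mulrA. Qed.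

Lemma measurable_wsum l : step_ok l -> measurable_fun setT (wsum l).
Proof.
move=> ok; rewrite /wsum.
rewrite (_ : (fun z => _) = (fun w => \sum_(p <- l) (if p \in l then p.1 * W p.2 w else 0))).
  apply: measurable_sum => p; have [pl|_] := boolP (p \in l); last exact: measurable_cst.
  by apply: measurable_funM => //; apply: (proj1 hW); exact: ok.
by apply/funext => w; apply: eq_big_seq => p ->.
Qed.

Lemma wsum_law l (B : set R) : step_ok l -> measurable B ->
  P (wsum l @^-1` B) = centered_normal (step_var l) B.
Proof.
move=> ok mB.
pose A (i : 'I_(size l)) := (nth (0, set0) l i).2.
pose c (i : 'I_(size l)) := (nth (0, set0) l i).1.
have := @proj2 _ _ hW (size l) A c _ B mB.
rewrite (_ : [set w | _] = wsum l @^-1` B); last first.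
  by apply/seteqP; split => w /=; rewrite /wsum (big_nth (0, set0)) big_mkord.
move=> ->; last by move=> i; apply: ok; exact: mem_nth.
congr centered_normal; rewrite /step_var /step_cov (big_nth (0, set0)) big_mkord.
by apply: eq_bigr => i _; rewrite (big_nth (0, set0)) big_mkord.
Qed.

(** Expectation under N(0, v); the degenerate case is separated as in [centered_normal]. *)
Definition nexp (v : R) (f : R -> \bar R) : \bar R :=
  if v == 0 then f 0 else (\int[leb]_x (f x * (normal_pdf 0 (Num.sqrt v) x)%:E))%E.

Lemma wsum_expect l (f : R -> \bar R) : step_ok l -> measurable_fun setT f ->
  (forall x, 0 <= f x)%E -> (\int[P]_w (f (wsum l w)) = nexp (step_var l) f)%E.
Proof.
move=> ok mf f0; have mw := measurable_wsum ok.
have := @ge0_integral_pushforward _ _ Omega (measurableTypeR R) R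
  (wsum l : _ -> measurableTypeR R) mw P setT f measurableT mf (fun x _ => f0 x).
rewrite preimage_setT /comp => <-.
have law (B : set (measurableTypeR R)) : measurable B ->
    pushforward P (wsum l : _ -> measurableTypeR R) B = centered_normal (step_var l) B.
  by move=> mB; exact: wsum_law.
rewrite /nexp; have [v0|v0] := eqVneq (step_var l) 0.
  transitivity (\int[\d_(0%R : measurableTypeR R)]_x f x)%E.
    apply: eq_measure_integral.
    by move=> B mB _; rewrite [LHS](law B mB) /centered_normal v0 eqxx.
  by rewrite integral_dirac//= ?diracT ?mul1e.
rewrite (@ge0_integral_density _ _ _ leb _ (normal_pdf 0 (Num.sqrt (step_var l)))) //.
- exact: measurable_normal_pdf.
- by move=> x; exact: normal_pdf_ge0.
- by move=> B mB; rewrite [LHS](law B mB) /centered_normal (negbTE v0).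
Qed.

End noise.

Section gaussian.
Context {R : realType} {d : measure_display} {Omega : measurableType d}.
Context (P : probability Omega R) (W : set (R * R) -> Omega -> R).
Hypothesis hW : white_noise P W.
Notation leb := (@lebesgue_measure R).
Implicit Types (l : seq (R * set (R * R))).

Lemma wsum_exp l : step_ok l ->
  (\int[P]_w (expR (wsum W l w))%:E = (expR (step_var l / 2))%:E)%E.
Proof.
move=> ok.
rewrite (wsum_expect hW (f := fun x => (expR x)%:E))//; last by apply/measurable_EFinP; exact: measurable_expR.
rewrite /nexp; case: eqVneq => [->|v0]; first by rewrite mul0r.
have v1 : 0 < step_var l by rewrite lt_neqAle eq_sym v0 step_var_ge0.
under eq_integral do rewrite -EFinM normal_pdf_exp// EFinM.
rewrite ge0_integralZl//.
- by rewrite integral_normal_pdf mule1.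
- by apply/measurable_EFinP; exact: measurable_normal_pdf.
- by move=> x _; rewrite lee_fin normal_pdf_ge0.
Qed.

Lemma nexp_ge0 (v : R) (f : R -> \bar R) : (forall x, 0 <= f x)%E -> (0 <= nexp v f)%E.
Proof.
move=> f0; rewrite /nexp; case: ifP => // _; apply: integral_ge0 => x _.
by rewrite mule_ge0// lee_fin normal_pdf_ge0.
Qed.

(** The iterated integral models two independent copies of the noise. Tonelli and the convolution of
    normal densities add the variances; since either variance may vanish, those cases are settled
    apart. *)
Lemma copy_law l l' (g : R -> R) : step_ok l -> step_ok l' ->
  measurable_fun setT g -> (forall x, 0 <= g x) ->
  (\int[P]_w \int[P]_w' (g (wsum W l w + wsum W l' w')%R)%:E =
   nexp (step_var l + step_var l') (EFin \o g))%E.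
Proof.
move=> ok ok' mg g0; set a := step_var l; set b := step_var l'.
have a0 : 0 <= a by exact: step_var_ge0.
have b0 : 0 <= b by exact: step_var_ge0.
have mgs x : measurable_fun setT (fun y : R => g (x + y)).
  by apply: measurableT_comp => //; exact: measurable_funD.
transitivity (\int[P]_w nexp b (fun y => (g (wsum W l w + y)%R)%:E))%E.
  apply: eq_integral => w _.
  by rewrite (wsum_expect hW (f := fun y => (g (wsum W l w + y)%R)%:E))//;
    do ?[by apply/measurable_EFinP|by move=> ?; rewrite lee_fin].
have [b1|b1] := eqVneq b 0.
  transitivity (\int[P]_w (g (wsum W l w))%:E)%E.
    by apply: eq_integral => w _; rewrite /nexp b1 eqxx addr0.
  rewrite (wsum_expect hW ok (f := fun x => (g x)%:E)) -/a; first by rewrite b1 addr0.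
    by apply/measurable_EFinP.
  by move=> x; rewrite lee_fin g0.
pose F x : \bar R := nexp b (fun y => (g (x + y)%R)%:E).
have FE x : F x = (\int[leb]_y ((g (x + y) * normal_pdf 0 (Num.sqrt b) y)%R)%:E)%E.
  by rewrite /F /nexp (negbTE b1).
have mF : measurable_fun setT F.
  rewrite (_ : F = fun x => \int[leb]_y ((g (x + y) * normal_pdf 0 (Num.sqrt b) y)%R)%:E)%E; last exact/funext.
  apply: (@measurable_fun_fubini_tonelli_F _ _ _ _ _ leb
    (fun z : R * R => ((g (z.1 + z.2) * normal_pdf 0 (Num.sqrt b) z.2)%R)%:E)) => //.
  - apply/measurable_EFinP; apply: measurable_funM.
      by apply: measurableT_comp => //; exact: measurable_funD.
    by apply: measurableT_comp => //; exact: measurable_normal_pdf.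
  - by move=> z; rewrite lee_fin mulr_ge0// normal_pdf_ge0.
have F0 x : (0 <= F x)%E by apply: nexp_ge0 => y; rewrite lee_fin.
rewrite -[LHS]/(\int[P]_w F (wsum W l w))%E (wsum_expect hW ok mF F0) -/a {1}/nexp.
have [a1|a1] := eqVneq a 0.
  by rewrite a1 add0r /F; congr nexp; apply/funext => y; rewrite add0r.
have a2 : 0 < a by rewrite lt_neqAle eq_sym a1.
have b2 : 0 < b by rewrite lt_neqAle eq_sym b1.
have ab0 : 0 < a + b by exact: addr_gt0.
rewrite /nexp (gt_eqF ab0).
clearbody F a b.
transitivity (\int[leb]_z (g z * normal_pdf 0 (Num.sqrt (a + b)) z)%:E)%E; last first.
  by apply: eq_integral => z _; rewrite EFinM.
rewrite -(normal_sum_law a2 b2 mg g0).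
apply: eq_integral => x _.
have m1 : measurable_fun setT (fun y : R => g (x + y) * normal_pdf 0 (Num.sqrt b) y).
  by apply: measurable_funM; [exact: (mgs x)|exact: measurable_normal_pdf].
rewrite FE muleC -ge0_integralZl.
- by apply: eq_integral => y _; rewrite -EFinM; congr EFin; ring.
- exact: measurableT.
- by apply/measurable_EFinP; exact: m1.
- by move=> y _; rewrite lee_fin mulr_ge0// normal_pdf_ge0.
- by rewrite lee_fin normal_pdf_ge0.
Qed.

Lemma wsum_lin (I : finType) (c : I -> R) (L : I -> seq (R * set (R * R))) w :
  wsum W (step_lin c L) w = \sum_i c i * wsum W (L i) w.
Proof.
rewrite /step_lin; elim: (index_enum I) => [|i s IH] /=; first by rewrite /wsum !big_nil.
by rewrite wsum_cat big_cons IH wsum_scale.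
Qed.

Lemma step_ok_lin (I : finType) (c : I -> R) (L : I -> seq (R * set (R * R))) :
  (forall i, step_ok (L i)) -> step_ok (step_lin c L).
Proof.
move=> ok; rewrite /step_lin; elim: (index_enum I) => [//|i s IH] /=.
by apply: step_ok_cat => //; exact: step_ok_scale.
Qed.

Lemma step_cov_linl (I : finType) (c : I -> R) (L : I -> seq (R * set (R * R))) l :
  step_cov (step_lin c L) l = \sum_i c i * step_cov (L i) l.
Proof.
rewrite /step_lin; elim: (index_enum I) => [|i s IH] /=; first by rewrite /step_cov !big_nil.
by rewrite step_cov_catl big_cons IH step_cov_scalel.
Qed.

(** The laws are transported for non-negative test functions, so 1 + cos stands in for cos and the
    constant is removed here. *)
Lemma cos_integral_eq d1 (T1 : measurableType d1) (P1 : probability T1 R)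
    d2 (T2 : measurableType d2) (P2 : probability T2 R) (f1 : T1 -> R) (f2 : T2 -> R) :
  measurable_fun setT f1 -> measurable_fun setT f2 ->
  (\int[P1]_w (1 + cos (f1 w))%:E = \int[P2]_w (1 + cos (f2 w))%:E)%E ->
  (\int[P1]_w (cos (f1 w))%:E = \int[P2]_w (cos (f2 w))%:E)%E.
Proof.
move=> m1 m2.
have E d' (T : measurableType d') (Q : probability T R) (f : T -> R) : measurable_fun setT f ->
    (\int[Q]_w (1 + cos (f w))%:E = 1 + \int[Q]_w (cos (f w))%:E)%E.
  move=> mf; under eq_integral do rewrite EFinD.
  rewrite integralD//; first by rewrite integral_cst//= probability_setT mule1.
    exact: finite_measure_integrable_cst.
  apply: (bounded_integrable Q (M := 1)); first exact: measurable_cosf.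
  by move=> w; rewrite ler_norml cos_geN1 cos_le1.
by rewrite !E// => /(congr1 (fun z => z - 1)%E); rewrite ![(1 + _)%E]addeC !addeK.
Qed.

Section blocks.
Variables (I J : finType) (L : I -> seq (R * set (R * R))) (L' : J -> seq (R * set (R * R))).
Hypotheses (okL : forall i, step_ok (L i)) (okL' : forall j, step_ok (L' j)).
Variables (a b : I -> R) (a' b' : J -> R).

(** The joint law on [Omega] is compared with the law under [P \x P] when the two blocks read
    different copies. With vanishing cross covariances every linear combination has the same
    variance on both sides, so the boxes have equal probabilities, and under the product measure
    they factor. *)
Lemma block_indep : (forall i j, step_cov (L i) (L' j) = 0) ->
  (P ([set w | forall i, (a i < wsum W (L i) w <= b i)%R] `&`
      [set w | forall j, (a' j < wsum W (L' j) w <= b' j)%R]) =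
   P [set w | forall i, (a i < wsum W (L i) w <= b i)%R] *
   P [set w | forall j, (a' j < wsum W (L' j) w <= b' j)%R])%E.
Proof.
move=> orth.
pose X1 (k : I + J) w := match k with inl i => wsum W (L i) w | inr j => wsum W (L' j) w end.
pose X2 (k : I + J) (z : Omega * Omega) :=
  match k with inl i => wsum W (L i) z.1 | inr j => wsum W (L' j) z.2 end.
pose aa (k : I + J) := match k with inl i => a i | inr j => a' j end.
pose bb (k : I + J) := match k with inl i => b i | inr j => b' j end.
have mL i : measurable_fun setT (wsum W (L i)) by exact: (measurable_wsum hW).
have mL' j : measurable_fun setT (wsum W (L' j)) by exact: (measurable_wsum hW).
have mX1 k : measurable_fun setT (X1 k) by case: k.
have mX2 k : measurable_fun setT (X2 k).
  by case: k => k; [exact: (measurableT_comp (mL k) measurable_fst)|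
    exact: (measurableT_comp (mL' k) measurable_snd)].
have := @cramer_wold_prob R _ _ _ P _ _ (P \x P)%E X1 X2 aa bb mX1 mX2.
rewrite (_ : [set w | forall i, aa i < X1 i w <= bb i] =
  [set w | forall i, a i < wsum W (L i) w <= b i] `&`
  [set w | forall j, a' j < wsum W (L' j) w <= b' j]); last first.
  apply/seteqP; split => w /=.
    by move=> h; split => i; [exact: (h (inl i))|exact: (h (inr i))].
  by move=> [h h'] [i|j]; [exact: h|exact: h'].
rewrite (_ : [set w | forall i, aa i < X2 i w <= bb i] =
  [set w | forall i, a i < wsum W (L i) w <= b i] `*`
  [set w | forall j, a' j < wsum W (L' j) w <= b' j]); last first.
  apply/seteqP; split => w /=.
    by move=> h; split => i; [exact: (h (inl i))|exact: (h (inr i))].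
  by move=> [h h'] [i|j]; [exact: h|exact: h'].
move=> H; rewrite -[RHS](@product_measure1E _ _ _ _ _ P P _ _ (measurable_box _ _ mL) (measurable_box _ _ mL')).
apply: H => c theta.
pose l := step_lin (fun i => c (inl i)) L; pose l' := step_lin (fun j => c (inr j)) L'.
have okl : step_ok l by exact: step_ok_lin.
have okl' : step_ok l' by exact: step_ok_lin.
have cov0 : step_cov l l' = 0.
  rewrite step_cov_linl big1// => i _; rewrite step_covC step_cov_linl big1 ?mulr0//.
  by move=> j _; rewrite step_covC orth mulr0.
have E1 w : \sum_i c i * X1 i w + theta = wsum W (l ++ l') w + theta.
  by rewrite big_sumType/= wsum_cat !wsum_lin.
have E2 z : \sum_i c i * X2 i z + theta = wsum W l z.1 + wsum W l' z.2 + theta.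
  by rewrite big_sumType/= !wsum_lin.
under eq_integral do rewrite E1; under [RHS]eq_integral do rewrite E2.
have mc : measurable_fun setT (fun x : R => 1 + cos (x + theta)).
  by apply: measurable_funD => //; apply: measurable_cosf; exact: measurable_funD.
have c0 (x : R) : 0 <= 1 + cos (x + theta) by have := cos_geN1 (x + theta); lra.
have mz : measurable_fun setT (fun z : Omega * Omega => wsum W l z.1 + wsum W l' z.2 + theta).
  apply: measurable_funD => //; apply: measurable_funD.
    exact: (measurableT_comp (measurable_wsum hW okl) measurable_fst).
  exact: (measurableT_comp (measurable_wsum hW okl') measurable_snd).
apply: cos_integral_eq.
- apply: measurable_funD => //; apply: (measurable_wsum hW); exact: step_ok_cat.
- exact: mz.
rewrite (@wsum_expect _ _ _ _ _ hW (l ++ l') (fun x => (1 + cos (x + theta))%:E))//; last 2 first.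
- exact: step_ok_cat.
- exact/measurable_EFinP.
rewrite fubini_tonelli1/=; last 2 first.
- apply/measurable_EFinP; apply: measurable_funD => //; exact: measurable_cosf.
- by move=> z; rewrite lee_fin.
rewrite step_var_cat cov0 mulr0 addr0; apply/esym.
exact: (copy_law okl okl' mc c0).
Qed.

End blocks.

(** The same comparison as for blocks, each combination now being read on both copies with opposite
    signs: variances double, which is the effect of the factor sqrt 2. *)
Lemma copy_diff (I : finType) (L : I -> seq (R * set (R * R))) (a b : I -> R) :
  (forall i, step_ok (L i)) ->
  P [set w | forall i, a i < Num.sqrt 2 * wsum W (L i) w <= b i] =
  (P \x P)%E [set z | forall i, a i < wsum W (L i) z.1 - wsum W (L i) z.2 <= b i].
Proof.
move=> okL.
have mL i : measurable_fun setT (wsum W (L i)) by exact: (measurable_wsum hW).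
apply: cramer_wold_prob.
- by move=> i; apply: measurable_funM.
- move=> i; apply: measurable_funB; first exact: (measurableT_comp (mL i) measurable_fst).
  exact: (measurableT_comp (mL i) measurable_snd).
move=> c theta; pose l := step_lin c L.
have okl : step_ok l by exact: step_ok_lin.
pose l1 := step_scale (Num.sqrt 2) l; pose l2 := step_scale (-1) l.
have ok1 : step_ok l1 by exact: step_ok_scale.
have ok2 : step_ok l2 by exact: step_ok_scale.
have E1 w : \sum_i c i * (Num.sqrt 2 * wsum W (L i) w) + theta = wsum W l1 w + theta.
  rewrite wsum_scale wsum_lin mulr_sumr; congr (_ + _); apply: eq_bigr => i _.
  by rewrite mulrCA.
have E2 (z : Omega * Omega) : \sum_i c i * (wsum W (L i) z.1 - wsum W (L i) z.2) + theta =
    wsum W l z.1 + wsum W l2 z.2 + theta.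
  rewrite wsum_scale mulN1r !wsum_lin -sumrB; congr (_ + _); apply: eq_bigr => i _.
  by rewrite mulrBr.
under eq_integral do rewrite E1; under [RHS]eq_integral do rewrite E2.
have mc : measurable_fun setT (fun x : R => 1 + cos (x + theta)).
  by apply: measurable_funD => //; apply: measurable_cosf; exact: measurable_funD.
have c0 (x : R) : 0 <= 1 + cos (x + theta) by have := cos_geN1 (x + theta); lra.
have mz : measurable_fun setT (fun z : Omega * Omega => wsum W l z.1 + wsum W l2 z.2 + theta).
  apply: measurable_funD => //; apply: measurable_funD.
    exact: (measurableT_comp (measurable_wsum hW okl) measurable_fst).
  exact: (measurableT_comp (measurable_wsum hW ok2) measurable_snd).
apply: cos_integral_eq.
- by apply: measurable_funD => //; apply: (measurable_wsum hW).
- exact: mz.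
rewrite (@wsum_expect _ _ _ _ _ hW l1 (fun x => (1 + cos (x + theta))%:E))//; last first.
  exact/measurable_EFinP.
rewrite fubini_tonelli1/=; last 2 first.
- apply/measurable_EFinP; apply: measurable_funD => //; exact: measurable_cosf.
- by move=> z; rewrite lee_fin.
rewrite step_var_scale sqr_sqrtr// (_ : 2 * _ = step_var l + step_var l2); last first.
  by rewrite step_var_scale; ring.
by apply/esym; exact: (copy_law okl ok2 mc c0).
Qed.

End gaussian.

(** * A weak Sidak inequality *)

Section elementary_bounds.
Context {R : realType}.
Implicit Types (x y z a r : R).

Lemma pow_le_exp n x : 0 <= x -> x ^+ n <= n`!%:R * expR x.
Proof.
move=> x0; case: n => [|n].
  by rewrite expr0 fact0 mul1r -[leLHS]expR0 ler_expR.
have f0 : 0 < (n.+1)`!%:R :> R by rewrite ltr0n fact_gt0.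
rewrite mulrC -ler_pdivrMr//; apply: le_trans (expR_ge1Dxn n x0).
by rewrite lerDr.
Qed.

Lemma pow_le_exp_ex n : exists F : R, 1 <= F /\ forall x, 0 <= x -> x ^+ n <= F * expR x.
Proof. by exists n`!%:R; split; [rewrite ler1n fact_gt0|exact: pow_le_exp]. Qed.

Lemma expNR_le x : 0 <= x -> expR (- x) <= (1 + x)^-1.
Proof.
move=> x0; rewrite expRN lef_pV2 ?posrE ?expR_gt0//; last by rewrite ltr_pwDl.
exact: expR_ge1Dx.
Qed.

Lemma geometric_sum_le a n : 0 <= a < 1 -> \sum_(i < n) a ^+ i <= (1 - a)^-1.
Proof.
move=> /andP[a0 a1]; have h : 0 < 1 - a by rewrite subr_gt0.
rewrite -[leRHS]mul1r ler_pdivlMr// mulrC -opprB mulNr -subrX1 opprB lerBlDr lerDl.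
exact: exprn_ge0.
Qed.

Lemma markov_ge0 d (T : measurableType d) (P : probability T R) (f : T -> R) (a : R) :
  measurable_fun setT f -> (forall w, 0 <= f w) -> 0 <= a ->
  (a%:E * P [set w | (a <= f w)%R] <= \int[P]_w (f w)%:E)%E.
Proof.
move=> mf f0 a0.
have mA : measurable [set w | a <= f w].
  rewrite (_ : [set w | _] = f @^-1` `[a, +oo[).
    by rewrite -[X in measurable X]setTI; apply: mf.
  by apply/seteqP; split => w /=; rewrite in_itv/= andbT.
rewrite -[X in (_ * P X)%E]setIT -integral_indic// -ge0_integralZl//; last by apply/measurable_EFinP; exact: measurable_indic.
apply: ge0_le_integral => //.
- by move=> w _; rewrite mule_ge0// lee_fin.
- by apply: emeasurable_funM => //; apply/measurable_EFinP; exact: measurable_indic.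
- exact/measurable_EFinP.
- move=> w _; rewrite -EFinM lee_fin indicE.
  by have [/set_mem/= h|_] := boolP (w \in _); rewrite ?mulr1 ?mulr0.
Qed.

(* The cost, in nats, of coding the integer [k] by the two-sided geometric law
   of ratio [exp (-1/r)]. *)
Definition code_cost (r : R) (k : nat) : R :=
  k%:R / r + ln ((1 + expR (- r^-1)) / (1 - expR (- r^-1))).

(** Order of the coding cost of a coordinate whose standard deviation is [r] times the cell size.
    The exponent 13 serves the chaining of the upper bound: level j has of order 4^(6j) = 2^(12j)
    coordinates while the ratio halves from level to level, so 13 is the first power that leaves a
    convergent geometric series. *)
Definition phi13 (r : R) : R := if r <= 1 then r ^+ 13 else r.

Lemma phi13_ge0 r : 0 <= r -> 0 <= phi13 r.
Proof. by rewrite /phi13; case: ifP => // _ /exprn_ge0. Qed.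

Lemma ratio_facts r : 0 < r -> let al := expR (- r^-1) in
  [/\ 0 < al, al < 1 & (1 - al)^-1 <= r + 1].
Proof.
move=> r0 al; have ri : 0 < r^-1 by rewrite invr_gt0.
have al0 : 0 < al by exact: expR_gt0.
have al1 : al <= (1 + r^-1)^-1 by apply: expNR_le; exact: ltW.
have h : 0 < 1 + r^-1 by rewrite addr_gt0.
have E : (1 + r^-1)^-1 = r / (r + 1) by field; rewrite !gt_eqF// ?addr_gt0//.
have r1 : 0 < r + 1 by rewrite addr_gt0.
have lt1 : r / (r + 1) < 1 by rewrite ltr_pdivrMr// mul1r ltrDl.
have alt : al < 1 by apply: le_lt_trans lt1; rewrite -E.
split => //.
rewrite -[leRHS]invrK lef_pV2 ?posrE ?invr_gt0 ?subr_gt0//.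
rewrite lerBrDr -lerBrDl; apply: (le_trans al1); rewrite E.
by rewrite (_ : 1 - _ = r / (r + 1))//; field; rewrite gt_eqF.
Qed.

(** For small [r] the normalising constant differs from 1 by a multiple of exp(-1/r), which is below
    any power of [r]; for large [r] it grows at most linearly. *)
Lemma log_ratio_le (F r : R) : 1 <= F -> (forall x, 0 <= x -> x ^+ 13 <= F * expR x) -> 0 < r ->
  ln ((1 + expR (- r^-1)) / (1 - expR (- r^-1))) <= (4 * F) * phi13 r.
Proof.
move=> f1 hF r0; have [al0 al1 alr] := ratio_facts r0.
set al := expR _ in al0 al1 alr *.
have h : 0 < 1 - al by rewrite subr_gt0.
have p : 0 < (1 + al) / (1 - al) by rewrite divr_gt0// addr_gt0.
have F0 : 0 < F by exact: lt_le_trans f1.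
have lnx x : 0 < x -> ln x <= x - 1 by move=> x0; have := @le_ln1Dx R (x - 1); rewrite (addrC 1) addrNK; apply; lra.
apply: (le_trans (lnx _ p)).
have E : (1 + al) / (1 - al) - 1 = 2 * al * (1 - al)^-1 by field; rewrite gt_eqF.
rewrite E /phi13; case: ifPn => [r1|]; last rewrite -ltNge => r1.
  have ale : al <= F * r ^+ 13.
    have ri : 0 <= r^-1 by rewrite invr_ge0 ltW.
    have := hF _ ri; rewrite exprVn => hp.
    rewrite /al expRN -[leRHS]invrK lef_pV2 ?posrE ?expR_gt0 ?invr_gt0 ?mulr_gt0 ?exprn_gt0//.
    by rewrite invfM ler_pdivrMl.
  apply: (@le_trans _ _ (2 * al * 2)).
    apply: ler_wpM2l; first by rewrite mulr_ge0// ltW.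
    by apply: (le_trans alr); rewrite -lerBrDr (le_trans r1)//; lra.
  by move: ale; set A := F * _ => ale; rewrite -[leRHS]mulrA -/A; lra.
apply: (@le_trans _ _ (2 * 1 * (r + 1))).
  apply: ler_pM; rewrite ?invr_ge0 ?mulr_ge0 ?(ltW h) ?(ltW al0)//.
  by rewrite ler_pM2l// ltW.
apply: (@le_trans _ _ (4 * r)); first by lra.
by rewrite ler_wpM2r ?(ltW r0)//; lra.
Qed.

(** Here [y] stands for a variable of variance at most one and [k] for the absolute value of the
    rounding of r * y. The factor exp y + exp(-y) is chosen because its mean is explicit for a
    Gaussian [y]. *)
Lemma code_cost_le : exists C : R, 0 < C /\ forall r y (k : nat), 0 < r ->
  (k%:R <= r * `|y| + 2^-1) -> ((0 < k)%N -> 2^-1 <= r * `|y|) ->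
  code_cost r k <= C * phi13 r * (expR y + expR (- y)).
Proof.
have [F [F1 hF]] := pow_le_exp_ex 13.
have [G [f14 hG]] := pow_le_exp_ex 14.
have [T [p14 p14']] : exists T : R, 2 <= T /\ T = 2 ^+ 14.
  by exists (2 ^+ 14); split => //; rewrite -[leLHS]expr1 ler_eXn2l// ltr1n.
have G0 : 0 < G by exact: lt_le_trans f14.
have T0 : 0 < T by exact: lt_le_trans p14.
exists (T * G + 4 * F); split.
  by rewrite addr_gt0 ?mulr_gt0//; exact: lt_le_trans F1.
move=> r y k r0 k1 k2; rewrite /code_cost.
have ph := phi13_ge0 (ltW r0).
set e := expR y + expR (- y).
have ey : expR `|y| <= e.
  rewrite /e; have [y0|y0] := leP 0 y.
    by rewrite ger0_norm// lerDl expR_ge0.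
  by rewrite ltr0_norm// lerDr expR_ge0.
have e1 : 1 <= e by apply: le_trans ey; rewrite -[leLHS]expR0 ler_expR.
have e0 : 0 <= e by apply: le_trans e1.
rewrite (mulrDl (T * G) (4 * F)) (mulrDl (T * G * _)); apply: lerD; last first.
  apply: (le_trans (log_ratio_le F1 hF r0)); rewrite ler_peMr// !mulr_ge0//.
  exact: le_trans F1.
have kz : k%:R <= 2 * (r * `|y|).
  have [k0|] := posnP k; first by rewrite k0 !mulr_ge0// ltW.
  by move=> /k2; lra.
have z0 : 0 <= r * `|y| by rewrite mulr_ge0// ltW.
rewrite ler_pdivrMr// /phi13; case: ifPn => [r1|]; last rewrite -ltNge => r1.
  have [k0|kp] := posnP k.
    by rewrite k0; rewrite !mulr_ge0 ?exprn_ge0// ltW.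
  (* A nonzero code word forces 2 r |y| >= 1, so thirteen extra powers of this quantity may be
     inserted; they supply the factor r^13. *)
  have h1 : 1 <= (2 * (r * `|y|)) ^+ 13.
    by rewrite exprn_ege1//; move/k2 : kp; lra.
  apply: (@le_trans _ _ ((2 * (r * `|y|)) ^+ 14)).
    by apply: (le_trans kz); rewrite exprS ler_peMr// mulr_ge0.
  have -> : (2 * (r * `|y|)) ^+ 14 = T * (r ^+ 13 * r) * `|y| ^+ 14.
    by rewrite p14' -exprSr -!exprMn mulrA.
  have hy : `|y| ^+ 14 <= G * e.
    by apply: le_trans (hG _ (normr_ge0 y)) _; rewrite ler_pM2l.
  have : 0 < r ^+ 13 by exact: exprn_gt0.
  move: hy; move: (r ^+ 13) (`|y| ^+ 14) => A Y hy A0.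
  apply: (@le_trans _ _ (T * (A * r) * (G * e))); last by rewrite le_eqVlt; apply/orP; left; apply/eqP; ring.
  by apply: ler_wpM2l hy; rewrite !mulr_ge0// ltW.
apply: (le_trans kz).
have yl : `|y| <= e.
  apply: le_trans ey; apply: le_trans (expR_ge1Dx _); lra.
have c1 : 2 <= T * G.
  by rewrite -[leLHS]mulr1; apply: ler_pM.
have re : 0 <= r * e by rewrite mulr_ge0// ltW.
apply: (@le_trans _ _ (2 * (r * e))).
  by rewrite ler_pM2l// ler_pM2l.
apply: (@le_trans _ _ (T * G * (r * e))).
  by rewrite ler_wpM2r.
rewrite -!mulrA; do 2 (rewrite ler_pM2l//).
by rewrite ler_pM2l// ler_peMr// ltW.
Qed.

(* The code words are the integers [0, .., K] and [-1, .., -K]. *)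
Definition code_abs K (c : 'I_K.+1 + 'I_K) : nat :=
  match c with inl m => m | inr m => m.+1 end.

(** Over all integers the geometric weights q^|k| with q = exp(-1/r) sum to (1+q)/(1-q), the
    quantity whose logarithm [code_cost] adds. *)
Lemma kraft (r : R) K : 0 < r ->
  \sum_(c : 'I_K.+1 + 'I_K) expR (- code_cost r (code_abs c)) <= 1.
Proof.
move=> r0; have [al0 al1 alr] := ratio_facts r0.
pose al := expR (- r^-1).
have h : 0 < 1 - al by rewrite subr_gt0.
have p : 0 < (1 + al) / (1 - al) by rewrite divr_gt0// addr_gt0.
have E k : expR (- code_cost r k) = al ^+ k * ((1 - al) / (1 + al)).
  rewrite /code_cost opprD expRD -lnV ?posrE// lnK ?posrE ?invr_gt0// invf_div.
  by rewrite /al -expRM_natl mulrN.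
rewrite big_sumType /=; under eq_bigr do rewrite E; under [X in _ + X]eq_bigr do rewrite E.
rewrite -!mulr_suml -mulrDl.
apply: (@le_trans _ _ (((1 - al)^-1 + al * (1 - al)^-1) * ((1 - al) / (1 + al)))).
  apply: ler_wpM2r; first by rewrite divr_ge0 ?ltW// addr_gt0.
  apply: lerD; first by apply: geometric_sum_le; rewrite ltW.
  under eq_bigr do rewrite exprS; rewrite -mulr_sumr ler_pM2l//.
  by apply: geometric_sum_le; rewrite ltW.
rewrite (_ : _ * _ = 1)//; field; rewrite !gt_eqF//.
by rewrite addr_gt0.
Qed.

End elementary_bounds.

(** * Small ball probabilities by coding *)

Section weak_sidak.
Context {R : realType} {d : measure_display} {Omega : measurableType d}.
Context (P : probability Omega R) (W : set (R * R) -> Omega -> R).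
Hypothesis hW : white_noise P W.
Notation leb := (@lebesgue_measure R).
Implicit Types (l : seq (R * set (R * R))).

Lemma finite_cover_prob d' (T : measurableType d') (Q : probability T R) (J : finType)
    (G : pred J) (A : J -> set T) (S : set T) :
  measurable S -> (forall c, measurable (A c)) ->
  (forall w, S w -> exists2 c, G c & A c w) ->
  (Q S <= \sum_(c | G c) Q (A c))%E.
Proof.
move=> mS mA cov.
have E B : measurable B -> (\int[Q]_w (\1_B w)%:E = Q B)%E.
  by move=> mB; rewrite integral_indic// setIT.
have -> : (\sum_(c | G c) Q (A c) = \sum_(c | G c) \int[Q]_w (\1_(A c) w)%:E)%E.
  by apply: eq_bigr => c _; rewrite E.
rewrite -E// -[X in (_ <= X)%E]big_filter -ge0_integral_sum//.
apply: ge0_le_integral => //.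
- by apply/measurable_EFinP; exact: measurable_indic.
- by apply: emeasurable_sum => c; apply/measurable_EFinP; exact: measurable_indic.
  move=> w _; rewrite big_filter sumEFin lee_fin indicE.
have [/set_mem Sw|_] := boolP (w \in S); last by apply: sumr_ge0.
have [c Gc Ac] := cov _ Sw.
  by rewrite (bigD1 c)//= indicE mem_set// lerDl sumr_ge0.
by move=> c; apply/measurable_EFinP; exact: measurable_indic.
Qed.

Lemma finite_disjoint_prob d' (T : measurableType d') (Q : probability T R) (J : finType)
    (G : pred J) (A : J -> set T) (B : set T) :
  measurable B -> (forall c, measurable (A c)) ->
  (forall c, G c -> A c `<=` B) ->
  (forall c c' w, A c w -> A c' w -> c = c') ->
  (\sum_(c | G c) Q (A c) <= Q B)%E.
Proof.
move=> mB mA AB dis.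
have E C : measurable C -> (\int[Q]_w (\1_C w)%:E = Q C)%E.
  by move=> mC; rewrite integral_indic// setIT.
have -> : (\sum_(c | G c) Q (A c) = \sum_(c | G c) \int[Q]_w (\1_(A c) w)%:E)%E.
  by apply: eq_bigr => c _; rewrite E.
rewrite -E// -[X in (X <= _)%E]big_filter -ge0_integral_sum//.
apply: ge0_le_integral => //.
- by move=> w _; apply: sume_ge0.
- by apply: emeasurable_sum => c; apply/measurable_EFinP; exact: measurable_indic.
- by apply/measurable_EFinP; exact: measurable_indic.
move=> w _; rewrite big_filter sumEFin lee_fin.
have [[c [Gc Ac]]|no] := pselect (exists c, G c /\ A c w).
  rewrite (bigD1 c)//= big1 ?addr0.
    by have Bw := AB c Gc w Ac; rewrite !indicE !mem_set.
  move=> c' /andP[_ cc']; rewrite indicE memNset// => Ac'.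
  by move/eqP : cc'; apply; exact: dis Ac' Ac.
rewrite big1// => c Gc; rewrite indicE memNset// => Ac; apply: no.
by exists c.
by move=> c; apply/measurable_EFinP; exact: measurable_indic.
Qed.

Lemma wsum_exp_scaled l (s : R) : step_ok l -> 0 < s -> step_var l <= s ^+ 2 ->
  (\int[P]_w (expR (wsum W l w / s))%:E <= (expR 2^-1)%:E)%E.
Proof.
move=> ok s0 vs.
have E w : wsum W l w / s = wsum W (step_scale s^-1 l) w by rewrite wsum_scale mulrC.
under eq_integral do rewrite E.
rewrite (wsum_exp hW); last exact: step_ok_scale.
rewrite lee_fin ler_expR step_var_scale exprVn ler_pdivrMr// mulVf//.
by rewrite mulrC ler_pdivrMr ?exprn_gt0// mul1r.
Qed.

(** Up to constants in the exponent the bound is a product over the coordinates. Only upper bounds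
    on the variances enter, whatever the correlations, and this is what lets all links of a chaining
    be treated at once. *)
Lemma weak_sidak : exists C : R, 0 < C /\
  forall (I : finType) (L : I -> seq (R * set (R * R))) (s e : I -> R),
  (forall i, step_ok (L i)) -> (forall i, 0 < s i) -> (forall i, 0 < e i) ->
  (forall i, step_var (L i) <= s i ^+ 2) ->
  ((expR (- (2 * (\sum_i C * phi13 (s i / e i)) + 1)) / 4)%:E <=
   P [set w | forall i, (- e i < wsum W (L i) w <= e i)%R])%E.
Proof.
have [C0 [C00 cost]] := @code_cost_le R.
exists (C0 * (2 * expR 2^-1)); split; first by rewrite !mulr_gt0 ?expR_gt0.
move=> I L s e ok s0 e0 vs.
pose r i := s i / e i.
have r0 i : 0 < r i by rewrite divr_gt0.
pose X i w := wsum W (L i) w.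
have mX i : measurable_fun setT (X i) by exact: (measurable_wsum hW).
pose y i w := X i w / s i.
have my i : measurable_fun setT (y i) by apply: measurable_funM.
(* A majorant of the total code length, with mean at most [H]. *)
pose N w := \sum_i C0 * phi13 (r i) * (expR (y i w) + expR (- y i w)).
set H := \sum_i _; pose B := 2 * H + 1.
have ph i : 0 <= phi13 (r i) by apply: phi13_ge0; exact: ltW.
have H0 : 0 <= H.
  by apply: sumr_ge0 => i _; apply: mulr_ge0 (ph i); rewrite !mulr_ge0 ?expR_ge0// ltW.
have B0 : 0 < B by rewrite /B; lra.
have mt i : measurable_fun setT (fun w => C0 * phi13 (r i) * (expR (y i w) + expR (- y i w))).
  apply: measurable_funM => //; apply: measurable_funD; first exact: measurableT_comp.
  by apply: measurableT_comp => //; exact: measurableT_comp.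
have mN : measurable_fun setT N by apply: measurable_sum.
have t0 i w : 0 <= C0 * phi13 (r i) * (expR (y i w) + expR (- y i w)).
  by rewrite !mulr_ge0 ?addr_ge0 ?expR_ge0// ltW.
have N0 w : 0 <= N w by apply: sumr_ge0.
have EN : (\int[P]_w (N w)%:E <= H%:E)%E.
  under eq_integral do rewrite -sumEFin.
  rewrite ge0_integral_sum; [|exact: measurableT|by move=> i; apply/measurable_EFinP|by move=> i w _; rewrite lee_fin].
  rewrite -sumEFin; apply: lee_sum => i _.
  have okN : step_ok (step_scale (-1) (L i)) by exact: step_ok_scale.
  under eq_integral do rewrite EFinM EFinD.
  have m1 : measurable_fun setT (fun w => (expR (y i w))%:E).
    by apply/measurable_EFinP; apply: measurableT_comp.
  have m2 : measurable_fun setT (fun w => (expR (- y i w))%:E).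
    by apply/measurable_EFinP; apply: measurableT_comp => //; exact: measurableT_comp.
  rewrite ge0_integralZl; [|exact: measurableT|exact: emeasurable_funD| |]; last 2 first.
  - by move=> w _; rewrite -EFinD lee_fin addr_ge0 ?expR_ge0.
  - by rewrite lee_fin mulr_ge0// ltW.
  rewrite ge0_integralD; [|exact: measurableT| |exact: m1| |exact: m2]; last 2 first.
  - by move=> w _; rewrite lee_fin expR_ge0.
  - by move=> w _; rewrite lee_fin expR_ge0.
  rewrite (_ : C0 * (2 * _) * _ = C0 * phi13 (r i) * (2 * expR 2^-1)); last by rewrite /r; ring.
  rewrite [leRHS]EFinM; apply: lee_wpmul2l; first by rewrite lee_fin mulr_ge0// ltW.
  rewrite mulr2n mulrDl mul1r EFinD; apply: leeD; first exact: wsum_exp_scaled.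
  have E w : - y i w = wsum W (step_scale (-1) (L i)) w / s i by rewrite wsum_scale mulN1r mulNr.
  under eq_integral do rewrite E.
  by apply: wsum_exp_scaled => //; rewrite step_var_scale sqrrN expr1n mul1r.
pose S := [set w | N w < B].
have mlt (f : Omega -> R) c : measurable_fun setT f -> measurable [set w | f w < c].
  move=> mf; rewrite (_ : [set w | _] = f @^-1` `]-oo, c[).
    by rewrite -[X in measurable X]setTI; apply: mf.
  by apply/seteqP; split => w /=; rewrite in_itv.
have mS : measurable S by exact: mlt.
(* Markov's inequality at level B = 2 H + 1, more than twice the mean. *)
have PS : ((2^-1)%:E <= P S)%E.
  have := le_trans (markov_ge0 P mN N0 (ltW B0)) EN.
  have -> : [set w | B <= N w] = ~` S.
    by apply/seteqP; split => w /=; rewrite /S/= leNgt => /negP.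
  rewrite probability_setC// -(fineK (fin_num_measure P S mS)).
  by rewrite -EFinB -EFinM !lee_fin /B => h; rewrite leNgt; apply/negP => h'; nra.
(* A word of cost below [B] in coordinate i codes an integer of size below [r i * B], so a finite
   alphabet suffices. *)
have [K KP] : exists K : nat, forall i, r i * B < K%:R.
  exists (Num.bound (\sum_i r i * B)) => i.
  apply: le_lt_trans (archi_boundP _); last by apply: sumr_ge0 => j _; rewrite mulr_ge0// ltW.
  by rewrite (bigD1 i)//= lerDl sumr_ge0// => j _; rewrite mulr_ge0// ltW.
pose J := {ffun I -> 'I_K.+1 + 'I_K}.
pose val (c : 'I_K.+1 + 'I_K) : R := match c with inl m => m%:R | inr m => - m.+1%:R end.
pose A (c : J) := [set w | forall i, val (c i) - 2^-1 <= X i w / e i < val (c i) + 2^-1].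
pose G (c : J) := \sum_i code_cost (r i) (code_abs (c i)) < B.
have mA c : measurable (A c).
  rewrite (_ : A c = \bigcap_(i in [set: I]) ((fun w => X i w / e i) @^-1` `[val (c i) - 2^-1, val (c i) + 2^-1[)).
    apply: fin_bigcap_measurable => // i _; rewrite -[X in measurable X]setTI.
    by apply: measurable_funM.
  apply/seteqP; split => [w h i _|w h i]; first by rewrite /= in_itv/=.
  by have := h i Logic.I; rewrite /= in_itv.
have Xy i w : X i w / e i = r i * y i w.
  by rewrite /r /y; field; rewrite !gt_eqF.
have cov w : S w -> exists2 c, G c & A c w.
  move=> Sw.
  pose k i := Num.floor (X i w / e i + 2^-1).
  have kf i : (k i)%:~R - 2^-1 <= X i w / e i < (k i)%:~R + 2^-1.
    have := floor_itv (X i w / e i + 2^-1); rewrite -/(k i) intrD /= => /andP[h1 h2].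
    by apply/andP; split; [lra|rewrite -(ltrD2r 2^-1); apply: (lt_le_trans h2); lra].
  pose n i : nat := `|k i|%N.
  have nk i : (n i)%:R = `|(k i)%:~R| :> R by rewrite /n -intr_norm natr_absz.
  have cc i : code_cost (r i) (n i) <= C0 * phi13 (r i) * (expR (y i w) + expR (- y i w)).
    apply: cost => //.
      rewrite nk -{1}(gtr0_norm (r0 i)) -normrM -Xy.
      have /andP[h1 h2] := kf i; rewrite ler_norml.
      have := ler_norm (X i w / e i); have := ler_norm (- (X i w / e i)); rewrite normrN.
      by move=> *; apply/andP; split; lra.
    move=> n0; rewrite -{1}(gtr0_norm (r0 i)) -normrM -Xy.
    have : 1 <= (n i)%:R :> R by rewrite ler1n.
    rewrite nk; have /andP[h1 h2] := kf i.
    have := ler_norm (X i w / e i); have := ler_norm (- (X i w / e i)); rewrite normrN.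
    by case: (ler0P ((k i)%:~R : R)) => *; lra.
  have ge0 i m : m%:R / r i <= code_cost (r i) m.
    rewrite /code_cost lerDl ln_ge0//.
    have [al0 al1 _] := ratio_facts (r0 i).
    by rewrite ler_pdivlMr ?subr_gt0// mul1r; lra.
  have NB : \sum_i code_cost (r i) (n i) < B by apply: le_lt_trans Sw; exact: ler_sum.
  have nK i : (n i < K)%N.
    rewrite -(ltr_nat R); apply: lt_trans (KP i); rewrite -ltr_pdivrMl// mulrC.
    apply: le_lt_trans (ge0 _ _) _; apply: le_lt_trans NB.
    rewrite (bigD1 i)//= lerDl sumr_ge0// => j _; apply: le_trans (ge0 _ _).
    by rewrite divr_ge0// ltW.
  have exc i : exists c : 'I_K.+1 + 'I_K, code_abs c = n i /\ val c = (k i)%:~R.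
    have := nK i; rewrite /n; case: (k i) => m /= mK.
      by exists (inl (inord m)); rewrite /= inordK// ltnS ltnW.
    by exists (inr (Ordinal (ltnW mK))); rewrite /= NegzE mulrNz.
  have [ci ca] := choice exc.
  exists [ffun i => ci i].
    rewrite /G; under eq_bigr do rewrite ffunE (ca _).1; exact: NB.
  by move=> i; rewrite ffunE (ca i).2; exact: kf.
have cov2 := finite_cover_prob P mS mA cov.
have dis c c' w : A c w -> A c' w -> c = c'.
  move=> h h'; apply/ffunP => i; have /andP[h1 h2] := h i; have /andP[h3 h4] := h' i.
  have lt1 : `|val (c i) - val (c' i)| < 1 by rewrite ltr_norml; apply/andP; split; lra.
  case: (c i) (c' i) lt1 => [m|m] [m'|m'] /= hm.
  - congr inl; apply/val_inj => /=; apply/eqP; rewrite eqn_leq; move: hm.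
    rewrite ltr_norml => /andP[u v].
    have u1 : (m'%:R : R) < m.+1%:R by rewrite -natr1; lra.
    have v1 : (m%:R : R) < m'.+1%:R by rewrite -natr1; lra.
    by move: u1 v1; rewrite !ltr_nat !ltnS => -> ->.
  - exfalso; move: hm; rewrite opprK ltr_norml => /andP[_].
    by rewrite -natrD -[X in _ < X]/(1%:R) ltr_nat addnS.
  - exfalso; move: hm; rewrite -opprD normrN ltr_norml => /andP[_].
    by rewrite -natrD -[X in _ < X]/(1%:R) ltr_nat addSn.
  - congr inr; apply/val_inj => /=; apply/eqP; rewrite eqn_leq; move: hm.
    rewrite ltr_norml -!natr1 => /andP[u v].
    have u1 : (m'%:R : R) < m.+1%:R by rewrite -natr1; lra.
    have v1 : (m%:R : R) < m'.+1%:R by rewrite -natr1; lra.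
    by move: u1 v1; rewrite !ltr_nat !ltnS => -> ->.
pose p c := fine (P (A c)).
have pE c : P (A c) = (p c)%:E by rewrite fineK// fin_num_measure.
have p0 c : 0 <= p c by rewrite fine_ge0.
have sp : 2^-1 <= \sum_(c | G c) p c.
  rewrite -lee_fin -sumEFin; apply: (le_trans PS); apply: (le_trans cov2).
  by under eq_bigr do rewrite pE.
(* Kraft's inequality for the product code: each admissible word weighs more than exp(-B), so at
   most exp B of them exist. *)
have card : \sum_(c | G c) expR (- B) <= 1.
  apply: (@le_trans _ _ (\sum_(c : J) \prod_i expR (- code_cost (r i) (code_abs (c i))))).
    rewrite big_mkcond /=; apply: ler_sum => c _; case: ifPn => Gc; last first.
      by apply: prodr_ge0 => i _; exact: expR_ge0.
    by rewrite -expR_sum ler_expR sumrN lerN2 ltW.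
  rewrite -(bigA_distr_bigA (fun i k => expR (- code_cost (r i) (code_abs k)))).
  suff /andP[_ //] : 0 <= \prod_i \sum_k expR (- code_cost (r i) (code_abs (k : 'I_K.+1 + 'I_K))) <= 1.
  apply: (big_ind (fun x : R => 0 <= x <= 1)); first by rewrite ler01 lexx.
    by move=> x z /andP[x0 x1] /andP[z0 z1]; rewrite mulr_ge0// mulr_ile1.
  move=> i _; rewrite kraft// andbT.
  by apply: sumr_ge0 => k _; exact: expR_ge0.
pose t := expR (- B) / 2.
have tp : 0 < t by rewrite divr_gt0 ?expR_gt0.
(* Cauchy-Schwarz in tangent form, p^2 >= 2 t p - t^2. The value t = exp(-B)/2 is fitted to a total
   mass of at least 1/2 carried by at most exp B cells. *)
have sq : t / 2 <= \sum_(c | G c) p c ^+ 2.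
  apply: (@le_trans _ _ (\sum_(c | G c) (2 * t * p c - t ^+ 2))).
    rewrite big_split/= -mulr_sumr sumrN.
    have -> : \sum_(c | G c) t ^+ 2 = (t / 2) * \sum_(c | G c) expR (- B).
      by rewrite mulr_sumr; apply: eq_bigr => c _; rewrite /t; field.
    have : (t / 2) * \sum_(c | G c) expR (- B) <= (t / 2) * 1.
      by apply: ler_wpM2l => //; rewrite divr_ge0 ?ltW.
    have : 2 * t * 2^-1 <= 2 * t * \sum_(c | G c) p c.
      by apply: ler_wpM2l => //; rewrite mulr_ge0 ?ltW.
    by move=> *; lra.
  apply: ler_sum => c _; rewrite -subr_ge0 (_ : _ - _ = (p c - t) ^+ 2) ?sqr_ge0//.
  by ring.
(* Two copies in one cell differ by less than [e i]. The window is relaxed to sqrt 2 times [e i] so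
   that [copy_diff] returns exactly the window [e i]. *)
pose D := [set z : Omega * Omega |
  forall i, - (Num.sqrt 2 * e i) < X i z.1 - X i z.2 <= Num.sqrt 2 * e i].
have s2 : 1 <= Num.sqrt 2 :> R by rewrite -[leLHS]sqrtr1 ler_wsqrtr// ler1n.
have mD : measurable D.
  apply: measurable_box => i; apply: measurable_funB.
    exact: (measurableT_comp (mX i) measurable_fst).
  exact: (measurableT_comp (mX i) measurable_snd).
have ds : (\sum_(c | G c) (P \x P)%E (A c `*` A c) <= (P \x P)%E D)%E.
  apply: (@finite_disjoint_prob _ _ (P \x P)%E _ _ _ _ mD).
  - by move=> c; exact: measurableX.
  - move=> c _ z [/= h1 h2] i; have /andP[a1 a2] := h1 i; have /andP[a3 a4] := h2 i.
    have : `|X i z.1 / e i - X i z.2 / e i| < 1 by rewrite ltr_norml; apply/andP; split; lra.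
    rewrite -mulrBl normrM (gtr0_norm (x := (e i)^-1)) ?invr_gt0// ltr_pdivrMr// mul1r.
    have : e i <= Num.sqrt 2 * e i by rewrite ler_peMl// ltW.
    by rewrite ltr_norml => h /andP[b1 b2]; apply/andP; split; lra.
  - by move=> c c' z [/= h _] [/= h' _]; exact: dis h h'.
have DE : (P \x P)%E D = P [set w | forall i, - e i < wsum W (L i) w <= e i].
  rewrite -[LHS](copy_diff hW (fun i => - (Num.sqrt 2 * e i)) (fun i => Num.sqrt 2 * e i) ok).
  congr (P _); apply/seteqP.
  have s2p : 0 < Num.sqrt 2 :> R by apply: lt_le_trans s2.
  by split => w /= h i; have := h i; rewrite -mulrN !ltr_pM2l// !ler_pM2l.
rewrite -DE; apply: le_trans ds.
have -> : (\sum_(c | G c) (P \x P)%E (A c `*` A c) = (\sum_(c | G c) p c ^+ 2)%:E)%E.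
  rewrite -sumEFin; apply: eq_bigr => c _.
  transitivity (P (A c) * P (A c))%E; first exact: product_measure1E.
  by rewrite pE -EFinM expr2.
rewrite lee_fin; apply: le_trans sq; rewrite /t -/B.
by rewrite le_eqVlt; apply/orP; left; apply/eqP; field.
Qed.

End weak_sidak.

(** * Bernstein inequality for Walsh integrals *)

Section noise_algebras.
Context {R : realType} {d : measure_display} {Omega : measurableType d}.
Context (P : probability Omega R) (W : set (R * R) -> Omega -> R).
Hypothesis hW : white_noise P W.
Implicit Types (l : seq (R * set (R * R))) (D : set (R * R)).

(** The generators of the filtration with the time strip replaced by an arbitrary region, so that
    past and future slabs are treated alike. *)
Definition noise_gen D : set (set Omega) :=
  [set E | exists A B, [/\ finite_area_set A, A `<=` D,
                           measurable (B : set R) & E = W A @^-1` B]]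
  `|` [set N | measurable N /\ P N = 0%E].
Definition noise_alg D := <<s noise_gen D >>.

Lemma noise_filtrationE t : noise_filtration P W t = noise_alg (`[0, t] `*` `[0, 1]).
Proof. by []. Qed.

Lemma noise_alg_measurable D E : noise_alg D E -> measurable E.
Proof.
apply: smallest_sub; first exact: sigma_algebra_measurable.
move=> F [[A [B [fA AD mB ->]]]|[]//].
by rewrite -[X in measurable X]setTI; apply: (proj1 hW).
Qed.

Lemma noise_algS D D' : D `<=` D' -> noise_alg D `<=` noise_alg D'.
Proof.
move=> DD'; apply: sub_sigma_algebra2 => F [[A [B [fA AD mB ->]]]|]; last by right.
by left; exists A, B; split => //; exact: subset_trans DD'.
Qed.

Definition step_in D l := forall p, p \in l -> finite_area_set p.2 /\ p.2 `<=` D.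

Lemma step_in_ok D l : step_in D l -> step_ok l.
Proof. by move=> h p /h[]. Qed.

(** A pi-system generating [noise_alg D], made of events to which [block_indep] applies; null events
    are adjoined as in the filtration. *)
Definition noise_box D : set (set Omega) :=
  [set E | exists (I : finType) (L : I -> seq (R * set (R * R))) (a b : I -> R),
     (forall i, step_in D (L i)) /\
     E = [set w | forall i, a i < wsum W (L i) w <= b i]]
  `|` [set N | measurable N /\ P N = 0%E].

Lemma noise_box_measurable D E : noise_box D E -> measurable E.
Proof.
move=> [[I [L [a [b [h ->]]]]]|[]//]; apply: measurable_box => i.
by apply: (measurable_wsum hW); exact: step_in_ok (h i).
Qed.

Lemma noise_box_setI D : setI_closed (noise_box D).
Proof.
move=> E F hE hF.
have mE := noise_box_measurable hE; have mF := noise_box_measurable hF.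
case: hE => [[I [L [a [b [h eE]]]]]|[_ E0]]; last first.
  by right; split; [exact: measurableI|apply: subset_measure0 E0 => //; exact: measurableI].
case: hF => [[J [L' [a' [b' [h' eF]]]]]|[_ F0]]; last first.
  by right; split; [exact: measurableI|apply: subset_measure0 F0 => //; exact: measurableI].
left; exists (I + J)%type, (fun k => match k with inl i => L i | inr j => L' j end),
  (fun k => match k with inl i => a i | inr j => a' j end),
  (fun k => match k with inl i => b i | inr j => b' j end); split; first by case.
rewrite eE eF; apply/seteqP; split => w /=.
  by move=> [u v] [i|j].
by move=> u; split => i; [exact: (u (inl i))|exact: (u (inr i))].
Qed.

Lemma noise_gen_box D : noise_gen D `<=` <<s noise_box D >>.
Proof.
move=> E [[A [B [fA AD mB ->]]]|N0]; last by apply: sub_sigma_algebra; right.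
have := @g_sigma_preimageE Omega R setT (W A) (@ocitv R).
move=> /seteqP[_ /(_ (W A @^-1` B))].
have hB : preimage_set_system setT (W A) ((@ocitv R).-sigma.-measurable) (W A @^-1` B).
  by exists B => //; rewrite setTI.
move=> /(_ hB); apply: sub_sigma_algebra2 => _ [_ [[a b] _ <-] <-]; rewrite setTI.
left; exists unit, (fun=> [:: (1, A)]), (fun=> a), (fun=> b); split.
  by move=> _ p; rewrite inE => /eqP ->.
apply/seteqP; split => w /=.
  by rewrite in_itv/= => h _; rewrite /wsum big_seq1 mul1r.
by move/(_ tt); rewrite in_itv/= /wsum big_seq1 mul1r.
Qed.

Lemma noise_alg_box D : noise_alg D `<=` <<s noise_box D >>.
Proof. by apply: smallest_sub; [exact: smallest_sigma_algebra|exact: noise_gen_box]. Qed.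

Lemma pi_lambda_indep (G : set (set Omega)) (D : set Omega) : setI_closed G ->
  (forall E, G E -> measurable E) -> measurable D ->
  (forall E, G E -> P (E `&` D) = P E * P D)%E ->
  forall E, <<s G >> E -> (P (E `&` D) = P E * P D)%E.
Proof.
move=> IG mG mD GD.
pose H := [set E | measurable E /\ (P (E `&` D) = P E * P D)%E].
have dH : dynkin H.
  split.
  - by split; [exact: measurableT|rewrite setTI probability_setT mul1e].
  - move=> E [mE hE]; split; first exact: measurableC.
    rewrite setIC -setDE measureD//; last exact: (le_lt_trans (probability_le1 P mD) (ltry _)).
    transitivity (P D - P (E `&` D))%E; first by rewrite (setIC E).
    rewrite hE probability_setC// -(fineK (fin_num_measure P E mE)) -(fineK (fin_num_measure P D mD)).
    by rewrite -EFinM -!EFinB -EFinM mulrBl mul1r.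
  - move=> F tF hF; split; first by apply: bigcupT_measurable => n; case: (hF n).
    have mF n : measurable (F n) by case: (hF n).
    rewrite setI_bigcupl measure_semi_bigcup//; last 3 first.
    + by move=> n; exact: measurableI.
    + exact: trivIset_setIr.
    + by apply: bigcupT_measurable => n; exact: measurableI.
    rewrite measure_semi_bigcup//; last exact: bigcupT_measurable.
    rewrite muleC -[X in (X * _)%E](fineK (fin_num_measure P D mD)) -nneseriesZl//.
    by apply: eq_eseriesr => n _; rewrite fineK ?fin_num_measure// muleC; case: (hF n).
have := lambda_system_subset IG (proj1 (dynkin_lambda_system H) dH) (D := setT).
move=> h E sE; suff [] : H E by [].
apply: (h _ _ E sE) => // F GF; split; [exact: mG|exact: GD].
Qed.

Lemma noise_box_indep D D' E F : D `&` D' = set0 -> noise_box D E -> noise_box D' F ->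
  (P (E `&` F) = P E * P F)%E.
Proof.
move=> DD' hE hF.
have mE := noise_box_measurable hE; have mF := noise_box_measurable hF.
case: hE => [[I [L [a [b [h eE]]]]]|[_ E0]]; last first.
  by rewrite E0 mul0e; apply: subset_measure0 E0 => //; exact: measurableI.
case: hF => [[J [L' [a' [b' [h' eF]]]]]|[_ F0]]; last first.
  by rewrite F0 mule0; apply: subset_measure0 F0 => //; exact: measurableI.
rewrite eE eF; apply: (block_indep hW) => [i|j|i j].
- exact: step_in_ok (h i).
- exact: step_in_ok (h' j).
rewrite /step_cov big_seq big1// => p pL; rewrite big_seq big1// => q qL.
rewrite (_ : p.2 `&` q.2 = set0) ?/area ?measure0 ?mulr0//.
rewrite -subset0 -DD'; apply: setISS; first exact: (h i p pL).2.
exact: (h' j q qL).2.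
Qed.

(** The pi-lambda argument is run twice, once in each of the two events, starting from boxes. *)
Lemma noise_indep D D' E F : D `&` D' = set0 -> noise_alg D E -> noise_alg D' F ->
  (P (E `&` F) = P E * P F)%E.
Proof.
move=> DD' hE hF; have mF := noise_alg_measurable hF.
apply: (pi_lambda_indep (G := noise_box D)) => //.
- exact: noise_box_setI.
- by move=> G; exact: noise_box_measurable.
- move=> G hG; rewrite setIC muleC.
  apply: (pi_lambda_indep (G := noise_box D')) => //.
  + exact: noise_box_setI.
  + by move=> K; exact: noise_box_measurable.
  + exact: noise_box_measurable hG.
  + by move=> K hK; rewrite setIC muleC; exact: noise_box_indep hG hK.
  + exact: noise_alg_box.
- exact: noise_alg_box.
Qed.

(** Under [P] the diagonal map into the product of the two sub-sigma-algebras has the product law.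
    In this way coefficients known at time T are treated as constants when one integrates over the
    noise after T. *)
Lemma freeze D D' (F : g_sigma_algebraType (noise_gen D) * g_sigma_algebraType (noise_gen D')
    -> \bar R) : D `&` D' = set0 ->
  measurable_fun setT F -> (forall z, 0 <= F z)%E ->
  (\int[P]_w F (w, w) = \int[P]_w \int[P]_w' F (w, w'))%E.
Proof.
move=> DD' mF F0.
pose G1 := g_sigma_algebraType (noise_gen D).
pose G2 := g_sigma_algebraType (noise_gen D').
have mid1 : measurable_fun setT (id : Omega -> G1).
  by move=> _ B mB; rewrite setTI; exact: noise_alg_measurable mB.
have mid2 : measurable_fun setT (id : Omega -> G2).
  by move=> _ B mB; rewrite setTI; exact: noise_alg_measurable mB.
pose X1 : {mfun Omega >-> G1} := HB.pack (id : Omega -> G1) (isMeasurableFun.Build _ _ _ _ _ mid1).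
pose X2 : {mfun Omega >-> G2} := HB.pack (id : Omega -> G2) (isMeasurableFun.Build _ _ _ _ _ mid2).
pose m1 := distribution P X1; pose m2 := distribution P X2.
pose diag (w : Omega) : G1 * G2 := (w, w).
have mdiag : measurable_fun setT diag by apply: measurable_fun_pair.
transitivity (\int[m1 \x m2]_z F z)%E.
  transitivity (\int[pushforward P diag]_z F z)%E.
    by rewrite ge0_integral_pushforward// preimage_setT.
  apply: eq_measure_integral => A mA _; apply/esym; apply: product_measure_unique => //.
  move=> A1 A2 mA1 mA2; rewrite /pushforward /= /m1 /m2 /distribution /pushforward/=.
  exact: (noise_indep DD' mA1 mA2).
rewrite fubini_tonelli1// /fubini_F.
rewrite /m1 /distribution ge0_integral_pushforward//=; last 2 first.
- exact: measurable_fun_fubini_tonelli_F.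
- by move=> x _; exact: integral_ge0.
rewrite preimage_setT; apply: eq_integral => w _ /=.
have mf2 : measurable_fun setT (fun y : G2 => F (w, y)).
  exact: (measurableT_comp mF (pair1_measurable (w : G1))).
have := ge0_integral_pushforward mid2 P measurableT mf2 (fun y _ => F0 (w, y)).
by rewrite preimage_setT.
Qed.

Lemma noise_alg_wsum D l : step_in D l ->
  measurable_fun setT (wsum W l : g_sigma_algebraType (noise_gen D) -> R).
Proof.
move=> h; rewrite (_ : wsum W l = fun w => \sum_(p <- l) (if p \in l then p.1 * W p.2 w else 0)).
  apply: measurable_sum => p; have [pl|_] := boolP (p \in l); last exact: measurable_cst.
  apply: measurable_funM => //; move=> _ B mB; rewrite setTI.
  by apply: sub_sigma_algebra; left; exists p.2, B; case: (h p pl).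
by apply/funext => w; apply: eq_big_seq => p ->.
Qed.

Lemma measurable_wrtP D (X : Omega -> R) :
  measurable_wrt (noise_alg D) X <->
  measurable_fun setT (X : g_sigma_algebraType (noise_gen D) -> R).
Proof.
split => [h _ B mB|h B mB]; first by rewrite setTI; exact: h.
by have := h measurableT B mB; rewrite setTI.
Qed.

End noise_algebras.

Section product_sigma_finite.
Context {R : realType}.
Context {d1 d2 : measure_display} (T1 : measurableType d1) (T2 : measurableType d2)
 (m1 : {sigma_finite_measure set T1 -> \bar R}) (m2 : {sigma_finite_measure set T2 -> \bar R}).
(** Makes Lebesgue measure on the plane available as a factor in Tonelli's theorem together with
    [P]. *)
Lemma prod_sigma_finite : sigma_finite setT (m1 \x m2)%E.
Proof.
have /sigma_finiteP[F [TF ndF Foo]] := sigma_finiteT m1.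
have /sigma_finiteP[G [TG ndG Goo]] := sigma_finiteT m2.
exists (fun n => F n `*` G n).
 rewrite -setXTT TF TG predeqE => -[x y]; split.
    move=> [/= [n _ Fnx] [k _ Gky]]; exists (maxn n k) => //; split.
    - by move: x Fnx; exact/subsetPset/ndF/leq_maxl.
    - by move: y Gky; exact/subsetPset/ndG/leq_maxr.
  by move=> [n _ []/= ? ?]; split; exists n.
move=> k; have [? ?] := Foo k; have [? ?] := Goo k.
split; first exact: measurableX.
by rewrite product_measure1E// lte_mul_pinfty// ge0_fin_numE.
Qed.
Let prodm := (m1 \x m2)%E.
HB.instance Definition _ := Measure.on prodm.
HB.instance Definition _ := Measure_isSigmaFinite.Build _ _ _ prodm prod_sigma_finite.
Definition product_sfm : {sigma_finite_measure set (T1 * T2)%type -> \bar R} := prodm.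

End product_sigma_finite.

(** * Exponential martingale of simple processes and Gaussian tails *)

Section bernstein.
Context {R : realType} {d : measure_display} {Omega : measurableType d}.
Context (P : probability Omega R) (W : set (R * R) -> Omega -> R).
Hypothesis hW : white_noise P W.
Notation leb := (@lebesgue_measure R).
Notation mu2 := (leb \x leb)%E.
Implicit Types (l : seq (R * set (R * R))) (D : set (R * R)).

Lemma tonelli_strip (f : R * R * Omega -> \bar R) :
  measurable_fun setT f -> (forall x, 0 <= f x)%E ->
  measurable_fun setT (fun w => \int[mu2]_z f (z, w))%E /\
  (\int[mu2 \x P]_p f p = \int[P]_w \int[mu2]_z f (z, w))%E.
Proof.
move=> mf f0.
pose m1 := product_sfm (@lebesgue_measure R) (@lebesgue_measure R).
split; first exact: (@measurable_fun_fubini_tonelli_G _ _ _ _ R m1 f mf f0).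
exact: (@fubini_tonelli2 _ _ _ _ R m1 P f mf f0).
Qed.

Lemma markov_ge0e (f : Omega -> \bar R) (a : R) :
  measurable_fun setT f -> (forall w, 0 <= f w)%E -> 0 <= a ->
  (a%:E * P [set w | (a%:E <= f w)%E] <= \int[P]_w f w)%E.
Proof.
move=> mf f0 a0.
have mA : measurable [set w | (a%:E <= f w)%E].
  rewrite (_ : [set w | _] = f @^-1` `[a%:E, +oo[).
    by rewrite -[X in measurable X]setTI; apply: mf => //; exact: emeasurable_itv.
  by apply/seteqP; split => w /=; rewrite in_itv/= andbT.
rewrite -[X in (_ * P X)%E]setIT -integral_indic// -ge0_integralZl//; last by apply/measurable_EFinP; exact: measurable_indic.
apply: ge0_le_integral => //.
- by move=> w _; rewrite mule_ge0// lee_fin.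
- by apply: emeasurable_funM => //; apply/measurable_EFinP; exact: measurable_indic.
- move=> w _; rewrite indicE.
  by have [/set_mem/= h|_] := boolP (w \in _); rewrite ?mule1 ?mule0.
Qed.

Lemma wsum_var0 l : step_ok l -> step_var l = 0 -> {ae P, forall w, wsum W l w = 0}.
Proof.
move=> ok v0; exists (wsum W l @^-1` (~` [set 0])); split.
- rewrite -[X in measurable X]setTI; apply: (measurable_wsum hW ok) => //.
  exact: measurableC.
- rewrite (wsum_law hW)//; last exact: measurableC.
  by rewrite /centered_normal v0 eqxx diracE memNset//= => h; exact: h.
- by move=> w /=.
Qed.

(** [white_noise] does not postulate additivity over sets. It holds almost surely all the same,
    because a combination whose step function vanishes has variance zero. *)
Lemma wsum_ae_eq l : step_ok l -> (forall z, stepf l z = 0) ->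
  {ae P, forall w, wsum W l w = 0}.
Proof.
move=> ok z0; apply: wsum_var0 => //; apply: EFin_inj; rewrite -step_varE//.
by under eq_integral do rewrite z0 expr0n/=; rewrite integral0.
Qed.

Lemma finite_area_rect (a b : R) (A : set R) : 0 <= a -> measurable A -> A `<=` `[0, 1] ->
  finite_area_set (`]a, b]%classic `*` A).
Proof.
move=> a0 mA A1; split.
- by apply: measurableX.
- move=> z [/= z1 z2]; split => /=; last exact: A1.
  by move: z1; rewrite !in_itv/= andbT => /andP[h _]; rewrite (le_trans a0)// ltW.
- rewrite /area product_measure1E//.
  apply: (@le_lt_trans _ _ (leb `]a, b] * leb `[0%R, 1%R])%E).
    by apply: lee_wpmul2l => //; apply: le_measure => //; rewrite inE.
  by rewrite !lebesgue_measure_itv/= !lte_fin ltr01 oppr0 adde0 mule1; case: ifP => // _; rewrite -EFinB ltry.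
Qed.

Lemma measurable_ofst d1 d2 (T1 : measurableType d1) (T2 : measurableType d2) (f : T1 -> R) :
  measurable_fun setT f -> measurable_fun setT (fun z : T1 * T2 => f z.1).
Proof. by move=> mf; exact: (measurableT_comp mf measurable_fst). Qed.

Lemma measurable_osnd d1 d2 (T1 : measurableType d1) (T2 : measurableType d2) (f : T2 -> R) :
  measurable_fun setT f -> measurable_fun setT (fun z : T1 * T2 => f z.2).
Proof. by move=> mf; exact: (measurableT_comp mf measurable_snd). Qed.

Lemma measurable_expm_prod d1 d2 (T1 : measurableType d1) (T2 : measurableType d2) N
    (c1 w1 c2 : 'I_N -> T1 -> R) (w2 : 'I_N -> T2 -> R) (q1 q2 : T1 -> R) :
  (forall i, measurable_fun setT (c1 i)) -> (forall i, measurable_fun setT (w1 i)) ->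
  (forall i, measurable_fun setT (c2 i)) -> (forall i, measurable_fun setT (w2 i)) ->
  measurable_fun setT q1 -> measurable_fun setT q2 ->
  measurable_fun setT (fun z : T1 * T2 =>
    (expR (\sum_(i < N) c1 i z.1 * w1 i z.1 - q1 z.1 / 2) *
     expR (\sum_(i < N) c2 i z.1 * w2 i z.2 - q2 z.1 / 2))%:E).
Proof.
move=> m1 m2 m3 m4 m5 m6; apply/measurable_EFinP; apply: measurable_funM.
  apply: (measurableT_comp (f := expR)) => //; apply: measurable_funB.
    by apply: measurable_sum => i; apply: measurable_funM; apply: measurable_ofst.
  by apply: measurable_funM => //; apply: measurable_ofst.
apply: (measurableT_comp (f := expR)) => //; apply: measurable_funB.
  by apply: measurable_sum => i; apply: measurable_funM; [apply: measurable_ofst|apply: measurable_osnd].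
by apply: measurable_funM => //; apply: measurable_ofst.
Qed.

Lemma le_last_path (x y : R) s : path <=%R y s -> x \in s -> x <= last y s.
Proof.
move=> + xs; move/splitPr: xs => [s1 s2]; rewrite last_cat /= cat_path /=.
move=> /and3P[_ _]; rewrite (path_sortedE le_trans) => /andP[/allP h _].
by have := mem_last x s2; rewrite inE => /orP[/eqP ->//|/h].
Qed.

Section one_simple.
Variable phi : simple R Omega.
Hypothesis vphi : valid_simple P W phi.
Let N := simple_size phi.
Let e i : elementary R Omega := simple_term (s := phi) i.
Let aa i := el_left (e i).
Let bb i := el_right (e i).
Let AA i := el_space (e i).
Let XX i := el_coef (e i).

Let aa0 i : 0 <= aa i. Proof. by have [/andP[]] := vphi i. Qed.
Let mAA i : measurable (AA i). Proof. by have [_ []] := vphi i. Qed.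
Let AA1 i : AA i `<=` `[0, 1]. Proof. by have [_ []] := vphi i. Qed.

(** The process stopped at time [T], as a step list with coefficients frozen at [w]. The same [w] is
    then fed into the noise, and the work lies in separating these two roles. *)
Let coefT (T : R) i w : R := if aa i < T then XX i w else 0.
Let setT_ (T : R) i : set (R * R) := `]aa i, Num.min (bb i) T]%classic `*` AA i.
Let LT T w : seq (R * set (R * R)) := [seq (coefT T i w, setT_ T i) | i <- enum 'I_N].
(** Increment of the stopped process over []T, T']]. If no end point lies strictly inside, a term
    contributes only when it covers the whole slab, and its coefficient is then known at time
    [T]. *)
Let coefS (T T' : R) i w : R := if (aa i <= T) && (T' <= bb i) then XX i w else 0.
Let setS (T T' : R) i : set (R * R) := `]T, T']%classic `*` AA i.
Let LS T T' w : seq (R * set (R * R)) := [seq (coefS T T' i w, setS T T' i) | i <- enum 'I_N].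
Let slab (T T' : R) : set (R * R) := `]T, T']%classic `*` `[0, 1]%classic.
Let past (T : R) : set (R * R) := `[0, T]%classic `*` `[0, 1]%classic.

Let okLT T w : step_in (past T) (LT T w).
Proof.
move=> p /mapP[i _ ->] /=; split; first exact: finite_area_rect.
move=> z [z1 z2]; split; last exact: (AA1 z2).
move: z1; rewrite /= !in_itv/= le_min => /andP[h /andP[_ ->]].
by rewrite (le_trans (aa0 i))// ltW.
Qed.

Let okLS T T' w : 0 <= T -> step_in (slab T T') (LS T T' w).
Proof.
move=> T0 p /mapP[i _ ->] /=; split; first exact: finite_area_rect.
by move=> z [z1 z2]; split; [|exact: (AA1 z2)].
Qed.

Let expm (l : seq (R * set (R * R))) w := expR (wsum W l w - step_var l / 2).
Let MT T w := expm (LT T w) w.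

Let G1 T := g_sigma_algebraType (noise_gen P W (past T)).
Let G2 T T' := g_sigma_algebraType (noise_gen P W (slab T T')).

Let coef_meas T i : aa i <= T -> measurable_fun setT (XX i : G1 T -> R).
Proof.
move=> aT; apply/measurable_wrtP => B mB.
have [_ _ _ /(_ B mB)] := vphi i; rewrite noise_filtrationE; apply: noise_algS.
by move=> z [/= z1 z2]; split => //=; move: z1; rewrite !in_itv/= => /andP[-> h]; exact: le_trans aT.
Qed.

Let mcoefT T i : measurable_fun setT (coefT T i : G1 T -> R).
Proof.
rewrite /coefT; case: ltP => h; last exact: measurable_cst.
by apply: coef_meas; exact: ltW.
Qed.

Let mcoefS T T' i : measurable_fun setT (coefS T T' i : G1 T -> R).
Proof.
rewrite /coefS; case: (leP (aa i) T) => h /=; last exact: measurable_cst.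
by case: (T' <= bb i); [exact: coef_meas|exact: measurable_cst].
Qed.

Let wsum_map (c : 'I_N -> R) (S : 'I_N -> set (R * R)) w :
  wsum W [seq (c i, S i) | i <- enum 'I_N] w = \sum_(i < N) c i * W (S i) w.
Proof. by rewrite /wsum big_map -big_enum. Qed.

Let var_map (c : 'I_N -> R) (S : 'I_N -> set (R * R)) :
  step_var [seq (c i, S i) | i <- enum 'I_N] =
  \sum_(i < N) \sum_(j < N) c i * c j * fine (area (S i `&` S j)).
Proof.
rewrite /step_var /step_cov big_map big_enum/=; apply: eq_bigr => i _.
by rewrite big_map big_enum.
Qed.

Let ct (T : R) i : R := if aa i < T then 1 else 0.
Let cs (T T' : R) i : R := if (aa i <= T) && (T' <= bb i) then 1 else 0.

Let coefTE t i w : coefT t i w = XX i w * ct t i.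
Proof. by rewrite /coefT /ct; case: ifP; rewrite ?mulr1 ?mulr0. Qed.
Let coefSE T T' i w : coefS T T' i w = XX i w * cs T T' i.
Proof. by rewrite /coefS /cs; case: ifP; rewrite ?mulr1 ?mulr0. Qed.

Let step_identity T T' : T < T' ->
  (forall i, (aa i <= T) || (T' <= aa i)) -> (forall i, (bb i <= T) || (T' <= bb i)) ->
  forall i z, ct T' i * \1_(setT_ T' i) z =
   ct T i * \1_(setT_ T i) z + cs T T' i * \1_(setS T T' i) z.
Proof.
move=> TT' ha hb i z.
have ab : aa i <= bb i by have [/andP[]] := vphi i.
rewrite /ct /cs /setT_ /setS !indicE !in_setX !mem_setE !in_itv /=.
case: (z.2 \in AA i); rewrite ?andbT ?andbF ?mulr0 ?addr0//.
have /orP[aT|aT'] := ha i; last first.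
  have h1 : (aa i < T') = false by apply/negbTE; rewrite -leNgt.
  have h2 : (aa i < T) = false by apply/negbTE; rewrite -leNgt ltW// (lt_le_trans TT').
  have h3 : (aa i <= T) = false by apply/negbTE; rewrite -ltNge (lt_le_trans TT').
  by rewrite h1 h2 h3 /= !mul0r addr0.
rewrite (le_lt_trans aT TT') aT /=.
have /orP[bT|bT'] := hb i.
  rewrite (min_l _) ?(le_trans bT (ltW TT'))// (min_l bT).
  rewrite (_ : T' <= bb i = false) ?mul0r ?addr0; last first.
    by apply/negbTE; rewrite -ltNge (le_lt_trans bT).
  case: (ltP (aa i) T) => // Ta; rewrite mul0r mul1r (_ : (_ < _ <= _) = false)//.
  by apply/negbTE/negP => /andP[h1 h2]; lra.
rewrite bT' (min_r bT') (min_r (le_trans (ltW TT') bT')).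
have [aT1|Ta] := ltP (aa i) T; last first.
  rewrite mul0r add0r (_ : aa i = T)//.
  by apply/eqP; rewrite eq_le aT Ta.
rewrite -mulrDr; congr (_ * _).
have [h1|h1] := leP z.1 T.
  by rewrite (le_trans h1 (ltW TT')) !andbT /= addr0.
by rewrite andbF add0r (lt_trans aT1 h1).
Qed.

Let ae_additive T T' : 0 <= T -> T < T' ->
  (forall i, (aa i <= T) || (T' <= aa i)) -> (forall i, (bb i <= T) || (T' <= bb i)) ->
  {ae P, forall w, forall i, coefT T' i w * W (setT_ T' i) w =
     coefT T i w * W (setT_ T i) w + coefS T T' i w * W (setS T T' i) w}.
Proof.
move=> T0 TT' ha hb.
pose l i := [:: (ct T' i, setT_ T' i); (- ct T i, setT_ T i); (- cs T T' i, setS T T' i)].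
have okl i : step_ok (l i).
  by move=> p; rewrite !inE => /or3P[] /eqP -> /=; exact: finite_area_rect.
have z0 i z : stepf (l i) z = 0.
  rewrite /stepf !big_cons big_nil /= (step_identity TT' ha hb); ring.
apply: filter_forall => i; have := wsum_ae_eq (okl i) (z0 i).
apply: filterS => w; rewrite /wsum !big_cons big_nil /= !coefTE coefSE -!mulrA => h.
have -> : ct T' i * W (setT_ T' i) w = ct T i * W (setT_ T i) w + cs T T' i * W (setS T T' i) w.
  by apply/eqP; rewrite -subr_eq0 -h; apply/eqP; ring.
ring.
Qed.

Let stepf_map (c : 'I_N -> R) (S : 'I_N -> set (R * R)) z :
  stepf [seq (c i, S i) | i <- enum 'I_N] z = \sum_(i < N) c i * \1_(S i) z.
Proof. by rewrite /stepf big_map -big_enum. Qed.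

Let var_additive T T' w : 0 <= T -> T < T' ->
  (forall i, (aa i <= T) || (T' <= aa i)) -> (forall i, (bb i <= T) || (T' <= bb i)) ->
  step_var (LT T' w) = step_var (LT T w) + step_var (LS T T' w).
Proof.
move=> T0 TT' ha hb.
have ok1 := step_in_ok (@okLT T w); have ok2 := step_in_ok (@okLS T T' w T0).
have ok3 := step_in_ok (@okLT T' w).
have cov0 : step_cov (LT T w) (LS T T' w) = 0.
  rewrite /step_cov big_seq big1// => p pL; rewrite big_seq big1// => q qL.
  rewrite (_ : p.2 `&` q.2 = set0) ?/area ?measure0 ?mulr0//.
  rewrite -subset0 => z [z1 z2].
  have [_ /(_ z z1)[/= + _]] := okLT pL; have [_ /(_ z z2)[/= + _]] := okLS T0 qL.
  by rewrite !in_itv/= => /andP[h1 _] /andP[_ h2]; have := lt_le_trans h1 h2; rewrite ltxx.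
have -> : step_var (LT T w) + step_var (LS T T' w) = step_var (LT T w ++ LS T T' w).
  by rewrite step_var_cat cov0 mulr0 addr0.
apply: EFin_inj; rewrite -!step_varE//; last exact: step_ok_cat.
apply: eq_integral => z _; congr ((_ ^+ 2)%:E).
rewrite stepf_cat /LT /LS !stepf_map -big_split /=; apply: eq_bigr => i _.
by rewrite !coefTE coefSE -!mulrA (step_identity TT' ha hb) mulrDr.
Qed.

(** [freeze] allows integrating first over the noise of the slab with the coefficients held fixed;
    [wsum_exp] then yields exactly exp(variance/2), which the compensator cancels. *)
Let MT_step T T' : 0 <= T -> T < T' ->
  (forall i, (aa i <= T) || (T' <= aa i)) -> (forall i, (bb i <= T) || (T' <= bb i)) ->
  (\int[P]_w (MT T' w)%:E = \int[P]_w (MT T w)%:E)%E.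
Proof.
move=> T0 TT' ha hb.
have dis : past T `&` slab T T' = set0.
  rewrite -subset0 => z [[/= z1 _] [/= z2 _]]; move: z1 z2; rewrite !in_itv/=.
  by move=> /andP[_ h2] /andP[h1 _]; have := lt_le_trans h1 h2; rewrite ltxx.
pose F (z : G1 T * G2 T T') : \bar R := (MT T z.1 * expm (LS T T' z.1) z.2)%:E.
have mw1 i : measurable_fun setT (W (setT_ T i) : G1 T -> R).
  move=> _ B mB; rewrite setTI; apply: sub_sigma_algebra; left.
  exists (setT_ T i), B; split => //; first exact: finite_area_rect.
  have := @okLT T point (coefT T i point, setT_ T i).
  by move=> /(_ (map_f _ (mem_enum _ i)))[].
have mw2 i : measurable_fun setT (W (setS T T' i) : G2 T T' -> R).
  move=> _ B mB; rewrite setTI; apply: sub_sigma_algebra; left.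
  exists (setS T T' i), B; split => //; first exact: finite_area_rect.
  have := @okLS T T' point T0 (coefS T T' i point, setS T T' i).
  by move=> /(_ (map_f _ (mem_enum _ i)))[].
have mq (c : 'I_N -> Omega -> R) (S : 'I_N -> set (R * R)) :
    (forall i, measurable_fun setT (c i : G1 T -> R)) ->
    measurable_fun setT (fun w : G1 T => step_var [seq (c i w, S i) | i <- enum 'I_N]).
  move=> mc; rewrite (_ : (fun w => _) = (fun w : G1 T =>
     \sum_(i < N) \sum_(j < N) c i w * c j w * fine (area (S i `&` S j)))); last first.
    by apply/funext => w; exact: var_map.
  by apply: measurable_sum => i; apply: measurable_sum => j; do 2 apply: measurable_funM => //.
have mF : measurable_fun setT F.
  have -> : F = (fun z : G1 T * G2 T T' =>
    (expR (\sum_(i < N) coefT T i z.1 * W (setT_ T i) z.1 - step_var (LT T z.1) / 2) *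
     expR (\sum_(i < N) coefS T T' i z.1 * W (setS T T' i) z.2 - step_var (LS T T' z.1) / 2))%:E).
    by apply/funext => z; rewrite /F /MT /expm !wsum_map.
  exact: (measurable_expm_prod (@mcoefT T) mw1 (@mcoefS T T') mw2 (mq _ _ (@mcoefT T)) (mq _ _ (@mcoefS T T'))).
have F0 z : (0 <= F z)%E by rewrite lee_fin mulr_ge0 ?expR_ge0.
have mwT (i : 'I_N) (S : set (R * R)) : finite_area_set S -> measurable_fun setT (W S).
  by move=> fS; exact: hW.1.
transitivity (\int[P]_w F (w, w))%E.
  have mo T1 (i : 'I_N) : measurable_fun setT (coefT T1 i).
    rewrite /coefT; case: (aa i < T1); last exact: measurable_cst.
    move=> _ B mB; rewrite setTI; have [_ _ _ /(_ B mB)] := vphi i.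
    by rewrite noise_filtrationE => hE; exact: noise_alg_measurable hE.
  apply: ge0_ae_eq_integral.
  - exact: measurableT.
  - apply/measurable_EFinP; apply: (measurableT_comp (f := expR)) => //; apply: measurable_funB.
      rewrite (_ : (fun x => _) = (fun z => \sum_(i < N) coefT T' i z * W (setT_ T' i) z)).
        apply: measurable_sum => i; apply: measurable_funM => //.
        by apply: hW.1; exact: finite_area_rect.
      by apply/funext => z; exact: wsum_map.
    apply: measurable_funM => //.
    rewrite (_ : (fun x => _) = (fun w =>
     \sum_(i < N) \sum_(j < N) coefT T' i w * coefT T' j w * fine (area (setT_ T' i `&` setT_ T' j)))); last first.
      by apply/funext => w; exact: var_map.
    by apply: measurable_sum => i; apply: measurable_sum => j; do 2 apply: measurable_funM => //.
  - have mdiag : measurable_fun setT (fun w : Omega => (w, w) : G1 T * G2 T T').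
      have mid D : measurable_fun setT (id : Omega -> g_sigma_algebraType (noise_gen P W D)).
        by move=> _ B mB; rewrite setTI; exact: noise_alg_measurable mB.
      exact: measurable_fun_pair (mid _) (mid _).
    exact: (measurableT_comp mF mdiag).
  - by move=> w _; rewrite lee_fin expR_ge0.
  - by move=> w _; exact: F0.
  - have := ae_additive T0 TT' ha hb; apply: filterS => w h _.
    rewrite /F /MT /expm /= -expRD; congr (expR _)%:E.
    rewrite (var_additive _ T0 TT' ha hb) /LT /LS !wsum_map (eq_bigr _ (fun i _ => h i)) big_split /=.
    by ring.
rewrite (freeze hW dis mF F0); apply: eq_integral => w _.
rewrite /F /=.
have ok2 := step_in_ok (@okLS T T' w T0).
transitivity (\int[P]_w' ((MT T w * expR (- (step_var (LS T T' w) / 2)))%:E * (expR (wsum W (LS T T' w) w'))%:E))%E.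
  by apply: eq_integral => w' _; rewrite /expm expRD -EFinM; congr EFin; ring.
rewrite ge0_integralZl; last 4 first.
- exact: measurableT.
- apply/measurable_EFinP; apply: measurableT_comp => //; exact: (measurable_wsum hW).
- by move=> w' _; rewrite lee_fin expR_ge0.
- by rewrite lee_fin mulr_ge0 ?expR_ge0.
by rewrite (wsum_exp hW ok2) -EFinM -mulrA -expRD addNr expR0 mulr1.
Qed.

Let MT_path s t : 0 <= t -> path <%R t s ->
  (forall i, (aa i <= t) || (aa i \in s)) -> (forall i, (bb i <= t) || (bb i \in s)) ->
  (\int[P]_w (MT (last t s) w)%:E = \int[P]_w (MT t w)%:E)%E.
Proof.
elim: s t => [//|t' s IH] t t0 /= /andP[tt' pth] ha hb.
have low x : (x <= t) || (x \in t' :: s) -> (x <= t) || (t' <= x).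
  case/orP => [->//|]; rewrite inE => /orP[/eqP ->|xs]; first by rewrite lexx orbT.
  by move: pth; rewrite (path_sortedE lt_trans) => /andP[/allP /(_ _ xs)/ltW -> _]; rewrite orbT.
have nxt x : (x <= t) || (x \in t' :: s) -> (x <= t') || (x \in s).
  case/orP => [h|]; first by rewrite (le_trans h (ltW tt')).
  by rewrite inE => /orP[/eqP ->|->]; rewrite ?lexx ?orbT.
rewrite (IH t' (le_trans t0 (ltW tt')) pth (fun i => nxt _ (ha i)) (fun i => nxt _ (hb i))).
exact: (MT_step t0 tt' (fun i => low _ (ha i)) (fun i => low _ (hb i))).
Qed.

Definition simple_steps (w : Omega) : seq (R * set (R * R)) :=
  [seq (XX i w, `]aa i, bb i]%classic `*` AA i) | i <- enum 'I_N].

Lemma simple_steps_ok w : step_ok (simple_steps w).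
Proof. by move=> p /mapP[i _ ->] /=; exact: finite_area_rect. Qed.

Lemma simple_integralE w : simple_integral W phi w = wsum W (simple_steps w) w.
Proof. by rewrite wsum_map. Qed.

Lemma simple_processE s y w : simple_process phi s y w = stepf (simple_steps w) (s, y).
Proof. by rewrite stepf_map. Qed.

Lemma measurable_simple_coef i : measurable_fun setT (XX i).
Proof.
move=> _ B mB; rewrite setTI; have [_ _ _ /(_ B mB)] := vphi i.
by rewrite noise_filtrationE => hE; exact: noise_alg_measurable hE.
Qed.

Lemma measurable_simple_integral : measurable_fun setT (simple_integral W phi).
Proof.
apply: measurable_sum => i; apply: measurable_funM; first exact: measurable_simple_coef.
exact: (hW.1 _ (finite_area_rect _ (aa0 i) (mAA i) (@AA1 i))).
Qed.

Lemma measurable_simple_process :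
  measurable_fun setT (fun p : R * R * Omega => simple_process phi p.1.1 p.1.2 p.2).
Proof.
apply: measurable_sum => i; apply: measurable_funM.
  exact: (measurableT_comp (measurable_simple_coef i) measurable_snd).
have m1 : measurable_fun setT (\1_(`]aa i, bb i]%classic `*` AA i) : R * R -> R).
  by apply: measurable_indic; exact: measurableX.
rewrite (_ : (fun x => _) = (\1_(`]aa i, bb i]%classic `*` AA i) : R * R -> R) \o fst).
  exact: (measurableT_comp m1 measurable_fst).
by apply/funext => x /=; congr (\1_ _ _); case: (x.1).
Qed.

Lemma measurable_simple_var : measurable_fun setT (fun w => step_var (simple_steps w)).
Proof.
rewrite (_ : (fun w => _) = (fun w => \sum_(i < N) \sum_(j < N) XX i w * XX j w *
   fine (area ((`]aa i, bb i]%classic `*` AA i) `&` (`]aa j, bb j]%classic `*` AA j))))).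
  apply: measurable_sum => i; apply: measurable_sum => j.
  do 2 (apply: measurable_funM => //); exact: measurable_simple_coef.
by apply/funext => w; exact: var_map.
Qed.

(** Iterates [MT_step] along the sorted positive end points, starting at time 0 where every
    coefficient is off. The integrands are non-negative, so no integrability has to be checked. *)
Lemma simple_exponential :
  (\int[P]_w (expR (simple_integral W phi w - step_var (simple_steps w) / 2))%:E = 1)%E.
Proof.
pose ts := [seq aa i | i <- enum 'I_N] ++ [seq bb i | i <- enum 'I_N].
pose s := sort <=%R (undup [seq x <- ts | 0 < x]).
have mems x : (x \in s) = (0 < x) && (x \in ts) by rewrite mem_sort mem_undup mem_filter.
have pth : path <%R 0 s.
  rewrite (path_sortedE lt_trans); apply/andP; split.
    by apply/allP => x; rewrite mems => /andP[].
  by rewrite lt_sorted_uniq_le sort_uniq undup_uniq/=; apply: sort_sorted; exact: le_total.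
have hts x : x \in ts -> (x <= 0) || (x \in s) by move=> xt; rewrite mems xt andbT leNgt orNb.
have taa i : aa i \in ts by rewrite mem_cat map_f ?mem_enum.
have tbb i : bb i \in ts by rewrite mem_cat (map_f bb) ?mem_enum ?orbT.
pose T := last 0 s.
have T0 : 0 <= T.
  rewrite /T; case: (s) pth => [//|y s'] pth; apply: ltW.
  move: pth; rewrite (path_sortedE lt_trans) => /andP[/allP h _].
  by apply: h => /=; rewrite mem_last.
have topx x : x \in ts -> x <= T.
  move=> /hts /orP[h|xs]; first exact: le_trans T0.
  by apply: le_last_path xs; apply: sub_path pth => ? ?; exact: ltW.
have E0 : (\int[P]_w (MT 0 w)%:E = 1)%E.
  rewrite (_ : (fun w => _) = cst 1%:E); first by rewrite integral_cst//= probability_setT mule1.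
  apply/funext => w; rewrite /MT /expm /LT wsum_map var_map.
  rewrite big1 => [|i _]; last by rewrite coefTE /ct ltNge aa0 mulr0 mul0r.
  rewrite big1 ?mul0r ?subr0 ?expR0// => i _; rewrite big1// => j _.
  by rewrite coefTE /ct ltNge aa0 !mulr0 !mul0r.
(* One more step past the last end point: [coefT] switches on strictly after the left end, so a
   degenerate term with both ends at [T] enters the list only later. *)
have TT1 : T < T + 1 by rewrite ltrDl.
have E2 := @MT_step T (T + 1) T0 TT1 (fun i => introT orP (or_introl (topx _ (taa i))))
  (fun i => introT orP (or_introl (topx _ (tbb i)))).
have E1 := MT_path (lexx 0) pth (fun i => hts _ (taa i)) (fun i => hts _ (tbb i)).
refine (etrans _ (etrans E2 (etrans E1 E0))).
apply: eq_integral => w _; rewrite /MT /expm simple_integralE.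
have h i : (XX i w, `]aa i, bb i]%classic `*` AA i) = (coefT (T + 1) i w, setT_ (T + 1) i).
  rewrite /coefT /setT_ (le_lt_trans (topx _ (taa i)) TT1).
  by rewrite (min_l (le_trans (topx _ (tbb i)) (ltW TT1))).
rewrite (_ : simple_steps w = LT (T + 1) w); first by [].
exact: (eq_map h).
Qed.

End one_simple.

Definition scale_simple (c : R) (phi : simple R Omega) : simple R Omega :=
  Simple (fun i : 'I_(simple_size phi) => let e := simple_term i in
    Elementary (el_left e) (el_right e) (el_space e) (fun w => c * el_coef e w)).

Lemma valid_scale c phi : valid_simple P W phi -> valid_simple P W (scale_simple c phi).
Proof.
move=> v i; have [h1 h2 [M hM] h4] := v i; split => //=.
  by exists (`|c| * M) => w; rewrite normrM ler_wpM2l.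
move: h4; rewrite noise_filtrationE => /measurable_wrtP h4; apply/measurable_wrtP.
by apply: measurable_funM => //; exact: measurable_cst.
Qed.

Lemma scale_simple_integral c phi w :
  simple_integral W (scale_simple c phi) w = c * simple_integral W phi w.
Proof. by rewrite /simple_integral mulr_sumr; apply: eq_bigr => i _ /=; rewrite mulrA. Qed.

Lemma scale_simple_steps c phi w :
  simple_steps (scale_simple c phi) w = step_scale c (simple_steps phi w).
Proof. by case: phi => n t; rewrite /simple_steps /step_scale /=; elim: (enum _) => //= i s ->. Qed.

(** Chernoff's bound with the scale c = a / V, optimal for Gaussian tails. On the event considered
    the random compensator is at most its value at [V]. *)
Lemma simple_tail_one phi (a V : R) : valid_simple P W phi -> 0 < a -> 0 < V ->
  (P [set w | (a <= simple_integral W phi w)%R /\ (step_var (simple_steps phi w) <= V)%R]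
    <= (expR (- (a ^+ 2 / (2 * V))))%:E)%E.
Proof.
move=> v a0 V0; set A := [set w | _].
pose c := a / V; have c0 : 0 < c by rewrite divr_gt0.
have vc := valid_scale (c := c) v.
pose g w := expR (simple_integral W (scale_simple c phi) w - step_var (simple_steps (scale_simple c phi) w) / 2).
have mg : measurable_fun setT (fun w => (g w)%:E).
  apply/measurable_EFinP; apply: (measurableT_comp (f := expR)) => //; apply: measurable_funB.
    exact: measurable_simple_integral.
  by apply: measurable_funM => //; exact: measurable_simple_var.
have mA : measurable A.
  rewrite (_ : A = simple_integral W phi @^-1` `[a, +oo[%classic `&` (fun w => step_var (simple_steps phi w)) @^-1` `]-oo, V]%classic).
    apply: measurableI; rewrite -[X in measurable X]setTI.
      exact: measurable_simple_integral.
    exact: measurable_simple_var.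
  by apply/seteqP; split => w /=; rewrite !in_itv/= andbT.
have sub : A `<=` [set w | ((expR (a ^+ 2 / (2 * V)))%:E <= (g w)%:E)%E].
  move=> w [h1 h2]; rewrite /= lee_fin /g ler_expR scale_simple_integral scale_simple_steps step_var_scale.
  have -> : a ^+ 2 / (2 * V) = c * a - c ^+ 2 * V / 2 by rewrite /c; field; rewrite gt_eqF.
  apply: lerB; first by rewrite ler_pM2l.
  by rewrite ler_pM2r ?invr_gt0// ler_pM2l// exprn_gt0.
have := markov_ge0e mg (fun w => _ : (0 <= (g w)%:E)%E) (expR_ge0 (a ^+ 2 / (2 * V))).
move=> /(_ (fun w => expR_ge0 _)); rewrite (simple_exponential vc) => h.
rewrite expRN -[leRHS]mule1 muleC lee_pdivlMr ?expR_gt0// muleC; apply: le_trans h.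
apply: lee_wpmul2l; first by rewrite lee_fin expR_ge0.
apply: le_measure => //; rewrite inE//.
rewrite (_ : [set w | _] = (fun w => (g w)%:E) @^-1` `[(expR (a ^+ 2 / (2 * V)))%:E, +oo[).
  by rewrite -[X in measurable X]setTI; apply: mg => //; exact: emeasurable_itv.
by apply/seteqP; split => w /=; rewrite in_itv/= andbT.
Qed.

Lemma simple_tail phi (a V : R) : valid_simple P W phi -> 0 < a -> 0 < V ->
  (P [set w | (a <= `|simple_integral W phi w|)%R /\ (step_var (simple_steps phi w) <= V)%R]
    <= (2 * expR (- (a ^+ 2 / (2 * V))))%:E)%E.
Proof.
move=> v a0 V0; have v1 := valid_scale (c := -1) v.
have ms (f q : Omega -> R) : measurable_fun setT f -> measurable_fun setT q ->
   measurable [set w | a <= f w /\ q w <= V].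
  move=> mf mq; rewrite (_ : [set w | _] = f @^-1` `[a, +oo[%classic `&` q @^-1` `]-oo, V]%classic).
    by apply: measurableI; rewrite -[X in measurable X]setTI; [apply: mf|apply: mq].
  by apply/seteqP; split => w /=; rewrite !in_itv/= andbT.
rewrite mulr_natl mulr2n EFinD.
apply: (le_trans _ (leeD (simple_tail_one v a0 V0) (simple_tail_one v1 a0 V0))).
have m1 := ms _ _ (measurable_simple_integral v) (measurable_simple_var v).
have m2 := ms _ _ (measurable_simple_integral v1) (measurable_simple_var v1).
refine (le_trans _ (measureU2 P m1 m2)).
apply: le_measure; rewrite ?inE.
- apply: ms; last exact: measurable_simple_var.
  by apply: measurableT_comp => //; exact: measurable_simple_integral.
- exact: measurableU.
move=> w [h1 h2]; rewrite /setU /= scale_simple_integral scale_simple_steps step_var_scale.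
rewrite sqrrN expr1n mul1r mulN1r; move: h1; rewrite ler_normr => /orP[h|h]; [left|right]; split => //.
Qed.

Lemma prob_le (A B : set Omega) : measurable A -> measurable B -> A `<=` B -> (P A <= P B)%E.
Proof. by move=> mA mB; apply: le_measure; rewrite inE. Qed.

Lemma prob_leU3 (A B C D : set Omega) : measurable A -> measurable B -> measurable C ->
  measurable D -> A `<=` B `|` C `|` D -> (P A <= P B + P C + P D)%E.
Proof.
move=> mA mB mC mD sub; have mBC : measurable (B `|` C) by exact: measurableU.
apply: (le_trans (prob_le mA (measurableU _ _ mBC mD) sub)).
refine (le_trans (measureU2 P mBC mD) _).
by apply: leeD => //; exact: (measureU2 P).
Qed.

Lemma chebyshev_e (f : Omega -> \bar R) (a : R) :
  measurable_fun setT f -> (forall w, 0 <= f w)%E -> 0 < a ->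
  (P [set w | (a%:E <= f w)%E] <= a^-1%:E * \int[P]_w f w)%E.
Proof.
move=> mf f0 a0; rewrite muleC lee_pdivlMr// muleC; exact: markov_ge0e (ltW a0).
Qed.

Lemma measurable_ge_e (f : Omega -> \bar R) (a : \bar R) :
  measurable_fun setT f -> measurable [set w | (a <= f w)%E].
Proof.
move=> mf; rewrite -[X in measurable X]setTI; exact: emeasurable_fun_c_infty.
Qed.

Lemma measurable_le_e (f : Omega -> \bar R) (a : \bar R) :
  measurable_fun setT f -> measurable [set w | (f w <= a)%E].
Proof.
move=> mf; rewrite -[X in measurable X]setTI; exact: emeasurable_fun_infty_c.
Qed.

Lemma integral_sqr_le d' (T : measurableType d') (mu : {measure set T -> \bar R}) (f g : T -> R) :
  measurable_fun setT f -> measurable_fun setT g ->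
  (\int[mu]_z (f z ^+ 2)%:E <= 2%:E * \int[mu]_z (g z ^+ 2)%:E
     + 2%:E * \int[mu]_z ((f z - g z) ^+ 2)%:E)%E.
Proof.
move=> mf mg.
have mg2 : measurable_fun setT (fun z => (g z ^+ 2)%:E).
  by apply/measurable_EFinP; exact: measurable_funX.
have md2 : measurable_fun setT (fun z => ((f z - g z) ^+ 2)%:E).
  by apply/measurable_EFinP; apply: measurable_funX; exact: measurable_funB.
have p2 (h : T -> R) z : setT z -> (0 <= (h z ^+ 2)%:E)%E by move=> _; rewrite lee_fin sqr_ge0.
rewrite -!ge0_integralZl//; try by move=> z _; rewrite lee_fin sqr_ge0.
rewrite -ge0_integralD//; first last.
- exact: measurable_funeM.
- by move=> z _; rewrite mule_ge0// lee_fin sqr_ge0.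
- exact: measurable_funeM.
- by move=> z _; rewrite mule_ge0// lee_fin sqr_ge0.
apply: ge0_le_integral.
- exact: measurableT.
- by move=> z _; rewrite lee_fin sqr_ge0.
- by apply/measurable_EFinP; exact: measurable_funX.
- by apply: emeasurable_funD; exact: measurable_funeM.
- move=> z _; rewrite -!EFinM -EFinD lee_fin.
  have := sqr_ge0 (g z - (f z - g z)); nra.
Qed.

Lemma le_of_cvg0 (c k1 k2 : R) (y : \bar R) (u v : nat -> \bar R) :
  u n @[n --> \oo] --> 0%E -> v n @[n --> \oo] --> 0%E ->
  (forall n, y <= c%:E + k1%:E * u n + k2%:E * v n)%E -> (y <= c%:E)%E.
Proof.
move=> cu cv h.
have h1 := cvgeZl (y := k1%:E) isT cu; rewrite mule0 in h1.
have h2 := cvgeZl (y := k2%:E) isT cv; rewrite mule0 in h2.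
have h3 : (c%:E + k1%:E * u n)%E @[n --> \oo] --> c%:E.
  by rewrite -[X in _ --> X]adde0; apply: cvgeD => //; exact: cvg_cst.
have cvg : (c%:E + k1%:E * u n + k2%:E * v n)%E @[n --> \oo] --> c%:E.
  by rewrite -[X in _ --> X]adde0; apply: cvgeD.
rewrite -(cvg_lim (@ereal_hausdorff R) cvg); apply: lime_ge.
  by apply/cvg_ex; exists c%:E.
by apply: nearW.
Qed.

(** The quadratic variation of the Walsh integral of [f], path by path and possibly infinite. *)
Definition energy (f : R -> R -> Omega -> R) (w : Omega) : \bar R :=
  (\int[mu2]_z (f z.1 z.2 w ^+ 2)%:E)%E.

Section energy.
Variable f : R -> R -> Omega -> R.
Hypothesis mf : measurable_fun setT (fun p : R * R * Omega => f p.1.1 p.1.2 p.2).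

Let mf2 : measurable_fun setT (fun p : R * R * Omega => (f p.1.1 p.1.2 p.2 ^+ 2)%:E).
Proof. by apply/measurable_EFinP; exact: measurable_funX. Qed.

Let f20 (p : R * R * Omega) : (0 <= (f p.1.1 p.1.2 p.2 ^+ 2)%:E)%E.
Proof. by rewrite lee_fin sqr_ge0. Qed.

Lemma measurable_energy : measurable_fun setT (energy f).
Proof. exact: (tonelli_strip mf2 f20).1. Qed.

Lemma energy_ge0 w : (0 <= energy f w)%E.
Proof. by apply: integral_ge0 => z _; rewrite lee_fin sqr_ge0. Qed.

Lemma energy_expect : (\int[P]_w energy f w =
  \int[mu2 \x P]_p (f p.1.1 p.1.2 p.2 ^+ 2)%:E)%E.
Proof. by rewrite (tonelli_strip mf2 f20).2. Qed.

Lemma measurable_section w : measurable_fun setT (fun z : R * R => f z.1 z.2 w).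
Proof.
have mp : measurable_fun setT (fun z : R * R => (z, w)) by exact: pair2_measurable.
exact: (measurableT_comp mf mp).
Qed.

End energy.

(** Approximation by simple processes halves the level [a] and relaxes the energy to 3 V = 2 V + 2
    (V/2), whence (a/2)^2 / (6 V) = a^2 / (24 V). The exceptional events, energy error above V/2 and
    integral error above a/2, vanish in the limit by Chebyshev's inequality. *)
Lemma bernstein f I (a V : R) : walsh_integral P W f I -> 0 < a -> 0 < V ->
  (P [set w | (a <= `|I w|)%R /\ (energy f w <= V%:E)%E]
    <= (2 * expR (- (a ^+ 2 / (24 * V))))%:E)%E.
Proof.
move=> [mf mI [phi [vphi cd cI]]] a0 V0.
have a20 : 0 < a / 2 by rewrite divr_gt0.
have V20 : 0 < V / 2 by rewrite divr_gt0.
have V30 : 0 < 3 * V by rewrite mulr_gt0.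
pose g n s y w := simple_process (phi n) s y w - f s y w.
have mg n : measurable_fun setT (fun p : R * R * Omega => g n p.1.1 p.1.2 p.2).
  by apply: measurable_funB => //; exact: measurable_simple_process.
have mD n : measurable_fun setT (fun w => ((simple_integral W (phi n) w - I w) ^+ 2)%:E).
  apply/measurable_EFinP; apply: measurable_funX; apply: measurable_funB => //.
  exact: measurable_simple_integral.
have qE n w : (step_var (simple_steps (phi n) w))%:E = energy (simple_process (phi n)) w.
  rewrite -step_varE; last exact: simple_steps_ok.
  by apply: eq_integral => z _; rewrite (simple_processE) -surjective_pairing.
apply: (le_of_cvg0 (k1 := (V / 2)^-1) (k2 := ((a / 2) ^+ 2)^-1) cd cI) => n.
rewrite -(energy_expect (mg n)).
pose A1 := [set w | (a / 2 <= `|simple_integral W (phi n) w|)%R /\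
   step_var (simple_steps (phi n) w) <= 3 * V].
pose A2 := [set w | ((V / 2)%:E <= energy (g n) w)%E].
pose A3 := [set w | (((a / 2) ^+ 2)%:E <= ((simple_integral W (phi n) w - I w) ^+ 2)%:E)%E].
have mA1 : measurable A1.
  rewrite /A1 (_ : [set w | _] =
    [set w | ((a / 2)%:E <= (`|simple_integral W (phi n) w|)%:E)%E] `&`
    [set w | ((step_var (simple_steps (phi n) w))%:E <= (3 * V)%:E)%E]).
    apply: measurableI; [apply: measurable_ge_e|apply: measurable_le_e]; apply/measurable_EFinP.
      by apply: measurableT_comp => //; exact: measurable_simple_integral.
    exact: measurable_simple_var.
  by apply/seteqP; split => w /=; rewrite !lee_fin.
have mA2 : measurable A2 by apply: measurable_ge_e; exact: measurable_energy.
have mA3 : measurable A3 by exact: measurable_ge_e.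
apply: (@le_trans _ _ (P A1 + P A2 + P A3)%E).
  apply: prob_leU3 => //.
    rewrite (_ : [set w | _] = [set w | (a%:E <= (`|I w|)%:E)%E] `&` [set w | (energy f w <= V%:E)%E]).
      apply: measurableI; [apply: measurable_ge_e|apply: measurable_le_e].
        by apply/measurable_EFinP; exact: measurableT_comp.
      exact: measurable_energy.
    by apply/seteqP; split => w /=; rewrite !lee_fin.
  move=> w [aI eV].
  have [h2|h2] := leP (V / 2)%:E (energy (g n) w); first by left; right.
  have [h3|h3] := leP (a / 2) `|simple_integral W (phi n) w - I w|.
    right; rewrite /A3 /= lee_fin -[leRHS]real_normK ?num_real//.
    by rewrite !expr2; apply: ler_pM => //; exact: ltW.
  left; left; split.
    have := lerB_dist (I w) (simple_integral W (phi n) w).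
    rewrite distrC in h3; lra.
  rewrite -lee_fin qE /energy.
  have m1 := measurable_section (measurable_simple_process (vphi n)) w.
  have m2 := measurable_section mf w.
  refine (le_trans (@integral_sqr_le _ _ (leb \x leb)%E _ _ m1 m2) _).
  have -> : (3 * V)%:E = (2%:E * V%:E + 2%:E * (V / 2)%:E)%E.
    by rewrite -!EFinM -EFinD; congr EFin; field.
  by apply: leeD; apply: lee_wpmul2l => //; exact: ltW.
have e1 : 2 * expR (- (a ^+ 2 / (24 * V))) = 2 * expR (- ((a / 2) ^+ 2 / (2 * (3 * V)))).
  by congr (_ * expR (- _)); field; rewrite gt_eqF.
apply: leeD; last by apply: chebyshev_e => //; [move=> w; rewrite lee_fin sqr_ge0|rewrite exprn_gt0].
apply: leeD; last by apply: chebyshev_e => //; [exact: measurable_energy|exact: energy_ge0].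
by rewrite e1; exact: simple_tail.
Qed.

End bernstein.

(** * Linearity of the Walsh integral *)

Section walsh_linear.
Context {R : realType} {d : measure_display} {Omega : measurableType d}.
Context (P : probability Omega R) (W : set (R * R) -> Omega -> R).
Hypothesis hW : white_noise P W.
Notation leb := (@lebesgue_measure R).
Notation mu2 := (leb \x leb)%E.

Definition cat_simple (phi psi : simple R Omega) : simple R Omega :=
  Simple (fun i : 'I_(simple_size phi + simple_size psi) =>
    match fintype.split i with inl j => simple_term (s := phi) j | inr j => simple_term (s := psi) j end).

Lemma cat_simpleE (phi psi : simple R Omega) (F : elementary R Omega -> R) :
  \sum_(i < simple_size (cat_simple phi psi)) F (simple_term i) =
  \sum_(i < simple_size phi) F (simple_term i) + \sum_(i < simple_size psi) F (simple_term i).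
Proof.
rewrite big_split_ord /=; congr (_ + _); apply: eq_bigr => i _.
  by case: split_ordP => j /eqP; rewrite ?eq_lshift ?eq_lrshift// => /eqP ->.
by case: split_ordP => j /eqP; rewrite ?eq_rshift ?eq_rlshift// => /eqP ->.
Qed.

Lemma cat_simple_process (phi psi : simple R Omega) s y w :
  simple_process (cat_simple phi psi) s y w = simple_process phi s y w + simple_process psi s y w.
Proof.
exact: (cat_simpleE phi psi (fun e => el_coef e w * \1_(`]el_left e, el_right e]%classic `*` el_space e) (s, y))).
Qed.

Lemma cat_simple_integral (phi psi : simple R Omega) w :
  simple_integral W (cat_simple phi psi) w = simple_integral W phi w + simple_integral W psi w.
Proof.
exact: (cat_simpleE phi psi (fun e => el_coef e w * W (`]el_left e, el_right e]%classic `*` el_space e) w)).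
Qed.

Lemma squeeze_e (a b c : nat -> \bar R) (k1 k2 : R) :
  (forall n, 0 <= a n)%E -> (forall n, a n <= k1%:E * b n + k2%:E * c n)%E ->
  b n @[n --> \oo] --> 0%E -> c n @[n --> \oo] --> 0%E -> a n @[n --> \oo] --> 0%E.
Proof.
move=> a0 ab cb cc.
have h1 := cvgeZl (y := k1%:E) isT cb; rewrite mule0 in h1.
have h2 := cvgeZl (y := k2%:E) isT cc; rewrite mule0 in h2.
have cvg : (k1%:E * b n + k2%:E * c n)%E @[n --> \oo] --> (0 : \bar R)%E.
  by rewrite -[X in _ --> X]adde0; apply: cvgeD.
apply: (squeeze_cvge _ (cvg_cst 0%E) cvg).
by apply: nearW => n; rewrite a0 ab.
Qed.

Lemma walsh_add f g I J : walsh_integral P W f I -> walsh_integral P W g J ->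
  walsh_integral P W (fun s y w => f s y w + g s y w) (fun w => I w + J w).
Proof.
move=> [mf mI [phi [vphi c1 c2]]] [mg mJ [psi [vpsi c3 c4]]].
split; [exact: measurable_funD|exact: measurable_funD|].
exists (fun n => cat_simple (phi n) (psi n)); split.
- by move=> n i; rewrite /valid_elementary /=; case: fintype.split => j; [exact: vphi|exact: vpsi].
- apply: (squeeze_e (k1 := 2) (k2 := 2) _ _ c1 c3) => n.
    by apply: integral_ge0 => z _; rewrite lee_fin sqr_ge0.
  have mD1 : measurable_fun setT (fun p : R * R * Omega => simple_process (phi n) p.1.1 p.1.2 p.2 - f p.1.1 p.1.2 p.2).
    exact: measurable_funB (measurable_simple_process hW (vphi n)) mf.
  have mD2 : measurable_fun setT (fun p : R * R * Omega => simple_process (psi n) p.1.1 p.1.2 p.2 - g p.1.1 p.1.2 p.2).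
    exact: measurable_funB (measurable_simple_process hW (vpsi n)) mg.
  have := @integral_sqr_le R _ _ ((leb \x leb) \x P)%E _ _ (measurable_funD mD1 mD2) mD1.
  congr (_ <= _)%E.
    apply: eq_integral => z _; congr ((_ ^+ 2)%:E).
    by rewrite cat_simple_process /=; ring.
  by congr (_ + _ * _)%E; apply: eq_integral => z _; congr ((_ ^+ 2)%:E) => /=; ring.
- apply: (squeeze_e (k1 := 2) (k2 := 2) _ _ c2 c4) => n.
    by apply: integral_ge0 => z _; rewrite lee_fin sqr_ge0.
  have mD1 : measurable_fun setT (fun w => simple_integral W (phi n) w - I w).
    exact: measurable_funB (measurable_simple_integral hW (vphi n)) mI.
  have mD2 : measurable_fun setT (fun w => simple_integral W (psi n) w - J w).
    exact: measurable_funB (measurable_simple_integral hW (vpsi n)) mJ.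
  have := @integral_sqr_le R _ _ P _ _ (measurable_funD mD1 mD2) mD1.
  congr (_ <= _)%E.
    apply: eq_integral => z _; congr ((_ ^+ 2)%:E).
    by rewrite cat_simple_integral /=; ring.
  by congr (_ + _ * _)%E; apply: eq_integral => z _; congr ((_ ^+ 2)%:E) => /=; ring.
Qed.

Lemma scale_simple_process c (phi : simple R Omega) s y w :
  simple_process (scale_simple c phi) s y w = c * simple_process phi s y w.
Proof. by rewrite /simple_process mulr_sumr; apply: eq_bigr => i _ /=; rewrite mulrA. Qed.

Lemma cvg0_scale (c : R) (a b : nat -> \bar R) : (forall n, b n = c%:E * a n)%E ->
  a n @[n --> \oo] --> 0%E -> b n @[n --> \oo] --> 0%E.
Proof.
move=> ba ca; have := cvgeZl (y := c%:E) isT ca; rewrite mule0.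
by under eq_fun do rewrite -ba.
Qed.

Lemma walsh_scale c f I : walsh_integral P W f I ->
  walsh_integral P W (fun s y w => c * f s y w) (fun w => c * I w).
Proof.
move=> [mf mI [phi [vphi c1 c2]]].
split; [by apply: measurable_funM|by apply: measurable_funM|].
have sq x y : ((c * x - c * y) ^+ 2)%:E = ((c ^+ 2)%:E * ((x - y) ^+ 2)%:E)%E.
  by rewrite -EFinM; congr EFin; ring.
exists (fun n => scale_simple c (phi n)); split.
- by move=> n; exact: valid_scale.
- apply: (cvg0_scale (c := c ^+ 2) _ c1) => n.
  have mD : measurable_fun setT (fun p : R * R * Omega => simple_process (phi n) p.1.1 p.1.2 p.2 - f p.1.1 p.1.2 p.2).
    exact: measurable_funB (measurable_simple_process hW (vphi n)) mf.
  rewrite -ge0_integralZl.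
  + by apply: eq_integral => z _; rewrite scale_simple_process sq.
  + exact: measurableT.
  + by apply/measurable_EFinP; apply: measurable_funX; exact: mD.
  + by move=> z _; rewrite lee_fin sqr_ge0.
  + by rewrite lee_fin sqr_ge0.
- apply: (cvg0_scale (c := c ^+ 2) _ c2) => n.
  rewrite -ge0_integralZl.
  + by apply: eq_integral => z _; rewrite scale_simple_integral sq.
  + exact: measurableT.
  + apply/measurable_EFinP; apply: measurable_funX.
    exact: measurable_funB (measurable_simple_integral hW (vphi n)) mI.
  + by move=> z _; rewrite lee_fin sqr_ge0.
  + by rewrite lee_fin sqr_ge0.
Qed.

Lemma walsh_elementary e : valid_elementary P W e ->
  walsh_integral P W
   (fun s y w => el_coef e w * \1_(`]el_left e, el_right e]%classic `*` el_space e) (s, y))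
   (fun w => el_coef e w * W (`]el_left e, el_right e]%classic `*` el_space e) w).
Proof.
move=> ve; pose phi : simple R Omega := Simple (fun _ : 'I_1 => e).
have vphi : valid_simple P W phi by [].
have pE s y w : simple_process phi s y w = el_coef e w * \1_(`]el_left e, el_right e]%classic `*` el_space e) (s, y).
  by rewrite /simple_process big_ord1.
have iE w : simple_integral W phi w = el_coef e w * W (`]el_left e, el_right e]%classic `*` el_space e) w.
  by rewrite /simple_integral big_ord1.
clearbody phi; split.
- rewrite (_ : (fun p : R * R * Omega => _) = (fun p : R * R * Omega => simple_process phi p.1.1 p.1.2 p.2)).
    exact (measurable_simple_process hW vphi).
  by apply/funext => p; rewrite pE.
- rewrite (_ : (fun w => _) = simple_integral W phi).
    exact (measurable_simple_integral hW vphi).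
  by apply/funext => w; rewrite iE.
exists (fun=> phi); split => //.
- under eq_fun do under eq_integral do rewrite pE subrr expr0n/=.
  by under eq_fun do rewrite integral0; exact: cvg_cst.
- under eq_fun do under eq_integral do rewrite iE subrr expr0n/=.
  by under eq_fun do rewrite integral0; exact: cvg_cst.
Qed.

(** Time sides are half-open intervals inside [[a, b]] and space sides are arbitrary Borel sets,
    which is the shape of a deterministic elementary process. *)
Definition rect_in (a b : R) (l : seq (R * set (R * R))) :=
  forall p, p \in l -> exists s t B, [/\ a <= s, s <= t, t <= b,
    measurable (B : set R) /\ B `<=` `[0, 1] & p.2 = `]s, t]%classic `*` B].

Definition slab (a b : R) : set (R * R) := `]a, b]%classic `*` `[0, 1]%classic.

Lemma rect_step a b l : 0 <= a -> rect_in a b l -> step_in (slab a b) l.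
Proof.
move=> a0 h p /h[s [t [B [h1 h2 h3 [mB B1] ->]]]]; split.
  exact: finite_area_rect (le_trans a0 h1) mB B1.
move=> z [z1 /B1 z2]; split => //; move: z1; rewrite /= !in_itv/= => /andP[h4 h5].
by rewrite (le_lt_trans h1 h4) (le_trans h5 h3).
Qed.

(** Presents Gaussian combinations as Walsh integrals, so that they can be subtracted from the
    solution inside a single Bernstein estimate. *)
Lemma walsh_rect a b l : 0 <= a -> rect_in a b l ->
  walsh_integral P W (fun s y w => stepf l (s, y)) (wsum W l).
Proof.
move=> a0; elim: l => [_|p l IH h].
  have -> : (fun s y (w : Omega) => stepf ([::] : seq (R * set (R * R))) (s, y)) = (fun s y w => 0).
    by apply/funext => s; apply/funext => y; apply/funext => w; rewrite /stepf big_nil.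
  have -> : wsum W [::] = (fun w => 0) by apply/funext => w; rewrite /wsum big_nil.
  pose e := Elementary 0 0 (set0 : set R) (fun _ : Omega => 0 : R).
  have ve : valid_elementary P W e.
    split => //=; [by rewrite lexx|by split|by exists 0 => w; rewrite normr0|].
    rewrite noise_filtrationE; apply/measurable_wrtP; exact: measurable_cst.
  have := walsh_elementary ve; congr walsh_integral.
    by apply/funext => s; apply/funext => y; apply/funext => w /=; rewrite mul0r.
  by apply/funext => w /=; rewrite mul0r.
have [s [t [B [h1 h2 h3 [mB B1] e2]]]] := h p (mem_head _ _).
pose e := Elementary s t B (fun _ : Omega => p.1).
have ve : valid_elementary P W e.
  split => //=; [by rewrite (le_trans a0 h1)|by exists `|p.1| => w|].
  rewrite noise_filtrationE; apply/measurable_wrtP; exact: measurable_cst.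
have hl : rect_in a b l by move=> q ql; apply: h; rewrite inE ql orbT.
have := walsh_add (walsh_elementary ve) (IH hl); congr walsh_integral.
  apply/funext => s'; apply/funext => y; apply/funext => w /=.
  by rewrite /stepf big_cons -e2.
by apply/funext => w /=; rewrite /wsum big_cons -e2.
Qed.

End walsh_linear.

(** * Approximation of kernels by sums of rectangles *)

Section density.
Import HBNNSimple.
Context {R : realType}.
Notation leb := (@lebesgue_measure R).
Notation mu2 := (leb \x leb)%E.
Variables (a b : R).
Hypothesis a0 : 0 <= a.
Let D : set (R * R) := slab a b.

Definition l2d (f g : R * R -> R) : \bar R := (\int[mu2]_z ((f z - g z) ^+ 2)%:E)%E.

Lemma l2d_triangle (f g h : R * R -> R) : measurable_fun setT f -> measurable_fun setT g ->
  measurable_fun setT h -> (l2d f h <= 2%:E * l2d f g + 2%:E * l2d g h)%E.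
Proof.
move=> mf mg mh.
have := @integral_sqr_le R _ _ (leb \x leb)%E _ _ (measurable_funB mf mh) (measurable_funB mf mg).
congr (_ <= _ + _ * _)%E; apply: eq_integral => z _; congr ((_ ^+ 2)%:E) => /=; ring.
Qed.

Definition rect_approx (h : R * R -> R) := measurable_fun setT h /\
  forall e : R, 0 < e -> exists l, rect_in a b l /\ (l2d h (stepf l) <= e%:E)%E.

Lemma measurable_rect l : rect_in a b l -> measurable_fun setT (stepf l).
Proof. by move=> rl; apply: measurable_stepf; exact: step_in_ok (rect_step a0 rl). Qed.

Lemma rect_approx_lim h : measurable_fun setT h ->
  (forall e : R, 0 < e -> exists h', rect_approx h' /\ (l2d h h' <= e%:E)%E) -> rect_approx h.
Proof.
move=> mh H; split => // e e0.
have e4 : 0 < e / 4 by rewrite divr_gt0.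
have [h' [[mh' /(_ _ e4)[l [rl hl]]] hh']] := H _ e4; exists l; split => //.
apply: le_trans (l2d_triangle mh mh' (measurable_rect rl)) _.
have -> : e = 2 * (e / 4) + 2 * (e / 4) by field.
by rewrite (EFinD (2 * (e / 4))) (EFinM 2 (e / 4)); apply: leeD; apply: lee_wpmul2l.
Qed.

Lemma rect_inD l l' : rect_in a b l -> rect_in a b l' -> rect_in a b (l ++ l').
Proof. by move=> h h' p; rewrite mem_cat => /orP[/h|/h']. Qed.

Lemma rect_inZ c l : rect_in a b l -> rect_in a b (step_scale c l).
Proof. by move=> h p /mapP[q /h + ->]. Qed.

Lemma rect_approxD f g : rect_approx f -> rect_approx g -> rect_approx (fun z => f z + g z).
Proof.
move=> [mf hf] [mg hg]; split => [|e e0]; first exact: measurable_funD.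
have e4 : 0 < e / 4 by rewrite divr_gt0.
have [l [rl hl]] := hf _ e4; have [l' [rl' hl']] := hg _ e4.
exists (l ++ l'); split; first exact: rect_inD.
have m1 := measurable_funB mf (measurable_rect rl).
have m2 := measurable_funB mg (measurable_rect rl').
have := @integral_sqr_le R _ _ (leb \x leb)%E _ _ (measurable_funD m1 m2) m1.
have -> : e = 2 * (e / 4) + 2 * (e / 4) by field.
move=> h; apply: (@le_trans _ _ (2%:E * l2d f (stepf l) + 2%:E * l2d g (stepf l'))%E); last first.
  by rewrite (EFinD (2 * (e / 4))) (EFinM 2 (e / 4)); apply: leeD; apply: lee_wpmul2l.
move: h; congr (_ <= _ + _ * _)%E; apply: eq_integral => z _; congr ((_ ^+ 2)%:E) => /=.
  by rewrite stepf_cat; ring.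
by ring.
Qed.

Lemma rect_approxZ c f : rect_approx f -> rect_approx (fun z => c * f z).
Proof.
move=> [mf hf]; split => [|e e0]; first exact: measurable_funM.
have c1 : 0 < c ^+ 2 + 1 by rewrite ltr_wpDl// sqr_ge0.
have [l [rl hl]] := hf (e / (c ^+ 2 + 1)) (divr_gt0 e0 c1).
exists (step_scale c l); split; first exact: rect_inZ.
have -> : l2d (fun z => c * f z) (stepf (step_scale c l)) = ((c ^+ 2)%:E * l2d f (stepf l))%E.
  rewrite /l2d -ge0_integralZl.
  - by apply: eq_integral => z _; rewrite stepf_scale -EFinM; congr EFin; ring.
  - exact: measurableT.
  - by apply/measurable_EFinP; apply: measurable_funX; exact: measurable_funB mf (measurable_rect rl).
  - by move=> z _; rewrite lee_fin sqr_ge0.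
  - by rewrite lee_fin sqr_ge0.
apply: (@le_trans _ _ ((c ^+ 2)%:E * (e / (c ^+ 2 + 1))%:E)%E).
  by apply: lee_wpmul2l; rewrite ?lee_fin ?sqr_ge0.
rewrite -EFinM lee_fin mulrA ler_pdivrMr// mulrC ler_pM2l//; lra.
Qed.

Lemma rect_approx_rect s t (B : set R) : a <= s -> s <= t -> t <= b -> measurable B -> B `<=` `[0, 1] ->
  rect_approx \1_(`]s, t]%classic `*` B).
Proof.
move=> h1 h2 h3 mB B1; have rl : rect_in a b [:: (1, `]s, t]%classic `*` B)].
  by move=> p; rewrite inE => /eqP ->; exists s, t, B.
split; first by apply: measurable_indic; exact: measurableX.
move=> e e0; exists [:: (1, `]s, t]%classic `*` B)]; split => //.
rewrite /l2d; under eq_integral do rewrite /stepf big_seq1 mul1r subrr expr0n/=.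
by rewrite integral0 lee_fin ltW.
Qed.

Lemma rect_approx0 : rect_approx (fun=> 0).
Proof.
split; first exact: measurable_cst.
move=> e e0; exists [::]; split => //.
rewrite /l2d; under eq_integral do rewrite /stepf big_nil subrr expr0n/=.
by rewrite integral0 lee_fin ltW.
Qed.

Lemma rect_approx_sum (I : Type) (r : seq I) (c : I -> R) (f : I -> R * R -> R) :
  (forall i, rect_approx (f i)) -> rect_approx (fun z => \sum_(i <- r) c i * f i z).
Proof.
move=> h; elim: r => [|i r IH].
  by under eq_fun do rewrite big_nil; exact: rect_approx0.
under eq_fun do rewrite big_cons.
by apply: rect_approxD => //; exact: rect_approxZ.
Qed.

Lemma rect_approx_dct (h : R * R -> R) (f : nat -> R * R -> R) : measurable_fun setT h ->
  (forall n, rect_approx (f n)) -> (forall n z, 0 <= f n z <= h z) ->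
  (forall z, f n z @[n --> \oo] --> h z) ->
  (\int[mu2]_z (h z ^+ 2)%:E < +oo)%E -> rect_approx h.
Proof.
move=> mh hf fh cf fin; apply: rect_approx_lim => // e e0.
have mf n : measurable_fun setT (f n) := (hf n).1.
have [] := @dominated_convergence _ _ _ (leb \x leb)%E setT measurableT
  (fun n z => ((h z - f n z) ^+ 2)%:E) (cst 0%E) (fun z => (h z ^+ 2)%:E).
- by move=> n; apply/measurable_EFinP; apply: measurable_funX; exact (measurable_funB mh (mf n)).
- exact: measurable_cst.
- apply: aeW => z _; apply: cvg_EFin; first by apply: nearW.
  rewrite (_ : 0 = (h z - h z) ^+ 2); last by rewrite subrr expr0n.
  rewrite expr2; under eq_fun do rewrite /= expr2.
  by apply: cvgM; apply: cvgB => //; exact: cvg_cst.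
- apply/integrableP; split; first by apply/measurable_EFinP; exact: measurable_funX.
  by under eq_integral do rewrite gee0_abs ?lee_fin ?sqr_ge0//.
- apply: aeW => z n _; rewrite gee0_abs ?lee_fin ?sqr_ge0//.
  by have /andP[] := fh n z => h1 h2; rewrite !expr2; apply: ler_pM; lra.
move=> _ _; rewrite integral0 => cv.
have /fine_cvgP[h1 h2] := cv.
have /cvgr_lt /(_ e e0) h3 := h2.
have [n [n1 n2]] : exists n, (fun n => l2d h (f n) \is a fin_num /\ fine (l2d h (f n)) < e) n.
  by near \oo => n; exists n; split; near: n.
exists (f n); split => //.
by rewrite -(fineK n1) lee_fin ltW.
Unshelve. all: by end_near.
Qed.

Let finD (A : set (R * R)) : measurable A -> A `<=` D ->
  (\int[mu2]_z ((\1_A z : R) ^+ 2)%:E < +oo)%E.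
Proof.
move=> mA AD; rewrite (_ : (fun z => _) = (fun z => (\1_A z)%:E)); last first.
  by apply/funext => z; rewrite indicE; case: (_ \in _); rewrite ?expr1n ?expr0n.
rewrite integral_indic// setIT; have [_ _] := finite_area_rect b a0 (@measurable_itv R `[0, 1]) (@subset_refl _ _).
by apply: le_lt_trans; apply: le_measure; rewrite ?inE//; exact: measurableX.
Qed.

(** Stated for a general map [g] because it serves twice: with the time projection, then with the
    identity. *)
Lemma dynkin_rect (T : Type) (g : R * R -> T) (E : set (R * R)) : measurable E -> E `<=` D ->
  rect_approx \1_E ->
  dynkin [set A : set T | measurable (g @^-1` A `&` E) /\ rect_approx \1_(g @^-1` A `&` E)].
Proof.
move=> mE ED hE; split.
- by rewrite /= preimage_setT setTI.
- move=> A [mA hA].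
  have e1 : g @^-1` (~` A) `&` E = E `\` (g @^-1` A `&` E).
    by apply/seteqP; split => z /=; [move=> [h1 h2]; split => // -[]|move=> [h1 h2]; split => // h3; exact: h2].
  rewrite /= e1; split; first exact: measurableD.
  rewrite (_ : \1_ _ = (fun z => \1_E z + (-1) * \1_(g @^-1` A `&` E) z)).
    by apply: rect_approxD => //; exact: rect_approxZ.
  apply/funext => z; rewrite !indicE in_setD in_setI.
  by case: (z \in E); case: (z \in g @^-1` A) => /=; rewrite ?mulr0 ?mulr1 ?addr0 ?addrN.
- move=> F tF hF; pose G n := g @^-1` (F n) `&` E.
  have mG n : measurable (G n) := (hF n).1.
  have e1 : g @^-1` (\bigcup_n F n) `&` E = \bigcup_n G n.
    by rewrite preimage_bigcup setI_bigcupl.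
  have mU : measurable (\bigcup_n G n) by exact: bigcupT_measurable.
  have dG i j z : G i z -> G j z -> i = j.
    by move=> [h1 _] [h2 _]; apply: tF => //; exists (g z).
  rewrite /= e1; split => //.
  pose f n z : R := \sum_(i <- index_iota 0 n) 1 * \1_(G i) z.
  have fE n z : f n z = \1_(\bigcup_(i < n) G i) z.
    rewrite /f; under eq_bigr do rewrite mul1r.
    elim: n => [|n IH]; first by rewrite big_geq// bigcup_mkord big_ord0 indicE in_set0.
    rewrite big_nat_recr//= IH (bigcup_mkord n.+1) big_ord_recr/= -bigcup_mkord !indicE in_setU.
    case: (boolP (z \in \bigcup_(i < n) G i)); case: (boolP (z \in G n)); rewrite ?addr0 ?add0r//.
    by move=> /set_mem h1 /set_mem[i /= iln h2]; have := dG _ _ _ h1 h2 => ni; rewrite -ni ltnn in iln.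
  apply: (rect_approx_dct (f := f)).
  + exact: measurable_indic.
  + by move=> n; apply: rect_approx_sum => i; exact: (hF i).2.
  + move=> n z; rewrite fE !indicE ler0n ler_nat /=.
    case: (boolP (z \in \bigcup_(i < n) G i)) => // /set_mem[i _ Gi].
    by rewrite mem_set//; exists i.
  + move=> z; rewrite indicE; have [/set_mem[i _ Gi]|nz] := boolP (z \in \bigcup_n G n).
      apply: cvg_near_cst; near=> n; rewrite fE indicE mem_set//; exists i => //=.
      by near: n; exists i.+1.
    apply: cvg_near_cst; near=> n; rewrite fE indicE memNset// => -[i _ Gi].
    by move/negP: nz; apply; apply/mem_set; exists i.
  + by apply: finD => // z [i _ []] _ /ED.
Unshelve. all: by end_near.
Qed.

(** Space sides being arbitrary already, a first Dynkin argument extends the time sides from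
    intervals to Borel sets, and a second one passes from products to all Borel subsets of the
    slab. *)
Lemma rect_approx_indic (A : set (R * R)) : measurable A -> A `<=` D -> rect_approx \1_A.
Proof.
move=> mA AD.
have mD : measurable D by exact: measurableX.
have prodE (X Y : set R) : fst @^-1` X `&` (`]a, b]%classic `*` Y) = ((X `&` `]a, b]%classic) `*` Y) :> set (R * R).
  by apply/seteqP; split => -[u v] /=; tauto.
have step1 (X Y : set R) : measurable X -> measurable Y -> Y `<=` `[0, 1] ->
    rect_approx \1_((X `&` `]a, b]%classic) `*` Y).
  move=> mX mY Y1; have [ba|ab] := ltP b a.
    rewrite (_ : _ `*` _ = set0).
      by rewrite indic0; exact: rect_approx0.
    by rewrite -subset0 => z [[_ /=]]; rewrite in_itv/= => /andP[h1 h2]; lra.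
  have dyn := @dynkin_rect R fst (`]a, b]%classic `*` Y).
  have {}dyn := dyn (measurableX (measurable_itv _) mY) (fun z hz => conj hz.1 (Y1 _ hz.2))
     (rect_approx_rect (lexx a) ab (lexx b) mY Y1).
  have := lambda_system_subset (@ocitvI R) (proj1 (dynkin_lambda_system _) dyn) (D := setT).
  move=> /(_ _ _ X mX)[] //.
  - move=> _ [[s t] _ <-] /=; rewrite prodE; split; first by apply: measurableX => //; exact: measurableI.
    rewrite (_ : _ `&` _ = `]Num.max s a, Num.min t b]%classic); last first.
      by apply/seteqP; split => u /=; rewrite !in_itv/= gt_max le_min; lra.
    have [h|h] := leP (Num.max s a) (Num.min t b).
      by apply: rect_approx_rect => //; [rewrite le_max lexx orbT|rewrite ge_min lexx orbT].
    rewrite (_ : _ `*` _ = set0); first by rewrite indic0; exact: rect_approx0.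
    by rewrite -subset0 => z [/=]; rewrite in_itv/= => /andP[h1 h2]; lra.
  - by move=> _; rewrite prodE.
have dyn := @dynkin_rect _ id D mD (@subset_refl _ D).
have {}dyn : dynkin [set A0 | measurable (id @^-1` A0 `&` D) /\ rect_approx \1_(id @^-1` A0 `&` D)].
  apply: dyn; rewrite /D /slab -[X in X `*` _]setTI; apply: step1 => //.
have IG : setI_closed [set (X : set R) `*` (Y : set R) | X in measurable & Y in measurable].
  move=> _ _ [X mX [Y mY <-]] [X' mX' [Y' mY' <-]].
  by exists (X `&` X'); [exact: measurableI|exists (Y `&` Y'); [exact: measurableI|rewrite setXI]].
have := lambda_system_subset IG (proj1 (dynkin_lambda_system _) dyn) (D := setT).
move: mA; rewrite measurable_prod_measurableType => mA /(_ _ _ A mA)[]//.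
- move=> _ [X mX [Y mY <-]] /=.
  have -> : (X `*` Y) `&` D = (X `&` `]a, b]%classic) `*` (Y `&` `[0, 1]%classic).
    by rewrite /D /slab setXI.
  rewrite -measurable_prod_measurableType; split; first by apply: measurableX; exact: measurableI.
  exact: (step1 X _ mX (measurableI _ _ mY (measurable_itv _)) (fun y h => h.2)).
- by move=> _; rewrite /= (setIidl AD).
Qed.

(** The intended [h] is the heat kernel cut to a slab. Simple functions increase to it, and
    dominated convergence turns this into convergence in L^2. *)
Lemma rect_approx_nonneg (h : R * R -> R) : measurable_fun setT h -> (forall z, 0 <= h z) ->
  (forall z, ~ D z -> h z = 0) -> (\int[mu2]_z (h z ^+ 2)%:E < +oo)%E -> rect_approx h.
Proof.
move=> mh h0 hD fin.
have mD : measurable D by exact: measurableX.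
have mhe : measurable_fun setT (EFin \o h) by exact/measurable_EFinP.
pose nf := nnsfun_approx measurableT mhe.
pose f n : R * R -> R := nf n.
have he0 z : setT z -> (0 <= (EFin \o h) z)%E by move=> _; rewrite lee_fin.
have cf z : f n z @[n --> \oo] --> h z.
  have := cvg_nnsfun_approx measurableT mhe he0 (x := z) I.
  by move=> /fine_cvgP[].
have fh n z : f n z <= h z.
  have nd : nondecreasing_seq (fun n => f n z).
    by move=> m k mk; have /lefP/(_ z) := nd_nnsfun_approx measurableT mhe mk.
  rewrite -(cvg_lim (@Rhausdorff R) (cf z)); apply: (nondecreasing_cvgn_le nd).
  by apply/cvg_ex; exists (h z).
have f0 n z : 0 <= f n z by [].
apply: (rect_approx_dct (f := f)) => //; last by move=> n z; rewrite f0 fh.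
move=> n; have fE z : f n z = \sum_(y \in range (f n)) y * \1_(f n @^-1` [set y] `&` D) z.
  have [Dz|nDz] := pselect (D z).
    rewrite [LHS](fimfunE (nf n)); apply: eq_fsbigr => y _; congr (_ * _).
    by rewrite !indicE in_setI (mem_set Dz) andbT.
  have -> : f n z = 0 by apply/eqP; rewrite eq_le f0 -(hD z nDz) fh.
  by rewrite fsbig1// => y _; rewrite indicE memNset ?mulr0// => -[].
rewrite (_ : f n = (fun z => \sum_(y <- finmap.enum_fset (fset_set (range (f n)))) y * \1_(f n @^-1` [set y] `&` D) z)).
  apply: rect_approx_sum => y; apply: rect_approx_indic; last by move=> z [].
  by apply: measurableI => //; exact: measurable_funPTI.
by apply/funext => z; rewrite [LHS]fE fsbig_finite.
Qed.

End density.

(** * The zero-one law *)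

Section zero_one.
Context {R : realType} {d : measure_display} {Omega : measurableType d}.
Context (P : probability Omega R) (W : set (R * R) -> Omega -> R).
Hypothesis hW : white_noise P W.
Notation leb := (@lebesgue_measure R).
Notation mu2 := (leb \x leb)%E.
Implicit Types (l : seq (R * set (R * R))).

(** A crude first moment, from |y| <= exp y + exp(-y) at the scale of the standard deviation. Only
    its vanishing together with the variance matters. *)
Lemma wsum_abs l : step_ok l ->
  (\int[P]_w (`|wsum W l w|)%:E <= (4 * Num.sqrt (step_var l))%:E)%E.
Proof.
move=> ok; have mw := measurable_wsum hW ok.
have mwa : measurable_fun setT (fun w => (`|wsum W l w|)%:E).
  by apply/measurable_EFinP; exact: measurableT_comp.
have [v0|vn0] := eqVneq (step_var l) 0.
  rewrite v0 sqrtr0 mulr0 (_ : (\int[P]_w _ = 0)%E)//; apply/eqP.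
  rewrite -(integral0 P setT); apply/eqP; apply: ge0_ae_eq_integral => //.
  by apply: filterS (wsum_var0 hW ok v0) => w h _ /=; rewrite h normr0.
have s0 : 0 < Num.sqrt (step_var l) by rewrite sqrtr_gt0 lt_def vn0 step_var_ge0.
set s := Num.sqrt _ in s0 *.
have vE : step_var l = s ^+ 2 by rewrite sqr_sqrtr// step_var_ge0.
have eh : expR (2^-1) <= 2 :> R.
  have := expR_ge1Dx (- 2^-1 : R); rewrite expRN => h.
  have e0 := expR_gt0 (2^-1 : R).
  have : 2^-1 <= (expR (2^-1))^-1 :> R by apply: le_trans h; lra.
  by rewrite lef_pV2 ?posrE.
have hexp c : c ^+ 2 * step_var l = 1 -> (\int[P]_w (expR (wsum W (step_scale c l) w))%:E <= 2%:E)%E.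
  move=> cv; rewrite (wsum_exp hW (step_ok_scale (c := c) ok)) step_var_scale cv lee_fin mul1r//.
have mexp c : measurable_fun setT (fun w => (s * expR (wsum W (step_scale c l) w))%:E).
  apply/measurable_EFinP; apply: measurable_funM => //; apply: measurableT_comp => //.
  exact: (measurable_wsum hW (step_ok_scale (c := c) ok)).
have mexp1 c : measurable_fun setT (fun w => (expR (wsum W (step_scale c l) w))%:E).
  apply/measurable_EFinP; apply: measurableT_comp => //.
  exact: (measurable_wsum hW (step_ok_scale (c := c) ok)).
have ze c : (forall w, 0 <= (s * expR (wsum W (step_scale c l) w))%:E)%E.
  by move=> w; rewrite lee_fin mulr_ge0 ?expR_ge0// ltW.
apply: (@le_trans _ _ (\int[P]_w ((s * expR (wsum W (step_scale s^-1 l) w))%:E +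
   (s * expR (wsum W (step_scale (- s^-1) l) w))%:E))%E).
  apply: ge0_le_integral => //.
  - by apply: emeasurable_funD.
  - move=> w _; rewrite -EFinD lee_fin !wsum_scale mulNr -mulrDr.
    rewrite -ler_pdivrMl//; set y := wsum _ _ _.
    have -> : s^-1 * `|y| = `|s^-1 * y| by rewrite normrM gtr0_norm ?invr_gt0.
    have h1 := expR_ge1Dx (s^-1 * y); have h2 := expR_ge1Dx (- (s^-1 * y)).
    have h3 := expR_gt0 (s^-1 * y); have h4 := expR_gt0 (- (s^-1 * y)).
    by rewrite ler_norml; apply/andP; split; lra.
rewrite ge0_integralD//.
have -> : (4 * s)%:E = (s%:E * 2%:E + s%:E * 2%:E)%E by rewrite -!EFinM -EFinD; congr EFin; ring.
have sv : s^-1 ^+ 2 * step_var l = 1 by rewrite vE exprVn mulVf// expf_neq0// gt_eqF.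
apply: leeD; under eq_integral do rewrite EFinM.
  rewrite ge0_integralZl//; last by rewrite lee_fin ltW.
  by apply: lee_wpmul2l; [rewrite lee_fin ltW|exact: hexp].
rewrite ge0_integralZl//; last by rewrite lee_fin ltW.
by apply: lee_wpmul2l; [rewrite lee_fin ltW|apply: hexp; rewrite sqrrN].
Qed.

Definition early (t : R) : set (R * R) := [set z | z.1 <= t].
Definition step_restrict (E : set (R * R)) l := [seq (p.1, p.2 `&` E) | p <- l].

Lemma measurable_early t : measurable (early t).
Proof.
rewrite (_ : early t = `]-oo, t]%classic `*` setT); first exact: measurableX.
by apply/seteqP; split => -[x y] /=; rewrite /early /= in_itv/=; tauto.
Qed.

Lemma finite_area_setIm (A B : set (R * R)) : finite_area_set A -> measurable B ->
  finite_area_set (A `&` B).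
Proof.
move=> [mA sA fA] mB; split; [exact: measurableI|by move=> z [/sA]|].
apply: le_lt_trans fA; apply: (@le_measure _ _ _ (leb \x leb)%E); rewrite ?inE//.
exact: measurableI.
Qed.

Lemma step_restrict_ok E l : measurable E -> step_ok l -> step_ok (step_restrict E l).
Proof. by move=> mE ok p /mapP[q ql ->]; apply: finite_area_setIm => //; exact: ok. Qed.

Lemma stepf_restrict E l z : stepf (step_restrict E l) z = stepf l z * \1_E z.
Proof.
rewrite /stepf big_map mulr_suml; apply: eq_bigr => p _.
by rewrite !indicE in_setI; case: (z \in p.2); case: (z \in E); rewrite /= ?mulr0 ?mulr1 ?mul0r.
Qed.

Lemma area_early_le (A : set (R * R)) (t : R) : 0 <= t -> measurable A -> A `<=` @strip R ->
  (area (A `&` early t) <= t%:E)%E.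
Proof.
move=> t0 mA As; apply: (@le_trans _ _ (area (`[0, t]%classic `*` `[0, 1]%classic))).
  apply: (@le_measure _ _ _ (leb \x leb)%E); rewrite ?inE.
  - by apply: measurableI => //; exact: measurable_early.
  - exact: measurableX.
  - move=> z [/As[/= + z2] z1]; rewrite !in_itv/= andbT => z0; split => //=.
    by rewrite z0.
apply: (@le_trans _ _ (leb `[0%R, t] * leb `[0%R, 1%R])%E); first by rewrite /area product_measure1E.
rewrite !lebesgue_measure_itv/= !lte_fin ltr01 !oppr0 !adde0 mule1.
by case: ifP => // _; rewrite lee_fin.
Qed.

(** The strip before time [t] has area [t], so the variance collected there is linear in [t], with a
    constant that depends on the weights alone. *)
Lemma early_var_le l : step_ok l -> exists K, 0 <= K /\ forall t, 0 <= t ->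
  step_var (step_restrict (early t) l) <= K * t.
Proof.
move=> ok; exists (\sum_(p <- l) \sum_(q <- l) `|p.1 * q.1|); split.
  by apply: sumr_ge0 => p _; apply: sumr_ge0 => q _.
move=> t t0; rewrite /step_var /step_cov big_map mulr_suml big_seq [leRHS]big_seq.
apply: ler_sum => p pl; rewrite big_map mulr_suml big_seq [leRHS]big_seq; apply: ler_sum => q ql.
have [mp ps fp] := ok p pl; have [mq qs fq] := ok q ql.
have h : (area ((p.2 `&` early t) `&` (q.2 `&` early t)) <= t%:E)%E.
  apply: le_trans (area_early_le t0 mp ps); apply: (@le_measure _ _ _ (leb \x leb)%E); rewrite ?inE.
  - by apply: measurableI; apply: measurableI => //; exact: measurable_early.
  - by apply: measurableI => //; exact: measurable_early.
  - by move=> z [].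
have h0 : (0 <= area ((p.2 `&` early t) `&` (q.2 `&` early t)))%E by exact: measure_ge0.
have hf : area ((p.2 `&` early t) `&` (q.2 `&` early t)) \is a fin_num.
  by rewrite ge0_fin_numE//; apply: le_lt_trans h _; rewrite ltry.
apply: (@le_trans _ _ (`|p.1 * q.1| * fine (area ((p.2 `&` early t) `&` (q.2 `&` early t))))) => /=.
  by apply: ler_wpM2r; [exact: fine_ge0|exact: ler_norm].
by apply: ler_wpM2l => //; rewrite -lee_fin fineK.
Qed.

Lemma cos_dist (x y : R) : `|cos x - cos y| <= `|x - y|.
Proof.
wlog xy : x y / x <= y.
  by move=> h; have [/h//|/ltW/h] := leP x y; rewrite distrC [leRHS]distrC.
have [->|nxy] := eqVneq x y; first by rewrite !subrr normr0.
have {}xy : x < y by rewrite lt_def eq_sym nxy.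
have [c _ h] := @MVT R cos (fun x => - sin x) x y xy
  (fun z _ => is_derive_cos z) (continuous_subspaceT (@continuous_cos R)).
rewrite distrC h normrM normrN [leRHS]distrC ler_piMl// ler_norml sin_geN1 sin_le1//.
Qed.

Lemma cvg0_sqrt_le (x y K : R) : 0 <= K -> (forall t, 0 < t -> x <= y + Num.sqrt (K * t)) -> x <= y.
Proof.
move=> K0 h; apply/ler_addgt0Pr => e e0.
have K1 : 0 < K + 1 by lra.
apply: (le_trans (h (e ^+ 2 / (K + 1)) _)); first by rewrite divr_gt0 ?exprn_gt0.
rewrite lerD2l -[leRHS]gtr0_norm// -sqrtr_sqr; apply: ler_wsqrtr.
rewrite mulrA ler_pdivrMr// mulrC ler_wpM2l ?sqr_ge0//; lra.
Qed.

Section tail_event.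
Variable E : set Omega.
Hypothesis hE : forall t, 0 < t -> noise_filtration P W t E.

Let mE : measurable E.
Proof. by have := hE ltr01; rewrite noise_filtrationE; exact: noise_alg_measurable. Qed.

Let late t l := step_restrict (~` early t) l.

(** [E] belongs to the noise before [t] and the cosine to the noise after [t], so [freeze] factors
    the expectation. *)
Lemma tail_event_cos_late t l th : 0 < t -> step_ok l ->
  (\int[P]_w (\1_E w * (1 + cos (wsum W (late t l) w + th)))%:E =
   \int[P]_w (fine (P E) * (1 + cos (wsum W (late t l) w + th)))%:E)%E.
Proof.
move=> t0 ok; have mNe : measurable (~` early t) by exact: measurableC (measurable_early t).
have okl := step_restrict_ok mNe ok.
pose D := `[0, t]%classic `*` `[0, 1]%classic : set (R * R).
pose D' := ~` early t : set (R * R).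
have dis : D `&` D' = set0.
  rewrite -subset0 => z [[/= z1 _] z2]; apply: z2; rewrite /early /=.
  by move: z1; rewrite in_itv/= => /andP[].
have m1 : measurable_fun setT (\1_E : g_sigma_algebraType (noise_gen P W D) -> R).
  by apply: measurable_indic; have := hE t0; rewrite noise_filtrationE.
have m2 : measurable_fun setT (fun w : g_sigma_algebraType (noise_gen P W D') => 1 + cos (wsum W (late t l) w + th)).
  apply: measurable_funD => //; apply: measurable_cosf; apply: measurable_funD => //.
  apply: noise_alg_wsum => p /mapP[q ql ->] /=; split; last by move=> z [].
  by apply: finite_area_setIm => //; exact: ok.
have F0 (w w' : Omega) : 0 <= \1_E w * (1 + cos (wsum W (late t l) w' + th)).
  by rewrite mulr_ge0// addrC -lerBlDr sub0r cos_geN1.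
have := freeze (D := D) (D' := D') hW (F := fun z => (\1_E z.1 * (1 + cos (wsum W (late t l) z.2 + th)))%:E) dis.
move=> -> //=; last first.
  by apply/measurable_EFinP; apply: measurable_funM; [exact: measurable_ofst m1|exact: measurable_osnd m2].
have m3 : measurable_fun setT (fun w : Omega => (1 + cos (wsum W (late t l) w + th))%:E).
  apply/measurable_EFinP; apply: measurable_funD => //; apply: measurable_cosf; apply: measurable_funD => //.
  exact: (measurable_wsum hW okl).
have p3 (w : Omega) : (0 <= (1 + cos (wsum W (late t l) w + th))%:E)%E.
  by rewrite lee_fin addrC -lerBlDr sub0r cos_geN1.
set K := (\int[P]_w (1 + cos (wsum W (late t l) w + th))%:E)%E.
have K0 : (0 <= K)%E by exact: integral_ge0.
transitivity (\int[P]_w (K * (\1_E w)%:E))%E.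
  apply: eq_integral => w _; under eq_integral do rewrite EFinM.
  by rewrite ge0_integralZl// muleC.
rewrite (@ge0_integralZl _ _ _ P setT measurableT (fun w => (\1_E w)%:E)) //.
rewrite integral_indic// setIT muleC.
have pE0 : (0 <= (fine (P E))%:E)%E by rewrite lee_fin fine_ge0.
under [RHS]eq_integral do rewrite EFinM.
  by rewrite ge0_integralZl// fineK ?fin_num_measure.
by apply/measurable_EFinP; exact: measurable_indic.
Qed.

Let pE := fine (P E).
Let pE01 : 0 <= pE <= 1.
Proof.
by rewrite /pE -!lee_fin fineK ?fin_num_measure// measure_ge0 probability_le1.
Qed.

Let cos0 (x : R) : 0 <= 1 + cos x. Proof. by have := cos_geN1 x; lra. Qed.

Let late_err t l : 0 <= t -> step_ok l -> forall K, 
  (forall t, 0 <= t -> step_var (step_restrict (early t) l) <= K * t) ->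
  (\int[P]_w (`|wsum W l w - wsum W (late t l) w|)%:E <= (4 * Num.sqrt (K * t))%:E)%E.
Proof.
move=> t0 ok K hK; have mNe : measurable (~` early t) by exact: measurableC (measurable_early t).
have ok1 := step_restrict_ok mNe ok; have ok2 := step_restrict_ok (measurable_early t) ok.
have ok3 := step_ok_scale (c := -1) ok1.
have ok4 : step_ok (l ++ step_scale (-1) (late t l)) by exact: step_ok_cat.
have := wsum_abs ok4.
under eq_integral do rewrite wsum_cat wsum_scale mulN1r.
move=> h; apply: le_trans h _; rewrite lee_fin ler_pM2l//; apply: ler_wsqrtr.
apply: le_trans (hK t t0); rewrite le_eqVlt; apply/orP; left; apply/eqP.
apply: EFin_inj; rewrite -!step_varE//; apply: eq_integral => z _; congr ((_ ^+ 2)%:E).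
rewrite stepf_cat stepf_scale !stepf_restrict !indicE in_setC.
by case: (z \in early t) => /=; ring.
Qed.

(** Dropping the noise before [t] changes the cosine by at most the absolute value of the dropped
    part, whose mean is O(sqrt t). The weight [u] covers both the indicator of [E] and the constant
    P(E). *)
Let u_le (u : Omega -> R) l t th K : measurable_fun setT u -> (forall w, 0 <= u w <= 1) -> 0 <= t -> step_ok l ->
  (forall t, 0 <= t -> step_var (step_restrict (early t) l) <= K * t) ->
  (\int[P]_w (u w * (1 + cos (wsum W l w + th)))%:E <=
     \int[P]_w (u w * (1 + cos (wsum W (late t l) w + th)))%:E + (4 * Num.sqrt (K * t))%:E)%E /\
  (\int[P]_w (u w * (1 + cos (wsum W (late t l) w + th)))%:E <=
     \int[P]_w (u w * (1 + cos (wsum W l w + th)))%:E + (4 * Num.sqrt (K * t))%:E)%E.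
Proof.
move=> mu u01 t0 ok hK.
have mNe : measurable (~` early t) by exact: measurableC (measurable_early t).
have ok1 := step_restrict_ok mNe ok.
have mY (l' : seq (R * set (R * R))) : step_ok l' -> measurable_fun setT (fun w => (u w * (1 + cos (wsum W l' w + th)))%:E).
  move=> ok'; apply/measurable_EFinP; apply: measurable_funM => //; apply: measurable_funD => //.
  by apply: measurable_cosf; apply: measurable_funD => //; exact: (measurable_wsum hW).
have Y0 (l' : seq (R * set (R * R))) w : setT w -> (0 <= (u w * (1 + cos (wsum W l' w + th)))%:E)%E.
  by move=> _; rewrite lee_fin mulr_ge0//; case/andP: (u01 w).
have mA : measurable_fun setT (fun w => (`|wsum W l w - wsum W (late t l) w|)%:E).
  apply/measurable_EFinP; apply: measurableT_comp => //; apply: measurable_funB; exact: (measurable_wsum hW).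
have key (x y : R) w : u w * (1 + cos (x + th)) <= u w * (1 + cos (y + th)) + `|x - y|.
  have := cos_dist (x + th) (y + th); rewrite (_ : x + th - (y + th) = x - y); last by ring.
  have /andP[h1 h2] := u01 w; move: (cos (x + th)) (cos (y + th)) => p q.
  rewrite ler_norml => /andP[_ h3]; have := normr_ge0 (x - y) => h4; nra.
have gen l1 l2 : step_ok l1 -> step_ok l2 ->
  (forall w, `|wsum W l1 w - wsum W l2 w| = `|wsum W l w - wsum W (late t l) w|) ->
  (\int[P]_w (u w * (1 + cos (wsum W l1 w + th)))%:E <=
     \int[P]_w (u w * (1 + cos (wsum W l2 w + th)))%:E + (4 * Num.sqrt (K * t))%:E)%E.
  move=> o1 o2 e12; apply: (@le_trans _ _ (\int[P]_w (u w * (1 + cos (wsum W l2 w + th)))%:E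
    + \int[P]_w (`|wsum W l w - wsum W (late t l) w|)%:E)%E); last first.
    by apply: leeD => //; exact: late_err.
  rewrite -ge0_integralD//; [|exact: Y0|exact: mY].
  apply: ge0_le_integral.
  - exact: measurableT.
  - exact: Y0.
  - exact: mY.
  - by apply: emeasurable_funD => //; exact: mY.
  - by move=> w _; rewrite -EFinD lee_fin -e12; exact: key.
split; apply: gen => // w; exact: distrC.
Qed.

(** The limit t -> 0 of the previous identity. Each side contributes an error 4 sqrt(K t), whence
    the constant 64 = 8^2. *)
Lemma tail_event_cos l th : step_ok l ->
  (\int[P]_w (\1_E w * (1 + cos (wsum W l w + th)))%:E =
   \int[P]_w (fine (P E) * (1 + cos (wsum W l w + th)))%:E)%E.
Proof.
move=> ok; have [K [K0 hK]] := early_var_le ok.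
have m1 : measurable_fun setT (\1_E : Omega -> R) by exact: measurable_indic.
have m2 : measurable_fun setT (cst pE : Omega -> R) by exact: measurable_cst.
have b1 (w : Omega) : 0 <= (\1_E w : R) <= 1 by rewrite indicE; case: (_ \in _); rewrite ?ler01 ?lexx.
have fn (u : Omega -> R) : measurable_fun setT u -> (forall w, 0 <= u w <= 1) ->
   (\int[P]_w (u w * (1 + cos (wsum W l w + th)))%:E)%E \is a fin_num.
  move=> mu u01; apply: (integrable_fin_num measurableT).
  apply: (bounded_integrable P (M := 2)).
    apply: measurable_funM => //; apply: measurable_funD => //.
    by apply: measurable_cosf; apply: measurable_funD => //; exact: (measurable_wsum hW).
  move=> w; have /andP[h1 h2] := u01 w; rewrite ger0_norm ?mulr_ge0//.
  have := cos_le1 (wsum W l w + th); have := cos0 (wsum W l w + th) => h3 h4; nra.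
have f1 := fn _ m1 b1; have f2 := fn _ m2 (fun=> pE01).
rewrite -(fineK f1) -(fineK f2); congr EFin; apply/eqP; rewrite eq_le; apply/andP; split.
  apply: (cvg0_sqrt_le (K := 64 * K)); first by rewrite mulr_ge0.
  move=> t t0; rewrite -lee_fin EFinD (fineK f1) (fineK f2).
  have [h1 _] := u_le th m1 b1 (ltW t0) ok hK; have [_ h2] := u_le th m2 (fun=> pE01) (ltW t0) ok hK.
  apply: (le_trans h1); rewrite (tail_event_cos_late th t0 ok).
  have -> : Num.sqrt (64 * K * t) = 4 * Num.sqrt (K * t) + 4 * Num.sqrt (K * t).
    by rewrite -mulrA sqrtrM// (_ : 64 = 8 ^+ 2) ?sqrtr_sqr ?ger0_norm//; lra.
  by rewrite EFinD addeA; apply: leeD.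
apply: (cvg0_sqrt_le (K := 64 * K)); first by rewrite mulr_ge0.
move=> t t0; rewrite -lee_fin EFinD (fineK f1) (fineK f2).
have [_ h1] := u_le th m1 b1 (ltW t0) ok hK; have [h2 _] := u_le th m2 (fun=> pE01) (ltW t0) ok hK.
apply: (le_trans h2); rewrite -(tail_event_cos_late th t0 ok).
have -> : Num.sqrt (64 * K * t) = 4 * Num.sqrt (K * t) + 4 * Num.sqrt (K * t).
  by rewrite -mulrA sqrtrM// (_ : 64 = 8 ^+ 2) ?sqrtr_sqr ?ger0_norm//; lra.
by rewrite EFinD addeA; apply: leeD.
Qed.

(** The Cramer-Wold device with weights 1_E and P(E) converts the cosine identities into
    independence of [E] from every noise box. The pi-lambda argument then makes [E] independent of
    itself. *)
Lemma zero_one_law : P E = 0%E \/ P E = 1%E.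
Proof.
have hS : noise_alg P W (@strip R) E.
  have := hE ltr01; rewrite noise_filtrationE; apply: noise_algS => z [/= z1 z2]; split => //=.
  by move: z1; rewrite !in_itv/= => /andP[->].
have ind F : noise_box P W (@strip R) F -> (P (F `&` E) = P F * P E)%E.
  move=> hF; have mF := noise_box_measurable hW hF.
  case: hF => [[I [L [a [b [h eF]]]]]|[_ F0]]; last first.
    by rewrite F0 mul0e; apply: subset_measure0 F0 => //; exact: measurableI.
  have okL i : step_ok (L i) by exact: step_in_ok (h i).
  have mL i : measurable_fun setT (wsum W (L i)) by exact: (measurable_wsum hW).
  have := @cramer_wold R I _ _ P _ _ P (fun i => wsum W (L i)) (fun i => wsum W (L i)) a b mL mL
    (\1_E) (cst pE) 1 (measurable_indic mE) (measurable_cst _).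
  rewrite -eF => H; have {}H := H _ _ _; transitivity (\int[P]_w (\1_E w * \1_F w)%:E)%E.
    rewrite setIC -[X in P X]setIT -integral_indic//; last exact: measurableI.
    by apply: eq_integral => w _; rewrite indicI.
  rewrite H.
  - rewrite -(fineK (fin_num_measure P E mE)) muleC.
    transitivity (\int[P]_w (pE%:E * (\1_F w)%:E))%E; first by apply: eq_integral => w _; rewrite -EFinM.
    rewrite ge0_integralZl//.
    + by rewrite integral_indic// setIT.
    + by apply/measurable_EFinP; exact: measurable_indic.
    + by rewrite lee_fin; case/andP: pE01.
  - by move=> w; rewrite indicE; case: (_ \in _); rewrite ?normr1 ?normr0.
  - by move=> w; case/andP: pE01 => h1 h2; rewrite ger0_norm.
  - move=> c th; pose l := step_lin c L; have okl : step_ok l by exact: step_ok_lin.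
    under eq_integral do rewrite -wsum_lin; under [RHS]eq_integral do rewrite -wsum_lin.
    have := tail_event_cos th okl.
    have spl (u : Omega -> R) : measurable_fun setT u -> (forall w, 0 <= u w <= 1) ->
      (\int[P]_w (u w * (1 + cos (wsum W l w + th)))%:E =
       \int[P]_w (u w)%:E + \int[P]_w (u w * cos (wsum W l w + th))%:E)%E.
      move=> mu u01; under eq_integral do rewrite mulrDr mulr1 EFinD.
      rewrite integralD//; apply: (bounded_integrable P (M := 1)) => //.
      + by move=> w; have /andP[h1 h2] := u01 w; rewrite ger0_norm.
      + apply: measurable_funM => //; apply: measurable_cosf; apply: measurable_funD => //.
        exact: (measurable_wsum hW).
      + move=> w; have /andP[h1 h2] := u01 w; rewrite normrM ger0_norm// mulr_ile1//.
        by rewrite ler_norml cos_geN1 cos_le1.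
    have b1 (w : Omega) : 0 <= (\1_E w : R) <= 1 by rewrite indicE; case: (_ \in _); rewrite ?ler01 ?lexx.
    rewrite (spl _ (measurable_indic mE) b1) (spl _ (measurable_cst pE) (fun=> pE01)).
    have -> : (\int[P]_w (cst pE w)%:E = P E)%E.
      transitivity (\int[P]_w (cst pE%:E w))%E; first by apply: eq_integral.
      by rewrite integral_cst// [X in (_ * X)%E]probability_setT mule1 fineK ?fin_num_measure.
    rewrite integral_indic// setIT => /(congr1 (fun z => z - P E)%E).
    by rewrite ![(P E + _)%E]addeC !addeK ?fin_num_measure.
have hEE : (P (E `&` E) = P E * P E)%E.
  apply: (pi_lambda_indep (G := noise_box P W (@strip R)) _ _ mE ind).
  - exact: noise_box_setI.
  - by move=> F; exact: noise_box_measurable.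
  - exact: noise_alg_box.
have h : pE = pE * pE.
  by apply: EFin_inj; rewrite EFinM /pE fineK ?fin_num_measure// -hEE setIid.
rewrite -(fineK (fin_num_measure P E mE)) -/pE.
have : pE * (1 - pE) = 0 by rewrite mulrBr mulr1 -h subrr.
by move=> /eqP; rewrite mulf_eq0 subr_eq0 => /orP[/eqP ->|/eqP <-]; [left|right].
Qed.

End tail_event.
End zero_one.

(** * Heat kernel estimates *)

Section gauss_kernel.
Context {R : realType}.

Definition gk (t x : R) : R := expR (- x ^+ 2 / (2 * t)) / Num.sqrt (2 * pi * t).
(** Gaussian profile of variance 4 t. Being wider than the kernel it dominates, up to constants and
    powers of t, the kernel, its shifts by at most sqrt t and its derivatives with their polynomial
    factors. *)
Definition ge8 (t x : R) : R := expR (- (x ^+ 2 / (8 * t))).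

Lemma gk_ge0 t x : 0 <= gk t x.
Proof. by rewrite /gk mulr_ge0 ?expR_ge0// invr_ge0 sqrtr_ge0. Qed.

Lemma ge8_ge0 t x : 0 <= ge8 t x. Proof. exact: expR_ge0. Qed.

(** The square root of a non-positive number is 0, and so is the inverse of 0. *)
Lemma gk_nonpos t x : t <= 0 -> gk t x = 0.
Proof.
move=> t0; rewrite /gk ler0_sqrtr ?invr0 ?mulr0//.
by rewrite -mulrA pmulr_rle0// pmulr_rle0// pi_gt0.
Qed.

Lemma pi_ge1 : 1 <= pi :> R. Proof. by apply: le_trans (pi_ge2 R); lra. Qed.

Lemma sqrt2pi_ge (t : R) : 0 < t -> Num.sqrt t <= Num.sqrt (2 * pi * t).
Proof.
move=> t0; apply: ler_wsqrtr; rewrite -{1}(mul1r t) ler_pM2r//.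
by have := pi_ge1; lra.
Qed.

Lemma sqrt_inv_bound (t : R) : 0 < t -> (Num.sqrt (2 * pi * t))^-1 <= (Num.sqrt t)^-1.
Proof.
move=> t0; have s0 : 0 < Num.sqrt t by rewrite sqrtr_gt0.
rewrite lef_pV2 ?posrE ?sqrt2pi_ge//; exact: lt_le_trans s0 (sqrt2pi_ge t0).
Qed.

Lemma gk_le_exp (t x : R) : 0 < t -> gk t x <= (Num.sqrt t)^-1 * expR (- (x ^+ 2 / (2 * t))).
Proof.
by move=> t0; rewrite /gk mulrC mulNr ler_wpM2r ?expR_ge0// sqrt_inv_bound.
Qed.

Lemma gk_bound (t x : R) : 0 < t -> gk t x <= (Num.sqrt t)^-1 * ge8 t x.
Proof.
move=> t0; apply: (le_trans (gk_le_exp x t0)); rewrite ler_wpM2l ?invr_ge0 ?sqrtr_ge0//.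
rewrite ler_expR lerN2 ler_wpM2l ?sqr_ge0// lef_pV2 ?posrE; lra.
Qed.

Lemma is_derive_gk_x (t x : R) : 0 < t -> is_derive x 1 (gk t) (- x / t * gk t x).
Proof.
move=> t0.
have h1 : is_derive x 1 (fun y : R => - y ^+ 2 / (2 * t)) (- x / t).
  rewrite (_ : (fun y => _) = (- (2 * t)^-1) \*: (fun y : R => y ^+ 2)); last first.
    by apply/funext => y /=; rewrite /GRing.scale/=; field; rewrite gt_eqF.
  by apply: is_derive_eq; rewrite /GRing.scale/=; field; rewrite gt_eqF.
have h2 := is_derive1_comp (is_derive_expR _) h1.
rewrite [X in is_derive _ _ X _](_ : gk t = (Num.sqrt (2 * pi * t))^-1 \*: (expR \o (fun y : R => - y ^+ 2 / (2 * t)))); last first.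
  by apply/funext => y /=; rewrite /GRing.scale/= mulrC.
by apply: is_derive_eq; rewrite /GRing.scale/= /gk; ring.
Qed.

Lemma is_derive_gk_t (t x : R) : 0 < t ->
  is_derive t 1 (gk ^~ x) ((x ^+ 2 / (2 * t ^+ 2) - (2 * t)^-1) * gk t x).
Proof.
move=> t0; have tn0 : t != 0 by rewrite gt_eqF.
have pn0 : pi != 0 :> R by rewrite gt_eqF ?pi_gt0.
have pt0 : 0 < 2 * pi * t by rewrite !mulr_gt0// pi_gt0.
have S0 : Num.sqrt (2 * pi * t) != 0 by rewrite gt_eqF// sqrtr_gt0.
have h0 : is_derive t 1 (fun y : R => 2 * y) 2.
  by apply: is_derive_eq; rewrite /GRing.scale/=; ring.
have t20 : 2 * t != 0 by rewrite mulf_neq0.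
have h1 : is_derive t 1 (fun y : R => - x ^+ 2 / (2 * y)) (x ^+ 2 / (2 * t ^+ 2)).
  have h := @is_deriveV R (fun y : R => 2 * y) t _ 1 t20 h0.
  rewrite (_ : (fun y => _) = (- x ^+ 2) \*: (fun y : R => (2 * y)^-1))//.
  by apply: is_derive_eq; rewrite /GRing.scale/= -exprVn; field.
have h2 := is_derive1_comp (is_derive_expR _) h1.
have h3 : is_derive t 1 (fun y : R => 2 * pi * y) (2 * pi).
  by apply: is_derive_eq; rewrite /GRing.scale/=; ring.
have h4 := is_derive1_comp (is_derive1_sqrt pt0) h3.
have h5 := @is_deriveV R _ t _ 1 S0 h4.
rewrite [X in is_derive _ _ X _](_ : gk ^~ x = (expR \o (fun y : R => - x ^+ 2 / (2 * y))) * (fun y => (Num.sqrt (2 * pi * y))^-1))//.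
apply: is_derive_eq; rewrite /GRing.scale/= /gk.
have e : Num.sqrt (2 * pi * t) ^+ 2 = 2 * pi * t by rewrite sqr_sqrtr// ltW.
have e3 : (2 * t)^-1 = pi / (2 * pi * t).
  by rewrite (_ : 2 * pi * t = pi * (2 * t)) ?invfM ?mulrA ?mulfV ?mul1r//; ring.
rewrite -exprVn; set S := Num.sqrt _ in S0 e *; set ex := expR _.
rewrite e3 -e.
by field; rewrite S0 tn0.
Qed.

(** Since exp(1/4) <= 2, it is enough that the difference of exponents, times 8 t, is 2 (t - h^2) +
    (x + 2 h)^2, a sum of non-negative terms. *)
Lemma ge8_shift (t x h : R) : 0 < t -> h ^+ 2 <= t ->
  expR (- ((x + h) ^+ 2 / (4 * t))) <= 2 * ge8 t x.
Proof.
move=> t0 ht.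
have eh : expR (4^-1) <= 2 :> R.
  have := expR_ge1Dx (- 4^-1 : R); rewrite expRN => h1.
  have e0 := expR_gt0 (4^-1 : R).
  have : 2^-1 <= (expR (4^-1))^-1 :> R by apply: le_trans h1; lra.
  by rewrite lef_pV2 ?posrE.
apply: (@le_trans _ _ (expR (4^-1) * ge8 t x)); last by rewrite ler_wpM2r ?expR_ge0.
rewrite -expRD ler_expR -subr_ge0.
have -> : 4^-1 - x ^+ 2 / (8 * t) - - ((x + h) ^+ 2 / (4 * t)) =
  (2 * (t - h ^+ 2) + (x + 2 * h) ^+ 2) / (8 * t) by field; rewrite gt_eqF.
by rewrite mulr_ge0 ?invr_ge0 ?addr_ge0 ?sqr_ge0 ?mulr_ge0//; lra.
Qed.

Lemma y_exp_le (y : R) : y * expR (- (y ^+ 2 / 4)) <= 1.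
Proof.
have := expR_ge1Dx (y ^+ 2 / 4); rewrite expRN => h; have e0 := expR_gt0 (y ^+ 2 / 4).
rewrite ler_pdivrMr// mul1r; apply: le_trans h.
by have := sqr_ge0 (y / 2 - 1); rewrite expr2; lra.
Qed.

Lemma y_exp_abs_le (y : R) : `|y| * expR (- (y ^+ 2 / 4)) <= 1.
Proof. by rewrite -normr_id -[y ^+ 2]real_normK ?num_real// normr_id y_exp_le. Qed.

(** Mean value theorem. The factor exp(-y^2/2) is split evenly: one half absorbs the linear factor
    |y| of the derivative, the other the shift of the intermediate point. *)
Lemma gk_space (t x h : R) : 0 < t -> h ^+ 2 <= t ->
  `|gk t (x + h) - gk t x| <= 2 * `|h| / t * ge8 t x.
Proof.
move=> t0 ht; have s0 : 0 < Num.sqrt t by rewrite sqrtr_gt0.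
have st : Num.sqrt t ^+ 2 = t by rewrite sqr_sqrtr// ltW.
have bd k : k ^+ 2 <= t -> `|- (x + k) / t * gk t (x + k)| <= 2 / t * ge8 t x.
  move=> kt; rewrite 2!normrM normrN (ger0_norm (gk_ge0 _ _)).
  have ti0 : 0 <= t^-1 by rewrite invr_ge0 ltW.
  rewrite (ger0_norm ti0).
  set y := (x + k) / Num.sqrt t.
  have ya : `|x + k| = `|y| * Num.sqrt t.
    by rewrite /y normrM (ger0_norm (_ : 0 <= (Num.sqrt t)^-1)) ?invr_ge0 ?ltW// mulfVK// gt_eqF.
  have ye : (x + k) ^+ 2 / (2 * t) = y ^+ 2 / 4 + (x + k) ^+ 2 / (4 * t).
    by rewrite /y expr_div_n st; field; rewrite gt_eqF.
  apply: (@le_trans _ _ (`|y| * Num.sqrt t / t * ((Num.sqrt t)^-1 * expR (- ((x + k) ^+ 2 / (2 * t)))))).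
    by rewrite ya ler_wpM2l ?gk_le_exp// !mulr_ge0 ?invr_ge0 ?sqrtr_ge0// ltW.
  rewrite ye opprD expRD.
  have -> : `|y| * Num.sqrt t / t * ((Num.sqrt t)^-1 * (expR (- (y ^+ 2 / 4)) * expR (- ((x + k) ^+ 2 / (4 * t))))) =
    t^-1 * (`|y| * expR (- (y ^+ 2 / 4))) * expR (- ((x + k) ^+ 2 / (4 * t))).
    by field; rewrite !gt_eqF.
  apply: (@le_trans _ _ (t^-1 * 1 * (2 * ge8 t x))).
    apply: ler_pM; [|exact: expR_ge0| |exact: ge8_shift].
      by rewrite !mulr_ge0 ?invr_ge0 ?expR_ge0// ltW.
    by rewrite ler_wpM2l ?y_exp_abs_le// invr_ge0 ltW.
  by rewrite mulr1 le_eqVlt; apply/orP; left; apply/eqP; ring.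
have cont : continuous (gk t).
  move=> z; apply: differentiable_continuous; apply/derivable1_diffP.
  by have [] := is_derive_gk_x z t0.
have key a b : a <= b -> (forall z, a <= z <= b -> `|- z / t * gk t z| <= 2 / t * ge8 t x) ->
    `|gk t b - gk t a| <= 2 / t * ge8 t x * (b - a).
  move=> ab hb; have [c] := MVT_segment ab (fun z _ => is_derive_gk_x z t0) (continuous_subspaceT cont).
  rewrite in_itv/= => hc ->; rewrite normrM (ger0_norm (_ : 0 <= b - a)) ?subr_ge0//.
  by rewrite ler_wpM2r ?subr_ge0// hb.
have sq k : `|k| <= `|h| -> k ^+ 2 <= t.
  move=> kh; apply: le_trans ht; rewrite -(real_normK (num_real k)) -(real_normK (num_real h)).
  by rewrite ler_sqr ?nnegrE.
rewrite (_ : 2 * `|h| / t * ge8 t x = 2 / t * ge8 t x * `|h|); last by ring.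
have [h0|h0] := leP 0 h.
  rewrite (ger0_norm h0) -[X in _ * X](_ : x + h - x = h); last by ring.
  apply: key; first by rewrite lerDl.
  move=> z /andP[z1 z2]; rewrite (_ : z = x + (z - x)); last by ring.
  by apply: bd; apply: sq; rewrite !ger0_norm ?subr_ge0//; lra.
rewrite distrC (ltr0_norm h0) -[X in _ * X](_ : x - (x + h) = - h); last by ring.
apply: key; first by rewrite gerDl ltW.
move=> z /andP[z1 z2]; rewrite (_ : z = x + (z - x)); last by ring.
by apply: bd; apply: sq; rewrite ler_norml ltr0_norm//; apply/andP; split; lra.
Qed.

(** The same splitting: half of the exponent absorbs the quadratic factor of the time derivative and
    the other half becomes [ge8], because the intermediate time is at most 2 t. *)
Lemma gk_time (t x e : R) : 0 < t -> 0 <= e <= t ->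
  `|gk (t + e) x - gk t x| <= 2 * e / (t * Num.sqrt t) * ge8 t x.
Proof.
move=> t0 /andP[e0 et]; have s0 : 0 < Num.sqrt t by rewrite sqrtr_gt0.
have te : t <= t + e by rewrite lerDl.
have cont : {within `[t, t + e], continuous (gk ^~ x)}.
  apply: derivable_within_continuous => z; rewrite in_itv/= => /andP[z1 _].
  by have [] := is_derive_gk_t x (lt_le_trans t0 z1).
have dd z : z \in `]t, t + e[ -> is_derive z 1 (gk ^~ x) ((x ^+ 2 / (2 * z ^+ 2) - (2 * z)^-1) * gk z x).
  by rewrite in_itv/= => /andP[z1 _]; apply: is_derive_gk_t; exact: lt_trans z1.
have [c] := MVT_segment te dd cont; rewrite in_itv/= => /andP[c1 c2] ->.
have c0 : 0 < c by exact: lt_le_trans c1.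
have sc : 0 < Num.sqrt c by rewrite sqrtr_gt0.
rewrite (_ : t + e - t = e); last by ring.
rewrite normrM (ger0_norm e0).
rewrite (_ : 2 * e / (t * Num.sqrt t) * ge8 t x = 2 / (t * Num.sqrt t) * ge8 t x * e); last by ring.
apply: ler_wpM2r => //; rewrite normrM (ger0_norm (gk_ge0 _ _)).
set y := x ^+ 2 / (2 * c).
have y0 : 0 <= y by rewrite mulr_ge0 ?sqr_ge0// invr_ge0; lra.
have -> : x ^+ 2 / (2 * c ^+ 2) - (2 * c)^-1 = (y - 2^-1) / c by rewrite /y; field; rewrite gt_eqF.
have ci0 : 0 <= c^-1 by rewrite invr_ge0 ltW.
rewrite normrM (ger0_norm ci0).
apply: (@le_trans _ _ (`|y - 2^-1| / c * ((Num.sqrt c)^-1 * expR (- (x ^+ 2 / (2 * c)))))).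
  by rewrite ler_wpM2l ?gk_le_exp// mulr_ge0 ?invr_ge0// ltW.
have e1 : `|y - 2^-1| * expR (- (y / 2)) <= 2.
  have := expR_ge1Dx (y / 2); rewrite expRN => h; have e2 := expR_gt0 (y / 2).
  rewrite ler_pdivrMr//; apply: (@le_trans _ _ (2 * (1 + y / 2))); last by rewrite ler_pM2l.
  by rewrite ler_norml; apply/andP; split; lra.
have e2 : expR (- (y / 2)) <= ge8 t x.
  rewrite ler_expR lerN2 /y -mulrA ler_wpM2l ?sqr_ge0//.
  by rewrite -invfM lef_pV2 ?posrE; lra.
rewrite -/y (_ : - y = - (y / 2) + - (y / 2)); last by field.
rewrite expRD.
have -> : `|y - 2^-1| / c * ((Num.sqrt c)^-1 * (expR (- (y / 2)) * expR (- (y / 2)))) =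
  (`|y - 2^-1| * expR (- (y / 2))) * (c * Num.sqrt c)^-1 * expR (- (y / 2)).
  by field; rewrite !gt_eqF.
have k0 : 0 <= (c * Num.sqrt c)^-1 by rewrite invr_ge0 mulr_ge0// ltW.
apply: ler_pM; [by rewrite !mulr_ge0 ?expR_ge0|exact: expR_ge0| |exact: e2].
apply: ler_pM; [by rewrite mulr_ge0 ?expR_ge0|exact: k0|exact: e1|].
rewrite lef_pV2 ?posrE ?mulr_gt0//.
by apply: ler_pM; [exact: ltW|exact: ltW|exact: c1|exact: ler_wsqrtr].
Qed.

End gauss_kernel.

(** * The periodised kernel: pointwise bounds *)

Section circle_kernel.
Context {R : realType}.
Notation leb := (@lebesgue_measure R).
Notation ge8 := (@ge8 R).
Notation gk := (@gk R).

Definition intsum (A : int -> R) : \bar R := \esum_(k in [set: int]) (A k)%:E.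

Lemma intsumE (A : int -> R) : (forall k, 0 <= A k) ->
  intsum A = (\sum_(0 <= k <oo) (A (Posz k))%:E + \sum_(0 <= k <oo) (A (Negz k))%:E)%E.
Proof.
move=> A0; have Ae k : (0 <= (A k)%:E)%E by rewrite lee_fin.
rewrite /intsum (esumID (range Posz))// !setTI.
have -> : ~` range Posz = range Negz.
  apply/seteqP; split => [[k|k] h|_ [k _ <-]] /=; [by exfalso; apply: h; exists k|by exists k|by move=> []].
rewrite !esum_image; [|by move=> ? ? _ _ []|by move=> ? ? _ _ []].
by rewrite !nneseries_esumT.
Qed.

Lemma intsum_ge0 (A : int -> R) : (forall k, 0 <= A k) -> (0 <= intsum A)%E.
Proof. by move=> A0; apply: esum_ge0 => k _; rewrite lee_fin. Qed.

Lemma nneseries_bound (a : nat -> R) (M : R) : (forall k, 0 <= a k) ->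
  (forall n, \sum_(k < n) a k <= M) -> (\sum_(0 <= k <oo) (a k)%:E <= M%:E)%E.
Proof.
move=> a0 h; apply: lime_le; first by apply: is_cvg_nneseries => n _ _; rewrite lee_fin.
by apply: nearW => n; rewrite sumEFin lee_fin big_mkord.
Qed.

Lemma intsum_bound (A : int -> R) (M1 M2 : R) : (forall k, 0 <= A k) ->
  (forall n, \sum_(k < n) A (Posz k) <= M1) -> (forall n, \sum_(k < n) A (Negz k) <= M2) ->
  (intsum A <= (M1 + M2)%:E)%E.
Proof.
by move=> A0 h1 h2; rewrite intsumE// EFinD; apply: leeD; exact: nneseries_bound.
Qed.

(** Only quadratic decay is kept. It suffices to sum over the periodic images, and its factor [t]
    makes distant images negligible for short times. *)
Lemma ge8_far (t y m : R) : 0 < t -> 0 < m -> m <= `|y| -> ge8 t y <= 8 * t / m ^+ 2.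
Proof.
move=> t0 m0 my; have m20 : 0 < m ^+ 2 by rewrite exprn_gt0.
have my2 : m ^+ 2 <= y ^+ 2 by rewrite -(real_normK (num_real y)) ler_sqr ?nnegrE// ltW.
rewrite /ge8 expRN; set u := _ / _.
have u1 : m ^+ 2 / (8 * t) <= u by rewrite ler_wpM2r// invr_ge0; lra.
have u0 : 0 < m ^+ 2 / (8 * t) by rewrite divr_gt0//; lra.
have -> : 8 * t / m ^+ 2 = (m ^+ 2 / (8 * t))^-1 by rewrite invf_div.
rewrite lef_pV2 ?posrE ?expR_gt0//; have := expR_ge1Dx u; lra.
Qed.

(** For k >= 2 the image lies at distance at least k - 1, and the bounds 8 t / (k - 1)^2 are summed
    by telescoping. *)
Lemma ge8_tail (t z : R) : 0 < t -> `|z| <= 1 -> forall n,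
  \sum_(k < n) ge8 t (z + k%:R) <= ge8 t z + ge8 t (z + 1) + 16 * t.
Proof.
move=> t0 z1 n; have e0 y : 0 <= ge8 t y := ge8_ge0 _ _.
suff h m : \sum_(k < m.+2) ge8 t (z + k%:R) <= ge8 t z + ge8 t (z + 1) + 16 * t * (1 - (m.+1%:R)^-1).
  apply: (@le_trans _ _ (\sum_(k < n.+2) ge8 t (z + k%:R))).
    by rewrite [leRHS]big_ord_recr [X in _ <= X + _]big_ord_recr/= -addrA lerDl addr_ge0.
  apply: (le_trans (h n)); rewrite lerD2l; apply: ler_piMr; first by rewrite mulr_ge0// ltW.
  by rewrite lerBlDr lerDl invr_ge0.
elim: m => [|m IH].
  by rewrite !big_ord_recr big_ord0/= add0r addr0 invr1 subrr mulr0 addr0.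
rewrite big_ord_recr/=; apply: (le_trans (lerD IH (ge8_far t0 (m := m.+1%:R) _ _))); rewrite ?ltr0n//.
  rewrite -[X in _ <= X]normr_id; apply: le_trans (ler_norm _).
  have -> : m.+2%:R = m.+1%:R + 1 :> R by rewrite -natr1.
  by move: z1; rewrite ler_norml => /andP[h1 h2]; apply: le_trans (ler_norm _); lra.
rewrite -addrA lerD2l; set x : R := m.+1%:R.
have x0 : 1 <= x by rewrite /x ler1n.
have -> : m.+2%:R = x + 1 :> R by rewrite /x natr1.
rewrite -lerBrDl -mulrBr -[8 * t]/(8 * t).
have -> : 1 - (x + 1)^-1 - (1 - x^-1) = (x * (x + 1))^-1 by field; apply/andP; split; lra.
have xp : 0 < x by lra.
rewrite ler_pdivrMr ?exprn_gt0//.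
have -> : 16 * t / (x * (x + 1)) * x ^+ 2 = t * (16 * x / (x + 1)) by field; apply/andP; split; lra.
rewrite mulrC ler_pM2l// ler_pdivlMr; lra.
Qed.

(** Majorant of the periodised [ge8] for |z| <= 1: the three nearest images, then 16 t for each of
    the two tails. *)
Definition bk (t z : R) : R := ge8 t z + ge8 t (z + 1) + ge8 t (z - 1) + 32 * t.

Lemma bk_ge0 t z : 0 < t -> 0 <= bk t z.
Proof. by move=> t0; rewrite /bk !addr_ge0 ?ge8_ge0//; lra. Qed.

Lemma ge8N t z : ge8 t (- z) = ge8 t z. Proof. by rewrite /ge8 sqrrN. Qed.

Lemma intsum_le (A : int -> R) (c t z : R) : 0 <= c -> 0 < t -> `|z| <= 1 ->
  (forall k, 0 <= A k <= c * ge8 t (z + k%:~R)) -> (intsum A <= (c * bk t z)%:E)%E.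
Proof.
move=> c0 t0 z1 hA.
have -> : c * bk t z = c * (ge8 t z + ge8 t (z + 1) + 16 * t) + c * (ge8 t (z - 1) + 16 * t).
  by rewrite /bk; ring.
apply: intsum_bound => [k|n|n]; first by case/andP: (hA k).
  apply: (@le_trans _ _ (c * \sum_(k < n) ge8 t (z + k%:R))); last by rewrite ler_wpM2l// ge8_tail.
  by rewrite mulr_sumr; apply: ler_sum => k _; case/andP: (hA (Posz k)).
apply: (@le_trans _ _ (c * \sum_(k < n) ge8 t (- z + k.+1%:R))).
  rewrite mulr_sumr; apply: ler_sum => k _; case/andP: (hA (Negz k)) => _.
  by rewrite -(ge8N t (- z + _)) opprD opprK NegzE mulrNz.
rewrite ler_wpM2l//; have := ge8_tail t0 (_ : `|- z| <= 1) n.+1; rewrite normrN => /(_ z1).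
rewrite big_ord_recl/= addr0 -addrA lerD2l => h.
by rewrite -(ge8N t (z - 1)) (_ : - (z - 1) = - z + 1); [exact: h|ring].
Qed.

Lemma intsum_diff (A A' : int -> R) (c t z : R) : 0 <= c -> 0 < t -> `|z| <= 1 ->
  (forall k, 0 <= A k) -> (forall k, 0 <= A' k) ->
  (forall k, `|A k - A' k| <= c * ge8 t (z + k%:~R)) ->
  (intsum A < +oo)%E -> (intsum A' < +oo)%E ->
  `|fine (intsum A) - fine (intsum A')| <= c * bk t z.
Proof.
move=> c0 t0 z1 A0 A0' hd fA fA'.
have one (X Y : int -> R) : (forall k, 0 <= X k) -> (forall k, 0 <= Y k) ->
    (forall k, `|X k - Y k| <= c * ge8 t (z + k%:~R)) -> (intsum X < +oo)%E -> (intsum Y < +oo)%E ->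
    fine (intsum X) - fine (intsum Y) <= c * bk t z.
  move=> X0 Y0 h fX fY; rewrite lerBlDl -lee_fin EFinD.
  have fnX : intsum X \is a fin_num by rewrite ge0_fin_numE// intsum_ge0.
  have fnY : intsum Y \is a fin_num by rewrite ge0_fin_numE// intsum_ge0.
  rewrite !fineK//; apply: (@le_trans _ _ (intsum Y + intsum (fun k => `|X k - Y k|%R))%E).
    rewrite /intsum -esumD//.
    - by apply: le_esum => k _; rewrite -EFinD lee_fin -lerBlDl ler_norm.
    - by move=> k _; rewrite lee_fin.
  by apply: leeD => //; apply: intsum_le => // k; rewrite normr_ge0 h.
rewrite ler_norml; apply/andP; split; last exact: one.
by rewrite lerNl opprB; apply: one => // k; rewrite distrC.
Qed.

Lemma hkE (t x : R) : heat_kernel t x = fine (intsum (fun k => gk t (x + k%:~R))).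
Proof. by []. Qed.

Lemma hk_ge0 (t x : R) : 0 <= heat_kernel t x.
Proof. by rewrite hkE; apply: fine_ge0; apply: intsum_ge0 => k; exact: gk_ge0. Qed.

Lemma hk_intsum_le (t z : R) : 0 < t -> `|z| <= 1 ->
  (intsum (fun k => gk t (z + k%:~R)) <= ((Num.sqrt t)^-1 * bk t z)%:E)%E.
Proof.
move=> t0 z1; apply: intsum_le => //.
by move=> k; rewrite gk_ge0 gk_bound.
Qed.

Lemma hk_fin (t z : R) : 0 < t -> `|z| <= 1 -> (intsum (fun k => gk t (z + k%:~R)) < +oo)%E.
Proof. by move=> t0 z1; apply: le_lt_trans (hk_intsum_le t0 z1) _; rewrite ltry. Qed.

Lemma hk_bound (t z : R) : 0 < t -> `|z| <= 1 -> heat_kernel t z <= (Num.sqrt t)^-1 * bk t z.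
Proof.
move=> t0 z1; rewrite hkE -lee_fin fineK; first exact: hk_intsum_le.
by rewrite ge0_fin_numE ?hk_fin//; apply: intsum_ge0 => k; exact: gk_ge0.
Qed.

Lemma hk_space (t z h : R) : 0 < t -> `|z| <= 1 -> `|z + h| <= 1 -> h ^+ 2 <= t ->
  `|heat_kernel t (z + h) - heat_kernel t z| <= 2 * `|h| / t * bk t z.
Proof.
move=> t0 z1 z2 ht; rewrite !hkE; apply: intsum_diff => //.
- by rewrite !mulr_ge0// invr_ge0 ltW.
- by move=> k; exact: gk_ge0.
- by move=> k; exact: gk_ge0.
- by move=> k; rewrite addrAC; exact: gk_space.
- exact: hk_fin.
- exact: hk_fin.
Qed.

Lemma hk_time (t z e : R) : 0 < t -> `|z| <= 1 -> 0 <= e <= t ->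
  `|heat_kernel (t + e) z - heat_kernel t z| <= 2 * e / (t * Num.sqrt t) * bk t z.
Proof.
move=> t0 z1 /andP[e0 et]; rewrite !hkE; apply: intsum_diff => //.
- by rewrite !mulr_ge0// invr_ge0 mulr_ge0 ?sqrtr_ge0// ltW.
- by move=> k; exact: gk_ge0.
- by move=> k; exact: gk_ge0.
- by move=> k; apply: gk_time; rewrite ?e0.
- by apply: hk_fin => //; lra.
- exact: hk_fin.
Qed.

Lemma measurable_sqrt : measurable_fun setT (@Num.sqrt R).
Proof. by apply: measurable_continuous; exact: sqrt_continuous. Qed.

Lemma measurable_gk d (T : measurableType d) (f g : T -> R) :
  measurable_fun setT f -> measurable_fun setT g -> measurable_fun setT (fun z => gk (f z) (g z)).
Proof.
(* Inverses are written as powers with exponent -1, and the maximum keeps the base non-negative; at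
   non-positive times both expressions are 0. *)
move=> mf mg; rewrite (_ : (fun z => _) = (fun z =>
   expR (- (g z) ^+ 2 * (Num.max (2 * f z) 0) `^ (-1)) * (Num.sqrt (2 * pi * f z)) `^ (-1))).
  apply: measurable_funM.
    apply: measurableT_comp => //; apply: measurable_funM.
      by apply: measurableT_comp => //; exact: measurable_funX.
    apply: (measurableT_comp (f := fun y : R => y `^ (-1))); first exact: measurable_powR.
    by apply: measurable_maxr => //; exact: measurable_funM.
  apply: (measurableT_comp (f := fun y : R => y `^ (-1))); first exact: measurable_powR.
  by apply: (measurableT_comp measurable_sqrt); exact: measurable_funM.
apply/funext => z; rewrite (powR_inv1 (sqrtr_ge0 _)).
have m0 : 0 <= Num.max (2 * f z) 0 by rewrite le_max lexx orbT.
rewrite (powR_inv1 m0).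
have [f0|f0] := leP (f z) 0; first by rewrite gk_nonpos// ler0_sqrtr ?invr0 ?mulr0// -mulrA pmulr_rle0// pmulr_rle0// pi_gt0.
by rewrite (max_l _)//; lra.
Qed.

Lemma measurable_hk d (T : measurableType d) (f g : T -> R) :
  measurable_fun setT f -> measurable_fun setT g ->
  measurable_fun setT (fun z => heat_kernel (f z) (g z)).
Proof.
move=> mf mg; apply: (measurableT_comp (f := fine)); first exact: fine_measurable.
have -> : (fun z => \esum_(k in [set: int]) (expR (- (g z + k%:~R) ^+ 2 / (2 * f z)) / Num.sqrt (2 * pi * f z))%:E)%E =
  (fun z => \sum_(0 <= k <oo) (gk (f z) (g z + (Posz k)%:~R))%:E + \sum_(0 <= k <oo) (gk (f z) (g z + (Negz k)%:~R))%:E)%E.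
  by apply/funext => z; rewrite -(intsumE (A := fun k => gk (f z) (g z + k%:~R)))// => k; exact: gk_ge0.
by apply: emeasurable_funD; apply: ge0_emeasurable_sum;
  [move=> k z _ _; rewrite lee_fin gk_ge0|move=> k _; apply/measurable_EFinP; apply: measurable_gk => //; exact: measurable_funD
  |move=> k z _ _; rewrite lee_fin gk_ge0|move=> k _; apply/measurable_EFinP; apply: measurable_gk => //; exact: measurable_funD].
Qed.

End circle_kernel.

(** * Spatial L^2 norms of the kernel and of its increments *)

Section kernel_l2.
Context {R : realType}.
Notation leb := (@lebesgue_measure R).
Notation mu2 := (leb \x leb)%E.

Lemma sqr_sum4 (p q r w : R) :
  (p + q + r + w) ^+ 2 <= 4 * (p ^+ 2 + q ^+ 2 + r ^+ 2 + w ^+ 2).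
Proof.
rewrite -subr_ge0 (_ : _ - _ = (p - q) ^+ 2 + (p - r) ^+ 2 + (p - w) ^+ 2 +
  (q - r) ^+ 2 + (q - w) ^+ 2 + (r - w) ^+ 2); last by ring.
by rewrite !addr_ge0// sqr_ge0.
Qed.

(** The square of [ge8 t] is a multiple of a normal density of variance 2 t, so its integral is
    known exactly. *)
Lemma ge8_sqr_pdf (t x y : R) : 0 < t ->
  ge8 t (x - y) ^+ 2 = Num.sqrt (4 * pi * t) * normal_pdf x (Num.sqrt (2 * t)) y.
Proof.
move=> t0; have s0 : Num.sqrt (2 * t) != 0 by rewrite gt_eqF// sqrtr_gt0; lra.
have t20 : 0 <= 2 * t by lra.
have p0 := pi_gt0 R.
rewrite normal_pdfE// /normal_peak /normal_fun sqr_sqrtr// /ge8 -expRM_natl mulr_natl.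
have -> : 2 * t * pi *+ 2 = 4 * pi * t by rewrite -mulr_natr; ring.
rewrite mulrA mulfV ?mul1r; last by rewrite gt_eqF// sqrtr_gt0 !mulr_gt0.
by congr expR; rewrite -mulr_natr; field; rewrite gt_eqF.
Qed.

Lemma int_ge8 (t x : R) : 0 < t ->
  (\int[leb]_y (ge8 t (x - y) ^+ 2)%:E <= (4 * Num.sqrt t)%:E)%E.
Proof.
move=> t0; under eq_integral do rewrite (ge8_sqr_pdf _ _ t0) EFinM.
rewrite ge0_integralZl; last 4 first.
- exact: measurableT.
- by apply/measurable_EFinP; exact: measurable_normal_pdf.
- by move=> y _; rewrite lee_fin normal_pdf_ge0.
- by rewrite lee_fin sqrtr_ge0.
rewrite integral_normal_pdf mule1 lee_fin.
have -> : 4 * Num.sqrt t = Num.sqrt (16 * t) by rewrite sqrtrM// (_ : 16 = 4 ^+ 2) ?sqrtr_sqr ?ger0_norm//; lra.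
by apply: ler_wsqrtr; rewrite ler_pM2r//; have /andP[_ h] := @pihalf_02 R; lra.
Qed.

(** Three images contribute 4 sqrt t each and the constant term at most 32^2 sqrt t; the outer 4
    comes from squaring a sum of four terms. *)
Definition Kb : R := 4 * (12 + 32 ^+ 2).
Lemma Kb_gt0 : 0 < Kb. Proof. by rewrite /Kb mulr_gt0// addr_gt0// exprn_gt0. Qed.

Let I01 : set R := `[0, 1]%classic.

Lemma measurable_ge8 (t : R) : measurable_fun setT (fun y => ge8 t y).
Proof.
apply: (measurableT_comp (f := expR)) => //.
rewrite (_ : (fun y => _) = (fun y : R => (- (8 * t)^-1) * y ^+ 2)); last by apply/funext => y; ring.
by apply: measurable_funM => //; exact: measurable_funX.
Qed.

Lemma measurable_bk (t : R) : measurable_fun setT (fun y => bk t y).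
Proof.
have h c : measurable_fun setT (fun y : R => ge8 t (y + c)).
  by apply: (measurableT_comp (measurable_ge8 t)); exact: measurable_funD.
by do 3 (apply: measurable_funD => //); exact: measurable_ge8.
Qed.

Lemma int_bk2 (t x : R) : 0 < t -> t <= 1 ->
  (\int[leb]_(y in I01) (bk t (x - y) ^+ 2)%:E <= (Kb * Num.sqrt t)%:E)%E.
Proof.
move=> t0 t1; have mI : measurable I01 by exact: measurable_itv.
pose a c y := ge8 t (x + c - y) ^+ 2.
have ma c : measurable_fun setT (fun y => (a c y)%:E).
  apply/measurable_EFinP; apply: measurable_funX; apply: (measurableT_comp (measurable_ge8 t)).
  exact: measurable_funB.
have a0 c y : (0 <= (a c y)%:E)%E by rewrite lee_fin sqr_ge0.
have ia c : (\int[leb]_(y in I01) (a c y)%:E <= (4 * Num.sqrt t)%:E)%E.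
  apply: le_trans (int_ge8 (x + c) t0).
  apply: ge0_subset_integral.
  - exact: mI.
  - exact: measurableT.
  - exact: ma.
  - by move=> y _; exact: a0.
  - by [].
have ic : (\int[leb]_(y in I01) ((32 * t) ^+ 2)%:E <= (32 ^+ 2 * Num.sqrt t)%:E)%E.
  rewrite integral_cst//= lebesgue_measure_itv/= lte_fin ltr01 oppr0 adde0 mule1 lee_fin exprMn.
  rewrite ler_wpM2l ?sqr_ge0//; have s1 : Num.sqrt t <= 1 by rewrite -[leRHS]sqrtr1 ler_wsqrtr.
  have s0 := sqrtr_ge0 t; have e : t = Num.sqrt t * Num.sqrt t by rewrite -expr2 sqr_sqrtr// ltW.
  apply: (@le_trans _ _ t); first by rewrite expr2 ler_piMl// ltW.
  by rewrite {1}e ler_piMl.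
have mfa c : measurable_fun I01 (fun y => (a c y)%:E) by exact: measurable_funTS.
apply: (@le_trans _ _ (4%:E * (\int[leb]_(y in I01) (a 0 y)%:E + \int[leb]_(y in I01) (a 1 y)%:E
   + \int[leb]_(y in I01) (a (-1) y)%:E + \int[leb]_(y in I01) ((32 * t) ^+ 2)%:E))%E).
  have D2 (f g : R -> R) : measurable_fun I01 (fun y => (f y)%:E) -> measurable_fun I01 (fun y => (g y)%:E) ->
      (forall y, 0 <= f y) -> (forall y, 0 <= g y) ->
      (\int[leb]_(y in I01) (f y)%:E + \int[leb]_(y in I01) (g y)%:E = \int[leb]_(y in I01) (f y + g y)%:E)%E.
    by move=> mf mg f0 g0; rewrite -ge0_integralD// => y _; rewrite lee_fin.
  have mD2 (f g : R -> R) : measurable_fun I01 (fun y => (f y)%:E) -> measurable_fun I01 (fun y => (g y)%:E) ->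
      measurable_fun I01 (fun y => (f y + g y)%:E).
    by move=> mf mg; under eq_fun do rewrite EFinD; exact: emeasurable_funD.
  have mc : measurable_fun I01 (fun y : R => ((32 * t) ^+ 2)%:E) by exact: measurable_cst.
  have m2 := mD2 _ _ (mfa 0) (mfa 1); have m3 := mD2 _ _ m2 (mfa (-1)); have m4 := mD2 _ _ m3 mc.
  have n0 c y : 0 <= a c y by exact: sqr_ge0.
  rewrite (D2 _ _ (mfa 0) (mfa 1))// (D2 _ _ m2 (mfa (-1)))//; last by move=> y; rewrite addr_ge0.
  rewrite (D2 _ _ m3 mc)//; [|by move=> y; rewrite !addr_ge0|by move=> y; exact: sqr_ge0].
  have p0 (y : R) : I01 y -> (0 <= (a 0 y + a 1 y + a (-1) y + (32 * t) ^+ 2)%:E)%E.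
    by move=> _; rewrite lee_fin !addr_ge0// sqr_ge0.
  rewrite -(ge0_integralZl leb mI m4 p0) //.
  apply: ge0_le_integral.
  - exact: mI.
  - by move=> y _; rewrite lee_fin sqr_ge0.
  - apply: measurable_funTS; apply/measurable_EFinP; apply: measurable_funX.
    by apply: (measurableT_comp (measurable_bk t)); exact: measurable_funB.
  - by apply: measurable_funeM.
  - move=> y _; rewrite -EFinM lee_fin /a /bk addr0.
    have e1 : x + 1 - y = x - y + 1 by ring.
    have e2 : x + -1 - y = x - y - 1 by ring.
    by rewrite e1 e2; exact: sqr_sum4.
have -> : Kb * Num.sqrt t = 4 * (4 * Num.sqrt t + 4 * Num.sqrt t + 4 * Num.sqrt t + 32 ^+ 2 * Num.sqrt t).
  by rewrite /Kb; ring.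
rewrite (EFinM 4); apply: lee_wpmul2l => //.
rewrite (EFinD (_ + _ + _)) (EFinD (_ + _)) (EFinD (4 * _)); by do 3 (apply: leeD => //).
Qed.

Lemma slice_bound (c : R) (t x : R) (f : R -> R) : 0 <= c -> 0 < t -> t <= 1 ->
  measurable_fun setT f -> (forall y, 0 <= y <= 1 -> `|f y| <= c * bk t (x - y)) ->
  (\int[leb]_(y in I01) (f y ^+ 2)%:E <= (c ^+ 2 * Kb * Num.sqrt t)%:E)%E.
Proof.
move=> c0 t0 t1 mf hf; have mI : measurable I01 by exact: measurable_itv.
apply: (@le_trans _ _ ((c ^+ 2)%:E * \int[leb]_(y in I01) (bk t (x - y) ^+ 2)%:E)%E).
  have mb : measurable_fun I01 (fun y => (bk t (x - y) ^+ 2)%:E).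
    apply: measurable_funTS; apply/measurable_EFinP; apply: measurable_funX.
    by apply: (measurableT_comp (measurable_bk t)); exact: measurable_funB.
  have b0 (y : R) : I01 y -> (0 <= (bk t (x - y) ^+ 2)%:E)%E by move=> _; rewrite lee_fin sqr_ge0.
  have c20 : (0 <= (c ^+ 2)%:E)%E by rewrite lee_fin sqr_ge0.
  rewrite -(ge0_integralZl leb mI mb b0 c20).
  apply: ge0_le_integral => //.
  - by move=> y _; rewrite lee_fin sqr_ge0.
  - by apply: measurable_funTS; apply/measurable_EFinP; exact: measurable_funX.
  - exact: measurable_funeM.
  - move=> y; rewrite /I01 /= in_itv/= => /hf h; rewrite -EFinM lee_fin -exprMn.
    rewrite -(real_normK (num_real (f y))) ler_sqr ?nnegrE//.
    by rewrite mulr_ge0// bk_ge0.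
rewrite -(mulrA (c ^+ 2)) (EFinM (c ^+ 2)); apply: lee_wpmul2l; first by rewrite lee_fin sqr_ge0.
exact: int_bk2.
Qed.

Lemma hk_measurable_y (t x : R) : measurable_fun setT (fun y : R => heat_kernel t (x - y)).
Proof. by apply: measurable_hk => //; exact: measurable_funB. Qed.

Lemma circle_dist (x y : R) : 0 <= x <= 1 -> 0 <= y <= 1 -> `|x - y| <= 1.
Proof. by move=> /andP[? ?] /andP[? ?]; rewrite ler_norml; apply/andP; split; lra. Qed.

Lemma hk_sq (t x : R) : 0 < t -> t <= 1 -> 0 <= x <= 1 ->
  (\int[leb]_(y in I01) (heat_kernel t (x - y) ^+ 2)%:E <= (Kb / Num.sqrt t)%:E)%E.
Proof.
move=> t0 t1 x01; have s0 : 0 < Num.sqrt t by rewrite sqrtr_gt0.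
have si : 0 <= (Num.sqrt t)^-1 by rewrite invr_ge0 ltW.
have := slice_bound (x := x) si t0 t1 (hk_measurable_y t x).
have -> : (Num.sqrt t)^-1 ^+ 2 * Kb * Num.sqrt t = Kb / Num.sqrt t by field; rewrite gt_eqF.
apply=> y y01; rewrite ger0_norm ?hk_ge0//; apply: hk_bound => //; exact: circle_dist.
Qed.

Lemma sq_diff_le (f g : R -> R) (M : R) : measurable_fun setT f -> measurable_fun setT g ->
  (\int[leb]_(y in I01) (f y ^+ 2)%:E <= M%:E)%E -> (\int[leb]_(y in I01) (g y ^+ 2)%:E <= M%:E)%E ->
  (\int[leb]_(y in I01) ((f y - g y) ^+ 2)%:E <= (4 * M)%:E)%E.
Proof.
move=> mf mg hf hg; have mI : measurable I01 by exact: measurable_itv.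
have m2 (h : R -> R) : measurable_fun setT h -> measurable_fun I01 (fun y => (2%:E * (h y ^+ 2)%:E)%E).
  move=> mh; apply: measurable_funeM; apply: measurable_funTS; apply/measurable_EFinP.
  exact: measurable_funX.
have p2 (h : R -> R) y : I01 y -> (0 <= 2%:E * (h y ^+ 2)%:E)%E by move=> _; rewrite mule_ge0// lee_fin sqr_ge0.
have mm (h : R -> R) : measurable_fun setT h -> measurable_fun I01 (fun y => (h y ^+ 2)%:E).
  by move=> mh; apply: measurable_funTS; apply/measurable_EFinP; exact: measurable_funX.
have pp (h : R -> R) y : I01 y -> (0 <= (h y ^+ 2)%:E)%E by move=> _; rewrite lee_fin sqr_ge0.
apply: (@le_trans _ _ (\int[leb]_(y in I01) (2%:E * (f y ^+ 2)%:E + 2%:E * (g y ^+ 2)%:E))%E).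
  apply: ge0_le_integral => //.
  - by move=> y _; rewrite lee_fin sqr_ge0.
  - by apply: mm; exact: measurable_funB.
  - by apply: emeasurable_funD; exact: m2.
  - move=> y _; rewrite -!EFinM -EFinD lee_fin; have := sqr_ge0 (f y + g y); rewrite sqrrD sqrrB; lra.
rewrite ge0_integralD//; [|exact: p2|exact: m2|exact: p2|exact: m2].
rewrite (ge0_integralZl leb mI (mm f mf) (pp f))// (ge0_integralZl leb mI (mm g mg) (pp g))//.
have -> : 4 * M = 2 * M + 2 * M by ring.
by rewrite (EFinD (2 * M)) (EFinM 2); apply: leeD; apply: lee_wpmul2l.
Qed.

Lemma half_frac (h t : R) : 0 < t -> t <= h -> 1 <= 2 * (h / (h + t)).
Proof. by move=> t0 th; rewrite mulrA ler_pdivlMr; lra. Qed.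

(** The fraction h^2/(h^2 + t) joins two regimes. For h^2 <= t the mean value bound is used; beyond
    that the two norms are simply added, and the fraction is at least 1/2. One formula can then be
    integrated over all time lags. *)
Lemma hk_sq_space (t x x' : R) : 0 < t -> t <= 1 -> 0 <= x <= 1 -> 0 <= x' <= 1 ->
  (\int[leb]_(y in I01) ((heat_kernel t (x' - y) - heat_kernel t (x - y)) ^+ 2)%:E
    <= (8 * Kb / Num.sqrt t * ((x' - x) ^+ 2 / ((x' - x) ^+ 2 + t)))%:E)%E.
Proof.
move=> t0 t1 x01 x01'; have s0 : 0 < Num.sqrt t by rewrite sqrtr_gt0.
have K0 := Kb_gt0; set h := x' - x; have [ht|ht] := leP (h ^+ 2) t; last first.
  apply: (le_trans (sq_diff_le (hk_measurable_y _ _) (hk_measurable_y _ _) (hk_sq t0 t1 x01') (hk_sq t0 t1 x01))).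
  rewrite lee_fin; have := half_frac t0 (ltW ht) => h1.
  have k0 : 0 <= 4 * Kb / Num.sqrt t by rewrite !mulr_ge0// ?invr_ge0 ltW.
  by have := ler_wpM2l k0 h1; lra.
have c0 : 0 <= 2 * `|h| / t by rewrite !mulr_ge0// invr_ge0 ltW.
have := slice_bound (x := x) c0 t0 t1 (measurable_funB (hk_measurable_y t x') (hk_measurable_y t x)).
move=> H; apply: (le_trans (H _)) => /=.
  move=> y y01; rewrite (_ : x' - y = x - y + h); last by rewrite /h; ring.
  apply: hk_space => //; first exact: circle_dist.
  by rewrite (_ : x - y + h = x' - y); [exact: circle_dist|rewrite /h; ring].
rewrite lee_fin; have e : t = Num.sqrt t * Num.sqrt t by rewrite -expr2 sqr_sqrtr// ltW.
have h20 : 0 <= h ^+ 2 by exact: sqr_ge0.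
have -> : (2 * `|h| / t) ^+ 2 * Kb * Num.sqrt t = 4 * Kb / Num.sqrt t * (h ^+ 2 / t).
  rewrite !exprMn real_normK ?num_real// exprVn.
  rewrite (_ : t ^+ 2 = t * (Num.sqrt t * Num.sqrt t)); last by rewrite -e expr2.
  by field; rewrite !gt_eqF.
have -> : 8 * Kb / Num.sqrt t * (h ^+ 2 / (h ^+ 2 + t)) = 4 * Kb / Num.sqrt t * (h ^+ 2 * (2 / (h ^+ 2 + t))).
  by field; rewrite !gt_eqF//; lra.
apply: ler_wpM2l; first by rewrite !mulr_ge0// ?invr_ge0 ltW.
apply: ler_wpM2l => //; rewrite ler_pdivlMr; last by lra.
by rewrite mulrC ler_pdivrMr//; lra.
Qed.

Lemma hk_sq_time (t x e : R) : 0 < t -> 0 <= e -> t + e <= 1 -> 0 <= x <= 1 ->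
  (\int[leb]_(y in I01) ((heat_kernel (t + e) (x - y) - heat_kernel t (x - y)) ^+ 2)%:E
    <= (8 * Kb / Num.sqrt t * (e / (e + t)))%:E)%E.
Proof.
move=> t0 e0 te1 x01; have s0 : 0 < Num.sqrt t by rewrite sqrtr_gt0.
have t1 : t <= 1 by lra.
have K0 := Kb_gt0; have [et|et] := leP e t; last first.
  have te0 : 0 < t + e by lra.
  have hte : (\int[leb]_(y in I01) (heat_kernel (t + e) (x - y) ^+ 2)%:E <= (Kb / Num.sqrt t)%:E)%E.
    apply: (le_trans (hk_sq te0 te1 x01)); rewrite lee_fin ler_pM2l//.
    by rewrite lef_pV2 ?posrE ?sqrtr_gt0//; apply: ler_wsqrtr; lra.
  apply: (le_trans (sq_diff_le (hk_measurable_y _ _) (hk_measurable_y _ _) hte (hk_sq t0 t1 x01))).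
  rewrite lee_fin; have := half_frac t0 (ltW et) => h1.
  have k0 : 0 <= 4 * Kb / Num.sqrt t by rewrite !mulr_ge0// ?invr_ge0 ltW.
  by have := ler_wpM2l k0 h1; lra.
have c0 : 0 <= 2 * e / (t * Num.sqrt t) by rewrite !mulr_ge0// invr_ge0 mulr_ge0// ltW.
have := slice_bound (x := x) c0 t0 t1 (measurable_funB (hk_measurable_y (t + e) x) (hk_measurable_y t x)).
move=> H; apply: (le_trans (H _)) => /=.
  by move=> y y01; apply: hk_time => //; [exact: circle_dist|rewrite e0].
rewrite lee_fin; have q : t = Num.sqrt t * Num.sqrt t by rewrite -expr2 sqr_sqrtr// ltW.
have -> : (2 * e / (t * Num.sqrt t)) ^+ 2 * Kb * Num.sqrt t = 4 * Kb / Num.sqrt t * (e * (e / (t * t))).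
  rewrite expr2 (_ : 2 * e / (t * Num.sqrt t) * (2 * e / (t * Num.sqrt t)) = 4 * e * e / (t * t * (Num.sqrt t * Num.sqrt t))); last first.
    by field; rewrite !gt_eqF.
  by field; rewrite !gt_eqF.
have -> : 8 * Kb / Num.sqrt t * (e / (e + t)) = 4 * Kb / Num.sqrt t * (e * (2 / (e + t))).
  by field; rewrite !gt_eqF//; lra.
apply: ler_wpM2l; first by rewrite !mulr_ge0// ?invr_ge0 ltW.
apply: ler_wpM2l => //; rewrite ler_pdivlMr; last by lra.
by rewrite mulrAC ler_pdivrMr; [nra|exact: mulr_gt0].
Qed.

End kernel_l2.

(** * Integration over time *)

Section kernel_energy.
Context {R : realType}.
Notation leb := (@lebesgue_measure R).
Notation mu2 := (leb \x leb)%E.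

(** A primitive is -2 sqrt(eta) atan(sqrt((t - s)/eta)); differences of arctangents are at most 4,
    which gives the 8. *)
Lemma atan_rate (t eta b : R) : 0 < eta -> 0 < b -> b < t ->
  (\int[leb]_(s in `[0%R, b]) ((Num.sqrt (t - s))^-1 * (eta / (eta + (t - s))))%:E
    <= (8 * Num.sqrt eta)%:E)%E.
Proof.
move=> e0 b0 bt; have se0 : 0 < Num.sqrt eta by rewrite sqrtr_gt0.
pose f s : R := (Num.sqrt (t - s))^-1 * (eta / (eta + (t - s))).
pose F s : R := (- (2 * Num.sqrt eta)) * atan ((Num.sqrt eta)^-1 * Num.sqrt (t - s)).
have dF s : s < t -> is_derive s 1 F (f s).
  move=> st; have ts0 : 0 < t - s by rewrite subr_gt0.
  have ss0 : 0 < Num.sqrt (t - s) by rewrite sqrtr_gt0.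
  have h1 : is_derive s 1 (fun y : R => t - y) (-1).
    have := @is_deriveB _ _ _ (cst t) id s 1 _ _ (is_derive_cst t s 1) (is_derive_id s 1).
    by rewrite sub0r.
  have h2 := @is_derive1_comp _ Num.sqrt (fun y : R => t - y) s _ _ (is_derive1_sqrt ts0) h1.
  have h3 : is_derive s 1 ((Num.sqrt eta)^-1 \*: (@Num.sqrt R \o (fun y : R => t - y)))
     ((Num.sqrt eta)^-1 *: ((2 * Num.sqrt (t - s))^-1 * -1)) by exact: is_deriveZ.
  have h4 := @is_derive1_comp _ atan _ s _ _ (is_derive1_atan _) h3.
  have h5 : is_derive s 1 ((- (2 * Num.sqrt eta)) \*: (atan \o ((Num.sqrt eta)^-1 \*: (@Num.sqrt R \o (fun y : R => t - y))))) _
    := is_deriveZ _ h4.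
  have e1 : eta = Num.sqrt eta * Num.sqrt eta by rewrite -expr2 sqr_sqrtr// ltW.
  have e2 : t - s = Num.sqrt (t - s) * Num.sqrt (t - s) by rewrite -expr2 sqr_sqrtr// ltW.
  apply: (@is_derive_eq _ _ _ _ _ _ _ _ h5); rewrite /GRing.scale/= /f.
  move: ss0 e2 se0 e1; set S := Num.sqrt (t - s); set E := Num.sqrt eta.
  move=> ss0 e2 se0 e1; rewrite e2 e1 -[E^-1 *: S]/(E^-1 * S).
  clearbody S E.
  by field; rewrite ?gt_eqF ?addr_gt0 ?mulr_gt0 ?exprn_gt0.
have cF s : s < t -> {for s, continuous F}.
  by move=> st; apply: differentiable_continuous; apply/derivable1_diffP; have [] := dF s st.
have csq : continuous (fun s => Num.sqrt (t - s)).
  move=> s; apply: continuous_comp; last exact: sqrt_continuous.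
  by apply: cvgB; [exact: cvg_cst|exact: cvg_id].
have cf s : s < t -> {for s, continuous f}.
  move=> st; have ts0 : 0 < t - s by rewrite subr_gt0.
  have ss0 : 0 < Num.sqrt (t - s) by rewrite sqrtr_gt0.
  apply: cvgM; first by apply: cvgV; [rewrite gt_eqF|exact: csq].
  apply: cvgM; first exact: cvg_cst.
  apply: cvgV; first by rewrite gt_eqF// addr_gt0.
  by apply: cvgD; [exact: cvg_cst|apply: cvgB; [exact: cvg_cst|exact: cvg_id]].
rewrite (@continuous_FTC2 _ f F)//.
- rewrite -EFinB lee_fin /F mulNr mulNr opprK addrC -mulrBr.
  have h1 := @atan_ltpi2 R ((Num.sqrt eta)^-1 * Num.sqrt (t - 0)).
  have h2 := @atan_gtNpi2 R ((Num.sqrt eta)^-1 * Num.sqrt (t - b)).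
  have /andP[_ h3] := @pihalf_02 R.
  have h4 : atan ((Num.sqrt eta)^-1 * Num.sqrt (t - 0)) - atan ((Num.sqrt eta)^-1 * Num.sqrt (t - b)) <= 4 by lra.
  have := ler_wpM2l (ltW se0) h4; lra.
- by apply: continuous_in_subspaceT => s; rewrite inE/= in_itv/= => /andP[_ sb]; apply: cf; exact: le_lt_trans sb bt.
- split.
  + by move=> s; rewrite in_itv/= => /andP[_ sb]; have [] := dF s (lt_trans sb bt).
  + by apply: cvg_at_right_filter; apply: cF; exact: lt_trans bt.
  + by apply: cvg_at_left_filter; exact: cF.
- by move=> s; rewrite in_itv/= => /andP[_ sb]; rewrite derive1E; have [] := dF s (lt_trans sb bt).
Qed.

(* Bound for the spatial L^2 norm of a kernel increment at time lag [t - s];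
   [eta] is the parabolic size of the increment. *)
Definition rate (t eta s : R) : R := (Num.sqrt (t - s))^-1 * (eta / (eta + (t - s))).

Lemma rate_ge0 t eta s : 0 <= eta -> s <= t -> 0 <= rate t eta s.
Proof.
by move=> e0 st; rewrite mulr_ge0 ?invr_ge0 ?sqrtr_ge0// mulr_ge0// invr_ge0; lra.
Qed.

Lemma rate_min_ge0 t eta s : 0 < eta -> 0 <= rate t eta (Num.min s t).
Proof. by move=> e0; apply: rate_ge0; [exact: ltW|rewrite ge_min lexx orbT]. Qed.

(** Beyond [t] the argument is frozen at [t], where the rate is 0 because the inverse of 0 is 0.
    This gives a non-negative function on the whole line. *)
Lemma measurable_rate t eta : 0 < eta -> measurable_fun setT
  (fun s : R => (rate t eta (Num.min s t))).
Proof.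
move=> e0; rewrite (_ : (fun s => _) = (fun s : R => (Num.sqrt (t - Num.min s t)) `^ (-1) *
    (eta * (eta + (t - Num.min s t)) `^ (-1)))); last first.
  apply/funext => s; have h : 0 <= eta + (t - Num.min s t).
    by apply: addr_ge0; [exact: ltW|rewrite subr_ge0 ge_min lexx orbT].
  by rewrite /rate (powR_inv1 (sqrtr_ge0 _)) (powR_inv1 h).
have mm : measurable_fun setT (fun s : R => t - Num.min s t).
  by apply: measurable_funB => //; exact: measurable_minr.
apply: measurable_funM.
  apply: (measurableT_comp (f := fun y : R => y `^ (-1))); first exact: measurable_powR.
  exact: (measurableT_comp measurable_sqrt mm).
apply: measurable_funM => //.
apply: (measurableT_comp (f := fun y : R => y `^ (-1))); first exact: measurable_powR.
exact: measurable_funD.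
Qed.

(** The integrand is singular at [t], so the primitive is used on closed intervals stopping short of
    [t], which exhaust []0, t[] by monotone convergence. *)
Lemma int_rate (t eta : R) : 0 < eta -> 0 < t ->
  (\int[leb]_(s in `]0%R, t[) (rate t eta (Num.min s t))%:E <= (8 * Num.sqrt eta)%:E)%E.
Proof.
move=> e0 t0; pose B n : set R := `[0, t - t / n.+2%:R]%classic.
have B0 n : 0 < t - t / n.+2%:R.
  rewrite subr_gt0 ltr_pdivrMr ?ltr0n// ltr_pMr// ltr1n//.
have Bt n : t - t / n.+2%:R < t by rewrite ltrBlDr ltrDl divr_gt0.
have mr (D : set R) : measurable_fun D (fun s => (rate t eta (Num.min s t))%:E).
  by apply: measurable_funTS; apply/measurable_EFinP; exact: measurable_rate.
have r0 s : (0 <= (rate t eta (Num.min s t))%:E)%E.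
  by rewrite lee_fin; exact: rate_min_ge0.
have U : `]0, t[%classic `<=` \bigcup_n B n.
  move=> s /=; rewrite in_itv/= => /andP[s0 st].
  have ts : 0 < t - s by rewrite subr_gt0.
  exists (Num.bound (t / (t - s))) => //; rewrite /B /= in_itv/= (ltW s0)/=.
  rewrite lerBrDr -lerBrDl ler_pdivrMr ?ltr0n//.
  have : t / (t - s) < (Num.bound (t / (t - s)))%:R by apply: archi_boundP; rewrite divr_ge0// ltW.
  rewrite ltr_pdivrMr// => h; apply: ltW; apply: (lt_trans h).
  by rewrite mulrC ltr_pM2l// ltr_nat ltnW.
apply: (@le_trans _ _ (\int[leb]_(s in \bigcup_n B n) (rate t eta (Num.min s t))%:E)%E).
  apply: ge0_subset_integral.
  - exact: measurable_itv.
  - by apply: bigcupT_measurable => n; exact: measurable_itv.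
  - exact: mr.
  - by move=> s _; exact: r0.
  - exact: U.
have nd : {homo B : n m / (n <= m)%N >-> (n <= m)%O}.
  move=> n m nm; rewrite subsetEset => s; rewrite /B /= !in_itv/= => /andP[-> h] /=.
  apply: (le_trans h); rewrite lerD2l lerN2 ler_pM2l// lef_pV2 ?posrE ?ltr0n// ler_nat ltnS ltnS//.
have cv : (\int[leb]_(s in B n) (rate t eta (Num.min s t))%:E)%E @[n --> \oo] -->
    (\int[leb]_(s in \bigcup_n B n) (rate t eta (Num.min s t))%:E)%E.
  apply: ge0_nondecreasing_set_cvg_integral.
  - exact: nd.
  - by move=> i; exact: measurable_itv.
  - by move=> i; exact: mr.
  - by move=> i x _; exact: r0.
rewrite -(cvg_lim (@ereal_hausdorff R) cv).
apply: lime_le; first by apply/cvg_ex; eexists; exact: cv.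
apply: nearW => n; apply: le_trans (atan_rate e0 (B0 n) (Bt n)).
rewrite le_eqVlt; apply/orP; left; apply/eqP; apply: eq_integral => s.
rewrite inE /B /= in_itv/= => /andP[_ h]; rewrite min_l//.
by apply: (le_trans h); exact: ltW.
Qed.

(** Every energy estimate of the kernel passes through here: a spatial bound by [rate] at each lag
    becomes a variance of order sqrt(eta) for an increment of parabolic size [eta]. *)
Lemma slice_energy (f : R * R -> R) (t eta K : R) : measurable_fun setT f -> 0 < eta -> 0 < t -> 0 <= K ->
  (forall z, ~ (0 < z.1 < t /\ 0 <= z.2 <= 1) -> f z = 0) ->
  (forall s, 0 < s < t -> (\int[leb]_(y in `[0%R, 1%R]) (f (s, y) ^+ 2)%:E <= (K * rate t eta s)%:E)%E) ->
  (\int[mu2]_z (f z ^+ 2)%:E <= (8 * K * Num.sqrt eta)%:E)%E.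
Proof.
move=> mf e0 t0 K0 f0 hf.
have mf2 : measurable_fun setT (fun z => (f z ^+ 2)%:E).
  by apply/measurable_EFinP; exact: measurable_funX.
have p2 (z : R * R) : (0 <= (f z ^+ 2)%:E)%E by rewrite lee_fin sqr_ge0.
rewrite (@fubini_tonelli1 _ _ _ _ R leb leb _ mf2 p2).
have mG := @measurable_fun_fubini_tonelli_F _ _ _ _ R leb _ mf2 p2.
rewrite /fubini_F in mG *.
have sl s : (\int[leb]_y (f (s, y) ^+ 2)%:E = if (0 < s < t)%R then \int[leb]_(y in `[0%R, 1%R]) (f (s, y) ^+ 2)%:E else 0)%E.
  case: ifPn => hs.
    rewrite [RHS]integral_mkcond; apply: eq_integral => y _; rewrite patchE.
    case: ifPn => // ny; rewrite f0 ?expr0n// => -[_ /= h].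
    by move/negP: ny; apply; rewrite inE/= in_itv/=.
  by rewrite integral0_eq// => y _; rewrite f0 ?expr0n//= => -[h _]; move: hs; rewrite h.
apply: (@le_trans _ _ (\int[leb]_(s in `]0%R, t[) (K * rate t eta (Num.min s t))%:E)%E).
  rewrite [leRHS]integral_mkcond; apply: ge0_le_integral.
  - exact: measurableT.
  - by move=> s _; apply: integral_ge0.
  - exact: mG.
  - apply/(measurable_restrictT _ _).1 => //; apply: measurable_funTS; apply/measurable_EFinP.
    by apply: measurable_funM => //; exact: measurable_rate.
  - move=> s _; rewrite sl patchE; case: ifPn => hs.
      rewrite ifT; last by rewrite inE/= in_itv/=.
      by rewrite min_l ?hf//; case/andP: hs => _ /ltW.
    by rewrite ifF//; apply/negP; rewrite inE/= in_itv/=; exact/negP.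
under eq_integral do rewrite EFinM.
rewrite ge0_integralZl//.
- have -> : 8 * K * Num.sqrt eta = K * (8 * Num.sqrt eta) by ring.
  by rewrite EFinM; apply: lee_wpmul2l; rewrite ?lee_fin//; exact: int_rate.
- by apply: measurable_funTS; apply/measurable_EFinP; exact: measurable_rate.
- by move=> s _; rewrite lee_fin; exact: rate_min_ge0.
Qed.

End kernel_energy.

(** * Space-time norms of the kernel *)

Section gker.
Context {R : realType}.
Notation leb := (@lebesgue_measure R).
Notation mu2 := (leb \x leb)%E.
Notation Kb := (@Kb R).

Definition gker (t x : R) (z : R * R) : R :=
  \1_(`]0, t[%classic `*` `[0, 1]%classic) z * heat_kernel (t - z.1) (x - z.2).

Definition sqn (f : R * R -> R) : \bar R := (\int[mu2]_z (f z ^+ 2)%:E)%E.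

Lemma gker_ge0 t x z : 0 <= gker t x z.
Proof. by rewrite mulr_ge0 ?hk_ge0. Qed.

Lemma measurable_gker t x : measurable_fun setT (gker t x).
Proof.
apply: measurable_funM; first by apply: measurable_indic; exact: measurableX.
by apply: measurable_hk; apply: measurable_funB.
Qed.

Lemma gker_in t x (s y : R) : 0 < s < t -> 0 <= y <= 1 -> gker t x (s, y) = heat_kernel (t - s) (x - y).
Proof. by move=> h1 h2; rewrite /gker indicE mem_set ?mul1r//; split; rewrite /= in_itv/=. Qed.

Lemma gker_out t x z : ~ (0 < z.1 < t /\ 0 <= z.2 <= 1) -> gker t x z = 0.
Proof.
by move=> h; rewrite /gker indicE memNset ?mul0r// => -[]; rewrite /= !in_itv/=.
Qed.

Lemma slice_eq (f g : R -> R) (M : R) : (forall y, 0 <= y <= 1 -> f y = g y) ->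
  (\int[leb]_(y in `[0%R, 1%R]) (g y ^+ 2)%:E <= M%:E)%E ->
  (\int[leb]_(y in `[0%R, 1%R]) (f y ^+ 2)%:E <= M%:E)%E.
Proof.
move=> fg; apply: le_trans; rewrite le_eqVlt; apply/orP; left; apply/eqP.
by apply: eq_integral => y; rewrite inE/= in_itv/= => /fg ->.
Qed.

Lemma rate_half (t a s : R) : 0 < a -> s < t -> t - s <= a ->
  (Num.sqrt (t - s))^-1 <= 2 * rate t a s.
Proof.
move=> a0 st h; have ts : 0 < t - s by rewrite subr_gt0.
have := half_frac ts h; rewrite /rate => h1.
have s0 : 0 <= (Num.sqrt (t - s))^-1 by rewrite invr_ge0 sqrtr_ge0.
by have := ler_wpM2l s0 h1; lra.
Qed.

(** Fixed by the time increment, the most expensive one: (2 * 64 + 2 * 16) times [Kb]. *)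
Definition Kg : R := 160 * Kb.
Lemma Kg_gt0 : 0 < Kg. Proof. by rewrite /Kg mulr_gt0// Kb_gt0. Qed.

(** The weight 1/sqrt(t - s) integrates to O(sqrt a) over the first [a] units of time, wherever [t]
    lies. This measures the noise that is forgotten when the field is restricted to a slab. *)
Lemma sqn_gker_early (t x a : R) : 0 <= t <= 1 -> 0 <= x <= 1 -> 0 < a ->
  (sqn (fun z => (gker t x z * \1_(early a) z)%R) <= (Kg * Num.sqrt a)%:E)%E.
Proof.
move=> /andP[t0 t1] x01 a0; have K0 := @Kb_gt0 R.
have mf : measurable_fun setT (fun z => gker t x z * \1_(early a) z).
  apply: measurable_funM; first exact: measurable_gker.
  by apply: measurable_indic; exact: measurable_early.
have s4 : Num.sqrt (2 * a) <= 2 * Num.sqrt a.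
  have -> : 2 * Num.sqrt a = Num.sqrt (4 * a) by rewrite sqrtrM// (_ : 4 = 2 ^+ 2) ?sqrtr_sqr ?ger0_norm//; lra.
  by apply: ler_wsqrtr; lra.
have a20 : 0 < 2 * a by lra.
(* [early a] contains the instant [a], whereas [slice_energy] wants an open horizon; doubling [a]
   leaves room for it. *)
pose T := Num.min t (2 * a).
have [tz|tn0] := eqVneq t 0.
  rewrite /sqn (_ : (fun z => _) = cst 0%E).
    by rewrite integral_cst// mul0e lee_fin mulr_ge0 ?sqrtr_ge0// ltW// Kg_gt0.
  apply/funext => z; rewrite gker_out ?mul0r ?expr0n//= tz => -[/andP[h1 h2] _].
  by have := lt_trans h1 h2; rewrite ltxx.
have tp : 0 < t by rewrite lt_def tn0.
have T0 : 0 < T by rewrite lt_min tp.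
have T2a : T <= 2 * a by rewrite ge_min lexx orbT.
apply: (@le_trans _ _ (8 * (2 * Kb) * Num.sqrt (2 * a))%:E).
  apply: (slice_energy (t := T) (eta := 2 * a)) => //; first by rewrite mulr_ge0// ltW.
    move=> z hz; have [za|za] := leP z.1 a; last first.
      by rewrite indicE memNset ?mulr0// /early /= => h; move: za; rewrite ltNge h.
    rewrite gker_out ?mul0r// => -[/andP[z1 z2] z3]; apply: hz; split => //.
    by rewrite z1 lt_min z2/=; lra.
  move=> s /andP[s0]; rewrite lt_min => /andP[st sa].
  apply: (slice_eq (g := fun y => \1_(early a) (s, 0) * heat_kernel (t - s) (x - y))).
    move=> y y01; rewrite gker_in ?s0// mulrC; congr (_ * _).
  have ts0 : 0 < t - s by rewrite subr_gt0.
  have ts1 : t - s <= 1 by lra.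
  have sT : s < T by rewrite lt_min st.
  apply: (@le_trans _ _ (\int[leb]_(y in `[0%R, 1%R]) (heat_kernel (t - s) (x - y) ^+ 2)%:E)%E).
    apply: ge0_le_integral => //.
    - by move=> y _; rewrite lee_fin sqr_ge0.
    - apply: measurable_funTS; apply/measurable_EFinP; apply: measurable_funX; apply: measurable_funM => //.
      exact: hk_measurable_y.
    - apply: measurable_funTS; apply/measurable_EFinP; apply: measurable_funX; exact: hk_measurable_y.
    - move=> y _; rewrite lee_fin exprMn indicE; case: (_ \in _); rewrite ?expr1n ?mul1r// expr0n mul0r sqr_ge0//.
  apply: (le_trans (hk_sq ts0 ts1 x01)); rewrite lee_fin -mulrA mulrCA ler_pM2l//.
  apply: le_trans (rate_half a20 sT _); last by lra.
  rewrite lef_pV2 ?posrE ?sqrtr_gt0 ?subr_gt0//; apply: ler_wsqrtr.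
  by rewrite lerD2r ge_min lexx.
rewrite lee_fin /Kg; have := sqrtr_ge0 a => sa0.
have k : 0 <= 16 * Kb by rewrite mulr_ge0// ltW.
have := ler_wpM2l k s4; have : 0 <= 128 * Kb * Num.sqrt a by rewrite !mulr_ge0// ltW.
lra.
Qed.

Lemma sqn_gker (t x : R) : 0 <= t <= 1 -> 0 <= x <= 1 -> (sqn (gker t x) <= (Kg * Num.sqrt t)%:E)%E.
Proof.
move=> t01 x01; have K0 := @Kb_gt0 R; have /andP[t0 t1] := t01.
have [tz|tn0] := eqVneq t 0.
  rewrite /sqn (_ : (fun z => _) = cst 0%E).
    by rewrite integral_cst// mul0e lee_fin mulr_ge0 ?sqrtr_ge0// ltW// Kg_gt0.
  apply/funext => z; rewrite gker_out ?expr0n//= tz => -[/andP[h1 h2] _].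
  by have := lt_trans h1 h2; rewrite ltxx.
have tp : 0 < t by rewrite lt_def tn0.
apply: le_trans (sqn_gker_early t01 x01 tp); rewrite le_eqVlt; apply/orP; left; apply/eqP.
apply: eq_integral => z _; congr ((_ ^+ 2)%:E).
have [zt|zt] := leP z.1 t; first by rewrite indicE mem_set ?mulr1.
by rewrite gker_out ?mul0r// => -[/andP[_ h] _]; have := lt_trans zt h; rewrite ltxx.
Qed.

Lemma sqn_gker_space (t x x' : R) : 0 <= t <= 1 -> 0 <= x <= 1 -> 0 <= x' <= 1 ->
  (sqn (fun z => (gker t x' z - gker t x z)%R) <= (Kg * `|x' - x|)%:E)%E.
Proof.
move=> /andP[t0 t1] x01 x01'; have K0 := @Kb_gt0 R.
have zero : (forall z, gker t x' z - gker t x z = 0) -> (sqn (fun z => (gker t x' z - gker t x z)%R) <= (Kg * `|x' - x|)%:E)%E.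
  move=> h; rewrite /sqn; under eq_integral do rewrite h expr0n/=.
  by rewrite integral0 lee_fin mulr_ge0// ltW// Kg_gt0.
have [tz|tn0] := eqVneq t 0.
  apply: zero => z; have n : ~ (0 < z.1 < t /\ 0 <= z.2 <= 1).
    by rewrite tz => -[/andP[h1 h2] _]; have := lt_trans h1 h2; rewrite ltxx.
  by rewrite !gker_out// subrr.
have [xx|xx] := eqVneq x' x; first by apply: zero => z; rewrite xx subrr.
have tp : 0 < t by rewrite lt_def tn0.
have h2 : 0 < (x' - x) ^+ 2 by rewrite exprn_even_gt0//= subr_eq0.
apply: (@le_trans _ _ (8 * (8 * Kb) * Num.sqrt ((x' - x) ^+ 2))%:E).
  apply: (slice_energy (t := t)) => //.
  - by apply: measurable_funB; exact: measurable_gker.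
  - by rewrite mulr_ge0// ltW.
  - by move=> z h; rewrite !gker_out ?subrr.
  - move=> s st; apply: (slice_eq (g := fun y => heat_kernel (t - s) (x' - y) - heat_kernel (t - s) (x - y))).
      by move=> y y01; rewrite !gker_in.
    case/andP: st => s0 st; have ts0 : 0 < t - s by rewrite subr_gt0.
    have ts1 : t - s <= 1 by lra.
    by have := hk_sq_space ts0 ts1 x01 x01'; rewrite /rate !mulrA.
rewrite sqrtr_sqr lee_fin ler_wpM2r//; rewrite /Kg; lra.
Qed.

(** Noise before [t] sees a kernel aged by t' - t, noise after [t] sees the later kernel alone. Both
    parts have energy of order sqrt(t' - t). *)
Lemma sqn_gker_time (t t' x : R) : 0 <= t -> t <= t' -> t' <= 1 -> 0 <= x <= 1 ->
  (sqn (fun z => (gker t' x z - gker t x z)%R) <= (Kg * Num.sqrt (t' - t))%:E)%E.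
Proof.
move=> t0 tt' t1' x01; have K0 := @Kb_gt0 R; have k0 := @Kg_gt0.
have [tz|tn] := eqVneq t' t.
  rewrite /sqn; under eq_integral do rewrite tz subrr expr0n/=.
  by rewrite integral0 lee_fin mulr_ge0 ?sqrtr_ge0// ltW.
have e0 : 0 < t' - t by rewrite subr_gt0 lt_def tn.
have t'0 : 0 < t' by lra.
have ms : measurable_fun setT (\1_(early t) : R * R -> R) by apply: measurable_indic; exact: measurable_early.
have mg := measurable_gker.
pose f1 z := (gker t' x z - gker t x z) * \1_(early t) z.
pose f z := gker t' x z - gker t x z.
have mf : measurable_fun setT f by apply: measurable_funB; exact: mg.
have mf1 : measurable_fun setT f1 by exact: measurable_funM.
have h1 : (sqn f1 <= (8 * (8 * Kb) * Num.sqrt (t' - t))%:E)%E.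
  have [tz|tnz] := eqVneq t 0.
    rewrite /sqn; under eq_integral => z _.
      rewrite /f1 (_ : _ * _ = 0) ?expr0n/=; last first.
        have [zt|zt] := leP z.1 t; last by rewrite indicE memNset ?mulr0// /early /= => h; move: zt; rewrite ltNge h.
        by rewrite !gker_out ?subrr ?mul0r// => -[/andP[h1 h2] _]; lra.
      over.
    by rewrite integral0 lee_fin !mulr_ge0 ?sqrtr_ge0// ltW.
  have tp : 0 < t by rewrite lt_def tnz.
  (* [early t] keeps the instant [t], where the later kernel survives; this null line is dropped to
     fit the open interval of [slice_energy]. *)
  have ae : (sqn f1 = sqn (fun z => (f1 z * \1_(`]-oo, t[%classic `*` setT) z)%R))%E.
    apply: ge0_ae_eq_integral.
    - exact: measurableT.
    - by apply/measurable_EFinP; exact: measurable_funX.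
    - apply/measurable_EFinP; apply: measurable_funX; apply: measurable_funM => //.
      by apply: measurable_indic; exact: measurableX.
    - by move=> z _; rewrite lee_fin sqr_ge0.
    - by move=> z _; rewrite lee_fin sqr_ge0.
    - exists ([set t] `*` setT); split; first exact: measurableX.
        transitivity (leb [set t] * leb setT)%E; first exact: product_measure1E.
        by rewrite lebesgue_measure_set1 mul0e.
      move=> z /= h; split => //=; apply: contrapT => zt; apply: h => _.
      have [zl|zl] := ltP z.1 t.
        by rewrite indicE mem_set ?mulr1//; split => //=; rewrite in_itv.
      have e1 : \1_(early t) z = 0 :> R.
        by rewrite indicE memNset// /early /= => h2; apply: zt; apply/eqP; rewrite eq_le h2 zl.
      by rewrite /f1 e1 mulr0 mul0r.
  rewrite ae; apply: (slice_energy (t := t)) => //.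
  - apply: measurable_funM => //; by apply: measurable_indic; exact: measurableX.
  - by rewrite mulr_ge0// ltW.
  - move=> z h; have [zt|zt] := ltP z.1 t; last first.
      by rewrite [X in _ * X]indicE memNset ?mulr0// => -[/=]; rewrite in_itv/= ltNge zt.
    rewrite /f1 !gker_out ?subrr ?mul0r// => -[/andP[h1 h2] h3]; apply: h; split => //; rewrite h1 ?zt//.
  - move=> s st; apply: (slice_eq (g := fun y => heat_kernel (t - s + (t' - t)) (x - y) - heat_kernel (t - s) (x - y))).
      move=> y y01; case/andP: (st) => s0 sl; rewrite /f1 !gker_in ?st//; last by rewrite s0 (lt_le_trans sl).
      rewrite !indicE !mem_set ?mulr1; [|by split => //=; rewrite in_itv|exact: ltW].
      by have e : t - s + (t' - t) = t' - s; [ring|rewrite e].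
    case/andP: st => s0 st; have ts0 : 0 < t - s by rewrite subr_gt0.
    have ts1 : t - s + (t' - t) <= 1 by lra.
    by have := hk_sq_time ts0 (ltW e0) ts1 x01; rewrite /rate !mulrA.
have h2 : (sqn (fun z => (f z - f1 z)%R) <= (8 * (2 * Kb) * Num.sqrt (t' - t))%:E)%E.
  apply: (slice_energy (t := t')) => //.
  - exact: measurable_funB.
  - by rewrite mulr_ge0// ltW.
  - move=> z h; have o1 := gker_out x h.
    have o2 : gker t x z = 0.
      by apply: gker_out => -[/andP[q1 q2] q3]; apply: h; split => //; rewrite q1 (lt_le_trans q2 tt').
    by rewrite /f1 /f o1 o2 subrr mul0r subrr.
  - move=> s /andP[s0 st'].
    have [st|st] := leP s t.
      apply: (slice_eq (g := fun=> 0)); first by move=> y _; rewrite /f1 /f indicE mem_set ?mulr1 ?subrr.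
      under eq_integral do rewrite expr0n/=.
      by rewrite integral0 lee_fin mulr_ge0//; [rewrite mulr_ge0// ltW|apply: rate_ge0; exact: ltW].
    apply: (slice_eq (g := fun y => heat_kernel (t' - s) (x - y))).
      move=> y y01; rewrite /f1 /f indicE memNset ?mulr0 ?subr0; last by rewrite /early /= => h; move: st; rewrite ltNge h.
      rewrite (gker_in _ _ y01) ?s0// (@gker_out t) ?subr0// => -[/andP[_ h] _].
      by have := lt_trans st h; rewrite ltxx.
    have ts0 : 0 < t' - s by rewrite subr_gt0.
    have ts1 : t' - s <= 1 by lra.
    apply: (le_trans (hk_sq ts0 ts1 x01)); rewrite lee_fin -mulrA mulrCA ler_pM2l//.
    by apply: rate_half => //; lra.
have := @integral_sqr_le R _ _ (leb \x leb)%E f f1 mf mf1 => H; apply: (le_trans H).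
have -> : Kg * Num.sqrt (t' - t) = 2 * (8 * (8 * Kb) * Num.sqrt (t' - t)) + 2 * (8 * (2 * Kb) * Num.sqrt (t' - t)).
  by rewrite /Kg; ring.
by rewrite (EFinD (2 * _)) (EFinM 2) (EFinM 2 (8 * (2 * Kb) * _)); apply: leeD; apply: lee_wpmul2l.
Qed.

End gker.

(** * Increments of the solution *)

Section solution.
Context {R : realType} {d : measure_display} {Omega : measurableType d}.
Context (P : probability Omega R) (W : set (R * R) -> Omega -> R).
Hypothesis hW : white_noise P W.
Notation leb := (@lebesgue_measure R).
Notation mu2 := (leb \x leb)%E.
Variables (sigma : R -> R) (D : R).
Hypotheses (D0 : 0 <= D) (hLip : forall a b, `|sigma a - sigma b| <= D * `|a - b|).
Variable u : R -> R -> Omega -> R.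
Hypothesis hu : mild_solution P W sigma (fun _ : R => 0) u.
Hypothesis hcont : continuous_paths P u.

Lemma walsh_u t x : 0 <= t -> 0 <= x <= 1 ->
  walsh_integral P W (mild_integrand sigma u t x) (u t x).
Proof.
move=> t0 x01; have [_ _ /(_ t x t0 x01)] := hu; congr walsh_integral.
apply/funext => w; rewrite /heat_flow; case: ifP => _; first by rewrite subr0.
rewrite (_ : (\int[_]_(y in _) _) = 0) ?subr0// /Rintegral.
by under eq_integral do rewrite mulr0; rewrite integral0.
Qed.

Lemma measurable_u t x : 0 <= t -> 0 <= x <= 1 -> measurable_fun setT (u t x).
Proof. by move=> t0 x01; have [] := walsh_u t0 x01. Qed.

Lemma mild_integrandE t x s y w :
  mild_integrand sigma u t x s y w = gker t x (s, y) * sigma (u s y w).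
Proof. by rewrite /mild_integrand /gker mulrA. Qed.

Lemma bernstein_event (E : set Omega) f I (a V : R) : measurable E ->
  walsh_integral P W f I -> 0 < a -> 0 < V ->
  (forall w, E w -> (energy f w <= V%:E)%E) ->
  (P (E `&` [set w | (a <= `|I w|)%R]) <= (2 * expR (- (a ^+ 2 / (24 * V))))%:E)%E.
Proof.
move=> mE wf a0 V0 hE; have [mf mI _] := wf.
apply: le_trans (bernstein hW wf a0 V0); apply: prob_le.
- apply: measurableI => //.
  rewrite (_ : [set w | _] = [set w | (a%:E <= (`|I w|)%:E)%E]).
    by apply: measurable_ge_e; apply/measurable_EFinP; exact: measurableT_comp.
  by apply/seteqP; split => w /=; rewrite lee_fin.
- rewrite (_ : [set w | _] = [set w | (a%:E <= (`|I w|)%:E)%E] `&` [set w | (energy f w <= V%:E)%E]).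
    apply: measurableI; [apply: measurable_ge_e|apply: measurable_le_e].
      by apply/measurable_EFinP; exact: measurableT_comp.
    exact: measurable_energy.
  by apply/seteqP; split => w /=; rewrite !lee_fin.
- by move=> w [/hE].
Qed.

Lemma energy_le_sqn (f : R -> R -> Omega -> R) w (g : R * R -> R) (M : R) : 0 <= M ->
  measurable_fun setT (fun p : R * R * Omega => f p.1.1 p.1.2 p.2) ->
  measurable_fun setT g ->
  (forall s y, `|f s y w| <= M * `|g (s, y)|) -> (energy f w <= (M ^+ 2)%:E * sqn g)%E.
Proof.
move=> M0 mf mg h.
have mg2 : measurable_fun setT (fun z => (g z ^+ 2)%:E).
  by apply/measurable_EFinP; exact: measurable_funX.
rewrite /energy /sqn -ge0_integralZl; last 4 first.
- exact: measurableT.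
- exact: mg2.
- by move=> z _; rewrite lee_fin sqr_ge0.
- by rewrite lee_fin sqr_ge0.
apply: ge0_le_integral.
- exact: measurableT.
- by move=> z _; rewrite lee_fin sqr_ge0.
- by apply/measurable_EFinP; apply: measurable_funX; exact: measurable_section mf w.
- exact: measurable_funeM.
- move=> z _; rewrite -EFinM lee_fin; have := h z.1 z.2; rewrite -surjective_pairing => h1.
  rewrite -(real_normK (num_real (f _ _ _))) -(real_normK (num_real (g z))) -exprMn.
  by rewrite ler_sqr ?nnegrE// mulr_ge0.
Qed.

(** At time 0 the integrand has zero energy, so the Bernstein bound holds for every V > 0 and forces
    all tails to vanish. *)
Lemma u_zero x : 0 <= x <= 1 -> {ae P, forall w, u 0 x w = 0}.
Proof.
move=> x01; have wf := walsh_u (lexx 0) x01.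
have mu0 := measurable_u (lexx 0) x01.
have e0 w : energy (mild_integrand sigma u 0 x) w = 0%E.
  rewrite /energy (_ : (fun z => _) = cst 0%E); first by rewrite integral_cst// mul0e.
  apply/funext => z; rewrite mild_integrandE gker_out ?mul0r ?expr0n//= => -[/andP[h1 h2] _].
  by have := lt_trans h1 h2; rewrite ltxx.
have pa (a : R) : 0 < a -> P [set w | a <= `|u 0 x w|] = 0%E.
  move=> a0; apply/eqP; rewrite eq_le measure_ge0 andbT; apply/lee_addgt0Pr => e ep.
  rewrite add0e; pose k := Num.bound (2 / e).
  have hk : 2 / e < k%:R by apply: archi_boundP; rewrite divr_ge0// ltW.
  have k0 : 0 < k%:R :> R by apply: le_lt_trans hk; rewrite divr_ge0// ltW.
  have V0 : 0 < a ^+ 2 / (24 * k%:R) by rewrite divr_gt0 ?exprn_gt0// mulr_gt0.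
  have := bernstein_event measurableT wf a0 V0; rewrite setTI => h.
  apply: (le_trans (h _)); first by move=> w _; rewrite e0 lee_fin ltW.
  rewrite lee_fin (_ : a ^+ 2 / _ = k%:R); last by field; rewrite !gt_eqF.
  rewrite expRN ler_pdivrMr ?expR_gt0//; have := expR_ge1Dx (k%:R : R) => h1.
  move: hk; rewrite ltr_pdivrMr// => hk; apply: le_trans (ltW hk) _.
  by rewrite mulrC ler_pM2l//; lra.
have neg : P.-negligible (\bigcup_n [set w | n.+1%:R^-1 <= `|u 0 x w|]).
  apply: negligible_bigcup => n; exists [set w | n.+1%:R^-1 <= `|u 0 x w|]; split => //.
    rewrite (_ : [set w | _] = [set w | ((n.+1%:R^-1)%:E <= (`|u 0 x w|)%:E)%E]).
      by apply: measurable_ge_e; apply/measurable_EFinP; exact: measurableT_comp.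
    by apply/seteqP; split => w /=; rewrite lee_fin.
  by apply: pa; rewrite invr_gt0.
apply: negligibleS neg.
move=> w /= /eqP un0; have := normr_gt0 (u 0 x w); rewrite un0 => np.
exists (Num.bound (`|u 0 x w|)^-1) => //=.
have hb : (`|u 0 x w|)^-1 < (Num.bound (`|u 0 x w|)^-1)%:R by apply: archi_boundP; rewrite invr_ge0.
rewrite -[leRHS]invrK lef_pV2 ?posrE ?invr_gt0//; apply: ltW; apply: (lt_trans hb).
by rewrite ltr_nat.
Qed.

Lemma sigma_bound v : `|sigma v| <= `|sigma 0| + D * `|v|.
Proof.
have := hLip v 0; rewrite subr0 => h; have := ler_normD (sigma v - sigma 0) (sigma 0).
by rewrite subrK => h2; lra.
Qed.

Definition bounded_on (t b : R) (w : Omega) :=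
  forall s y, 0 <= s <= t -> 0 <= y <= 1 -> `|u s y w| <= b.

(** On [E] the factor sigma(u) is at most |sigma 0| + D over the supports of both kernels, so the
    energy of the increment is bounded deterministically. *)
Lemma bdiff (E : set Omega) (T t x t' x' a V : R) : measurable E ->
  (forall w, E w -> bounded_on T 1 w) ->
  0 <= t <= T -> 0 <= x <= 1 -> 0 <= t' <= T -> 0 <= x' <= 1 -> 0 < a -> 0 < V ->
  (((`|sigma 0| + D) ^+ 2)%:E * sqn (fun z => (gker t x z - gker t' x' z)%R) <= V%:E)%E ->
  (P (E `&` [set w | (a <= `|u t x w - u t' x' w|)%R]) <= (2 * expR (- (a ^+ 2 / (24 * V))))%:E)%E.
Proof.
move=> mE hE /andP[t0 tT] x01 /andP[t0' tT'] x01' a0 V0 hV.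
have M0 : 0 <= `|sigma 0| + D by rewrite addr_ge0.
have wd' := walsh_add hW (walsh_u t0 x01) (walsh_scale hW (-1) (walsh_u t0' x01')).
rewrite (_ : [set w | _] = [set w | a <= `|u t x w + -1 * u t' x' w|]); last first.
  by apply/seteqP; split => w /=; rewrite mulN1r.
apply: (bernstein_event mE wd' a0 V0) => w Ew; apply: le_trans hV.
have [mf _ _] := wd'.
apply: energy_le_sqn => //; first by apply: measurable_funB; exact: measurable_gker.
move=> s y; rewrite !mild_integrandE mulN1r -mulrBl normrM mulrC.
have [g0|gn0] := eqVneq (gker t x (s, y) - gker t' x' (s, y)) 0; first by rewrite g0 normr0 !mulr0.
apply: ler_wpM2r => //.
have [sy|sy] : (0 <= s <= T /\ 0 <= y <= 1) \/ ~ (0 <= s <= T /\ 0 <= y <= 1) by apply: EM.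
  apply: (le_trans (sigma_bound _)); rewrite lerD2l ler_piMr//; exact: (hE w Ew s y sy.1 sy.2).
exfalso; move/negP: gn0; apply; apply/eqP.
rewrite !gker_out ?subrr//= => -[/andP[s0 st] y01]; apply: sy; split => //; rewrite (ltW s0)/=; lra.
Qed.

(** The energy splits in two: replacing sigma(u) by sigma(0) costs D b on the kernel, and replacing
    the kernel by a step function costs the approximation error. With a small bound [b] near time 0
    the first error is of lower order than the field. *)
Lemma blin (E : set Omega) (t x a V b : R) l : measurable E -> rect_in 0 t l -> 0 <= b ->
  (forall w, E w -> bounded_on t b w) -> 0 <= t <= 1 -> 0 <= x <= 1 -> 0 < a -> 0 < V ->
  (2%:E * (((D * b) ^+ 2)%:E * sqn (gker t x)) + 2%:E * ((sigma 0 ^+ 2)%:E * l2d (gker t x) (stepf l)) <= V%:E)%E ->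
  (P (E `&` [set w | (a <= `|u t x w - sigma 0 * wsum W l w|)%R]) <= (2 * expR (- (a ^+ 2 / (24 * V))))%:E)%E.
Proof.
move=> mE rl b0 hE /andP[t0 t1] x01 a0 V0 hV.
have ml : measurable_fun setT (stepf l) by apply: measurable_stepf; exact: step_in_ok (rect_step (lexx 0) rl).
have mg := @measurable_gker R t x.
have wd := walsh_add hW (walsh_u t0 x01) (walsh_scale hW (- sigma 0) (walsh_rect hW (lexx 0) rl)).
rewrite (_ : [set w | _] = [set w | a <= `|u t x w + (- sigma 0) * wsum W l w|]); last first.
  by apply/seteqP; split => w /=; rewrite mulNr.
apply: (bernstein_event mE wd a0 V0) => w Ew; apply: le_trans hV.
have [mf _ _] := wd.
have ms := measurable_section (f := fun s y w => mild_integrand sigma u t x s y w + - sigma 0 * stepf l (s, y)) mf w.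
have [mu _ _] := walsh_u t0 x01.
have msu := measurable_section (f := mild_integrand sigma u t x) mu w.
pose h z := mild_integrand sigma u t x z.1 z.2 w - sigma 0 * gker t x z.
have mh : measurable_fun setT h by apply: measurable_funB => //; exact: measurable_funM.
have H := @integral_sqr_le R _ _ (leb \x leb)%E _ _ ms mh.
apply: (le_trans H); apply: leeD; apply: lee_wpmul2l => //.
  rewrite /sqn -ge0_integralZl; last 4 first.
  - exact: measurableT.
  - by apply/measurable_EFinP; exact: measurable_funX.
  - by move=> z _; rewrite lee_fin sqr_ge0.
  - by rewrite lee_fin sqr_ge0.
  apply: ge0_le_integral.
  - exact: measurableT.
  - by move=> z _; rewrite lee_fin sqr_ge0.
  - by apply/measurable_EFinP; exact: measurable_funX.
  - by apply: measurable_funeM; apply/measurable_EFinP; exact: measurable_funX.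
  - move=> z _; rewrite -EFinM lee_fin -exprMn /h mild_integrandE -surjective_pairing.
    rewrite -(real_normK (num_real (_ - _))) -[leRHS](real_normK (num_real _)) ler_sqr ?nnegrE//.
    rewrite (_ : _ - _ = (sigma (u z.1 z.2 w) - sigma 0) * gker t x z); last by ring.
    rewrite (normrM _ (gker t x z)) (normrM (D * b)) (normrM D b); have [g0|gn0] := eqVneq (gker t x z) 0; first by rewrite g0 normr0 !mulr0.
    apply: ler_wpM2r => //; rewrite (ger0_norm D0) (ger0_norm b0).
    apply: (le_trans (hLip _ _)); apply: ler_wpM2l => //; rewrite subr0.
    have [zz|zz] : (0 < z.1 < t /\ 0 <= z.2 <= 1) \/ ~ (0 < z.1 < t /\ 0 <= z.2 <= 1) by apply: EM.
      by apply: (hE w Ew) => //; [case: zz => /andP[/ltW -> /ltW ->]|case: zz].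
    by move: gn0; rewrite gker_out// eqxx.
rewrite /l2d -ge0_integralZl; last 4 first.
- exact: measurableT.
- by apply/measurable_EFinP; apply: measurable_funX; exact: measurable_funB.
- by move=> z _; rewrite lee_fin sqr_ge0.
- by rewrite lee_fin sqr_ge0.
rewrite le_eqVlt; apply/orP; left; apply/eqP; apply: eq_integral => z _.
by rewrite -EFinM; congr EFin; rewrite /h -surjective_pairing; ring.
Qed.

End solution.

(** * Localisation and modulus of continuity on the parabolic grid *)

Section modulus.
Context {R : realType} {d : measure_display} {Omega : measurableType d}.
Context (P : probability Omega R) (W : set (R * R) -> Omega -> R).
Hypothesis hW : white_noise P W.
Notation leb := (@lebesgue_measure R).
Notation mu2 := (leb \x leb)%E.
Variables (sigma : R -> R) (D : R).
Hypotheses (D0 : 0 <= D) (hLip : forall a b, `|sigma a - sigma b| <= D * `|a - b|).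
Variable u : R -> R -> Omega -> R.
Hypothesis hu : mild_solution P W sigma (fun _ : R => 0) u.
Hypothesis hcont : continuous_paths P u.

Definition rq (q : rat) : R := ratr q.

Definition good_path (w : Omega) :=
  {within @strip R, continuous (fun p => u p.1 p.2 w)} /\ forall y, 0 <= y <= 1 -> u 0 y w = 0.

Lemma dense_bound w (T X b : R) (S : R -> R -> Prop) :
  {within @strip R, continuous (fun p => u p.1 p.2 w)} -> 0 <= X <= 1 ->
  (forall s y e, 0 <= s <= T -> 0 <= y <= X -> 0 < e -> exists s' y',
     [/\ S s' y', 0 <= s', 0 <= y' <= 1, `|s - s'| < e & `|y - y'| < e]) ->
  (forall s y, S s y -> `|u s y w| <= b) ->
  forall s y, 0 <= s <= T -> 0 <= y <= X -> `|u s y w| <= b.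
Proof.
move=> cw /andP[X0 X1] dS hb s y sT yX; rewrite leNgt; apply/negP => lt.
have Asy : @strip R (s, y).
  by case/andP: sT => s0 _; case/andP: yX => y0 y1; split; rewrite /= in_itv/= ?s0 ?y0//; lra.
have e0 : 0 < `|u s y w| - b by rewrite subr_gt0.
have := (subspace_continuousP _ _).1 cw (s, y) Asy => /cvgrPdist_lt/(_ _ e0).
rewrite near_withinE => /nbhs_ballP[e /= ep he].
have [s' [y' [Ss s0' y01' ss yy]]] := dS s y e sT yX ep.
have A' : @strip R (s', y') by split; rewrite /= in_itv/= ?s0' ?y01'.
have B' : ball (s, y) e (s', y') by split; rewrite /ball/=.
have := he (s', y') B' A' => /= h; have := hb _ _ Ss => h2.
by have := lerB_dist (u s y w) (u s' y' w); lra.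
Qed.

Lemma rat_near (T s e : R) : 0 < T -> 0 <= s <= T -> 0 < e ->
  exists q : rat, [/\ 0 <= rq q, rq q <= T & `|s - rq q| < e].
Proof.
move=> T0 /andP[s0 sT] e0.
have lt : Num.max 0 (s - e) < Num.min T (s + e) by rewrite gt_max !lt_min; lra.
have [q] := rat_in_itvoo lt; rewrite -/(rq q) in_itv/= gt_max lt_min => /andP[/andP[h1 h2] /andP[h3 h4]].
by exists q; split; [exact: ltW|exact: ltW|rewrite ltr_norml; apply/andP; split; lra].
Qed.

(** Restriction to rational points makes the event measurable; on continuous paths it means the same
    for all points. *)
Definition rat_bounded (T X b : R) : set Omega := [set w | forall q q' : rat,
  0 <= rq q <= T -> 0 <= rq q' <= X -> `|u (rq q) (rq q') w| <= b].

Lemma measurable_rat_bounded T X b : X <= 1 -> measurable (rat_bounded T X b).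
Proof.
move=> X1; pose A n : set Omega := match unpickle n : option (rat * rat) with
  | Some q => if (0 <= rq q.1 <= T) && (0 <= rq q.2 <= X) then [set w | `|u (rq q.1) (rq q.2) w| <= b] else setT
  | None => setT end.
rewrite (_ : rat_bounded T X b = \bigcap_n A n).
  apply: bigcapT_measurable => n; rewrite /A; case: unpickle => // q.
  case: ifP => // /andP[/andP[h1 h2] /andP[h3 h4]].
  rewrite (_ : [set w | _] = [set w | ((`|u (rq q.1) (rq q.2) w|)%:E <= b%:E)%E]).
    apply: measurable_le_e; apply/measurable_EFinP; apply: measurableT_comp => //.
    by apply: (measurable_u hu) => //; rewrite h3 (le_trans h4).
  by apply/seteqP; split => w /=; rewrite lee_fin.
apply/seteqP; split => w.
  move=> h n _; rewrite /A; case: unpickle => // q; case: ifP => // /andP[h1 h2]; exact: h.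
move=> h q q' h1 h2; have := h (pickle (q, q')) Logic.I.
by rewrite /A pickleK /= h1 h2.
Qed.

Lemma rat_bounded_all T X b w : 0 < T -> 0 < X <= 1 -> {within @strip R, continuous (fun p => u p.1 p.2 w)} ->
  rat_bounded T X b w -> forall s y, 0 <= s <= T -> 0 <= y <= X -> `|u s y w| <= b.
Proof.
move=> T0 /andP[X0 X1] cw hr.
pose S (s y : R) := exists q q' : rat, [/\ s = rq q, y = rq q', 0 <= rq q <= T  & 0 <= rq q' <= X].
apply: (dense_bound (S := S)) => //; first by rewrite (ltW X0).
  move=> s y e sT yX e0; have [q [q0 qT hq]] := rat_near T0 sT e0.
  have [q' [q0' qX hq']] := rat_near X0 yX e0.
  exists (rq q), (rq q'); split => //; last by rewrite q0' (le_trans qX).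
  by exists q, q'; split => //; rewrite ?q0 ?q0'.
by move=> s y [q [q' [-> -> h1 h2]]]; exact: hr.
Qed.

(** Vanishing at time 0 holds almost surely at all rational points at once, and at the remaining
    points by continuity. *)
Lemma exists_good : exists G : set Omega, [/\ measurable G, P G = 1%E & forall w, G w -> good_path w].
Proof.
have [N [mN PN hN]] := hcont.
pose Z w := forall n, match unpickle n : option rat with
   Some q => 0 <= rq q <= 1 -> u 0 (rq q) w = 0 | None => True end.
have z : {ae P, forall w, Z w}.
  apply: ae_foralln => n; case: unpickle => [q|]; last exact: aeW.
  have [q01|nq] := boolP (0 <= rq q <= 1); last by apply: aeW => w.
  by apply: filterS (u_zero hW hu q01) => w h _.
have [N' [mN' PN' hN']] := z.
exists (~` (N `|` N')); split.
- by apply: measurableC; exact: measurableU.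
- rewrite probability_setC; last exact: measurableU.
  have z0 : P (N `|` N') = 0%E.
    apply: measure_negligible; first exact: measurableU.
    by apply: negligibleU; [exists N; split|exists N'; split].
  by rewrite [X in (1 - X)%E](_ : _ = 0%E) ?sube0.
- move=> w /not_orP[nN nN'].
  have cw : {within @strip R, continuous (fun p => u p.1 p.2 w)} by apply: contrapT => h; apply: nN; apply: hN.
  have zw : Z w by apply: contrapT => h; apply: nN'; exact: hN'.
  split => // y y01; apply/eqP; rewrite -normr_le0.
  apply: (@dense_bound w 0 1 0 (fun s y => s = 0 /\ exists q : rat, y = rq q /\ 0 <= rq q <= 1) cw) => //.
  + by rewrite ler01 lexx.
  + move=> s y' e s0 y01' e0; have [q [q0 q1 hq]] := rat_near ltr01 y01' e0.
    exists 0, (rq q); split => //; first by split => //; exists q; rewrite q0 q1.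
    * by rewrite q0 q1.
    * by case/andP: s0 => s1 s2; rewrite subr0 ger0_norm//; exact: le_lt_trans s2 e0.
  + move=> s y' [-> [q [-> q01]]]; have := zw (pickle q); rewrite pickleK => ->//.
    by rewrite normr0.
  + by rewrite lexx.
Qed.

(** Compactness of [[0, 1]] makes continuity at time 0, where u vanishes, uniform in space. *)
Lemma good_small w : good_path w -> exists k, bounded_on u (k.+1%:R^-1) 1 w.
Proof.
move=> [cw z].
have := (compact_near_coveringP _).1 (@segment_compact R 0 1).
move=> /(_ R (0 : R)^'+ (fun t y => forall s, 0 <= s <= t -> 0 <= y <= 1 -> `|u s y w| <= 1) _).
have : forall x : R, [set` `[0, 1]] x -> \forall x' \near x & i \near (0 : R)^'+,
   forall s, 0 <= s <= i -> 0 <= x' <= 1 -> `|u s x' w| <= 1.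
  move=> x /=; rewrite in_itv/= => x01.
  have A : @strip R (0, x) by split; rewrite /= in_itv/= ?lexx.
  have := (subspace_continuousP _ _).1 cw (0, x) A => /cvgrPdist_lt/(_ 1 ltr01).
  rewrite near_withinE => /nbhs_ballP[e /= ep he].
  exists (ball x e, [set t | t < e]) => /=.
    split; first exact: nbhsx_ballx.
    by apply: nbhs_right_lt.
  move=> [y t] /= [hy te] s /andP[s0 st] y01.
  have A' : @strip R (s, y) by split; rewrite /= in_itv/= ?s0.
  have B' : ball ((0 : R), x) e (s, y).
    split => //=; rewrite /ball/= sub0r normrN ger0_norm//; exact: le_lt_trans st te.
  have h : `|u 0 x w - u s y w| < 1 := he (s, y) B' A'.
  by move: h; rewrite (z x x01) sub0r normrN => /ltW.
move=> h1 h2; have {h1 h2} := h2 h1.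
rewrite near_withinE => /nbhs_ballP[e /= ep he].
have [k hk] : exists k : nat, k.+1%:R^-1 < e.
  exists (Num.bound e^-1); have hb : e^-1 < (Num.bound e^-1)%:R by apply: archi_boundP; rewrite invr_ge0 ltW.
  rewrite -[ltRHS]invrK ltf_pV2 ?posrE ?invr_gt0//; apply: (lt_trans hb); by rewrite ltr_nat.
exists k => s y sk y01.
have k0 : 0 < k.+1%:R^-1 :> R by rewrite invr_gt0.
apply: (he k.+1%:R^-1) => //=.
by rewrite /ball/= sub0r normrN gtr0_norm.
Qed.

(** The time up to which |u| <= 1 is random but almost surely positive, so some deterministic [T]
    works with positive probability. *)
Lemma exists_lambda : exists (T : R) (L : set Omega), [/\ 0 < T <= 1, measurable L, (0 < P L)%E &
  forall w, L w -> good_path w /\ bounded_on u T 1 w].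
Proof.
have [G [mG PG hG]] := exists_good.
pose L k : set Omega := G `&` rat_bounded (k.+1%:R^-1) 1 1.
have mL k : measurable (L k) by apply: measurableI => //; exact: measurable_rat_bounded.
have [k Lk] : exists k, (0 < P (L k))%E.
  apply: contrapT => /forallNP h.
  have z k : P (L k) = 0%E by apply/eqP; rewrite eq_le measure_ge0 andbT leNgt; apply/negP/h.
  have : P.-negligible (\bigcup_k L k) by apply: negligible_bigcup => k; exists (L k); split; [exact: mL|exact: z|].
  move=> [A [mA PA sA]].
  have : (P G <= P A)%E.
    apply: prob_le => // w Gw; apply: sA; have [k hk] := good_small (hG w Gw).
    exists k => //; split => // q q' h1 h2; exact: hk.
  by rewrite PG PA lee_fin ler10.
have k0 : 0 < k.+1%:R^-1 :> R by rewrite invr_gt0.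
exists (k.+1%:R^-1), (L k); split => //.
  by rewrite k0 invf_le1// ler1n.
move=> w [Gw rw]; split; first exact: hG.
move=> s y sT y01; apply: (rat_bounded_all k0 _ (hG w Gw).1 rw) => //.
by rewrite ltr01 lexx.
Qed.

(** Parabolic grid of scale 4^-j: mesh 4^(-4j) in time and 4^(-2j) in space, so that the field
    varies by order 4^-j across a cell. The parent of an index is its quotient by 4^4 in time and by
    4^2 in space. *)
Definition tq (j a : nat) : R := a%:R * (4^-1) ^+ (4 * j).
Definition xq (j b : nat) : R := b%:R * (4^-1) ^+ (2 * j).

Lemma q4_gt0 n : 0 < (4^-1 : R) ^+ n. Proof. by rewrite exprn_gt0. Qed.

Lemma tq_ge0 j a : 0 <= tq j a. Proof. by rewrite mulr_ge0// ltW// q4_gt0. Qed.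
Lemma xq_ge0 j a : 0 <= xq j a. Proof. by rewrite mulr_ge0// ltW// q4_gt0. Qed.

Lemma expn4_q (m : nat) : (4 ^ m)%:R * (4^-1 : R) ^+ m = 1.
Proof. by rewrite natrX -exprMn mulfV ?expr1n// pnatr_eq0. Qed.

Lemma tq_le1 j a : (a <= 4 ^ (4 * j))%N -> tq j a <= 1.
Proof. by move=> h; rewrite -(expn4_q (4 * j)) ler_wpM2r ?ler_nat// ltW// q4_gt0. Qed.

Lemma xq_le1 j b : (b <= 4 ^ (2 * j))%N -> xq j b <= 1.
Proof. by move=> h; rewrite -(expn4_q (2 * j)) ler_wpM2r ?ler_nat// ltW// q4_gt0. Qed.

Lemma tq_parent j a : 0 <= tq j.+1 a - tq j (a %/ 4 ^ 4) <= (4^-1) ^+ (4 * j).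
Proof.
rewrite /tq {1 3}(divn_eq a (4 ^ 4)) natrD natrM mulnS exprD.
have e := expn4_q 4; set q4 : R := (4^-1) ^+ 4 in e *; set c : R := (4 ^ 4)%:R in e *.
have -> : ((a %/ 4 ^ 4)%:R * c + (a %% 4 ^ 4)%:R) * (q4 * (4^-1) ^+ (4 * j)) - (a %/ 4 ^ 4)%:R * (4^-1) ^+ (4 * j)
  = ((a %/ 4 ^ 4)%:R * (c * q4 - 1) + (a %% 4 ^ 4)%:R * q4) * (4^-1) ^+ (4 * j) by ring.
rewrite e subrr mulr0 add0r; have p := q4_gt0 (4 * j); have p4 : 0 < q4 by exact: q4_gt0.
apply/andP; split; first by rewrite !mulr_ge0//; exact: ltW.
apply: ler_piMl; first exact: ltW.
rewrite -[leRHS]e; apply: ler_wpM2r; first exact: ltW.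
by rewrite /c ler_nat ltnW// ltn_mod.
Qed.

Lemma xq_parent j b : 0 <= xq j.+1 b - xq j (b %/ 4 ^ 2) <= (4^-1) ^+ (2 * j).
Proof.
rewrite /xq {1 3}(divn_eq b (4 ^ 2)) natrD natrM mulnS exprD.
have e := expn4_q 2; set q4 : R := (4^-1) ^+ 2 in e *; set c : R := (4 ^ 2)%:R in e *.
have -> : ((b %/ 4 ^ 2)%:R * c + (b %% 4 ^ 2)%:R) * (q4 * (4^-1) ^+ (2 * j)) - (b %/ 4 ^ 2)%:R * (4^-1) ^+ (2 * j)
  = ((b %/ 4 ^ 2)%:R * (c * q4 - 1) + (b %% 4 ^ 2)%:R * q4) * (4^-1) ^+ (2 * j) by ring.
rewrite e subrr mulr0 add0r; have p := q4_gt0 (2 * j); have p4 : 0 < q4 by exact: q4_gt0.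
apply/andP; split; first by rewrite !mulr_ge0//; exact: ltW.
apply: ler_piMl; first exact: ltW.
rewrite -[leRHS]e; apply: ler_wpM2r; first exact: ltW.
by rewrite /c ler_nat ltnW// ltn_mod.
Qed.

Lemma parent_le j k a : (a <= 4 ^ (k * j.+1))%N -> (a %/ 4 ^ k <= 4 ^ (k * j))%N.
Proof.
by move=> h; rewrite -(@mulnK (4 ^ (k * j)) (4 ^ k)) ?expn_gt0// leq_div2r// -expnD addnC -mulnS.
Qed.

Lemma lee_twice (x : R) (A B : \bar R) : (A <= x%:E -> B <= x%:E ->
  2%:E * A + 2%:E * B <= (4 * x)%:E)%E.
Proof.
move=> hA hB; have -> : 4 * x = 2 * x + 2 * x by ring.
by rewrite (EFinD (2 * x)) (EFinM 2 x); apply: leeD; apply: lee_wpmul2l.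
Qed.

Lemma sqn_link j a b : (a <= 4 ^ (4 * j.+1))%N -> (b <= 4 ^ (2 * j.+1))%N ->
  (sqn (fun z => (gker (tq j.+1 a) (xq j.+1 b) z - gker (tq j (a %/ 4 ^ 4)) (xq j (b %/ 4 ^ 2)) z)%R)
    <= (4 * Kg * (4^-1) ^+ (2 * j))%:E)%E.
Proof.
move=> ha hb; have ha' := parent_le ha; have hb' := parent_le hb.
have /andP[t1 t2] := tq_parent j a; have /andP[x1 x2] := xq_parent j b.
set t := tq j.+1 a in t1 t2 *; set t' := tq j _ in t1 t2 *; set x := xq j.+1 b in x1 x2 *; set x' := xq j _ in x1 x2 *.
have mg := @measurable_gker R.
have H := @integral_sqr_le R _ _ (leb \x leb)%E _ _ (measurable_funB (mg t x) (mg t' x')) (measurable_funB (mg t x) (mg t' x)).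
have t01 : t <= 1 by exact: tq_le1.
have x01 : 0 <= x <= 1 by rewrite xq_ge0 xq_le1.
have x01' : 0 <= x' <= 1 by rewrite xq_ge0 xq_le1.
have t01' : 0 <= t' <= 1 by rewrite tq_ge0 tq_le1.
have k0 := @Kg_gt0 R.
have h1 := sqn_gker_time (tq_ge0 j (a %/ 4 ^ 4)) (_ : t' <= t) t01 x01.
have {}h1 : (sqn (fun z => (gker t x z - gker t' x z)%R) <= (Kg * (4^-1) ^+ (2 * j))%:E)%E.
  apply: (le_trans (h1 _)); first by rewrite -subr_ge0.
  rewrite lee_fin ler_pM2l//; have -> : (4^-1 : R) ^+ (2 * j) = Num.sqrt ((4^-1) ^+ (4 * j)).
    by rewrite (_ : 4 * j = (2 * j) * 2)%N ?exprM ?sqrtr_sqr ?ger0_norm// ?ltW ?q4_gt0// mulnAC.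
  exact: ler_wsqrtr.
have h2 : (sqn (fun z => (gker t' x z - gker t' x' z)%R) <= (Kg * (4^-1) ^+ (2 * j))%:E)%E.
  apply: (le_trans (sqn_gker_space t01' x01' x01)); rewrite lee_fin ler_pM2l//.
  by rewrite ger0_norm.
apply: (le_trans H).
rewrite -mulrA; apply: lee_twice; first exact: h1.
apply: le_trans h2; rewrite le_eqVlt; apply/orP; left; apply/eqP.
by apply: eq_integral => z _; congr ((_ ^+ 2)%:E) => /=; ring.
Qed.

(** The factor j + 1 over the natural size 4^-j makes each failure probability of order exp(-c
    (j+1)^2), which beats the roughly 4^(6(j+1)) links of the level. *)
Definition links_ok (T : R) (j0 : nat) (w : Omega) := forall j a b, (j0 <= j)%N ->
  (a <= 4 ^ (4 * j.+1))%N -> (b <= 4 ^ (2 * j.+1))%N -> tq j.+1 a <= T ->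
  `|u (tq j.+1 a) (xq j.+1 b) w - u (tq j (a %/ 4 ^ 4)) (xq j (b %/ 4 ^ 2)) w|
     <= j.+1%:R * (4^-1) ^+ j.

(** Completing the square bounds exp((L + 1) x - c x^2), which leaves exp(-x) to be summed
    geometrically. *)
Lemma summable_gauss (c L K : R) : 0 < c -> 0 <= L -> 0 <= K ->
  (\sum_(0 <= j <oo) (K * (L ^+ j.+1 * expR (- (c * j.+1%:R ^+ 2))))%:E < +oo)%E.
Proof.
move=> c0 L0 K0; pose M := expR ((L + 1) ^+ 2 / (4 * c)).
have bd j : K * (L ^+ j.+1 * expR (- (c * j.+1%:R ^+ 2))) <= K * (M * 2^-1 ^+ j.+1).
  apply: ler_wpM2l => //; set x : R := j.+1%:R.
  have e1 : L ^+ j.+1 <= expR (L * x).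
    rewrite expRM_natr; apply: lerXn2r; rewrite ?nnegrE ?expR_ge0//.
    by have := expR_ge1Dx L; lra.
  have e2 : expR (- x) <= 2^-1 ^+ j.+1 :> R.
    have -> : - x = -1 * x by rewrite mulN1r.
    rewrite /x expRM_natr; apply: lerXn2r; rewrite ?nnegrE ?expR_ge0//.
    by have := @expNR_le R 1 ler01; rewrite (_ : (1 + 1)^-1 = 2^-1).
  apply: (@le_trans _ _ (expR (L * x) * expR (- (c * x ^+ 2)))); first by rewrite ler_wpM2r ?expR_ge0.
  apply: (@le_trans _ _ (M * expR (- x))); last by rewrite ler_wpM2l ?expR_ge0.
  rewrite /M -!expRD ler_expR -subr_ge0.
  have -> : (L + 1) ^+ 2 / (4 * c) + - x - (L * x + - (c * x ^+ 2)) = (2 * c * x - (L + 1)) ^+ 2 / (4 * c).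
    by field; rewrite gt_eqF.
  by rewrite mulr_ge0 ?sqr_ge0// invr_ge0 mulr_ge0// ltW.
apply: (@le_lt_trans _ _ (K * (M * 2))%:E); last by rewrite ltry.
apply: nneseries_bound => [j|n].
  by rewrite !mulr_ge0 ?expR_ge0 ?exprn_ge0.
apply: (@le_trans _ _ (\sum_(j < n) K * (M * 2^-1 ^+ j.+1))); first by apply: ler_sum.
rewrite -mulr_sumr -mulr_sumr; apply: ler_wpM2l => //; apply: ler_wpM2l; first exact: expR_ge0.
under eq_bigr do rewrite exprS; rewrite -mulr_sumr.
have h2 : 0 <= (2^-1 : R) < 1 by lra.
have := geometric_sum_le n h2; rewrite (_ : (1 - 2^-1)^-1 = 2); last by field.
lra.
Qed.

(** A Bernstein bound for each link up to time [T], a union bound over the level, then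
    Borel-Cantelli over the levels. *)
Lemma modulus (T : R) (L : set Omega) : 0 < T <= 1 -> measurable L ->
  (forall w, L w -> bounded_on u T 1 w) ->
  {ae P, forall w, L w -> exists j0, links_ok T j0 w}.
Proof.
move=> T01 mL hL; have T1 : T <= 1 by case/andP: T01.
have T0 : 0 <= T by case/andP: T01 => /ltW.
pose M := `|sigma 0| + D; have M0 : 0 <= M by rewrite addr_ge0.
have k0 := @Kg_gt0 R.
pose V j : R := (M ^+ 2 + 1) * (4 * Kg * (4^-1) ^+ (2 * j)).
have V0 j : 0 < V j by rewrite !mulr_gt0// ?q4_gt0// ltr_wpDl ?sqr_ge0.
pose c := (96 * (M ^+ 2 + 1) * Kg)^-1.
have c0 : 0 < c by rewrite invr_gt0 !mulr_gt0// ltr_wpDl ?sqr_ge0.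
pose I j := ('I_(4 ^ (4 * j.+1)).+1 * 'I_(4 ^ (2 * j.+1)).+1)%type.
pose dif j (i : I j) w := `|u (tq j.+1 i.1) (xq j.+1 i.2) w - u (tq j (i.1 %/ 4 ^ 4)) (xq j (i.2 %/ 4 ^ 2)) w|.
pose Ev j (i : I j) : set Omega := L `&` [set w | j.+1%:R * (4^-1) ^+ j <= dif j i w].
pose G j : pred (I j) := fun i => tq j.+1 i.1 <= T.
pose F j : set Omega := [set w | exists2 i : I j, G j i & Ev j i w].
have ia j (i : I j) : (i.1 <= 4 ^ (4 * j.+1))%N by rewrite -ltnS ltn_ord.
have ib j (i : I j) : (i.2 <= 4 ^ (2 * j.+1))%N by rewrite -ltnS ltn_ord.
have mu1 j (i : I j) : measurable_fun setT (u (tq j.+1 i.1) (xq j.+1 i.2)).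
  by apply: (measurable_u hu); rewrite ?tq_ge0// xq_ge0 xq_le1.
have mu2' j (i : I j) : measurable_fun setT (u (tq j (i.1 %/ 4 ^ 4)) (xq j (i.2 %/ 4 ^ 2))).
  by apply: (measurable_u hu); rewrite ?tq_ge0// xq_ge0 xq_le1// parent_le.
have mEv j (i : I j) : measurable (Ev j i).
  apply: measurableI => //; rewrite (_ : [set w | _] = [set w | ((j.+1%:R * (4^-1) ^+ j)%:E <= (dif j i w)%:E)%E]).
    by apply: measurable_ge_e; apply/measurable_EFinP; apply: measurableT_comp => //; exact: measurable_funB.
  by apply/seteqP; split => w /=; rewrite lee_fin.
have mF j : measurable (F j).
  rewrite (_ : F j = \bigcup_(i in [set i | G j i]) Ev j i); first by apply: fin_bigcup_measurable => [|i _]; [exact: finite_finset|exact: mEv].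
  by apply/seteqP; split => w [i h1 h2]; exists i.
have PE j (i : I j) : G j i -> (P (Ev j i) <= (2 * expR (- (c * j.+1%:R ^+ 2)))%:E)%E.
  move=> Gi; have -> : c * j.+1%:R ^+ 2 = (j.+1%:R * (4^-1) ^+ j) ^+ 2 / (24 * V j).
    rewrite /c /V exprMn -exprM mulnC; have q := q4_gt0 (2 * j); set y := (4^-1) ^+ _ in q *.
    have M1 : 0 < M ^+ 2 + 1 by rewrite ltr_wpDl ?sqr_ge0.
    by field; rewrite !gt_eqF.
  have /andP[t1 _] := tq_parent j i.1.
  apply: (bdiff hW D0 hLip hu mL hL) => //.
  - by rewrite tq_ge0.
  - by rewrite xq_ge0 xq_le1.
  - by rewrite tq_ge0; apply: le_trans Gi; rewrite -subr_ge0.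
  - by rewrite xq_ge0 xq_le1// parent_le.
  - apply: (@le_trans _ _ ((M ^+ 2)%:E * (4 * Kg * (4^-1) ^+ (2 * j))%:E)%E).
      by apply: lee_wpmul2l; [rewrite lee_fin sqr_ge0|exact: sqn_link].
    rewrite -EFinM lee_fin /V ler_wpM2r//; last by rewrite lerDl.
    by rewrite !mulr_ge0// ?(ltW k0)// ltW ?q4_gt0.
have PF j : (P (F j) <= (8 * ((4 ^ 6)%:R ^+ j.+1 * expR (- (c * j.+1%:R ^+ 2))))%:E)%E.
  apply: (@le_trans _ _ (\sum_(i | G j i) P (Ev j i))%E).
    by apply: finite_cover_prob => // w [i h1 h2]; exists i.
  apply: (@le_trans _ _ (\sum_(i | G j i) (2 * expR (- (c * j.+1%:R ^+ 2)))%:E)%E).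
    by apply: lee_sum => i; exact: PE.
  rewrite sumEFin lee_fin.
  apply: (@le_trans _ _ (\sum_(i : I j) (2 * expR (- (c * j.+1%:R ^+ 2))))).
    by rewrite big_mkcond/=; apply: ler_sum => i _; case: (G j i) => //; rewrite mulr_ge0 ?expR_ge0.
  rewrite sumr_const card_prod !card_ord -[leLHS]mulr_natr; set E := expR _.
  have E0 : 0 <= E by exact: expR_ge0.
  have -> : 8 * ((4 ^ 6)%:R ^+ j.+1 * E) = 2 * E * (4%:R * (4 ^ 6)%:R ^+ j.+1) by ring.
  apply: ler_wpM2l; first by rewrite mulr_ge0.
  rewrite -natrX -natrM ler_nat -expnM.
  have -> : (6 * j.+1 = 4 * j.+1 + 2 * j.+1)%N by rewrite -mulnDl.
  rewrite expnD; move: (expn_gt0 4 (4 * j.+1)) (expn_gt0 4 (2 * j.+1)); rewrite /=.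
  move: (4 ^ (4 * j.+1))%N (4 ^ (2 * j.+1))%N => p q p0 q0; nia.
have sumF : (\sum_(0 <= j <oo) P (F j) < +oo)%E.
  apply: le_lt_trans (summable_gauss (K := 8) (L := (4 ^ 6)%:R) c0 _ _) => //.
  apply: lee_nneseries => // j _; exact: PF.
have := lim_sup_set_cvg0 mF sumF => z.
exists (lim_sup_set F); split => //.
  by apply: bigcapT_measurable => n; apply: bigcup_measurable => j _.
move=> w /= /not_implyP[Lw /forallNP h] n _.
have := h n; rewrite /links_ok => /existsNP[j] /existsNP[a] /existsNP[b].
move=> /not_implyP[nj] /not_implyP[ha] /not_implyP[hb] /not_implyP[hT] /negP.
rewrite -ltNge => lt; exists j => //.
have ha' : (a < (4 ^ (4 * j.+1)).+1)%N by [].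
have hb' : (b < (4 ^ (2 * j.+1)).+1)%N by [].
by exists (Ordinal ha', Ordinal hb') => //; split => //; exact: ltW.
Qed.

End modulus.

(** * Chaining from the grid to all points *)

Section chaining.
Context {R : realType} {d : measure_display} {Omega : measurableType d}.
Variable u : R -> R -> Omega -> R.

(** A closed form dominating the sum of (j + 1) 4^-j over j >= N. *)
Definition tailB (N : nat) : R := 4 * N.+1%:R * (4^-1) ^+ N.

Lemma tailB_ge0 N : 0 <= tailB N.
Proof. by rewrite !mulr_ge0// ltW// q4_gt0. Qed.

Lemma tailB_step N : N.+1%:R * (4^-1) ^+ N + tailB N.+1 <= tailB N.
Proof.
rewrite /tailB exprS -subr_ge0 -(natr1 N.+1).
have -> : 4 * N.+1%:R * 4^-1 ^+ N - (N.+1%:R * 4^-1 ^+ N + 4 * (N.+1%:R + 1) * (4^-1 * 4^-1 ^+ N))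
  = (2 * N.+1%:R - 1) * 4^-1 ^+ N :> R by field.
apply: mulr_ge0; last by rewrite ltW// q4_gt0.
have : 1 <= N.+1%:R :> R by rewrite ler1n.
lra.
Qed.

Lemma chain_bound T j0 w N m a b : links_ok u T j0 w -> (j0 <= N)%N ->
  (a <= 4 ^ (4 * (N + m)))%N -> (b <= 4 ^ (2 * (N + m)))%N -> tq (N + m) a <= T ->
  `|u (tq (N + m) a) (xq (N + m) b) w - u (tq N (a %/ 4 ^ (4 * m))) (xq N (b %/ 4 ^ (2 * m))) w|
    <= tailB N - tailB (N + m).
Proof.
move=> lk jN; elim: m a b => [|m IH] a b ha hb hT.
  by rewrite addn0 !muln0 !divn1 subrr normr0 subrr.
rewrite addnS in ha hb hT *.
have ha' := parent_le ha; have hb' := parent_le hb.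
have hT' : tq (N + m) (a %/ 4 ^ 4) <= T.
  by apply: le_trans hT; have /andP[+ _] := @tq_parent R (N + m) a; rewrite subr_ge0.
have h1 := lk (N + m)%N a b (leq_trans jN (leq_addr _ _)) ha hb hT.
have h2 := IH _ _ ha' hb' hT'; rewrite -!divnMA -!expnD -!mulnS in h2.
apply: (le_trans (ler_distD (u (tq (N + m) (a %/ 4 ^ 4)) (xq (N + m) (b %/ 4 ^ 2)) w) _ _)).
have := tailB_step (N + m); lra.
Qed.

Lemma grid_floor (s : R) k : 0 <= s -> exists a : nat,
  a%:R * (4^-1) ^+ k <= s < a.+1%:R * (4^-1) ^+ k.
Proof.
move=> s0; have q := @q4_gt0 R k.
have s0' : 0 <= s / (4^-1) ^+ k by rewrite divr_ge0// ltW.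
exists (Num.truncn (s / (4^-1) ^+ k)); have /andP[h1 h2] := truncn_itv s0'.
by rewrite -ler_pdivlMr// h1 -ltr_pdivrMr.
Qed.

Lemma q4_small (e : R) : 0 < e -> exists m, forall k, (m <= k)%N -> (4^-1) ^+ k < e.
Proof.
move=> e0; exists (Num.bound e^-1) => k hk.
have hb : e^-1 < (Num.bound e^-1)%:R by apply: archi_boundP; rewrite invr_ge0 ltW.
rewrite exprVn -[ltRHS]invrK ltf_pV2 ?posrE ?invr_gt0 ?exprn_gt0//; apply: (lt_le_trans hb).
apply: (@le_trans _ _ k%:R); first by rewrite ler_nat.
by rewrite -natrX ler_nat ltnW// ltn_expl.
Qed.

Lemma grid_near (s S e : R) N k0 : 0 <= s -> s <= S -> S <= 1 -> 0 < e -> (0 < k0)%N ->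
  exists M, forall m, (M <= m)%N -> exists a : nat, [/\ a%:R * (4^-1) ^+ (k0 * (N + m)) <= s,
    (a <= 4 ^ (k0 * (N + m)))%N & `|s - a%:R * (4^-1) ^+ (k0 * (N + m))| < e].
Proof.
move=> s0 sS S1 e0 hk; have [M hM] := q4_small e0; exists M => m Mm.
have [a /andP[h1 h2]] := grid_floor (k0 * (N + m)) s0; exists a.
have q := @q4_gt0 R (k0 * (N + m)).
have hq : (4^-1) ^+ (k0 * (N + m)) < e.
  by apply: hM; apply: (leq_trans Mm); apply: (leq_trans (leq_addl N m)); rewrite leq_pmull.
split => //.
  rewrite -(ler_nat R) -(ler_pM2r q) expn4_q; exact: le_trans h1 (le_trans sS S1).
rewrite ger0_norm ?subr_ge0//; move: h2; rewrite -natr1 mulrDl mul1r; lra.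
Qed.

(** Every point is a limit of finer grid points obtained by rounding down. Their ancestors at level
    [N] fall in the listed index range, and chaining back to them costs [tailB N]. *)
Lemma grid_sup T j0 w N A Bd (S X c : R) : good_path u w -> links_ok u T j0 w -> (j0 <= N)%N ->
  S <= T -> S <= 1 -> S < tq N A -> 0 <= X <= 1 -> X < xq N Bd ->
  (forall a b, (a < A)%N -> (b < Bd)%N -> (a <= 4 ^ (4 * N))%N -> (b <= 4 ^ (2 * N))%N ->
     `|u (tq N a) (xq N b) w| <= c) ->
  forall s y, 0 <= s <= S -> 0 <= y <= X -> `|u s y w| <= c + tailB N.
Proof.
move=> [cw _] lk jN ST S1 SA X01 XB hc.
pose Sg (s y : R) := exists m a b, [/\ s = tq (N + m) a, y = xq (N + m) b, s <= S, y <= X &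
  (a <= 4 ^ (4 * (N + m)))%N /\ (b <= 4 ^ (2 * (N + m)))%N].
apply: (dense_bound (S := Sg)) => //.
  move=> s y e /andP[s0 sS] /andP[y0 yX] e0; have /andP[X0 X1] := X01.
  have [M1 h1] := @grid_near s S e N 4 s0 sS S1 e0 isT.
  have [M2 h2] := @grid_near y X e N 2 y0 yX X1 e0 isT.
  have [a [a1 a2 a3]] := h1 (maxn M1 M2) (leq_maxl _ _).
  have [b [b1 b2 b3]] := h2 (maxn M1 M2) (leq_maxr _ _).
  exists (tq (N + maxn M1 M2) a), (xq (N + maxn M1 M2) b); split => //.
  - by exists (maxn M1 M2), a, b; split => //; [exact: le_trans a1 sS|exact: le_trans b1 yX].
  - exact: tq_ge0.
  - by rewrite xq_ge0 xq_le1.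
move=> s y [m [a [b [-> -> sS yX [ha hb]]]]].
have h1 := chain_bound lk jN ha hb (le_trans sS ST).
have aA : (a %/ 4 ^ (4 * m) < A)%N.
  rewrite ltn_divLR ?expn_gt0// -(ltr_nat R).
  rewrite -(ltr_pM2r (@q4_gt0 R (4 * (N + m)))); apply: (le_lt_trans sS); apply: (lt_le_trans SA).
  by rewrite natrM mulnDr exprD mulrACA expn4_q mulr1.
have bB : (b %/ 4 ^ (2 * m) < Bd)%N.
  rewrite ltn_divLR ?expn_gt0// -(ltr_nat R).
  rewrite -(ltr_pM2r (@q4_gt0 R (2 * (N + m)))); apply: (le_lt_trans yX); apply: (lt_le_trans XB).
  by rewrite natrM mulnDr exprD mulrACA expn4_q mulr1.
have ha' : (a %/ 4 ^ (4 * m) <= 4 ^ (4 * N))%N.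
  by rewrite -(@mulnK (4 ^ (4 * N)) (4 ^ (4 * m))) ?expn_gt0// leq_div2r// -expnD -mulnDr.
have hb' : (b %/ 4 ^ (2 * m) <= 4 ^ (2 * N))%N.
  by rewrite -(@mulnK (4 ^ (2 * N)) (4 ^ (2 * m))) ?expn_gt0// leq_div2r// -expnD -mulnDr.
have h2 := hc _ _ aA bB ha' hb'; have := tailB_ge0 (N + m).
set U := u (tq (N + m) a) (xq (N + m) b) w in h1 *; set U' := u _ _ w in h1 h2.
by have := ler_normD (U - U') U'; rewrite subrK; lra.
Qed.

(** Up to time 4^(-4(n+1)) every ancestor at level [n] has time index 0, where u vanishes; only the
    chaining cost remains. *)
Lemma small_bound T j0 w n : good_path u w -> links_ok u T j0 w -> (j0 <= n)%N ->
  (4^-1) ^+ (4 * n.+1) <= T -> bounded_on u ((4^-1) ^+ (4 * n.+1)) (tailB n) w.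
Proof.
move=> gw lk jn hT s y hs hy; rewrite -[leRHS]add0r.
have lt1 : (4^-1 : R) < 1 by rewrite invf_lt1// ltr1n.
apply: (grid_sup (A := 1) (Bd := (4 ^ (2 * n)).+1) (S := (4^-1) ^+ (4 * n.+1)) (X := 1) gw lk jn) => //.
- by rewrite exprn_ile1// ltW.
- by rewrite /tq mul1r ltr_iXn2l// ltn_pmul2l.
- by rewrite ler01 lexx.
- by rewrite /xq -natr1 mulrDl expn4_q mul1r ltrDl q4_gt0.
- move=> [|//] b _ hb _ hb'; rewrite /tq mul0r (gw.2 (xq n b)) ?normr0//.
  by rewrite xq_ge0 xq_le1.
Qed.

End chaining.

(** * The lower bound *)

Section gauss_step.
Context {R : realType} {d : measure_display} {Omega : measurableType d}.
Context (P : probability Omega R) (W : set (R * R) -> Omega -> R).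
Hypothesis hW : white_noise P W.
Notation leb := (@lebesgue_measure R).
Implicit Types (l : seq (R * set (R * R))).

(** Length 2 h times the peak of the density; sqrt(2 pi) >= 2 absorbs the 2. *)
Lemma wsum_interval l (a h v : R) : step_ok l -> 0 < v -> v <= step_var l -> 0 <= h ->
  (P [set w | (a - h < wsum W l w <= a + h)%R] <= (h / Num.sqrt v)%:E)%E.
Proof.
move=> ok v0 vl h0.
have s0 : 0 < step_var l by exact: lt_le_trans vl.
pose J : set R := `]a - h, a + h]%classic; have mB : measurable J by exact: measurable_itv.
rewrite (_ : [set w | _] = [set w | J (wsum W l w)]); last first.
  by apply/seteqP; split => w /=; rewrite /J /= in_itv.
rewrite (wsum_law hW ok mB) /centered_normal gt_eqF// /normal_prob.
set s := Num.sqrt (step_var l); have s1 : 0 < s by rewrite sqrtr_gt0.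
apply: (@le_trans _ _ (\int[leb]_(x in J) (normal_peak s)%:E)%E).
  apply: ge0_le_integral => //.
  - by move=> x _; rewrite lee_fin normal_pdf_ge0.
  - apply: measurable_funTS; apply/measurable_EFinP; exact: measurable_normal_pdf.
  - by move=> x _; rewrite lee_fin normal_pdf_ub// gt_eqF.
have eJ : @lebesgue_measure R `]a - h, a + h]%classic = (2 * h)%:E.
  rewrite lebesgue_measure_itv/= lte_fin; case: ifPn => [_|]; first by rewrite -EFinD; congr EFin; ring.
  by rewrite -leNgt => ah; congr EFin; lra.
rewrite integral_cst// [X in (_ * X)%E](_ : _ = (2 * h)%:E); last exact: eJ.
have sv : 0 < Num.sqrt v by rewrite sqrtr_gt0.
rewrite -EFinM lee_fin.
have e : Num.sqrt v * 2 <= Num.sqrt (s ^+ 2 * pi *+ 2).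
  have e2 : 2 = Num.sqrt 4 :> R by rewrite (_ : 4 = 2 ^+ 2) ?sqrtr_sqr ?ger0_norm//; ring.
  rewrite [X in _ * X]e2 -sqrtrM; last exact: ltW.
  apply: ler_wsqrtr; rewrite sqr_sqrtr; last exact: ltW.
  rewrite -[leRHS]mulr_natr -mulrA.
  have p2 : 4 <= pi * 2 :> R by have := @pi_ge2 R; lra.
  by apply: ler_pM => //; exact: ltW.
rewrite /normal_peak; set q := Num.sqrt (s ^+ 2 * pi *+ 2) in e *.
have q0 : 0 < q by apply: lt_le_trans e; rewrite mulr_gt0.
rewrite ler_pdivlMr// -mulrA ler_pdivrMl//.
have := ler_wpM2l h0 e; lra.
Qed.

Lemma indep_boxes (I : finType) (L : I -> seq (R * set (R * R))) (a b : I -> R) (q : R) (r : seq I) :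
  (forall i, step_ok (L i)) -> (forall i k, i != k -> step_cov (L i) (L k) = 0) -> 0 <= q ->
  (forall i, P [set w | (a i < wsum W (L i) w <= b i)%R] <= q%:E)%E -> uniq r ->
  (P [set w | forall i, i \in r -> (a i < wsum W (L i) w <= b i)%R] <= (q ^+ size r)%:E)%E.
Proof.
move=> ok cv q0 hq; elim: r => [_|i r IH /= /andP[ir ur]].
  by rewrite (_ : [set w | _] = setT) ?probability_setT//; apply/seteqP; split.
pose L1 (_ : unit) := L i; pose L2 (j : seq_sub r) := L (ssval j).
have c0 (x : unit) (j : seq_sub r) : step_cov (L1 x) (L2 j) = 0.
  by apply: cv; apply: contraNneq ir => ->; exact: ssvalP.
pose S1 : set Omega := [set w | forall x : unit, (a i < wsum W (L1 x) w <= b i)%R].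
pose S2 : set Omega := [set w | forall j : seq_sub r, (a (ssval j) < wsum W (L2 j) w <= b (ssval j))%R].
have H : P (S1 `&` S2) = (P S1 * P S2)%E.
  exact: (block_indep hW (L := L1) (L' := L2) (fun _ => ok i) (fun j => ok _)
    (fun _ => a i) (fun _ => b i) (fun j => a (ssval j)) (fun j => b (ssval j)) c0).
have e1 : S1 = [set w | (a i < wsum W (L i) w <= b i)%R].
  by apply/seteqP; split => w /= h; [exact: h tt|move=> []].
have e2 : S2 = [set w | forall i, i \in r -> (a i < wsum W (L i) w <= b i)%R].
  apply/seteqP; split => w /= h; last by move=> j; exact: h (ssvalP j).
  by move=> j jr; exact: h (SeqSub jr).
rewrite e1 e2 in H.
rewrite (_ : [set w | _] = [set w | (a i < wsum W (L i) w <= b i)%R] `&`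
    [set w | forall i, i \in r -> (a i < wsum W (L i) w <= b i)%R]); last first.
  apply/seteqP; split => w /=.
    by move=> h; split; [apply: h; rewrite mem_head|move=> j jr; apply: h; rewrite inE jr orbT].
  by move=> [h1 h2] j; rewrite inE => /orP[/eqP ->//|]; exact: h2.
by rewrite H exprS EFinM; apply: lee_pmul => //; exact: IH.
Qed.

Lemma int_cell (x e : R) : 0 < e -> exists z : int, z%:~R * e < x <= (z + 1)%:~R * e.
Proof.
move=> e0; exists (Num.ceil (x / e) - 1).
have /andP[h1 h2] := Num.Theory.ceil_itv (x / e).
by rewrite subrK -ltr_pdivlMr// h1 -ler_pdivrMr.
Qed.

Lemma int_cell_inj (x e : R) (z z' : int) : 0 < e -> z%:~R * e < x <= (z + 1)%:~R * e ->
  z'%:~R * e < x <= (z' + 1)%:~R * e -> z = z'.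
Proof.
move=> e0 /andP[h1 h2] /andP[h3 h4].
have := lt_le_trans h1 h4; have := lt_le_trans h3 h2.
rewrite !ltr_pM2r// !ltr_int !ltzD1 => h5 h6.
by apply/eqP; rewrite eq_le h5 h6.
Qed.

(** Maximum principle: in the row of the largest |x k| the off-diagonal part is at most half of
    it. *)
Lemma dominant_inv (I : finType) (c : I -> I -> R) (x : I -> R) (h : R) :
  (forall i, c i i = 1) -> (forall i, \sum_(k | k != i) `|c i k| <= 2^-1) ->
  (forall i, `|\sum_k c i k * x k| <= h) -> forall k, `|x k| <= 2 * h.
Proof.
move=> c1 cd hx k.
case: (@arg_maxP _ R I k predT (fun k => `|x k|) isT) => i _ hi.
apply: (@le_trans _ _ `|x i|); first exact: hi.
have := hx i; rewrite (bigD1 i)//= c1 mul1r => h1.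
have h2 : `|\sum_(j | j != i) c i j * x j| <= 2^-1 * `|x i|.
  apply: (le_trans (ler_norm_sum _ _ _)).
  apply: (@le_trans _ _ (\sum_(j | j != i) `|c i j| * `|x i|)).
    by apply: ler_sum => j _; rewrite normrM ler_wpM2l//; exact: hi.
  by rewrite -mulr_suml ler_wpM2r.
have := lerB_normD (x i) (\sum_(j | j != i) c i j * x j); lra.
Qed.

Variables (I J : finType) (X : J -> seq (R * set (R * R))) (aJ bJ : J -> R).
Variables (H psi : I -> seq (R * set (R * R))) (v eta : R).
Hypotheses (okX : forall j, step_ok (X j)) (okH : forall i, step_ok (H i)) (okP : forall i, step_ok (psi i)).
Hypotheses (v0 : 0 < v) (eta0 : 0 < eta).
Hypothesis orth : forall i k, i != k -> step_cov (psi i) (psi k) = 0.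
Hypothesis past : forall j k, step_cov (X j) (psi k) = 0.
Hypothesis diag : forall i, step_cov (H i) (psi i) = step_var (psi i).
Hypothesis vle : forall i, v <= step_var (psi i).
Hypothesis dom : forall i, \sum_(k | k != i) `|step_cov (H i) (psi k) / step_var (psi k)| <= 2^-1.

Let A : set Omega := [set w | forall j, (aJ j < wsum W (X j) w <= bJ j)%R].
Let B : set Omega := [set w | forall i, (- eta < wsum W (H i) w <= eta)%R].
Let c i k := step_cov (H i) (psi k) / step_var (psi k).
Let Rst i := H i ++ step_scale (-1) (step_lin (c i) psi).

(* [A] constrains the past and [psi] is the fresh noise.  The part of [H]
   orthogonal to [psi] is cut into countably many cells; on each cell diagonal
   dominance confines every [psi i] to an interval of length of order [eta]. *)
Lemma gauss_step : (P (A `&` B) <= ((7 * eta / Num.sqrt v) ^+ #|I|)%:E * P A)%E.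
Proof.
have vp i : 0 < step_var (psi i) by exact: lt_le_trans (vle i).
have okR i : step_ok (Rst i).
  by apply: step_ok_cat => //; apply: step_ok_scale; exact: step_ok_lin.
have covR i k : step_cov (Rst i) (psi k) = 0.
  rewrite step_cov_catl step_cov_scalel step_cov_linl (bigD1 k)//= big1 => [|m mk].
    by rewrite addr0 /c -/(step_var (psi k)) divfK ?mulN1r ?subrr// gt_eqF.
  by rewrite orth ?mulr0.
have wR i w : wsum W (Rst i) w = wsum W (H i) w - \sum_k c i k * wsum W (psi k) w.
  by rewrite wsum_cat wsum_scale wsum_lin mulN1r.
pose LL (m : J + I) := match m with inl j => X j | inr i => Rst i end.
have okLL m : step_ok (LL m) by case: m.
pose aa (z : {ffun I -> int}) (m : J + I) := match m with inl j => aJ j | inr i => (z i)%:~R * eta end.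
pose bb (z : {ffun I -> int}) (m : J + I) := match m with inl j => bJ j | inr i => (z i + 1)%:~R * eta end.
pose Az z : set Omega := [set w | forall m, (aa z m < wsum W (LL m) w <= bb z m)%R].
have mbox (K : finType) (L : K -> seq (R * set (R * R))) a b : (forall k, step_ok (L k)) ->
  measurable [set w | forall k, (a k < wsum W (L k) w <= b k)%R].
  by move=> ok; apply: measurable_box => k; exact: (measurable_wsum hW).
have mAz z : measurable (Az z) by exact: mbox.
have mA : measurable A by exact: mbox.
have mB : measurable B by exact: mbox.
have sv : 0 < Num.sqrt v by rewrite sqrtr_gt0.
set q := 7 * eta / Num.sqrt v; have q0 : 0 <= q by rewrite divr_ge0 ?mulr_ge0 ?ltW.
have step z : (P (Az z `&` B) <= (q ^+ #|I|)%:E * P (Az z))%E.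
  have [e|/set0P[w0 [Aw0 Bw0]]] := eqVneq (Az z `&` B) set0.
    by rewrite e measure0; apply: mule_ge0 => //; rewrite lee_fin exprn_ge0.
  (* The intervals are centred at a reference outcome of the cell. Two outcomes differ by 2 eta in
     [H] and by eta in the remainder, hence by 3 eta in the linear system and 6 eta after inversion;
     7 leaves room for half-open intervals. *)
  pose lo k := wsum W (psi k) w0 - 7 * eta; pose hi k := wsum W (psi k) w0 + 7 * eta.
  have sub : Az z `&` B `<=` [set w | forall k, (lo k < wsum W (psi k) w <= hi k)%R] `&` Az z.
    move=> w [Aw Bw]; split => // k.
    have := @dominant_inv I c (fun k => wsum W (psi k) w - wsum W (psi k) w0) (3 * eta) _ dom _ k.
    have c1 i : c i i = 1 by rewrite /c diag divff// gt_eqF.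
    have h3 i : `|\sum_k c i k * (wsum W (psi k) w - wsum W (psi k) w0)| <= 3 * eta.
      rewrite (_ : \sum_k _ = \sum_k c i k * wsum W (psi k) w - \sum_k c i k * wsum W (psi k) w0); last first.
        by rewrite -sumrB; apply: eq_bigr => m _; rewrite mulrBr.
      have := wR i w; have := wR i w0.
      have /= /andP[r1 r2] := Aw (inr i); have /= /andP[r3 r4] := Aw0 (inr i).
      have /andP[b1 b2] := Bw i; have /andP[b3 b4] := Bw0 i.
      rewrite rmorphD/= mulrDl mul1r in r2 r4 => e0 e1.
      by rewrite ler_norml; apply/andP; split; lra.
    move=> /(_ c1 h3); rewrite ler_norml /lo /hi => /andP[h4 h5].
    have e0 := eta0; move: h4 h5; set x1 := wsum W _ w; set x2 := wsum W _ w0 => h4 h5.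
    by apply/andP; split; lra.
  have mlo := mbox I psi lo hi okP.
  apply: (le_trans (prob_le _ _ _ sub)); [exact: measurableI|exact: measurableI|].
  have c0 i m : step_cov (psi i) (LL m) = 0.
    by rewrite step_covC; case: m => [j|k] /=; [exact: past|exact: covR].
  rewrite (block_indep hW okP okLL lo hi (aa z) (bb z) c0); apply: lee_wpmul2r => //.
  rewrite (_ : [set w | _] = [set w | forall i, i \in enum I -> (lo i < wsum W (psi i) w <= hi i)%R]); last first.
    by apply/seteqP; split => w /= h i; [move=> _|]; apply: h; rewrite mem_enum.
  rewrite cardE; apply: indep_boxes => //; last exact: enum_uniq.
  move=> i; apply: wsum_interval => //; first by rewrite mulr_ge0// ltW.
(* The cells, enumerated over all integer vectors, partition [A]; summing the cell estimate gives
   the claim. *)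
pose F (n : nat) : set Omega := match pickle_inv n with Some z => Az z | None => set0 end.
have mF n : measurable (F n) by rewrite /F; case: pickle_inv.
have FA : \bigcup_n F n = A.
  apply/seteqP; split => w.
    move=> [n _]; rewrite /F; case: pickle_inv => // z h j; exact: h (inl j).
  move=> Aw; have hz i := @int_cell (wsum W (Rst i) w) eta eta0.
  have [z hz'] := choice hz.
  exists (pickle [ffun i => z i]) => //; rewrite /F pickleK_inv => -[j|i] /=; first exact: Aw.
  by rewrite ffunE; exact: hz'.
have tF : trivIset setT F.
  apply/trivIsetP => n m _ _ nm; rewrite -subset0 => w []; rewrite /F.
  case En : (pickle_inv n) => [z|//]; case Em : (pickle_inv m) => [z'|//] h h'.
  have ez : z = z' by apply/ffunP => i; exact: int_cell_inj eta0 (h (inr i)) (h' (inr i)).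
  move/eqP: nm; apply; have := @pickle_invK {ffun I -> int} n; have := @pickle_invK {ffun I -> int} m.
  by rewrite En Em /= -ez => -> ->.
have -> : P A = (\sum_(n <oo) P (F n))%E by rewrite -FA; apply: measure_semi_bigcup => //; exact: bigcupT_measurable.
rewrite -nneseriesZl//.
apply: (@le_trans _ _ (\sum_(n <oo) P (F n `&` B))%E).
  apply: measure_sigma_subadditive => //.
  - by move=> n; exact: measurableI.
  - exact: measurableI.
  - by rewrite -setI_bigcupl FA.
apply: lee_nneseries => // n _; rewrite /F; case: pickle_inv => [z|]; first exact: step.
by rewrite set0I measure0 mule0.
Qed.

End gauss_step.

(** * Noise windows and their covariances *)

Section windows.
Context {R : realType}.
Notation leb := (@lebesgue_measure R).
Notation mu2 := (leb \x leb)%E.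
Implicit Types (l : seq (R * set (R * R))).

Lemma sqn_le (f g : R * R -> R) : measurable_fun setT f -> measurable_fun setT g ->
  (forall z, `|f z| <= `|g z|) -> (sqn f <= sqn g)%E.
Proof.
move=> mf mg h; apply: ge0_le_integral => //.
- by move=> z _; rewrite lee_fin sqr_ge0.
- by apply/measurable_EFinP; exact: measurable_funX.
- by apply/measurable_EFinP; exact: measurable_funX.
- move=> z _; rewrite lee_fin -(real_normK (num_real (f z))) -(real_normK (num_real (g z))).
  by rewrite ler_sqr ?nnegrE.
Qed.

Lemma sqn_indic (c : R) (U : set (R * R)) : measurable U ->
  (sqn (fun z => (c * \1_U z)%R) = (c ^+ 2)%:E * mu2 U)%E.
Proof.
move=> mU; rewrite /sqn.
under eq_integral => z _.
  rewrite (_ : (c * \1_U z) ^+ 2 = c ^+ 2 * \1_U z); last first.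
    by rewrite exprMn; congr (_ * _); rewrite indicE; case: (_ \in _); rewrite ?expr1n ?expr0n.
  rewrite (EFinM (c ^+ 2)).
  over.
rewrite ge0_integralZl; last 4 first.
- exact: measurableT.
- by apply/measurable_EFinP; exact: measurable_indic.
- by move=> z _; rewrite lee_fin.
- by rewrite lee_fin sqr_ge0.
by rewrite integral_indic// setIT.
Qed.

(** The most recent noise around [x], of duration th and width sqrt th: the parabolic cell in which
    the kernel is of order 1/sqrt th. *)
Definition win (th t x : R) : set (R * R) :=
  `]t - th, t]%classic `*` `[x - Num.sqrt th / 2, x + Num.sqrt th / 2]%classic.

Lemma measurable_win th t x : measurable (win th t x).
Proof. by apply: measurableX; exact: measurable_itv. Qed.

Lemma area_rect (a b a' b' : R) : a <= b -> a' <= b' ->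
  (mu2 (`]a, b]%classic `*` `[a', b']%classic) = ((b - a) * (b' - a'))%:E)%E.
Proof.
move=> ab ab'; rewrite product_measure1E//.
have e1 : @lebesgue_measure R `]a, b]%classic = (b - a)%:E.
  rewrite lebesgue_measure_itv/= lte_fin.
  by case: ltP => // ba; congr EFin; apply/eqP; rewrite eq_sym subr_eq0 eq_le ba ab.
have e2 : @lebesgue_measure R `[a', b']%classic = (b' - a')%:E.
  rewrite lebesgue_measure_itv/= lte_fin.
  by case: ltP => // ba; congr EFin; apply/eqP; rewrite eq_sym subr_eq0 eq_le ba ab'.
by rewrite EFinM; congr (_ * _)%E; [exact: e1|exact: e2].
Qed.

Lemma win_area th t x : 0 <= th -> (mu2 (win th t x) = (th * Num.sqrt th)%:E)%E.
Proof.
move=> th0; have s0 := sqrtr_ge0 th; rewrite area_rect; last 2 first.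
- by lra.
- by lra.
by congr EFin; field.
Qed.

(** Distances at most 1/2 keep the two neighbouring images at least 1/2 away. They contribute 32
    each to the constant and the remaining images 32, whence 96. *)
Lemma gker_win_far (th t x x' m : R) : 0 < m -> 0 < th -> th <= t ->
  (forall y, x' - Num.sqrt th / 2 <= y <= x' + Num.sqrt th / 2 -> m <= `|x - y| <= 2^-1) ->
  (sqn (fun z => (gker t x z * \1_(win th t x') z)%R) <=
    (Num.sqrt th * (th * (8 / m ^+ 2 + 96)) ^+ 2)%:E)%E.
Proof.
move=> m0 th0 tht hm; set K := 8 / m ^+ 2 + 96.
have K0 : 0 <= K by rewrite addr_ge0// divr_ge0// sqr_ge0.
have sth := sqrtr_ge0 th.
have mw := measurable_win th t x'.
have mg := @measurable_gker R t x.
apply: (@le_trans _ _ (sqn (fun z => ((Num.sqrt th * K) * \1_(win th t x') z)%R))).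
  apply: sqn_le.
  - by apply: measurable_funM => //; exact: measurable_indic.
  - by apply: measurable_funM => //; exact: measurable_indic.
  move=> z; rewrite indicE; have [|_] := boolP (z \in win th t x'); last by rewrite !mulr0.
  rewrite inE => -[/=]; rewrite !in_itv/= => /andP[z1 z2] hz; rewrite !mulr1.
  rewrite (ger0_norm (gker_ge0 t x z)) ger0_norm ?mulr_ge0//.
  have [nz|nz] := pselect (0 < z.1 < t /\ 0 <= z.2 <= 1); last first.
    by rewrite gker_out// mulr_ge0.
  case: z nz z1 z2 hz => s y /= [/andP[s0 st] y01] z1 z2 hz.
  rewrite gker_in ?s0//; have /andP[my y12] := hm y hz.
  have t0 : 0 < t - s by rewrite subr_gt0.
  have y1 : `|x - y| <= 1 by lra.
  apply: (le_trans (hk_bound t0 y1)).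
  have h1 := ge8_far t0 m0 my.
  have hh : 0 < 2^-1 :> R by [].
  have h2 : ge8 (t - s) (x - y + 1) <= 8 * (t - s) / 2^-1 ^+ 2.
    by apply: ge8_far => //; move: y12; rewrite ler_norml ler_normr => /andP[? ?]; apply/orP; left; lra.
  have h3 : ge8 (t - s) (x - y - 1) <= 8 * (t - s) / 2^-1 ^+ 2.
    by apply: ge8_far => //; move: y12; rewrite ler_norml ler_normr => /andP[? ?]; apply/orP; right; lra.
  have e4 : 8 * (t - s) / 2^-1 ^+ 2 = 32 * (t - s) :> R by field.
  rewrite e4 in h2 h3.
  have hb : bk (t - s) (x - y) <= (t - s) * K.
    have -> : (t - s) * K = 8 * (t - s) / m ^+ 2 + 96 * (t - s) by rewrite /K; ring.
    rewrite /bk; lra.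
  have st0 : 0 < Num.sqrt (t - s) by rewrite sqrtr_gt0.
  apply: (@le_trans _ _ ((Num.sqrt (t - s))^-1 * ((t - s) * K))).
    by rewrite ler_wpM2l// invr_ge0 ltW.
  rewrite mulrA ler_wpM2r//.
  rewrite -[X in _ * X](@sqr_sqrtr _ (t - s) (ltW t0)) expr2 mulrA mulVf ?gt_eqF// mul1r.
  by apply: ler_wsqrtr; lra.
rewrite sqn_indic// win_area; last exact: ltW.
rewrite -EFinM lee_fin.
by rewrite exprMn sqr_sqrtr ?(ltW th0)// !exprMn le_eqVlt; apply/orP; left; apply/eqP; ring.
Qed.

Lemma hk_ge_gk (t z : R) : 0 < t -> `|z| <= 1 -> gk t z <= heat_kernel t z.
Proof.
move=> t0 z1; rewrite hkE -lee_fin fineK; last first.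
  by rewrite ge0_fin_numE ?hk_fin//; apply: intsum_ge0 => k; exact: gk_ge0.
apply: esum_ge; exists [set 0%R]; last by rewrite fsbig_set1 addr0.
by split => //; exact: finite_set1.
Qed.

(** On the older half of the window the lag is between th/2 and th, and the central image alone is
    at least 1/(4 sqrt th). This gives sqrt th / 32. *)
Lemma gker_win_near (th t x : R) : 0 < th -> th <= t -> 0 <= x - Num.sqrt th / 2 -> x + Num.sqrt th / 2 <= 1 ->
  ((3 / 100 * Num.sqrt th)%:E <= sqn (fun z => (gker t x z * \1_(win th t x) z)%R))%E.
Proof.
move=> th0 tht hx1 hx2; have sth := sqrtr_ge0 th.
have sth0 : 0 < Num.sqrt th by rewrite sqrtr_gt0.
have mw := measurable_win th t x.
have mg := @measurable_gker R t x.
pose U : set (R * R) := `]t - th, t - th / 2]%classic `*` `[x - Num.sqrt th / 2, x + Num.sqrt th / 2]%classic.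
have mU : measurable U by apply: measurableX; exact: measurable_itv.
pose c := (4 * Num.sqrt th)^-1.
have c0 : 0 < c by rewrite invr_gt0 mulr_gt0.
apply: (@le_trans _ _ (sqn (fun z => (c * \1_U z)%R))).
  rewrite sqn_indic// area_rect; [|lra|lra].
  rewrite -EFinM lee_fin /c.
  have -> : (t - th / 2 - (t - th)) * (x + Num.sqrt th / 2 - (x - Num.sqrt th / 2)) = Num.sqrt th ^+ 2 / 2 * Num.sqrt th.
    by rewrite sqr_sqrtr ?(ltW th0)//; field.
  have -> : (4 * Num.sqrt th)^-1 ^+ 2 * (Num.sqrt th ^+ 2 / 2 * Num.sqrt th) = Num.sqrt th / 32.
    by field; rewrite gt_eqF.
  lra.
apply: sqn_le.
- by apply: measurable_funM => //; exact: measurable_indic.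
- by apply: measurable_funM => //; exact: measurable_indic.
move=> z; rewrite [X in `|c * X|]indicE; have [|_] := boolP (z \in U); last by rewrite mulr0 normr0.
rewrite inE => -[/=]; rewrite !in_itv/= => /andP[z1 z2] /andP[z3 z4]; rewrite mulr1.
have -> : \1_(win th t x) z = 1 :> R.
  rewrite indicE mem_set//; split; rewrite /= in_itv/=; first by rewrite z1/=; lra.
  by rewrite z3 z4.
rewrite mulr1 (ger0_norm (gker_ge0 t x z)) gtr0_norm//.
case: z z1 z2 z3 z4 => s y /= z1 z2 z3 z4.
rewrite gker_in; last 2 first.
- by apply/andP; split; lra.
- by apply/andP; split; lra.
have t0 : 0 < t - s by lra.
have y1 : `|x - y| <= Num.sqrt th / 2 by rewrite ler_norml; apply/andP; split; lra.
apply: le_trans (hk_ge_gk t0 _); last by lra.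
have y2 : (x - y) ^+ 2 <= th / 4.
  rewrite -(real_normK (num_real _)) (_ : th / 4 = (Num.sqrt th / 2) ^+ 2).
    by rewrite ler_sqr ?nnegrE//; lra.
  by rewrite exprMn sqr_sqrtr ?(ltW th0)//; field.
have e1 : 3 / 4 <= expR (- (x - y) ^+ 2 / (2 * (t - s))).
  have : - 4^-1 <= - (x - y) ^+ 2 / (2 * (t - s)).
    rewrite mulNr lerN2 ler_pdivrMr; lra.
  rewrite -(ler_expR (- 4^-1)) => h; apply: le_trans h; have := expR_ge1Dx (- 4^-1 : R); lra.
have p4 : pi <= 4 :> R.
  have [/andP[_ h] _] := pihalf_02_cos_pihalf R; lra.
have p0 := pi_ge0 R.
have e2 : Num.sqrt (2 * pi * (t - s)) <= 3 * Num.sqrt th.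
  have -> : 3 * Num.sqrt th = Num.sqrt (9 * th).
    by rewrite sqrtrM// (_ : 9 = 3 ^+ 2) ?sqrtr_sqr ?ger0_norm//; ring.
  apply: ler_wsqrtr.
  apply: (@le_trans _ _ (8 * th)); last by lra.
  by apply: ler_pM; rewrite ?mulr_ge0//; lra.
have e3 : 0 < Num.sqrt (2 * pi * (t - s)).
  by rewrite sqrtr_gt0 !mulr_gt0//; have := pi_ge2 R; lra.
rewrite /gk /c ler_pdivlMr// -ler_pdivlMl ?invr_gt0 ?mulr_gt0// invrK.
apply: (le_trans e2); apply: (@le_trans _ _ (4 * Num.sqrt th * (3 / 4))); first by lra.
by rewrite ler_pM2l// mulr_gt0.
Qed.

(** Telescoping on both sides of i, using 1/m^2 <= 2/m - 2/(m+1). *)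
Lemma inv_sqr_sum (K i : nat) : (i < K)%N ->
  \sum_(k < K | (k : nat) != i) ((if (k <= i)%N then (i - k)%:R else (k - i)%:R) ^- 2 : R) <= 4.
Proof.
move=> iK.
pose h (k : nat) : R := if (k <= i)%N then 2 / (i - k).+1%:R else 4 - 2 / (k - i)%:R.
have key (m : nat) : (0 < m)%N -> (m%:R ^- 2 : R) <= 2 / m%:R - 2 / m.+1%:R.
  move=> m0; have m1 : 1 <= m%:R :> R by rewrite ler1n.
  rewrite -(natr1 m) -subr_ge0; set x : R := m%:R in m1 *.
  have -> : 2 / x - 2 / (x + 1) - x ^- 2 = (x - 1) / (x ^+ 2 * (x + 1)).
    by field; rewrite !gt_eqF//; lra.
  by rewrite divr_ge0 ?mulr_ge0 ?sqr_ge0//; lra.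
apply: (@le_trans _ _ (\sum_(0 <= k < K) (h k.+1 - h k))); last first.
  rewrite telescope_sumr// /h leqNgt iK/=.
  by rewrite -addrA gerDl -opprD oppr_le0 addr_ge0 ?divr_ge0.
rewrite big_mkord big_mkcond/=; apply: ler_sum => k _; rewrite /h.
case: (ltngtP k i) => [ki|ik|->] /=.
- rewrite -subSn// subSS.
  have i0 : (0 < i - k)%N by rewrite subn_gt0.
  by have := key _ i0; rewrite -subSn ?(ltnW ki)//.
- have i0 : (0 < k - i)%N by rewrite subn_gt0.
  rewrite subSn; last exact: ltnW.
  have := key _ i0; move: (2 / _) (2 / _) (_ ^- 2) => p q r; lra.
- by rewrite subSn// subnn !divr1; have -> : 4 - 2 - 2 = 0 :> R by ring.
Qed.

Lemma cov_restrict l l' (U : set (R * R)) : measurable U -> step_ok l -> step_ok l' ->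
  step_cov l (step_restrict U l') = step_cov (step_restrict U l) (step_restrict U l').
Proof.
move=> mU ok ok'; have okU := step_restrict_ok mU ok; have okU' := step_restrict_ok mU ok'.
apply: EFin_inj.
have [_ <-] := stepf_prod_integral ok okU'; have [_ <-] := stepf_prod_integral okU okU'.
apply: eq_integral => z _; rewrite !stepf_restrict; congr EFin.
by rewrite indicE; case: (z \in U); rewrite ?mulr1 ?mulr0.
Qed.

Lemma cov_disjoint l l' : step_ok l -> step_ok l' -> (forall z, stepf l z * stepf l' z = 0) ->
  step_cov l l' = 0.
Proof.
move=> ok ok' h; apply: EFin_inj; have [_ <-] := stepf_prod_integral ok ok'.
by under eq_integral do rewrite h; rewrite integral0.
Qed.

(** Cauchy-Schwarz, as non-negativity of the variance of the regression residual. *)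
Lemma cov_sqr_le l l' : step_ok l -> step_ok l' -> 0 < step_var l' ->
  (step_cov l l' / step_var l') ^+ 2 <= step_var l / step_var l'.
Proof.
move=> ok ok' v0; set x := step_cov l l' / step_var l'.
have := step_var_ge0 (step_ok_cat ok (step_ok_scale (c := - x) ok')).
rewrite step_var_cat step_var_scale step_cov_scaler sqrrN => h.
rewrite ler_pdivlMr//; have e : step_cov l l' = x * step_var l' by rewrite /x divfK// gt_eqF.
by rewrite e in h; lra.
Qed.

End windows.

(** * Small ball probability of the Gaussian grid *)

Section gauss_grid.
Context {R : realType} {d : measure_display} {Omega : measurableType d}.
Context (P : probability Omega R) (W : set (R * R) -> Omega -> R).
Hypothesis hW : white_noise P W.
Notation leb := (@lebesgue_measure R).
Notation mu2 := (leb \x leb)%E.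
Implicit Types (l : seq (R * set (R * R))).

Lemma gauss_seq (K T : nat) (l psi : 'I_K -> 'I_T -> seq (R * set (R * R))) (v eta : R) :
  (forall i j, step_ok (l i j)) -> (forall i j, step_ok (psi i j)) -> 0 < v -> 0 < eta ->
  (forall i k j, i != k -> step_cov (psi i j) (psi k j) = 0) ->
  (forall i k (j j' : 'I_T), (j' < j)%N -> step_cov (l i j') (psi k j) = 0) ->
  (forall i j, step_cov (l i j) (psi i j) = step_var (psi i j)) ->
  (forall i j, v <= step_var (psi i j)) ->
  (forall i j, \sum_(k | k != i) `|step_cov (l i j) (psi k j) / step_var (psi k j)| <= 2^-1) ->
  (P [set w | forall (i : 'I_K) (j : 'I_T), (- eta < wsum W (l i j) w <= eta)%R]
    <= ((((7 * eta / Num.sqrt v) ^+ K) ^+ T)%:E))%E.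
Proof.
move=> okl okp v0 e0 orth past diag vle dom.
suff h m : (m <= T)%N -> (P [set w | forall (i : 'I_K) (j : 'I_T), (j < m)%N -> (- eta < wsum W (l i j) w <= eta)%R]
    <= ((((7 * eta / Num.sqrt v) ^+ K) ^+ m)%:E))%E.
  rewrite (_ : [set w | _] = [set w | forall (i : 'I_K) (j : 'I_T), (j < T)%N -> (- eta < wsum W (l i j) w <= eta)%R]).
    exact: h.
  by apply/seteqP; split => w /= H i j; [move=> _; exact: H|exact: H].
elim: m => [|m IH] mT.
  by rewrite expr0; rewrite (_ : [set w | _] = setT) ?probability_setT//; apply/seteqP; split.
pose X (p : 'I_K * {j : 'I_T | (j < m)%N}) := l p.1 (val p.2).
pose jm := Ordinal mT.
have H := gauss_step hW (X := X) (fun=> - eta) (fun=> eta) (H := fun i => l i jm) (psi := fun i => psi i jm)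
  (fun p => okl _ _) (fun i => okl _ _) (fun i => okp _ _) v0 e0 (fun i k => @orth i k jm)
  (fun p k => past p.1 k jm (val p.2) (valP p.2)) (fun i => diag i jm) (fun i => vle i jm) (fun i => dom i jm).
rewrite card_ord in H.
rewrite (_ : [set w | _] = [set w | forall p : 'I_K * {j : 'I_T | (j < m)%N}, (- eta < wsum W (X p) w <= eta)%R] `&`
   [set w | forall i : 'I_K, (- eta < wsum W (l i jm) w <= eta)%R]); last first.
  apply/seteqP; split => w /=.
    move=> h; split => [[i [j jm']]|i]; last exact: h i jm (ltnSn m).
    by apply: h; exact: ltnW.
  move=> [h1 h2] i j; rewrite ltnS leq_eqVlt => /orP[/eqP jE|jm']; last exact: h1 (i, exist _ j jm').
  by rewrite (_ : j = jm)//; exact: val_inj.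
apply: (le_trans H); rewrite exprS EFinM; apply: lee_wpmul2l.
  by rewrite lee_fin exprn_ge0// divr_ge0 ?sqrtr_ge0// mulr_ge0// ltW.
rewrite (_ : [set w | _] = [set w | forall (i : 'I_K) (j : 'I_T), (j < m)%N -> (- eta < wsum W (l i j) w <= eta)%R]).
  exact: IH (ltnW mT).
apply/seteqP; split => w /= h; first by move=> i j jm'; exact: h (i, exist _ j jm').
by move=> [i [j jm']]; exact: h.
Qed.

(** A spacing of 128 window widths makes the covariances diagonally dominant; the shift by 1/2 keeps
    the first window inside the circle. *)
Definition gx (th : R) (i : nat) : R := (i%:R + 2^-1) * (128 * Num.sqrt th).
Definition gtm (th : R) (j : nat) : R := j.+1%:R * th.

(** The fresh noise of a grid point is its step list restricted to its window. By restriction its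
    covariance with the whole list equals its own variance, disjoint windows are orthogonal, and the
    lists of earlier times end before the window opens. *)
Lemma gauss_grid (K T : nat) (th eta : R) (l : 'I_K -> 'I_T -> seq (R * set (R * R))) :
  (0 < K)%N -> 0 < th -> K%:R * (128 * Num.sqrt th) <= 2^-1 -> 0 < eta ->
  (forall (i : 'I_K) (j : 'I_T), rect_in 0 (gtm th j) (l i j)) ->
  (forall (i : 'I_K) (j : 'I_T), (l2d (gker (gtm th j) (gx th i)) (stepf (l i j)) <= (Num.sqrt th * th ^+ 2)%:E)%E) ->
  (P [set w | forall (i : 'I_K) (j : 'I_T), (- eta < wsum W (l i j) w <= eta)%R]
    <= ((((7 * eta / Num.sqrt (Num.sqrt th / 100)) ^+ K) ^+ T)%:E))%E.
Proof.
move=> K0 th0 Kl eta0 rl al; set s := Num.sqrt th in Kl *.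
have s0 : 0 < s by rewrite sqrtr_gt0.
have es : th = s ^+ 2 by rewrite sqr_sqrtr ?(ltW th0).
have K1 : 1 <= K%:R :> R by rewrite ler1n.
have s256 : s <= 256^-1.
  have : 1 * (128 * s) <= K%:R * (128 * s) by rewrite ler_wpM2r// mulr_ge0// ltW.
  lra.
have Kth : K%:R * th <= 256^-1 * 256^-1.
  rewrite es expr2 mulrA.
  by apply: ler_pM; rewrite ?mulr_ge0 ?(ltW s0)//; lra.
have th2 : th ^+ 2 <= 1000^-1.
  have t1 : th <= 256^-1 * 256^-1.
    by apply: le_trans Kth; rewrite ler_peMl// ltW.
  rewrite expr2; apply: (@le_trans _ _ ((256^-1 * 256^-1) * (256^-1 * 256^-1))); last by lra.
  by apply: ler_pM => //; exact: ltW.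
pose U (i : 'I_K) (j : 'I_T) := win th (gtm th j) (gx th i).
have mU i j : measurable (U i j) by exact: measurable_win.
pose psi (i : 'I_K) (j : 'I_T) := step_restrict (U i j) (l i j).
have tht j : th <= gtm th j by rewrite /gtm ler_peMl ?ler1n// ltW.
have t0 j : 0 < gtm th j by exact: lt_le_trans (tht j).
have okl (i : 'I_K) (j : 'I_T) : step_ok (l i j) by exact: step_in_ok (rect_step (lexx 0) (rl i j)).
have mst (i : 'I_K) (j : 'I_T) : measurable_fun setT (stepf (l i j)) by exact: measurable_stepf.
have okr (i k : 'I_K) (j : 'I_T) : step_ok (step_restrict (U k j) (l i j)) by exact: step_restrict_ok.
have xb (i : 'I_K) : s * 64 <= gx th i <= 2^-1 - s * 64.
  have i1 : (i.+1%:R : R) <= K%:R by rewrite ler_nat.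
  have : i.+1%:R * (128 * s) <= K%:R * (128 * s) by rewrite ler_wpM2r// mulr_ge0// ltW.
  have : 0 <= i%:R * (128 * s) by rewrite !mulr_ge0// ltW.
  by rewrite /gx -/s -(natr1 i); lra.
have mgw (i k : 'I_K) (j : 'I_T) : measurable_fun setT (fun z => gker (gtm th j) (gx th i) z * \1_(U k j) z).
  by apply: measurable_funM; [exact: measurable_gker|exact: measurable_indic].
have msw (i k : 'I_K) (j : 'I_T) : measurable_fun setT (fun z => stepf (l i j) z * \1_(U k j) z).
  by apply: measurable_funM => //; exact: measurable_indic.
have sv (i k : 'I_K) (j : 'I_T) : (sqn (fun z => (stepf (l i j) z * \1_(U k j) z)%R) = (step_var (step_restrict (U k j) (l i j)))%:E)%E.
  by rewrite -(step_varE (okr i k j)); apply: eq_integral => z _; rewrite stepf_restrict.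
have df (i k : 'I_K) (j : 'I_T) : (\int[mu2]_z ((gker (gtm th j) (gx th i) z * \1_(U k j) z - stepf (l i j) z * \1_(U k j) z) ^+ 2)%:E
    <= (s * th ^+ 2)%:E)%E.
  apply: le_trans (al i j); apply: ge0_le_integral => //.
  - by move=> z _; rewrite lee_fin sqr_ge0.
  - apply/measurable_EFinP; apply: measurable_funX; exact (measurable_funB (mgw i k j) (msw i k j)).
  - apply/measurable_EFinP; apply: measurable_funX.
    exact (measurable_funB (@measurable_gker R (gtm th j) (gx th i)) (mst i j)).
  - move=> z _; rewrite lee_fin -mulrBl exprMn indicE; case: (_ \in _); rewrite ?expr1n ?mulr1//.
    by rewrite expr0n mulr0 sqr_ge0.
have vle (i : 'I_K) (j : 'I_T) : s / 100 <= step_var (psi i j).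
  have h1 : 0 <= gx th i - s / 2 by have := xb i; lra.
  have h2 : gx th i + s / 2 <= 1 by have := xb i; lra.
  have a1 := gker_win_near th0 (tht j) h1 h2.
  have a2 := integral_sqr_le mu2 (mgw i i j) (msw i i j).
  have a3 : ((3 / 100 * s)%:E <= 2%:E * (step_var (psi i j))%:E + 2%:E * (s * th ^+ 2)%:E)%E.
    apply: (le_trans a1); apply: (le_trans a2); apply: leeD; apply: lee_wpmul2l => //.
    by rewrite -sv.
  move: a3; rewrite -!EFinM -EFinD lee_fin => a3.
  have : s * th ^+ 2 <= s * 1000^-1 by rewrite ler_pM2l.
  lra.
have sp : 0 < s / 100 by rewrite divr_gt0.
apply: (gauss_seq (psi := psi) (v := s / 100)) => //.
- by move=> i j; exact: okr.
- move=> i k j ik; apply: (cov_disjoint (okr i i j) (okr k k j)) => z; rewrite !stepf_restrict !indicE.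
  have [z1|] := boolP (z \in U i j); last by rewrite mulr0 mul0r.
  have [z2|] := boolP (z \in U k j); last by rewrite mulr0 mulr0.
  exfalso; move: z1 z2; rewrite !inE => -[_] /=; rewrite in_itv/= -/s => /andP[a1 a2] [_] /=.
  rewrite in_itv/= -/s => /andP[b1 b2].
  have : `|i%:R - k%:R : R| < 1.
    have : `|gx th i - gx th k| <= s by clear -hW a1 a2 b1 b2; rewrite ler_norml; apply/andP; split; lra.
    rewrite /gx -/s -mulrBl (_ : i%:R + 2^-1 - (k%:R + 2^-1) = i%:R - k%:R); last by ring.
    rewrite (normrM (i%:R - k%:R)) (gtr0_norm (_ : 0 < 128 * s)) ?mulr_gt0// => h.
    rewrite ltNge; apply/negP => h1.
    have : 1 * (128 * s) <= `|i%:R - k%:R| * (128 * s) by rewrite ler_wpM2r// mulr_ge0// ltW.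
    lra.
  have [ki|ik'] := leqP k i.
    rewrite -natrB// normr_nat -[X in _ < X]/(1%:R) ltr_nat ltnS leqn0 subn_eq0 => ik'.
    by move/eqP: ik; apply; apply/val_inj/eqP; rewrite eqn_leq ik' ki.
  rewrite distrC -natrB ?(ltnW ik')// normr_nat -[X in _ < X]/(1%:R) ltr_nat ltnS leqn0 subn_eq0 leqNgt ik'.
  by [].
- move=> i k j j' jj; apply: (cov_disjoint (okl i j') (okr k k j)) => z; rewrite stepf_restrict indicE.
  have [z2|] := boolP (z \in U k j); last by rewrite !mulr0.
  have [z1|z1] := boolP (z.1 <= gtm th j').
    exfalso; move: z2; rewrite inE => -[/=]; rewrite in_itv/= => /andP[h _] _.
    have : gtm th j' <= gtm th j - th.
      rewrite /gtm -(natr1 j) mulrDl mul1r addrK ler_wpM2r ?(ltW th0)//.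
      by rewrite ler_nat.
    lra.
  rewrite (_ : stepf (l i j') z = 0) ?mul0r//.
  rewrite /stepf big_seq big1// => p /(rl i j')[a [b [B [h1 h2 h3 _ ->]]]].
  rewrite indicE memNset ?mulr0// => -[/=]; rewrite in_itv/= => /andP[_ zb] _.
  by move/negP: z1; apply; exact: le_trans zb h3.
- move=> i j; exact: cov_restrict.
- move=> i j; have i0 := ltn_ord i.
  (* Windows at index distance d are at least 64 d s away, and 8 th / (64 d s)^2 = d^-2 / 512. The
     15 is chosen with 15^2 / 100 >= 2, which pays for the variance bound s / 100 and the factor 2
     of the splitting; 97 in place of 96 takes in the approximation error. *)
  pose c (k : 'I_K) : R := 15 * (512^-1 * ((if (k <= i)%N then (i - k)%:R else (k - i)%:R) ^- 2) + 97 * th).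
  have ck (k : 'I_K) : k != i -> `|step_cov (l i j) (psi k j) / step_var (psi k j)| <= c k.
    move=> ki; have vk := lt_le_trans sp (vle k j).
    pose dd : R := if (k <= i)%N then (i - k)%:R else (k - i)%:R.
    have d1 : 1 <= dd.
      rewrite /dd; case: leqP => h; last by rewrite ler1n subn_gt0.
      by rewrite ler1n subn_gt0 ltn_neqAle h andbT; apply: contra ki => /eqP h'; apply/eqP/val_inj.
    have dx : `|gx th i - gx th k| = dd * (128 * s).
      rewrite /gx -/s -mulrBl (_ : i%:R + 2^-1 - (k%:R + 2^-1) = i%:R - k%:R); last by ring.
      rewrite (normrM (i%:R - k%:R)) (gtr0_norm (_ : 0 < 128 * s)) ?mulr_gt0//; congr (_ * _).
      rewrite /dd; case: leqP => h; first by rewrite -natrB// normr_nat.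
      by rewrite distrC -natrB ?(ltnW h)// normr_nat.
    have dd2 : 0 <= dd ^- 2 by rewrite invr_ge0; exact: sqr_ge0.
    have c0 : 0 <= c k.
      by have := th0; rewrite /c -/dd; move: (dd ^- 2) dd2 => p p0 ?; lra.
    rewrite -(ger0_norm c0) -ler_sqr ?nnegrE// !real_normK ?num_real//.
    rewrite /psi (cov_restrict (mU k j) (okl i j) (okl k j)).
    apply: (le_trans (cov_sqr_le (okr i k j) (okr k k j) vk)).
    rewrite ler_pdivrMr//.
    apply: (@le_trans _ _ (c k ^+ 2 * (s / 100))); last by rewrite ler_wpM2l ?sqr_ge0//; exact: vle.
    have m0 : 0 < 64 * dd * s by rewrite !mulr_gt0//; lra.
    have hm y : gx th k - Num.sqrt th / 2 <= y <= gx th k + Num.sqrt th / 2 -> 64 * dd * s <= `|gx th i - y| <= 2^-1.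
      rewrite -/s => /andP[y1 y2]; have := xb i; have := xb k => xk xi.
      apply/andP; split; last by clear -hW y1 y2 xk xi s0; rewrite ler_norml; apply/andP; split; lra.
      have := ler_distD y (gx th i) (gx th k); rewrite dx => h.
      have h' : `|y - gx th k| <= s / 2 by clear -hW y1 y2; rewrite ler_norml; apply/andP; split; lra.
      have : 1 * s <= dd * s by rewrite ler_wpM2r// ltW.
      by clear -hW s0 h h'; lra.
    have a1 := gker_win_far m0 th0 (tht j) hm.
    have a2 := integral_sqr_le mu2 (msw i k j) (mgw i k j).
    have a3 : ((step_var (step_restrict (U k j) (l i j)))%:E <=
        2%:E * (s * (th * (8 / (64 * dd * s) ^+ 2 + 96)) ^+ 2)%:E + 2%:E * (s * th ^+ 2)%:E)%E.
      rewrite -sv; apply: (le_trans a2); apply: leeD; apply: lee_wpmul2l => //.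
      apply: le_trans (df i k j); rewrite le_eqVlt; apply/orP; left; apply/eqP.
      by apply: eq_integral => z _; rewrite -sqrrN opprB.
    move: a3; rewrite -!EFinM -EFinD lee_fin => a3; apply: (le_trans a3).
    have dn : dd != 0 by clear -hW d1; rewrite gt_eqF//; lra.
    have e1 : th * (8 / (64 * dd * s) ^+ 2 + 96) = 512^-1 * dd ^- 2 + 96 * th.
      by rewrite es; field; rewrite dn gt_eqF.
    rewrite e1 /c -/dd; set y := 512^-1 * dd ^- 2.
    have y0 : 0 <= y by apply: mulr_ge0 dd2; rewrite invr_ge0 ler0n.
    rewrite exprMn; set z := (y + 96 * th) ^+ 2.
    have : z + th ^+ 2 <= (y + 97 * th) ^+ 2.
      rewrite /z; have : 0 <= y * th by rewrite mulr_ge0// ltW.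
      have : 0 <= th * th by rewrite mulr_ge0// ltW.
      by clear -hW y0; nra.
    move=> h; have := ler_wpM2l (ltW s0) h; have := mulr_ge0 (ltW s0) (sqr_ge0 (y + 97 * th)).
    by clear -hW h; lra.
  apply: (@le_trans _ _ (\sum_(k | k != i) c k)); first by apply: ler_sum.
  rewrite /c -mulr_sumr big_split/= -mulr_sumr sumr_const.
  have hQ (B : R) : 0 <= B -> B *+ #|[pred k : 'I_K | k != i]| <= K%:R * B.
    move=> B0; rewrite -[leLHS]mulr_natl; apply: ler_wpM2r => //.
    by rewrite ler_nat; apply: (leq_trans (max_card _)); rewrite card_ord.
  have {}hQ := hQ (97 * th) (mulr_ge0 (ler0n R 97) (ltW th0)).
  move: hQ; move: (_ *+ _) => Q hQ; rewrite mulrCA in hQ; move: (K%:R * th) Kth hQ => kth.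
  have := inv_sqr_sum i0 (R := R); move: (\sum_(_ | _) _ ^- 2) => S; lra.
Qed.

Lemma poly_geo k : exists F : R, 0 < F /\ forall n, (n.+1%:R : R) ^+ k <= F * 4 ^+ n.
Proof.
have [F [F1 hF]] := @pow_le_exp_ex R k; exists (F * 4); split; first by lra.
move=> n; apply: (le_trans (hF n.+1%:R _)) => //; rewrite -mulrA; apply: ler_wpM2l; first by lra.
rewrite -exprS -[X in expR X]mul1r expRM_natr; apply: lerXn2r; rewrite ?nnegrE ?expR_ge0//.
have := @expR_ge1Dx R (- 2^-1); rewrite expRN => h; have e0 := expR_gt0 (2^-1 : R).
have h2 : expR 2^-1 <= 2 :> R by rewrite -[leRHS]invrK -[leLHS]invrK lef_pV2 ?posrE ?invr_gt0//; lra.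
have -> : expR 1 = expR 2^-1 * expR 2^-1 :> R by rewrite -expRD; congr expR; field.
have -> : 4 = 2 * 2 :> R by ring.
by apply: ler_pM => //; exact: ltW.
Qed.

Lemma sum_inv_sqr n : \sum_(k < n) (k.+1%:R : R) ^- 2 <= 2.
Proof.
suff h : \sum_(k < n) (k.+1%:R : R) ^- 2 <= 2 - 2 / n.+1%:R.
  by apply: (le_trans h); rewrite gerBl divr_ge0.
elim: n => [|n IH]; first by rewrite big_ord0 divr1 subrr.
rewrite big_ord_recr/=; apply: (le_trans (lerD IH (lexx _))).
rewrite -subr_ge0 -(natr1 n.+1); set x : R := n.+1%:R.
have x1 : 1 <= x by rewrite ler1n.
have -> : 2 - 2 / (x + 1) - (2 - 2 / x + x ^- 2) = (x - 1) / (x ^+ 2 * (x + 1)).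
  by field; rewrite !gt_eqF//; lra.
by rewrite divr_ge0 ?mulr_ge0 ?sqr_ge0//; lra.
Qed.

End gauss_grid.

(** * From the Gaussian grid to the solution, along 4^-n *)

Section lower_bound.
Context {R : realType} {d : measure_display} {Omega : measurableType d}.
Context (P : probability Omega R) (W : set (R * R) -> Omega -> R).
Hypothesis hW : white_noise P W.
Notation leb := (@lebesgue_measure R).
Notation mu2 := (leb \x leb)%E.
Variables (sigma : R -> R) (D : R).
Hypotheses (D0 : 0 <= D) (hLip : forall a b, `|sigma a - sigma b| <= D * `|a - b|).
Variable u : R -> R -> Omega -> R.
Hypothesis hu : mild_solution P W sigma (fun _ : R => 0) u.
Hypothesis hcont : continuous_paths P u.
Hypothesis hs0 : sigma 0 != 0.

(** Discarding the noise before [a] keeps the approximating rectangles after [a], so that fields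
    built on different slabs use disjoint noise. *)
Lemma kernel_steps (a t x e : R) : 0 <= a -> 0 <= t <= 1 -> 0 <= x <= 1 -> 0 < e ->
  exists l, rect_in a t l /\
    (l2d (fun z => (gker t x z * \1_(~` early a) z)%R) (stepf l) <= e%:E)%E.
Proof.
move=> a0 t01 x01 e0.
have mg := @measurable_gker R t x.
have mh : measurable_fun setT (fun z => gker t x z * \1_(~` early a) z).
  by apply: measurable_funM => //; apply: measurable_indic; apply: measurableC; exact: measurable_early.
have h0 z : 0 <= gker t x z * \1_(~` early a) z by rewrite mulr_ge0 ?gker_ge0.
suff [_ H] : rect_approx a t (fun z => gker t x z * \1_(~` early a) z) by exact: H.
apply: (rect_approx_nonneg a0 mh h0).
- move=> z nz; rewrite indicE; have [|_] := boolP (z \in ~` early a); last by rewrite mulr0.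
  rewrite inE => /= /negP; rewrite -ltNge => az.
  rewrite gker_out ?mul0r// => -[/andP[_ zt] y01]; apply: nz; split; rewrite /= in_itv/= ?y01//.
  by rewrite az ltW.
- apply: (@le_lt_trans _ _ (sqn (gker t x))).
    apply: sqn_le => // z; rewrite normrM indicE; case: (_ \in _); rewrite ?normr1 ?mulr1//.
    by rewrite normr0 mulr0.
  by apply: le_lt_trans (sqn_gker t01 x01) _; rewrite ltry.
Qed.

Lemma kernel_steps0 (t x e : R) : 0 <= t <= 1 -> 0 <= x <= 1 -> 0 < e ->
  exists l, rect_in 0 t l /\ (l2d (gker t x) (stepf l) <= e%:E)%E.
Proof.
move=> t01 x01 e0; have [l [rl hl]] := kernel_steps (lexx 0) t01 x01 e0; exists l; split => //.
apply: le_trans hl; rewrite le_eqVlt; apply/orP; left; apply/eqP; apply: eq_integral => z _.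
congr ((_ ^+ 2)%:E); congr (_ - _); rewrite indicE.
have [|] := boolP (z \in ~` early 0); first by rewrite mulr1.
rewrite notin_setE /= => /contrapT z0; rewrite gker_out ?mulr0// => -[/andP[z1 _] _].
by move: z0; rewrite /early/= leNgt z1.
Qed.

Lemma cube_root (y : R) : 1 <= y -> exists K : nat, [/\ (0 < K)%N, y <= K%:R ^+ 3 & K%:R ^+ 3 <= 8 * y].
Proof.
move=> y1; have ex : exists k : nat, y <= k%:R ^+ 3.
  exists (Num.bound y); have : y < (Num.bound y)%:R by apply: archi_boundP; lra.
  set b : R := _%:R => yb; have b1 : 1 <= b by lra.
  by apply: (le_trans (ltW yb)); rewrite exprS ler_peMr ?exprn_ege1//; lra.
case: (ex_minnP ex) => K hK mK; exists K.
have K0 : (0 < K)%N by case: K hK {mK} => //; rewrite expr0n/=; lra.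
split => //; have [K1|K1] := leqP K 1.
  have -> : K = 1%N by apply/eqP; rewrite eqn_leq K1.
  by rewrite expr1n; lra.
have h : K.-1%:R ^+ 3 < y by rewrite ltNge; apply/negP => /mK; rewrite leqNgt ltn_predL K0.
have h2 : (K%:R : R) <= 2 * K.-1%:R.
  by rewrite -natrM ler_nat; case: K K1 {hK mK K0 h} => // k; rewrite /= ltnS => k0; rewrite mul2n -addnn -addn1 leq_add2l.
have h3 : (K%:R : R) ^+ 3 <= (2 * K.-1%:R) ^+ 3 by apply: lerXn2r; rewrite ?nnegrE ?mulr_ge0.
apply: (le_trans h3); rewrite exprMn (_ : 2 ^+ 3 = 8); last by ring.
by rewrite ler_wpM2l// ltW.
Qed.

Lemma expN_inv (x : R) : 0 < x -> expR (- x) <= x^-1.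
Proof.
move=> x0; apply: (le_trans (expNR_le (ltW x0))).
by rewrite lef_pV2 ?posrE ?addr_gt0//; lra.
Qed.

(** One scale r = 4^-n, in sixth powers to avoid roots of the logarithm. The exceptional event
    collects a small Gaussian grid, of probability O(n^-2) by the choice of K, and a failure of the
    linearisation, whose probability is r^2 up to powers of n. *)
Lemma lower_scale : exists c C : R, [/\ 0 < c, 0 <= C & forall (n : nat) (E : set Omega), 1 <= ln (n%:R : R) ->
  measurable E -> (forall w, E w -> bounded_on u ((4^-1) ^+ (4 * n)) (tailB n.-1) w) ->
  exists F : set Omega, [/\ measurable F, (P F <= (C * n.+1%:R ^- 2)%:E)%E &
    forall w, E w -> ~ F w -> exists t x, [/\ 0 <= t <= (4^-1) ^+ (4 * n), 0 <= x <= (4^-1) ^+ (2 * n) &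
      c * ((4^-1) ^+ n) ^+ 6 <= `|u t x w| ^+ 6 * ln (n%:R : R)]]].
Proof.
have k0 := @Kg_gt0 R.
pose S := `|sigma 0|; have S0 : 0 < S by rewrite normr_gt0.
pose CV := 2 * ((16 * D) ^+ 2 * Kg) + 2 * S ^+ 2.
have CV0 : 0 < CV.
  apply: ltr_wpDl; last by rewrite mulr_gt0 ?exprn_gt0.
  by rewrite mulr_ge0// mulr_ge0 ?sqr_ge0// ltW.
(* 140 makes 7 eta / sqrt(s / 100) equal to 1/2; 128 is the spacing factor of [gx]; 24 is the
   constant of the Bernstein bound. *)
have [N1 [N10 eN1]] : exists N1 : R, 0 < N1 /\ N1 = 140 by exists 140; split => //; exact: ltr0n.
have [N2 [N20 N21 eN2]] : exists N2 : R, [/\ 0 < N2, 8 <= N2 & N2 = 128].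
  by exists 128; split; [exact: ltr0n|rewrite ler_nat|].
have [N3 [N30 eN3]] : exists N3 : R, 0 < N3 /\ N3 = 24 by exists 24; split => //; exact: ltr0n.
pose c5 := S ^+ 2 / (4 * N1 ^+ 2 * N3 * (N2 * 8) * CV).
have c50 : 0 < c5 by rewrite divr_gt0 ?exprn_gt0// !mulr_gt0// exprn_gt0.
have [F6 [F60 hF6]] := @poly_geo R 6.
pose C := 4 + 2 * (N2 ^+ 2 * 8) / c5 * F6.
exists ((S / 2) ^+ 6 / ((N1 ^+ 2) ^+ 3 * (N2 ^+ 3 * 8))), C; split.
- by rewrite divr_gt0 ?exprn_gt0 ?mulr_gt0 ?divr_gt0// ?exprn_gt0.
- by rewrite addr_ge0// !mulr_ge0 ?invr_ge0 ?(ltW c50) ?(ltW F60) ?(ltW N20).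
move=> n E y1 mE hE; set y := ln _ in y1 *.
have n0 : (0 < n)%N.
  by case: (posnP n) => [n0|//]; move: y1; rewrite /y n0 ln0//; lra.
have nR : 0 < n%:R :> R by rewrite ltr0n.
have yn : 1 + y <= n%:R by rewrite -[leRHS](lnK nR); exact: expR_ge1Dx.
(* K^3 lies between ln n and 8 ln n. With M = 128 K, s = r^2 / M and th = s^2 below, the K points
   span r^2 and the T = M^2 times span r^4, so K T = 128^2 K^3 values are constrained. *)
have [K [K0 yK Ky]] := cube_root y1.
have K1 : 1 <= K%:R :> R by rewrite ler1n.
have [M eM] : exists M : nat, M = (128 * K)%N by eexists.
have eMR : M%:R = N2 * K%:R :> R by rewrite eM natrM eN2.
have M1 : 1 <= M%:R :> R by rewrite eMR -[leLHS]mulr1; apply: ler_pM => //; lra.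
set r : R := (4^-1) ^+ n; have r0 : 0 < r by exact: q4_gt0.
have r1 : r <= 4^-1.
  rewrite /r -(prednK n0) exprS ler_piMr// exprn_ile1//.
  lra.
have er4 : (4^-1) ^+ (4 * n) = r ^+ 4 by rewrite /r -exprM mulnC.
have er2 : (4^-1) ^+ (2 * n) = r ^+ 2 by rewrite /r -exprM mulnC.
rewrite er4 er2 in hE *.
pose s := r ^+ 2 / M%:R; have s0 : 0 < s by rewrite divr_gt0 ?exprn_gt0//; lra.
pose th := s ^+ 2; have th0 : 0 < th by rewrite exprn_gt0.
have es : Num.sqrt th = s by rewrite sqrtr_sqr gtr0_norm.
have sM : s * M%:R = r ^+ 2 by rewrite divfK// gt_eqF//; lra.
have r21 : r ^+ 2 <= 4^-1 by clear -hW D0 hLip hu hcont hs0 r0 r1; rewrite expr2; apply: (@le_trans _ _ (4^-1 * 1)); [apply: ler_pM => //; lra|lra].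
have sr : s <= r ^+ 2 by rewrite -sM ler_peMr// ltW.
have s1 : s <= 1 by lra.
have ths : th <= s by rewrite /th expr2 -[leRHS]mulr1; apply: ler_wpM2l => //; exact: ltW.
have thr : th <= r ^+ 2 by exact: le_trans ths sr.
have Kl : K%:R * (128 * Num.sqrt th) <= 2^-1.
  by rewrite es mulrA (mulrC K%:R) -eN2 -eMR mulrC sM; lra.
pose T := (M * M)%N.
have eT : T%:R * th = r ^+ 4 by rewrite natrM /th (_ : r ^+ 4 = (r ^+ 2) ^+ 2); [rewrite -sM; ring|ring].
have tb (j : 'I_T) : 0 <= gtm th j <= r ^+ 4.
  rewrite /gtm mulr_ge0 ?(ltW th0)//= -eT ler_wpM2r ?(ltW th0)//.
  by rewrite ler_nat ltn_ord.
have r41 : r ^+ 4 <= 1 by rewrite exprn_ile1 ?(ltW r0)//; lra.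
have tb1 (j : 'I_T) : 0 <= gtm th j <= 1 by have /andP[-> h] := tb j; exact: le_trans h r41.
have xb (i : 'I_K) : 0 <= gx th i <= r ^+ 2.
  have i1 : (i.+1%:R : R) <= K%:R by rewrite ler_nat.
  have : i.+1%:R * (N2 * s) <= K%:R * (N2 * s) by rewrite ler_wpM2r// mulr_ge0// ltW.
  have : 0 <= i%:R * (N2 * s) by rewrite !mulr_ge0// ltW.
  have : K%:R * (N2 * s) = r ^+ 2 by rewrite -sM eMR; ring.
  have : 0 <= N2 * s by rewrite mulr_ge0// ltW.
  by rewrite /gx es -(natr1 i) -eN2 (mulrDl i%:R 1); move: (N2 * s) => ns; lra.
have xb1 (i : 'I_K) : 0 <= gx th i <= 1 by have /andP[-> h] := xb i; apply: le_trans h _; lra.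
have se0 : 0 < s * th ^+ 2 by rewrite mulr_gt0// exprn_gt0.
have hl (p : 'I_K * 'I_T) : exists l, rect_in 0 (gtm th p.2) l /\
   (l2d (gker (gtm th p.2) (gx th p.1)) (stepf l) <= (s * th ^+ 2)%:E)%E.
  exact: kernel_steps0.
have [ll hll] := choice hl.
pose l i j := ll (i, j).
have q0 : 0 < Num.sqrt s by rewrite sqrtr_gt0.
(* A fixed fraction of the standard deviation of the window noise; its sixth power is of order r^6 /
   K^3. *)
pose eta := Num.sqrt s / N1; have eta0 : 0 < eta by rewrite divr_gt0.
have eta2 : eta ^+ 2 = s / N1 ^+ 2 by rewrite exprMn sqr_sqrtr ?(ltW s0)// exprVn.
have PG := @gauss_grid R d Omega P W hW K T th eta l K0 th0 Kl eta0
  (fun i j => (hll (i, j)).1) _.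
rewrite es in PG; have {}PG := PG (fun i j => (hll (i, j)).2).
have eq2 : 7 * eta / Num.sqrt (s / 100) = 2^-1.
  have -> : s / 100 = s * (10^-1) ^+ 2 by field.
  rewrite sqrtrM ?(ltW s0)// sqrtr_sqr ger0_norm ?invr_ge0// /eta eN1; field; rewrite gt_eqF//.
rewrite eq2 -exprM in PG.
set G : set Omega := [set w | _] in PG.
have mW i j : measurable_fun setT (wsum W (l i j)).
  by apply: (measurable_wsum hW); exact: step_in_ok (rect_step (lexx 0) (hll (i, j)).1).
have mG : measurable G.
  pose L2 (p : 'I_K * 'I_T) := wsum W (l p.1 p.2).
  rewrite (_ : G = [set w | forall p, (- eta < L2 p w <= eta)%R]).
    by apply: measurable_box => p; exact: mW.
  by apply/seteqP; split => w h; [move=> [i j]; exact: h|move=> i j; exact: h (i, j)].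
(* Since |u| <= 16 n r on the time range, the linearisation error has energy of order n^2 r^4,
   against a^2 of order r^2 / M. The Bernstein exponent is so large that exp(-x) <= 1/x suffices. *)
pose V := n%:R ^+ 2 * r ^+ 4 * CV; have V0 : 0 < V by rewrite !mulr_gt0 ?exprn_gt0.
pose a := S * eta / 2.
have a0 : 0 < a by rewrite divr_gt0// mulr_gt0.
pose B (p : 'I_K * 'I_T) : set Omega := E `&` [set w | (a <= `|u (gtm th p.2) (gx th p.1) w - sigma 0 * wsum W (ll p) w|)%R].
have mB p : measurable (B p).
  apply: measurableI => //; rewrite (_ : [set w | _] = [set w | (a%:E <= (`|u (gtm th p.2) (gx th p.1) w - sigma 0 * wsum W (ll p) w|)%:E)%E]).
    apply: measurable_ge_e; apply/measurable_EFinP; apply: measurableT_comp => //.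
    apply: measurable_funB; first by have /andP[h _] := tb1 p.2; exact: (measurable_u hu).
    by apply: measurable_funM => //; case: p => i j; exact: mW.
  by apply/seteqP; split => w /=; rewrite lee_fin.
have tn : tailB n.-1 = 16 * n%:R * r :> R.
  by have := prednK n0; rewrite /tailB /r; move: (n.-1) => m <-; rewrite exprS; field.
have PB p : (P (B p) <= (2 * (n%:R ^+ 3 * r ^+ 2 / c5))%:E)%E.
  have b0 : 0 <= tailB n.-1 :> R by exact: tailB_ge0.
  have hEp w : E w -> bounded_on u (gtm th p.2) (tailB n.-1) w.
    by move=> Ew q z /andP[q1 q2] z01; apply: (hE w Ew) => //; rewrite q1 (le_trans q2)//; case/andP: (tb p.2).
  apply: (le_trans (blin hW D0 hLip hu mE (hll p).1 b0 hEp (tb1 p.2) (xb1 p.1) a0 V0 _)).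
    have e1 : (sqn (gker (gtm th p.2) (gx th p.1)) <= (Kg * r ^+ 2)%:E)%E.
      apply: (le_trans (sqn_gker (tb1 p.2) (xb1 p.1))); rewrite lee_fin ler_pM2l//.
      rewrite (_ : r ^+ 2 = Num.sqrt ((r ^+ 2) ^+ 2)); last by rewrite sqrtr_sqr ger0_norm ?sqr_ge0.
      by apply: ler_wsqrtr; rewrite -exprM; case/andP: (tb p.2).
    have e2 : (l2d (gker (gtm th p.2) (gx th p.1)) (stepf (ll p)) <= (n%:R ^+ 2 * r ^+ 4)%:E)%E.
      apply: (le_trans (hll p).2); rewrite lee_fin.
      have n1 : 1 <= n%:R ^+ 2 :> R by rewrite exprn_ege1// ler1n.
      apply: (@le_trans _ _ (1 * r ^+ 4)); last by rewrite ler_wpM2r// exprn_ge0// ltW.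
      rewrite mul1r (_ : r ^+ 4 = r ^+ 2 * r ^+ 2); last by ring.
      apply: ler_pM => //; [exact: ltW|exact: sqr_ge0|].
      by clear -hW D0 hLip hu hcont hs0 th0 ths s1 thr; rewrite expr2; apply: le_trans thr; rewrite -[leRHS]mulr1; apply: ler_wpM2l; [exact: ltW|lra].
    apply: (@le_trans _ _ (2%:E * (((D * tailB n.-1) ^+ 2)%:E * (Kg * r ^+ 2)%:E) + 2%:E * ((sigma 0 ^+ 2)%:E * (n%:R ^+ 2 * r ^+ 4)%:E))%E).
      apply: leeD; apply: lee_wpmul2l => //; apply: lee_wpmul2l => //; rewrite lee_fin sqr_ge0//.
    rewrite -!EFinM -EFinD lee_fin tn /V /CV /S real_normK ?num_real// le_eqVlt; apply/orP; left; apply/eqP.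
    ring.
  rewrite lee_fin ler_wpM2l//; apply: (le_trans (expN_inv _)); first by apply: divr_gt0; [exact: exprn_gt0|exact: mulr_gt0].
  rewrite invf_div /a exprMn exprMn eta2 /V -eN3.
  have -> : n%:R ^+ 3 * r ^+ 2 / c5 = (n%:R ^+ 2 * r ^+ 2 * (4 * N1 ^+ 2 * N3 * CV) / S ^+ 2) * (N2 * (8 * n%:R)).
    by rewrite /c5; field; rewrite !gt_eqF.
  have -> : N3 * (n%:R ^+ 2 * r ^+ 4 * CV) / (S ^+ 2 * (s / N1 ^+ 2) * (2^-1) ^+ 2) =
    (n%:R ^+ 2 * r ^+ 2 * (4 * N1 ^+ 2 * N3 * CV) / S ^+ 2) * M%:R.
    by rewrite /s; clear -hW D0 hLip hu hcont hs0 S0 N10 N20 N30 CV0 nR r0 M1; field; rewrite !gt_eqF//; lra.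
  apply: ler_wpM2l.
    apply: divr_ge0; last exact: sqr_ge0.
    apply: mulr_ge0; first by apply: mulr_ge0; exact: sqr_ge0.
    apply: mulr_ge0; last exact: ltW.
    by apply: mulr_ge0; [apply: mulr_ge0 => //; exact: sqr_ge0|exact: ltW].
  rewrite eMR; apply: ler_wpM2l; first exact: ltW.
  apply: (@le_trans _ _ (K%:R ^+ 3)); last by clear -hW D0 hLip hu hcont hs0 Ky yn; lra.
  by rewrite exprS ler_peMr ?exprn_ege1//; lra.
exists (G `|` \bigcup_(p in [set: 'I_K * 'I_T]) B p).
have mU : measurable (\bigcup_(p in [set: 'I_K * 'I_T]) B p).
  by apply: fin_bigcup_measurable => //; exact: finite_finset.
split; first exact: measurableU.
- refine (le_trans (measureU2 P mG mU) _).
  have PU : (P (\bigcup_(p in [set: 'I_K * 'I_T]) B p) <= (2 * (N2 ^+ 2 * 8) / c5 * F6 * n.+1%:R ^- 2)%:E)%E.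
    apply: (@le_trans _ _ (\sum_(p : 'I_K * 'I_T) P (B p))%E).
      by apply: (finite_cover_prob _) => // w [p _ h]; exists p.
    apply: (@le_trans _ _ (\sum_(p : 'I_K * 'I_T) (2 * (n%:R ^+ 3 * r ^+ 2 / c5))%:E)%E).
      by apply: lee_sum => p _; exact: PB.
    rewrite sumEFin lee_fin sumr_const card_prod !card_ord -[leLHS]mulr_natr.
    have e1 : (K * T)%:R = N2 ^+ 2 * K%:R ^+ 3 :> R by rewrite !natrM eMR; ring.
    rewrite e1.
    have n2 : 0 < n.+1%:R ^+ 2 :> R by rewrite exprn_gt0.
    rewrite ler_pdivlMr//.
    have h1 : n%:R ^+ 3 * n%:R * n.+1%:R ^+ 2 <= F6 * 4 ^+ n.
      apply: le_trans (hF6 n); rewrite -exprSr (_ : n.+1%:R ^+ 6 = n.+1%:R ^+ 4 * n.+1%:R ^+ 2); last by ring.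
      by rewrite ler_wpM2r ?(ltW n2)//; apply: lerXn2r; rewrite ?nnegrE// ler_nat.
    have h2 : 4 ^+ n * r ^+ 2 <= 1.
      rewrite expr2 mulrA /r -exprMn mulfV ?expr1n ?mul1r ?pnatr_eq0//; apply: le_trans r1 _; clear -hW D0 hLip hu hcont hs0 r0; lra.
    have A0 : 0 <= 2 * (N2 ^+ 2 * 8) / c5.
      apply: divr_ge0; last exact: ltW.
      by apply: mulr_ge0 => //; apply: mulr_ge0 => //; exact: sqr_ge0.
    apply: (@le_trans _ _ (2 * (N2 ^+ 2 * 8) / c5 * (n%:R ^+ 3 * n%:R * n.+1%:R ^+ 2 * r ^+ 2))).
      have -> : 2 * (n%:R ^+ 3 * r ^+ 2 / c5) * (N2 ^+ 2 * K%:R ^+ 3) * n.+1%:R ^+ 2 =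
        (2 * N2 ^+ 2 / c5 * n%:R ^+ 3 * n.+1%:R ^+ 2 * r ^+ 2) * K%:R ^+ 3 by ring.
      have -> : 2 * (N2 ^+ 2 * 8) / c5 * (n%:R ^+ 3 * n%:R * n.+1%:R ^+ 2 * r ^+ 2) =
        (2 * N2 ^+ 2 / c5 * n%:R ^+ 3 * n.+1%:R ^+ 2 * r ^+ 2) * (8 * n%:R) by ring.
      apply: ler_wpM2l; last by clear -hW D0 hLip hu hcont hs0 Ky yn; lra.
      apply: mulr_ge0; last exact: sqr_ge0.
      apply: mulr_ge0; last exact: sqr_ge0.
      apply: mulr_ge0; last by rewrite exprn_ge0.
      apply: divr_ge0; last exact: ltW.
      by apply: mulr_ge0 => //; exact: sqr_ge0.
    apply: ler_wpM2l => //.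
    apply: (@le_trans _ _ (F6 * 4 ^+ n * r ^+ 2)); first by rewrite ler_wpM2r ?sqr_ge0.
    by rewrite -mulrA -[leRHS]mulr1; apply: ler_wpM2l; [exact: ltW|].
  (* 2^(-K T) <= exp(-K T / 2), and K T / 2 exceeds 2 K^3 >= 2 ln n. *)
  have PG2 : (P G <= (4 * n.+1%:R ^- 2)%:E)%E.
    apply: (le_trans PG); rewrite lee_fin.
    have h1 : 2^-1 <= expR (- 2^-1) :> R by have := @expR_ge1Dx R (- 2^-1); clear -hW D0 hLip hu hcont hs0 r0; lra.
    apply: (@le_trans _ _ (expR (- 2^-1) ^+ (K * T))).
      by apply: lerXn2r; rewrite ?nnegrE ?expR_ge0.
    rewrite -expRM_natr; apply: (@le_trans _ _ (expR (- (2 * y)))).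
      rewrite ler_expR !natrM eMR.
      have -> : - 2^-1 * (K%:R * (N2 * K%:R * (N2 * K%:R))) = - (2^-1 * (N2 * N2) * K%:R ^+ 3) by field.
      rewrite lerN2; apply: ler_pM => //; first by clear -hW D0 hLip hu hcont hs0 y1; lra.
      have : 8 * 8 <= N2 * N2 by apply: ler_pM.
      by clear -hW D0 hLip hu hcont hs0 r0; lra.
    rewrite expRN mulrC expRM_natr lnK//.
    rewrite ler_pdivlMr ?exprn_gt0// mulrC ler_pdivrMr ?exprn_gt0//.
    rewrite (_ : 4 = 2 ^+ 2); last by ring.
    rewrite -exprMn; apply: lerXn2r; rewrite ?nnegrE ?mulr_ge0//.
    by rewrite -(natr1 n) -(subnK n0) natrD; have := ler0n R (n - 1); clear -hW D0 hLip hu hcont hs0 r0; lra.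
  rewrite /C mulrDl EFinD; exact: leeD.
- move=> w Ew /not_orP[nG nU].
  have [i [j nb]] : exists i j, ~ (- eta < wsum W (l i j) w <= eta).
    move: nG => /existsNP[i] /existsNP[j h]; by exists i, j.
  exists (gtm th j), (gx th i); split; [exact: tb|exact: xb|].
  have h1 : eta <= `|wsum W (l i j) w|.
    rewrite leNgt; apply/negP; rewrite ltr_norml => /andP[h1 h2]; apply: nb.
    by rewrite h1 ltW.
  have h2 : `|u (gtm th j) (gx th i) w - sigma 0 * wsum W (l i j) w| < a.
    by rewrite ltNge; apply/negP => h; apply: nU; exists (i, j).
  set U := u _ _ w in h2 *.
  have h3 : S * eta / 2 <= `|U|.
    have := lerB_dist (sigma 0 * wsum W (l i j) w) U; rewrite normrM -/S distrC => h4.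
    have : S * eta <= S * `|wsum W (l i j) w| by rewrite ler_wpM2l// ltW.
    by move: h2; rewrite /a; clear -hW D0 hLip hu hcont hs0 h4; lra.
  apply: (@le_trans _ _ ((S * eta / 2) ^+ 6 * y)); last first.
    apply: ler_wpM2r; first by clear -hW D0 hLip hu hcont hs0 y1; lra.
    by apply: lerXn2r => //; rewrite nnegrE; apply: divr_ge0 => //; apply: mulr_ge0; exact: ltW.
  have -> : (S * eta / 2) ^+ 6 = (S / 2) ^+ 6 * (eta ^+ 2) ^+ 3 by field.
  rewrite eta2.
  have -> : (s / N1 ^+ 2) ^+ 3 = r ^+ 6 / ((N1 ^+ 2) ^+ 3 * (N2 ^+ 3 * K%:R ^+ 3)).
    by rewrite /s eMR; clear -hW D0 hLip hu hcont hs0 N10 N20 K1; field; rewrite !gt_eqF//; lra.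
  have p1 : 0 < (N1 ^+ 2) ^+ 3 * N2 ^+ 3 :> R by rewrite mulr_gt0// !exprn_gt0.
  have K3 : 0 < K%:R ^+ 3 :> R by clear -hW D0 hLip hu hcont hs0 K1; rewrite exprn_gt0//; lra.
  set A := (S / 2) ^+ 6; set Q := (N1 ^+ 2) ^+ 3 * N2 ^+ 3 in p1 *.
  have A0 : 0 <= A by rewrite exprn_ge0// divr_ge0// ltW.
  have r60 : 0 <= r ^+ 6 by rewrite exprn_ge0// ltW.
  have e1 z : (N1 ^+ 2) ^+ 3 * (N2 ^+ 3 * z) = Q * z by rewrite /Q mulrA.
  rewrite (e1 8) (e1 (K%:R ^+ 3)); move: (r ^+ 6) r60 (K%:R ^+ 3) K3 Ky p1 {e1} => r6 r60 k3 K3 Ky.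
  move: A A0 Q => A A0 Q p1; rewrite (invfM Q 8) (invfM Q k3).
  have -> : A * (Q^-1 * 8^-1) * r6 = A * r6 * Q^-1 * 8^-1 by ring.
  have -> : A * (r6 * (Q^-1 * k3^-1)) * y = A * r6 * Q^-1 * (y / k3) by ring.
  apply: ler_wpM2l; first by apply: mulr_ge0; [exact: mulr_ge0|rewrite invr_ge0 ltW].
  by rewrite ler_pdivlMr//; clear -hW D0 hLip hu hcont hs0 Ky; lra.
Qed.

(** The event [E n] asks for the deterministic bound [tailB] and does not involve [L]. On [L] the
    modulus of continuity puts almost every path in [E n] for all large n, and Borel-Cantelli
    removes the exceptional events. *)
Lemma lower_bound (T : R) (L : set Omega) : 0 < T <= 1 -> measurable L ->
  (forall w, L w -> bounded_on u T 1 w) ->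
  exists c : R, 0 < c /\ {ae P, forall w, L w -> exists n0, forall n, (n0 <= n)%N ->
    exists t x, [/\ 0 <= t <= (4^-1) ^+ (4 * n), 0 <= x <= (4^-1) ^+ (2 * n) &
      c * ((4^-1) ^+ n) ^+ 6 <= `|u t x w| ^+ 6 * ln (n%:R : R)]}.
Proof.
move=> T01 mL hL; have [c [C [c0 C0 H]]] := lower_scale; exists c; split => //.
have [G [mG PG hG]] := exists_good hW hu hcont.
pose E n := G `&` rat_bounded u ((4^-1) ^+ (4 * n)) 1 (tailB n.-1).
have mE n : measurable (E n) by apply: measurableI => //; exact: (measurable_rat_bounded hu).
have hE n w : E n w -> bounded_on u ((4^-1) ^+ (4 * n)) (tailB n.-1) w.
  move=> [Gw rw] s y hs hy; apply: (rat_bounded_all (q4_gt0 _) _ (hG w Gw).1 rw) => //.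
  by rewrite ltr01 lexx.
have ex n : exists F : set Omega, [/\ measurable F, (P F <= (C * n.+1%:R ^- 2)%:E)%E &
    1 <= ln (n%:R : R) -> forall w, E n w -> ~ F w -> exists t x, [/\ 0 <= t <= (4^-1) ^+ (4 * n), 0 <= x <= (4^-1) ^+ (2 * n) &
      c * ((4^-1) ^+ n) ^+ 6 <= `|u t x w| ^+ 6 * ln (n%:R : R)]].
  have [l1|l1] := boolP (1 <= ln (n%:R : R)).
    by have [F [h1 h2 h3]] := H n (E n) l1 (mE n) (hE n); exists F.
  exists set0; split => //.
  by rewrite measure0 lee_fin mulr_ge0// invr_ge0 sqr_ge0.
have [F hF] := choice ex.
have mF n : measurable (F n) by have [] := hF n.
have sF : (\sum_(0 <= n <oo) P (F n) < +oo)%E.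
  apply: (@le_lt_trans _ _ (\sum_(0 <= n <oo) (C * n.+1%:R ^- 2)%:E)%E).
    by apply: lee_nneseries => // n _; have [] := hF n.
  apply: (@le_lt_trans _ _ (C * 2)%:E); last by rewrite ltry.
  apply: nneseries_bound => [k|n]; first by rewrite mulr_ge0// invr_ge0 sqr_ge0.
  by rewrite -mulr_sumr ler_wpM2l// sum_inv_sqr.
have z1 := lim_sup_set_cvg0 mF sF.
have z2 := modulus hW D0 hLip hu T01 mL hL.
have n1 : {ae P, forall w, ~ lim_sup_set F w}.
  exists (lim_sup_set F); split => //; last by move=> w /= /contrapT.
  by apply: bigcapT_measurable => n; apply: bigcup_measurable => j _.
have n2 : {ae P, forall w, G w}.
  exists (~` G); split => //; first exact: measurableC.
  by rewrite probability_setC// [X in (1 - X)%E]PG subee.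
apply: filterS3 n1 n2 z2 => w nl Gw hl Lw.
have [j0 lk] := hl Lw.
have [n3 hn3] : exists n3, forall n, (n3 <= n)%N -> ~ F n w.
  apply: contrapT => /forallNP h; apply: nl => n _.
  by have /existsNP[k /not_implyP[nk /contrapT Fk]] := h n; exists k.
have [n4 hn4] := @q4_small R T (andP T01).1.
pose N0 := Num.bound (expR 1 : R).
exists (maxn (maxn n3 j0.+1) (maxn n4 N0)) => n; rewrite !geq_max => /andP[/andP[a1 a2] /andP[a3 a4]].
have n0 : (0 < n)%N by exact: leq_ltn_trans a2.
have [_ _ hh] := hF n; apply: hh.
- rewrite -[leLHS](expRK 1) ler_ln ?posrE ?expR_gt0 ?ltr0n//.
  apply: (@le_trans _ _ N0%:R); last by rewrite ler_nat.
  by apply: ltW; apply: archi_boundP; exact: expR_ge0.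
- split => // q q' h1 h2.
  have b := @small_bound R d Omega u T j0 w n.-1 (hG w Gw) lk.
  rewrite (prednK n0) in b; apply: b => //.
  + by rewrite -ltnS (prednK n0).
  + by apply/ltW/hn4; apply: (leq_trans a3); rewrite leq_pmull.
- exact: hn3.
Qed.

End lower_bound.

(** * The upper bound *)

Section cascade.
Context {R : realType} {d : measure_display} {Omega : measurableType d}.
Context (P : probability Omega R) (W : set (R * R) -> Omega -> R).
Hypothesis hW : white_noise P W.
Notation leb := (@lebesgue_measure R).
Notation mu2 := (leb \x leb)%E.
Implicit Types (l : seq (R * set (R * R))).

Lemma phi13_le (x : R) : 0 <= x -> phi13 x <= x /\ phi13 x <= x ^+ 13.
Proof.
move=> x0; rewrite /phi13; have [x1|x1] := boolP (x <= 1); split => //.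
- by rewrite exprS; apply: ler_piMr => //; exact: exprn_ile1.
- have x1' : 1 <= x by rewrite ltW// ltNge.
  by rewrite exprS; apply: ler_peMr => //; exact: exprn_ege1.
Qed.

(** With truncated subtraction the exponent is |J - j|. Each term is bounded by an increment of [h],
    which starts non-negative and never exceeds 3. *)
Lemma dyadic_sum (J m : nat) : \sum_(j < m) (2^-1 : R) ^+ ((J - j) + (j - J)) <= 3.
Proof.
pose h (j : nat) : R := if (j <= J)%N then (2^-1) ^+ (J - j) else 3 - 2 * (2^-1) ^+ (j - J).
have p n : 0 < (2^-1 : R) ^+ n by rewrite exprn_gt0.
apply: (@le_trans _ _ (\sum_(0 <= j < m) (h j.+1 - h j))).
  rewrite big_mkord; apply: ler_sum => j _; rewrite /h; case: (ltngtP j J) => [jJ|jJ|->].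
  - have -> : (j - J = 0)%N by apply/eqP; rewrite subn_eq0 ltnW.
    rewrite addn0 -(subnSK jJ) exprS; move: (p (J - j.+1)%N).
    by move: (_ ^+ _) => z; lra.
  - have -> : (J - j = 0)%N by apply/eqP; rewrite subn_eq0 ltnW.
    by rewrite add0n subSn ?(ltnW jJ)// exprS; move: (_ ^+ _) => z; lra.
  - by rewrite subnn subSn// subnn expr0 expr1; lra.
rewrite telescope_sumr// /h leq0n; have := p (J - 0)%N; case: leqP => mJ.
  have : (2^-1 : R) ^+ (J - m) <= 1 by rewrite exprn_ile1//; lra.
  by move: (_ ^+ (J - m)) (_ ^+ (J - 0)) => z z'; lra.
by move: (p (m - J)%N); move: (_ ^+ (m - J)) (_ ^+ (J - 0)) => z z'; lra.
Qed.

Lemma link_var l l' (g g' : R * R -> R) (v e : R) : step_ok l -> step_ok l' ->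
  measurable_fun setT g -> measurable_fun setT g' ->
  (l2d g (stepf l) <= e%:E)%E -> (l2d g' (stepf l') <= e%:E)%E ->
  (sqn (fun z => (g z - g' z)%R) <= v%:E)%E -> step_var (l ++ step_scale (-1) l') <= 2 * v + 8 * e.
Proof.
move=> ok ok' mg mg' h h' hv.
have ml := measurable_stepf ok; have ml' := measurable_stepf ok'.
have okc : step_ok (l ++ step_scale (-1) l') by apply: step_ok_cat => //; exact: step_ok_scale.
rewrite -lee_fin -step_varE//.
have e1 : (\int[mu2]_z (stepf (l ++ step_scale (-1) l') z ^+ 2)%:E = \int[mu2]_z ((stepf l z - stepf l' z) ^+ 2)%:E)%E.
  by apply: eq_integral => z _; rewrite stepf_cat stepf_scale mulN1r.
rewrite e1; apply: (le_trans (integral_sqr_le mu2 (measurable_funB ml ml') (measurable_funB mg mg'))).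
have e2 : (\int[mu2]_z (((stepf l z - stepf l' z) - (g z - g' z)) ^+ 2)%:E <= (4 * e)%:E)%E.
  have mA : measurable_fun setT (fun z => g' z - stepf l' z) by exact: measurable_funB.
  have mB : measurable_fun setT (fun z => g z - stepf l z) by exact: measurable_funB.
  have H := integral_sqr_le mu2 (measurable_funB mA mB) mA.
  rewrite (_ : \int[mu2]_z _ = \int[mu2]_z (((g' z - stepf l' z) - (g z - stepf l z)) ^+ 2)%:E)%E; last first.
    by apply: eq_integral => z _; congr ((_ ^+ 2)%:E); ring.
  apply: (le_trans H); apply: lee_twice; first exact: h'.
  apply: le_trans h; rewrite le_eqVlt; apply/orP; left; apply/eqP.
  by apply: eq_integral => z _; congr EFin; rewrite /=; ring.
have -> : 2 * v + 8 * e = 2 * v + 2 * (4 * e) by ring.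
rewrite (EFinD (2 * v)) (EFinM 2 v) (EFinM 2 (4 * e)).
by apply: leeD; apply: lee_wpmul2l.
Qed.

Definition late (a : R) t x (z : R * R) : R := gker t x z * \1_(~` early a) z.

Lemma measurable_late a t x : measurable_fun setT (late a t x).
Proof.
apply: measurable_funM; first exact: measurable_gker.
by apply: measurable_indic; apply: measurableC; exact: measurable_early.
Qed.

Lemma sqn_late_le (a t x t' x' : R) :
  (sqn (fun z => (late a t x z - late a t' x' z)%R) <= sqn (fun z => (gker t x z - gker t' x' z)%R))%E.
Proof.
have m1 := @measurable_gker R t x; have m2 := @measurable_gker R t' x'.
apply: sqn_le; [exact: (measurable_funB (measurable_late a t x) (measurable_late a t' x'))
  |exact: (measurable_funB m1 m2)|move=> z].
by rewrite /late -mulrBl indicE; case: (_ \in _); rewrite ?mulr1// mulr0 normr0.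
Qed.

Lemma sqn_late1 (a t x : R) : (sqn (late a t x) <= sqn (gker t x))%E.
Proof.
apply: sqn_le; [exact: measurable_late|exact: measurable_gker|move=> z].
by rewrite /late indicE; case: (_ \in _); rewrite ?mulr1// mulr0 normr0.
Qed.

(** Consecutive slabs abut at time 4^(-4 (n+1)^2), so different n use disjoint noise. *)
Definition slabn (n : nat) : set (R * R) := slab ((4^-1) ^+ (4 * n.+1 ^ 2)) ((4^-1) ^+ (4 * n ^ 2)).

Lemma succ_mul_le (p q : nat) : (0 < p)%N -> (0 < q)%N -> (p.+1 * q.+1 <= 4 * (p * q))%N.
Proof.
move=> p0 q0; apply: (@leq_trans ((2 * p) * (2 * q))); last by rewrite mulnACA.
by apply: leq_mul; rewrite mul2n -addnn -add1n leq_add2r.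
Qed.

(** A link at level j is allowed 4^-J 2^(-|J - j|) r, the most at the level J where 4^(6J) is of
    order ln n. Coarser links are few and finer links have room to spare, so the costs decrease
    geometrically on both sides of J and their total fits into ln n. *)
Lemma cascade : exists C : R, 0 < C /\ forall n : nat, C <= ln (n%:R : R) ->
  exists (l : nat -> nat -> seq (R * set (R * R))) (B : set Omega) (e : R),
  [/\ forall a b, (a <= 4 ^ (4 * (n ^ 2 + n)))%N -> (b <= 4 ^ (2 * (n ^ 2 + n)))%N ->
        rect_in ((4^-1) ^+ (4 * n.+1 ^ 2)) (tq (n ^ 2 + n) a) (l a b) /\
        (l2d (late ((4^-1) ^+ (4 * n.+1 ^ 2)) (tq (n ^ 2 + n) a) (xq (n ^ 2 + n) b)) (stepf (l a b))
          <= (Kg * (4^-1) ^+ (2 * n.+1 ^ 2))%:E)%E,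
      noise_alg P W (slabn n) B, (((4 * n%:R)^-1)%:E <= P B)%E,
      0 <= e /\ e ^+ 6 * ln (n%:R : R) <= C * ((4^-1) ^+ (n ^ 2)) ^+ 6 &
      forall w, B w -> forall a b, (a <= 4 ^ (4 * n))%N -> (b <= 4 ^ (2 * n))%N -> `|wsum W (l a b) w| <= e].
Proof.
have [C0 [C00 sidak]] := weak_sidak hW; have k0 := @Kg_gt0 R.
(* 136 = 2 * 4 * 16 + 8: a link variance is measured at the parent level, coarser by 4^2, and the 8
   is for the two step approximations. *)
have [N2 [N20 eN2]] : exists N2 : R, 0 < N2 /\ N2 = 136 by exists 136; split => //; exact: ltr0n.
pose C1 := N2 * Kg + 1; have C11 : 1 <= C1 by rewrite lerDr mulr_ge0// ltW.
pose C13 := C1 ^+ 13.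
have C131 : 1 <= C13 by exact: exprn_ege1.
(* 24 = 2 * 4 * 3: the doubling in [weak_sidak], the count of indices at a level, and
   [dyadic_sum]. *)
pose C2 := 24 * C0 * C13; have C20 : 0 < C2 by rewrite !mulr_gt0//; lra.
pose W6 : R := 4 ^+ 6; have W61 : 1 <= W6 by rewrite exprn_ege1//; lra.
pose C := 3 ^+ 6 * (W6 * C2 + 1) + (C2 + 1).
have C0' : 0 < C by rewrite addr_gt0 ?mulr_gt0 ?exprn_gt0// addr_gt0// mulr_gt0//; lra.
exists C; split => // n hn; set y := ln _ in hn *.
have CC2 : C2 + 1 < C by rewrite ltrDr mulr_gt0 ?exprn_gt0// addr_gt0// mulr_gt0//; lra.
have n0 : (0 < n)%N.
  by case: (posnP n) => [n0|//]; move: hn; rewrite /y n0 ln0//; lra.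
have nR : 0 < n%:R :> R by rewrite ltr0n.
(* The last J with C2 * 4^(6J) + 1 <= ln n, hence 4^-J of order (ln n)^(-1/6). *)
have [J [J1 J2]] : exists J : nat, C2 * W6 ^+ J + 1 <= y /\ y < C2 * W6 ^+ J.+1 + 1.
  have ex : exists k : nat, y < C2 * W6 ^+ k + 1.
    have yc : 0 <= y / C2 by rewrite divr_ge0// ?(ltW C20)//; lra.
    exists (Num.bound (y / C2)); have := archi_boundP yc; rewrite ltr_pdivrMr// => h.
    set k := Num.bound _ in h *; apply: (lt_trans h); rewrite mulrC.
    apply: (@le_lt_trans _ _ (C2 * W6 ^+ k)); last by rewrite ltrDl.
    rewrite ler_wpM2l ?(ltW C20)//.
    apply: (@le_trans _ _ (4 ^+ k)); first by rewrite -natrX ler_nat ltnW// ltn_expl.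
    by apply: lerXn2r; rewrite ?nnegrE//; [lra|rewrite /W6 exprS ler_peMr// exprn_ege1//; lra].
  case: (ex_minnP ex) => k hk mk; case: k hk mk => [hk _|k hk mk].
    by exfalso; move: hk; rewrite expr0 mulr1; lra.
  exists k; split => //; rewrite leNgt; apply/negP => /mk; by rewrite ltnn.
set N0 := (n ^ 2)%N; set s0 : R := (4^-1) ^+ (4 * n.+1 ^ 2).
pose r : R := (4^-1) ^+ N0; have r0 : 0 < r by exact: q4_gt0.
have s00 : 0 < s0 by exact: q4_gt0.
(* An approximation error of the order of the energy discarded before the slab; it lies below the
   link variances of all levels j <= n because (n+1)^2 >= n^2 + n. *)
pose del : R := Kg * (4^-1) ^+ (2 * n.+1 ^ 2).
have del0 : 0 < del by rewrite mulr_gt0// q4_gt0.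
have hl (p : nat * nat * nat) : exists l, (p.1.2 <= 4 ^ (4 * (N0 + p.1.1)))%N -> (p.2 <= 4 ^ (2 * (N0 + p.1.1)))%N ->
   rect_in s0 (tq (N0 + p.1.1) p.1.2) l /\
   (l2d (late s0 (tq (N0 + p.1.1) p.1.2) (xq (N0 + p.1.1) p.2)) (stepf l) <= del%:E)%E.
  have [h1|h1] := boolP (p.1.2 <= 4 ^ (4 * (N0 + p.1.1)))%N; last by exists [::].
  have [h2|h2] := boolP (p.2 <= 4 ^ (2 * (N0 + p.1.1)))%N; last by exists [::].
  have t01 : 0 <= (tq (N0 + p.1.1) p.1.2 : R) <= 1 by rewrite tq_ge0 tq_le1.
  have x01 : 0 <= (xq (N0 + p.1.1) p.2 : R) <= 1 by rewrite xq_ge0 xq_le1.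
  by have [l hl] := kernel_steps (ltW s00) t01 x01 del0; exists l.
have [ll hll] := choice hl; pose l j a b := ll (j, a, b).
pose I := {j : 'I_n.+1 & ('I_(4 ^ (4 * j)).+1 * 'I_(4 ^ (2 * j)).+1)%type}.
pose va (j a b : nat) := [/\ (j <= n)%N, (a <= 4 ^ (4 * j))%N & (b <= 4 ^ (2 * j))%N].
have vaI (i : I) : va (tag i) (tagged i).1 (tagged i).2.
  by split; rewrite -ltnS ltn_ord.
have va4 k (j a : nat) : (a <= 4 ^ (k * j))%N -> (a <= 4 ^ (k * (N0 + j)))%N.
  by move=> h; apply: (leq_trans h); rewrite leq_exp2l// leq_mul2l leq_addl orbT.
have vl j a b : va j a b -> rect_in s0 (tq (N0 + j) a) (l j a b) /\
   (l2d (late s0 (tq (N0 + j) a) (xq (N0 + j) b)) (stepf (l j a b)) <= del%:E)%E.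
  by move=> [_ h1 h2]; apply: (hll (j, a, b)); exact: va4.
have tqr j a : (a <= 4 ^ (4 * j))%N -> tq (N0 + j) a <= r ^+ 4.
  move=> h; rewrite /tq mulnDr exprD mulrCA /r -exprM (mulnC N0) ger_pMr ?q4_gt0//.
  exact: (@tq_le1 R j a h).
have rin j a b : va j a b -> rect_in s0 (r ^+ 4) (l j a b).
  move=> v p /((vl _ _ _ v).1)[x [y' [Z [h1 h2 h3 h4 h5]]]]; exists x, y', Z; split => //.
  by apply: (le_trans h3); apply: tqr; case: v.
have sin j a b : va j a b -> step_in (slabn n) (l j a b).
  move=> v; have := rect_step (ltW s00) (rin _ _ _ v).
  by rewrite /slabn /r -exprM (mulnC N0).
have okl j a b : va j a b -> step_ok (l j a b) by move=> /sin; exact: step_in_ok.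
pose par k a := (a %/ 4 ^ k)%N.
have vpar j a b : va j.+1 a b -> va j (par 4 a) (par 2 b).
  by move=> [h1 h2 h3]; split; [exact: ltnW|exact: parent_le|exact: parent_le].
pose LK (j a b : nat) := if j is j'.+1 then l j a b ++ step_scale (-1) (l j' (par 4 a) (par 2 b)) else l 0%N a b.
have okLK j a b : va j a b -> step_in (slabn n) (LK j a b).
  case: j => [|j] v; first exact: sin.
  move=> p; rewrite mem_cat => /orP[/(sin _ _ _ v)//|/mapP[p' pl' ->]] /=.
  exact: (sin _ _ _ (vpar _ _ _ v)) pl'.
pose sj (j : nat) : R := C1 * (4^-1) ^+ (N0 + j).
have sj0 j : 0 < sj j by rewrite mulr_gt0 ?q4_gt0//; lra.
have sj2 j : N2 * Kg * (4^-1) ^+ (2 * (N0 + j)) <= sj j ^+ 2.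
  rewrite /sj exprMn -exprM (mulnC _ 2%N); apply: ler_wpM2r; first by rewrite ltW// q4_gt0.
  apply: (@le_trans _ _ (C1 * 1)); first by rewrite mulr1 lerDl.
  by rewrite expr2 ler_wpM2l//; lra.
have dele j : (j <= n)%N -> del <= Kg * (4^-1) ^+ (2 * (N0 + j)).
  move=> jn; rewrite ler_wpM2l ?(ltW k0)//; apply: ler_wiXn2l; [by []|lra|].
  rewrite leq_mul2l /=; apply: (@leq_trans (n * n + n)).
    by rewrite mulnn leq_add2l.
  by rewrite -(mulnn n.+1) mulSn mulnS addnA [leqRHS]addnC leq_add2l leq_addl.
have kq j : 0 < Kg * (4^-1 : R) ^+ (2 * (N0 + j)) by rewrite mulr_gt0// q4_gt0.
have vLK j a b : va j a b -> step_var (LK j a b) <= sj j ^+ 2.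
  move=> v; apply: le_trans (sj2 j); rewrite -mulrA eN2; case: j v => [|j] v.
    have [h1 h2] := vl _ _ _ v; have ok := okl _ _ _ v; have [_ va1 vb1] := v.
    rewrite -lee_fin -step_varE//.
    have ml := measurable_late s0 (tq (N0 + 0) a) (xq (N0 + 0) b).
    apply: (le_trans (integral_sqr_le mu2 (measurable_stepf ok) ml)).
    have x01 : 0 <= (xq (N0 + 0) b : R) <= 1 by rewrite xq_ge0 xq_le1// va4.
    have t01 : 0 <= (tq (N0 + 0) a : R) <= 1 by rewrite tq_ge0 tq_le1// va4.
    have e1 : (\int[mu2]_z (late s0 (tq (N0 + 0) a) (xq (N0 + 0) b) z ^+ 2)%:E <= (Kg * (4^-1) ^+ (2 * (N0 + 0)))%:E)%E.
      apply: (le_trans (sqn_late1 _ _ _)); apply: (le_trans (sqn_gker t01 x01)).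
      rewrite lee_fin ler_pM2l//; have -> : (4^-1 : R) ^+ (2 * (N0 + 0)) = Num.sqrt (r ^+ 4).
        rewrite (_ : r ^+ 4 = (r ^+ 2) ^+ 2); last by ring.
        by rewrite sqrtr_sqr ger0_norm ?sqr_ge0// /r -exprM addn0 mulnC.
      by apply: ler_wsqrtr; exact: tqr.
    have e2 : (\int[mu2]_z ((stepf (l 0%N a b) z - late s0 (tq (N0 + 0) a) (xq (N0 + 0) b) z) ^+ 2)%:E <= (Kg * (4^-1) ^+ (2 * (N0 + 0)))%:E)%E.
      apply: (@le_trans _ _ del%:E); last by rewrite lee_fin dele.
      apply: le_trans h2; rewrite le_eqVlt; apply/orP; left; apply/eqP.
      by apply: eq_integral => z _; congr EFin; ring.
    apply: (le_trans (lee_twice e1 e2)); rewrite lee_fin ler_wpM2r ?(ltW (kq _))//.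
    by rewrite ler_nat.
  have v' := vpar _ _ _ v; have [h1 h2] := vl _ _ _ v; have [h1' h2'] := vl _ _ _ v'.
  have [jn va1 vb1] := v.
  have sl : (sqn (fun z => (late s0 (tq (N0 + j.+1) a) (xq (N0 + j.+1) b) z - late s0 (tq (N0 + j) (par 4 a)) (xq (N0 + j) (par 2 b)) z)%R)
     <= (4 * Kg * (4^-1) ^+ (2 * (N0 + j)))%:E)%E.
    apply: (le_trans (sqn_late_le _ _ _ _ _)); rewrite addnS; apply: sqn_link.
      by rewrite -addnS; exact: va4.
    by rewrite -addnS; exact: va4.
  apply: (le_trans (link_var (okl _ _ _ v) (okl _ _ _ v') (measurable_late _ _ _) (measurable_late _ _ _) h2 h2' sl)).
  have := dele _ jn; rewrite addnS mulnS [in leRHS]exprD.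
  have -> : 4 * Kg * 4^-1 ^+ (2 * (N0 + j)) = 16 * (4 * (Kg * (4^-1 ^+ 2 * 4^-1 ^+ (2 * (N0 + j))))) :> R by field.
  rewrite [X in _ -> _ <= _ * (Kg * X)]exprD; move: (Kg * _) => z; lra.
pose dd (j : nat) := ((J - j) + (j - J))%N.
pose ej (j : nat) : R := (4^-1) ^+ J * (2^-1) ^+ dd j * r.
have ej0 j : 0 < ej j by rewrite !mulr_gt0 ?q4_gt0// exprn_gt0.
pose B : set Omega := [set w | forall i : I, (- ej (tag i) < wsum W (LK (tag i) (tagged i).1 (tagged i).2) w <= ej (tag i))%R].
exists (l n), B, (3 * ((4^-1) ^+ J * r)); split.
- move=> a b ha hb; exact: (hll (n, a, b)) ha hb.
- have := @measurable_box R I (fun i => - ej (tag i)) (fun i => ej (tag i)) _ (g_sigma_algebraType (noise_gen P W (slabn n)))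
    (fun i => wsum W (LK (tag i) (tagged i).1 (tagged i).2)) (fun i => noise_alg_wsum (okLK _ _ _ (vaI i))).
  exact.
- have H := sidak I (fun i => LK (tag i) (tagged i).1 (tagged i).2) (fun i => sj (tag i)) (fun i => ej (tag i))
    (fun i => step_in_ok (okLK _ _ _ (vaI i))) (fun i => sj0 _) (fun i => ej0 _) (fun i => vLK _ _ _ (vaI i)).
  apply: le_trans H; rewrite lee_fin invfM mulrC ler_wpM2r//.
  have -> : n%:R^-1 = expR (- y) by rewrite expRN lnK.
  rewrite ler_expR lerN2; apply: le_trans J1; rewrite lerD2r.
  (* At level J - m the ratio of deviation to window is C1 * 8^m, and this linear cost is outweighed
     by the factor 4^(-6m) in the count. At level J + m it is C1 * 2^-m, and the thirteenth power
     beats the count 4^(6m) = 2^(12m). *)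
  have key (j : nat) : W6 ^+ j * phi13 (sj j / ej j) <= C13 * W6 ^+ J * (2^-1) ^+ dd j.
    have p1 := @q4_gt0 R N0; have p2 := @q4_gt0 R j; have C1p : 0 < C1 by clear -hW C11; lra.
    have x0 : 0 <= sj j / ej j by rewrite divr_ge0// ltW.
    have [f1 f2] := phi13_le x0.
    have W0 m : 0 <= W6 ^+ m by clear -hW W61; rewrite exprn_ge0//; lra.
    have [jJ|Jj] := leqP j J.
      have [m eJ] : exists m, (J = j + m)%N by exists (J - j)%N; rewrite subnKC.
      have em : dd j = m by rewrite /dd eJ addKn (_ : j - _ = 0)%N ?addn0//; apply/eqP; rewrite subn_eq0 leq_addr.
      have p3 := @q4_gt0 R m; have p4 : 0 < (2^-1 : R) ^+ m by rewrite exprn_gt0.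
      have eX : sj j / ej j = C1 * 8 ^+ m.
        rewrite /sj /ej em eJ /r !exprD.
        have -> : 8 ^+ m = ((4^-1) ^+ m * (2^-1) ^+ m)^-1 :> R.
          by rewrite -exprMn -exprVn; congr (_ ^+ _); field.
        by field; rewrite !gt_eqF.
      rewrite em; apply: (@le_trans _ _ (W6 ^+ j * (C13 * 8 ^+ m))).
        apply: ler_wpM2l => //; apply: (le_trans f1); rewrite eX.
        by apply: ler_wpM2r; [rewrite exprn_ge0|rewrite /C13 exprS ler_peMr ?exprn_ege1//; clear -hW C11; lra].
      rewrite mulrCA -[leRHS]mulrA; apply: ler_wpM2l; first by lra.
      rewrite eJ exprD -[leRHS]mulrA; apply: ler_wpM2l => //.
      rewrite -exprMn; apply: lerXn2r; rewrite ?nnegrE//; first by clear -hW W61; rewrite mulr_ge0//; lra.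
      rewrite ler_pdivlMr// /W6; apply: (@le_trans _ _ (4 ^+ 2)); first by rewrite expr2; clear -hW r0; lra.
      by apply: ler_weXn2l => //; clear -hW r0; lra.
    have [m eJ] : exists m, (j = J + m)%N by exists (j - J)%N; rewrite subnKC// ltnW.
    have em : dd j = m by rewrite /dd eJ addKn (_ : J - _ = 0)%N//; apply/eqP; rewrite subn_eq0 leq_addr.
    have p3 := @q4_gt0 R m; have p4 : 0 < (2^-1 : R) ^+ m by rewrite exprn_gt0.
    have p5 := @q4_gt0 R J.
    have eX : sj j / ej j = C1 * (2^-1) ^+ m.
      rewrite /sj /ej em eJ /r !exprD.
      have -> : (4^-1) ^+ m = (2^-1) ^+ m * (2^-1) ^+ m :> R by rewrite -exprMn; congr (_ ^+ _); field.
      by field; rewrite !gt_eqF.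
    rewrite em; apply: (@le_trans _ _ (W6 ^+ j * (C1 * (2^-1) ^+ m) ^+ 13)).
      by apply: ler_wpM2l => //; rewrite -eX.
    have -> : (C1 * (2^-1) ^+ m) ^+ 13 = C13 * ((2^-1) ^+ m) ^+ 13 by rewrite exprMn.
    rewrite eJ exprD.
    have -> : W6 ^+ J * W6 ^+ m * (C13 * ((2^-1) ^+ m) ^+ 13) = C13 * W6 ^+ J * (W6 ^+ m * ((2^-1) ^+ m) ^+ 13).
      by move: (W6 ^+ J) (W6 ^+ m) (_ ^+ 13) => x1 x2 x3; ring.
    apply: ler_wpM2l; first by apply: mulr_ge0 => //; clear -hW C131; lra.
    rewrite -exprM mulnC exprM -exprMn; apply: lerXn2r; rewrite ?nnegrE//.
      by rewrite mulr_ge0 ?exprn_ge0//; lra.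
    rewrite /W6 (_ : 4 = 2 ^+ 2 :> R); last by ring.
    rewrite -exprM exprS mulrCA -exprMn mulfV ?expr1n ?mulr1//; exact: lexx.
  have cnt (j : nat) : (((4 ^ (4 * j)).+1 * (4 ^ (2 * j)).+1)%:R : R) <= 4 * W6 ^+ j.
    rewrite /W6 -exprM -natrX -natrM ler_nat (_ : 6 * j = 4 * j + 2 * j)%N; last by rewrite -mulnDl.
    by rewrite expnD; apply: succ_mul_le; rewrite expn_gt0.
  rewrite -(@sig_big_dep _ _ _ _ (fun j : 'I_n.+1 => ('I_(4 ^ (4 * j)).+1 * 'I_(4 ^ (2 * j)).+1)%type : finType)
    xpredT (fun _ => xpredT) (fun j _ => C0 * phi13 (sj j / ej j))).
  apply: (@le_trans _ _ (2 * \sum_(j < n.+1) (C0 * (4 * (C13 * W6 ^+ J))) * (2^-1) ^+ dd j)).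
    apply: ler_wpM2l => //; apply: ler_sum => j _.
    rewrite sumr_const card_prod !card_ord -[leLHS]mulr_natr -mulrA -[leRHS]mulrA; apply: ler_wpM2l; first exact: ltW.
    have ph : 0 <= phi13 (sj j / ej j) by apply: phi13_ge0; rewrite divr_ge0// ltW.
    apply: (@le_trans _ _ (phi13 (sj j / ej j) * (4 * W6 ^+ j))); first exact: ler_wpM2l (cnt j).
    by have := key j; move: (phi13 _) (W6 ^+ j) => x z h; rewrite mulrCA (mulrC x) -[leRHS]mulrA; apply: ler_wpM2l.
  rewrite -mulr_sumr; have := dyadic_sum J n.+1; move: (\sum_(_ < _) _) => z hz.
  have p0 : 0 <= C0 * (4 * (C13 * W6 ^+ J)) by apply: mulr_ge0; [exact: ltW|apply: mulr_ge0 => //; apply: mulr_ge0; [clear -hW C131; lra|apply: exprn_ge0; clear -hW W61; lra]].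
  have := ler_wpM2l p0 hz; rewrite /C2; move: (W6 ^+ J) => x; lra.
- split; first by rewrite !mulr_ge0// ltW// q4_gt0.
  have qW : ((4^-1 : R) ^+ J) ^+ 6 * W6 ^+ J = 1.
    by rewrite exprAC -exprMn /W6 -exprMn mulVf ?expr1n.
  have W0 : 1 <= W6 ^+ J by rewrite exprn_ege1.
  have y2 : y <= (W6 * C2 + 1) * W6 ^+ J by rewrite exprS in J2; move: (W6 ^+ J) W0 J2 => x x1 h; lra.
  rewrite exprMn exprMn -/r; set e6 := ((4^-1) ^+ J) ^+ 6 in qW *.
  have e60 : 0 <= e6 by rewrite exprn_ge0// ltW// q4_gt0.
  have r60 : 0 <= r ^+ 6 by rewrite exprn_ge0// ltW.
  apply: (@le_trans _ _ (3 ^+ 6 * (e6 * r ^+ 6) * ((W6 * C2 + 1) * W6 ^+ J))).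
    by apply: ler_wpM2l => //; rewrite mulr_ge0 ?exprn_ge0// mulr_ge0.
  have -> : 3 ^+ 6 * (e6 * r ^+ 6) * ((W6 * C2 + 1) * W6 ^+ J) = (3 ^+ 6 * (W6 * C2 + 1)) * r ^+ 6 * (e6 * W6 ^+ J) by ring.
  rewrite qW mulr1; apply: ler_wpM2r => //; rewrite /C lerDl; lra.
- move=> w Bw a b ha hb.
  have LKle j a' b' : va j a' b' -> `|wsum W (LK j a' b') w| <= ej j.
    move=> [v1 v2 v3]; rewrite -ltnS in v1; rewrite -ltnS in v2; rewrite -ltnS in v3.
    have /= /andP[h1 h2] := Bw (existT _ (Ordinal v1) (Ordinal v2, Ordinal v3) : I).
    by rewrite ler_norml (ltW h1) h2.
  have main j a' b' : va j a' b' -> `|wsum W (l j a' b') w| <= \sum_(k < j.+1) ej k.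
    elim: j a' b' => [|j IH] a' b' v; first by rewrite big_ord1; exact: LKle v.
    rewrite big_ord_recr/=; have h1 := IH _ _ (vpar _ _ _ v); have h2 := LKle _ _ _ v.
    rewrite /LK wsum_cat wsum_scale mulN1r in h2.
    have := ler_normD (wsum W (l j (par 4 a') (par 2 b')) w) (wsum W (l j.+1 a' b') w - wsum W (l j (par 4 a') (par 2 b')) w).
    rewrite addrCA subrr addr0 => h; apply: (le_trans h); exact: lerD.
  have vn : va n a b by split.
  apply: (le_trans (main n a b vn)); rewrite /ej -mulr_suml -mulr_sumr mulrA.
  apply: ler_wpM2r; first exact: ltW.
  rewrite mulrC; apply: ler_wpM2r; first by rewrite ltW// q4_gt0.
  exact: dyadic_sum.
Qed.

End cascade.

(** * From the slab field to the solution, along 4^-(n^2) *)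

Section upper_bound.
Context {R : realType} {d : measure_display} {Omega : measurableType d}.
Context (P : probability Omega R) (W : set (R * R) -> Omega -> R).
Hypothesis hW : white_noise P W.
Notation leb := (@lebesgue_measure R).
Notation mu2 := (leb \x leb)%E.
Variables (sigma : R -> R) (D : R).
Hypotheses (D0 : 0 <= D) (hLip : forall a b, `|sigma a - sigma b| <= D * `|a - b|).
Variable u : R -> R -> Omega -> R.
Hypothesis hu : mild_solution P W sigma (fun _ : R => 0) u.
Hypothesis hcont : continuous_paths P u.
Hypothesis hs0 : sigma 0 != 0.

Lemma slab_sub (a b a' b' : R) : a' <= a -> b <= b' -> slab a b `<=` slab a' b'.
Proof.
move=> aa bb z [/= z1 z2]; split => //=; move: z1; rewrite !in_itv/= => /andP[h1 h2].
by rewrite (le_lt_trans aa)//= (le_trans h2).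
Qed.

Lemma slab_disj (a b a' b' : R) : b' <= a -> slab a b `&` slab a' b' = set0.
Proof.
move=> ba; rewrite -subset0 => z [[/= z1 _] [/= z2 _]]; move: z1 z2; rewrite !in_itv/= => /andP[h1 _] /andP[_ h2].
by have := lt_le_trans h1 (le_trans h2 ba); rewrite ltxx.
Qed.

Lemma q4_le (m k : nat) : (k <= m)%N -> (4^-1 : R) ^+ m <= (4^-1) ^+ k.
Proof. by move=> h; apply: ler_wiXn2l => //; lra. Qed.

(** Makes the product of the factors 1 - 1/(4 m) telescope: its fourth power over m = N, ..., N + k
    - 1 is at most N/(N + k). *)
Lemma one_sub_pow4 (m : R) : 1 <= m -> (1 - (4 * m)^-1) ^+ 4 * (m + 1) <= m.
Proof.
move=> m1; have m0 : 0 < m by lra.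
have x0 : 0 < (4 * m)^-1 by rewrite invr_gt0 mulr_gt0.
have x1 : (4 * m)^-1 <= 1 by rewrite invf_le1 ?mulr_gt0//; lra.
have h : 1 - (4 * m)^-1 <= expR (- (4 * m)^-1) by have := expR_ge1Dx (- (4 * m)^-1); lra.
have h4 : (1 - (4 * m)^-1) ^+ 4 <= expR (- (4 * m)^-1) ^+ 4.
  by apply: lerXn2r; rewrite ?nnegrE ?expR_ge0//; lra.
have e : expR (- (4 * m)^-1) ^+ 4 = expR (- m^-1).
  by rewrite -expRM_natr; congr expR; field; rewrite gt_eqF.
have i0 : 0 <= m^-1 by rewrite invr_ge0 ltW.
have := expNR_le i0; rewrite -e => h5.
have h6 := le_trans h4 h5.
apply: (@le_trans _ _ ((1 + m^-1)^-1 * (m + 1))); first by rewrite ler_wpM2r//; lra.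
have -> : (1 + m^-1)^-1 = m / (m + 1) by field; rewrite !gt_eqF//; lra.
by rewrite divfK// gt_eqF//; lra.
Qed.

(** The series of 1/(4 n) diverges only logarithmically. The divergence is used in the form p^4 (N +
    k) <= N, where p bounds the probability of avoiding k consecutive events. *)
Lemma borel_cantelli2 (B : nat -> set Omega) (n1 : nat) :
  (forall n, (n1 <= n)%N -> noise_alg P W (slabn n) (B n)) ->
  (forall n, (n1 <= n)%N -> (((4 * n%:R)^-1)%:E <= P (B n))%E) ->
  {ae P, forall w, forall N, exists n, (N <= n)%N /\ B n w}.
Proof.
move=> aB pB; pose Z N : set Omega := [set w | forall n, (N <= n)%N -> ~ B n w].
have mB n : (n1 <= n)%N -> measurable (B n) by move=> /aB; exact: noise_alg_measurable.
have mZ N : (n1 <= N)%N -> measurable (Z N).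
  move=> nN; rewrite (_ : Z N = \bigcap_(n in [set n | (N <= n)%N]) ~` B n).
    apply: bigcap_measurable; first by exists N => /=.
    by move=> n /= Nn; apply: measurableC; apply: mB; exact: leq_trans Nn.
  by apply/seteqP; split => w h n /= Nn; exact: h.
have PZ N : (n1 <= N)%N -> (0 < N)%N -> P (Z N) = 0%E.
  move=> nN N0.
  pose A k : set Omega := [set w | forall n, (N <= n)%N -> (n < N + k)%N -> ~ B n w].
  pose Dk k := slab ((4^-1 : R) ^+ (4 * (N + k) ^ 2)) ((4^-1) ^+ (4 * N ^ 2)).
  have key k : noise_alg P W (Dk k) (A k) /\ exists p : R, [/\ 0 <= p, (P (A k) <= p%:E)%E & p ^+ 4 * (N + k)%:R <= N%:R].
    elim: k => [|k [IH1 [p [p0 IH2 IH3]]]].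
      have -> : A 0%N = setT.
        by apply/seteqP; split => // w _ n h1 h2; move: (leq_ltn_trans h1 h2); rewrite addn0 ltnn.
      split; first exact: (@measurableT _ (g_sigma_algebraType (noise_gen P W (Dk 0%N)))).
      by exists 1; split => //; [rewrite probability_setT|rewrite addn0 expr1n mul1r].
    have eA : A k.+1 = A k `&` ~` B (N + k)%N.
      apply/seteqP; split => w.
        move=> h; split; last by apply: h; rewrite ?leq_addr// addnS ltnS.
        by move=> n h1 h2; apply: h => //; rewrite addnS ltnS ltnW.
      move=> [h1 h2] n Nn; rewrite addnS ltnS leq_eqVlt => /orP[/eqP -> //|]; exact: h1.
    have nk : (n1 <= N + k)%N by apply: (leq_trans nN); exact: leq_addr.
    have sqle i j : (i <= j)%N -> (4 * i ^ 2 <= 4 * j ^ 2)%N by move=> ij; rewrite leq_mul2l /= leq_exp2r.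
    have cB : noise_alg P W (slabn (N + k)) (~` B (N + k)%N).
      exact: (@measurableC _ (g_sigma_algebraType (noise_gen P W (slabn (N + k)))) _ (aB _ nk)).
    rewrite eA; split.
      apply: (@measurableI _ (g_sigma_algebraType (noise_gen P W (Dk k.+1)))).
        apply: noise_algS IH1; apply: slab_sub => //; apply: q4_le; apply: sqle.
        by rewrite leq_add2l.
      apply: noise_algS cB; apply: slab_sub; first by rewrite addnS.
      by apply: q4_le; apply: sqle; exact: leq_addr.
    have m1 : 1 <= (N + k)%:R :> R by rewrite ler1n (leq_trans N0)// leq_addr.
    set m : R := (N + k)%:R in m1 IH3.
    have x0 : 0 < (4 * m)^-1 by rewrite invr_gt0 mulr_gt0//; lra.
    have x1 : (4 * m)^-1 <= 1 by rewrite invf_le1 ?mulr_gt0//; lra.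
    exists (p * (1 - (4 * m)^-1)); split.
    - by rewrite mulr_ge0//; lra.
    - rewrite (noise_indep hW _ IH1 cB); last by apply: slab_disj; exact: lexx.
      rewrite EFinM; apply: lee_pmul => //.
      rewrite probability_setC; last exact: mB.
      by rewrite EFinB; apply: leeB => //; exact: pB.
    - rewrite addnS -(natr1 (N + k)) -/m exprMn -mulrA; apply: le_trans IH3.
      by apply: ler_wpM2l; [exact: exprn_ge0|exact: one_sub_pow4].
  apply/eqP; rewrite eq_le measure_ge0 andbT.
  have fZ : P (Z N) = (fine (P (Z N)))%:E by rewrite fineK// fin_num_measure//; exact: mZ.
  rewrite fZ lee_fin leNgt; apply/negP; set z := fine _ => z0.
  have zk k : z ^+ 4 * (N + k)%:R <= N%:R.
    have [IH1 [p [p0 h1 h2]]] := key k; apply: le_trans h2; apply: ler_wpM2r => //.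
    apply: lerXn2r; rewrite ?nnegrE ?(ltW z0)//.
    rewrite -lee_fin -fZ; apply: le_trans h1; apply: prob_le; first exact: mZ.
      exact: noise_alg_measurable IH1.
    by move=> w h n Nn _; exact: h.
  have z40 : 0 < z ^+ 4 by rewrite exprn_gt0.
  have Nz : 0 <= N%:R / z ^+ 4 by rewrite divr_ge0// ltW.
  have := archi_boundP Nz; set k := Num.bound _; rewrite ltr_pdivrMr// => hk.
  have := zk k; rewrite natrD mulrDr; have := mulr_ge0 (ltW z40) (ler0n R N); lra.
have h N : {ae P, forall w, exists n, (N <= n)%N /\ B n w}.
  pose N' := maxn N (maxn n1 1); exists (Z N').
  have h1 : (n1 <= N')%N by rewrite /N' !leq_max leqnn !orbT.
  have h2 : (0 < N')%N by rewrite /N' !leq_max leqnn !orbT.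
  split; [exact: mZ|exact: PZ|move=> w /= nw n Nn Bn].
  by apply: nw; exists n; split => //; apply: leq_trans Nn; rewrite leq_maxl.
exact: ae_foralln.
Qed.

(** Two effects separate the solution from the slab field: the nonlinearity, of relative size
    4^(-n^2) up to powers of n, and the noise before the slab, of relative size 4^(-2n) thanks to
    the quadratic gaps. An exponential tail in 4^n covers the roughly 4^(6n) grid points. *)
Lemma linear_scale : exists C : R, 0 <= C /\ forall (n : nat) (E : set Omega) (l : nat -> nat -> seq (R * set (R * R))),
  (0 < n)%N -> measurable E -> (forall w, E w -> bounded_on u ((4^-1) ^+ (4 * n ^ 2)) (tailB (n ^ 2).-1) w) ->
  (forall a b, (a <= 4 ^ (4 * (n ^ 2 + n)))%N -> (b <= 4 ^ (2 * (n ^ 2 + n)))%N ->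
        rect_in ((4^-1) ^+ (4 * n.+1 ^ 2)) (tq (n ^ 2 + n) a) (l a b) /\
        (l2d (late ((4^-1) ^+ (4 * n.+1 ^ 2)) (tq (n ^ 2 + n) a) (xq (n ^ 2 + n) b)) (stepf (l a b))
          <= (Kg * (4^-1) ^+ (2 * n.+1 ^ 2))%:E)%E) ->
  exists F : set Omega, [/\ measurable F, (P F <= (C * n.+1%:R ^- 2)%:E)%E &
    forall w, E w -> ~ F w -> forall a b, (a <= 4 ^ (4 * n))%N -> (b <= 4 ^ (2 * n))%N ->
      `|u (tq (n ^ 2 + n) a) (xq (n ^ 2 + n) b) w - sigma 0 * wsum W (l a b) w| <= (4^-1) ^+ (n ^ 2) / n.+1%:R].
Proof.
have k0 := @Kg_gt0 R.
pose S := `|sigma 0|; have S0 : 0 < S by rewrite normr_gt0.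
have [CV [CV0 eCV]] : exists CV : R, 0 < CV /\ CV = 2 * ((16 * D) ^+ 2 * Kg) + 8 * (S ^+ 2 * Kg).
  exists (2 * ((16 * D) ^+ 2 * Kg) + 8 * (S ^+ 2 * Kg)); split => //.
  apply: ltr_wpDl; last by rewrite !mulr_gt0 ?exprn_gt0.
  by rewrite mulr_ge0// mulr_ge0 ?sqr_ge0// ltW.
have [N3 [N30 eN3]] : exists N3 : R, 0 < N3 /\ N3 = 24 by exists 24; split => //; exact: ltr0n.
have [F6 [F60 hF6]] := @poly_geo R 6; have [F2 [F20 hF2]] := @poly_geo R 2.
have [F7 [F71 hF7]] := @pow_le_exp_ex R 7.
pose c := (N3 * CV * F6)^-1; have c0 : 0 < c by rewrite invr_gt0 !mulr_gt0.
pose C := 8 * F7 * F2 / c ^+ 7.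
have C0 : 0 <= C by rewrite divr_ge0 ?exprn_ge0 ?(ltW c0)// !mulr_ge0 ?(ltW F20)//; lra.
exists C; split => // n E l n0 mE hE hl.
have nR : 1 <= n%:R :> R by rewrite ler1n.
set N0 := (n ^ 2)%N in hE hl *; set s0 : R := (4^-1) ^+ (4 * n.+1 ^ 2) in hl *.
have N00 : (0 < N0)%N by rewrite expn_gt0 n0.
set r : R := (4^-1) ^+ N0; have r0 : 0 < r by exact: q4_gt0.
have er4 : (4^-1) ^+ (4 * N0) = r ^+ 4 by rewrite /r -exprM mulnC.
rewrite er4 in hE.
have s00 : 0 < s0 by exact: q4_gt0.
pose Y : R := 4 ^+ n; have Y0 : 0 < Y by rewrite exprn_gt0.
have qY : (4^-1) ^+ (2 * n) = Y ^- 2 by rewrite /Y -exprM mulnC exprVn.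
have rY : r ^+ 2 <= Y ^- 2.
  by rewrite -qY /r -exprM (mulnC _ 2%N); apply: q4_le; rewrite leq_mul2l /= /N0 -mulnn leq_pmulr.
(* A common bound for both energies: n^4 r^4 from the nonlinearity, with r^2 <= Y^-2, and r^2 Y^-2
   from the early noise. *)
pose V := r ^+ 2 * Y ^- 2 * n%:R ^+ 4 * CV.
have Y20 : 0 < Y ^- 2 by rewrite invr_gt0 exprn_gt0.
have r20 : 0 < r ^+ 2 by rewrite exprn_gt0.
have n40 : 1 <= n%:R ^+ 4 :> R by exact: exprn_ege1.
have V0 : 0 < V by rewrite /V; apply: mulr_gt0 => //; apply: mulr_gt0; [exact: mulr_gt0|lra].
pose a := r / n.+1%:R; have a0 : 0 < a by rewrite divr_gt0.
pose I := ('I_(4 ^ (4 * n)).+1 * 'I_(4 ^ (2 * n)).+1)%type.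
pose dif (i : I) w := `|u (tq (N0 + n) i.1) (xq (N0 + n) i.2) w - sigma 0 * wsum W (l i.1 i.2) w|.
pose B (i : I) : set Omega := E `&` [set w | (a <= dif i w)%R].
have i1 (i : I) : (i.1 <= 4 ^ (4 * n))%N by rewrite -ltnS ltn_ord.
have i2 (i : I) : (i.2 <= 4 ^ (2 * n))%N by rewrite -ltnS ltn_ord.
have up k x : (x <= 4 ^ (k * n))%N -> (x <= 4 ^ (k * (N0 + n)))%N.
  by move=> h; apply: (leq_trans h); rewrite leq_exp2l// leq_mul2l leq_addl orbT.
have hli (i : I) := hl i.1 i.2 (up _ _ (i1 i)) (up _ _ (i2 i)).
have tr (i : I) : tq (N0 + n) i.1 <= r ^+ 4.
  rewrite /tq mulnDr exprD mulrCA er4 ger_pMr ?exprn_gt0//.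
  exact: (@tq_le1 R n i.1 (i1 i)).
have t01 (i : I) : 0 <= (tq (N0 + n) i.1 : R) <= 1 by rewrite tq_ge0 tq_le1// up.
have x01 (i : I) : 0 <= (xq (N0 + n) i.2 : R) <= 1 by rewrite xq_ge0 xq_le1// up.
have rl (i : I) : rect_in 0 (tq (N0 + n) i.1) (l i.1 i.2).
  move=> p /((hli i).1)[x [y [Z [h1 h2 h3 h4 h5]]]]; exists x, y, Z; split => //.
  exact: le_trans (ltW s00) h1.
have mB i : measurable (B i).
  apply: measurableI => //; rewrite (_ : [set w | _] = [set w | (a%:E <= (dif i w)%:E)%E]).
    apply: measurable_ge_e; apply/measurable_EFinP; apply: measurableT_comp => //.
    apply: measurable_funB; first by have /andP[h _] := t01 i; exact: (measurable_u hu).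
    apply: measurable_funM => //; apply: (measurable_wsum hW).
    exact: step_in_ok (rect_step (lexx 0) (rl i)).
  by apply/seteqP; split => w /=; rewrite lee_fin.
have tn : tailB N0.-1 = 16 * n%:R ^+ 2 * r :> R.
  have e : (n%:R ^+ 2 : R) = N0%:R by rewrite -natrX.
  by rewrite e; have := prednK N00; rewrite /tailB /r; move: (N0.-1) => m <-; rewrite exprS; field.
have PB i : (P (B i) <= (2 * expR (- (c * Y)))%:E)%E.
  have b0 : 0 <= tailB N0.-1 :> R by exact: tailB_ge0.
  have hEp w : E w -> bounded_on u (tq (N0 + n) i.1) (tailB N0.-1) w.
    by move=> Ew q z /andP[q1 q2] z01; apply: (hE w Ew) => //; rewrite q1 (le_trans q2).
  apply: (le_trans (blin hW D0 hLip hu mE (rl i) b0 hEp (t01 i) (x01 i) a0 V0 _)).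
    have e1 : (sqn (gker (tq (N0 + n) i.1) (xq (N0 + n) i.2)) <= (Kg * r ^+ 2)%:E)%E.
      apply: (le_trans (sqn_gker (t01 i) (x01 i))); rewrite lee_fin ler_pM2l//.
      rewrite (_ : r ^+ 2 = Num.sqrt ((r ^+ 2) ^+ 2)); last by rewrite sqrtr_sqr ger0_norm ?sqr_ge0.
      by apply: ler_wsqrtr; rewrite -exprM.
    have e2 : (l2d (gker (tq (N0 + n) i.1) (xq (N0 + n) i.2)) (stepf (l i.1 i.2)) <= (4 * (Kg * (4^-1) ^+ (2 * n.+1 ^ 2)))%:E)%E.
      have ok : step_ok (l i.1 i.2) by exact: step_in_ok (rect_step (lexx 0) (rl i)).
      apply: (le_trans (l2d_triangle (@measurable_gker R _ _) (measurable_late s0 (tq (N0 + n) i.1) (xq (N0 + n) i.2)) (measurable_stepf ok))).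
      apply: lee_twice; last exact: (hli i).2.
      have h := sqn_gker_early (t01 i) (x01 i) s00.
      have es : Num.sqrt s0 = (4^-1) ^+ (2 * n.+1 ^ 2).
        rewrite /s0 (_ : 4 * n.+1 ^ 2 = (2 * n.+1 ^ 2) * 2)%N; last by rewrite mulnAC.
        by rewrite exprM sqrtr_sqr ger0_norm// ltW// q4_gt0.
      rewrite es in h; apply: le_trans h; rewrite le_eqVlt; apply/orP; left; apply/eqP.
      apply: eq_integral => z _; congr ((_ ^+ 2)%:E).
      rewrite /late !indicE in_setC; case: (_ \in _); rewrite /= ?mulr0 ?mulr1 ?subr0 ?subrr//.
    have e3 : (4^-1) ^+ (2 * n.+1 ^ 2) <= r ^+ 2 * Y ^- 2.
      rewrite -qY /r -exprM -exprD; apply: q4_le.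
      rewrite mulnC -mulnDr leq_mul2l /= /N0.
      by rewrite -(mulnn n.+1) mulSn mulnS addnA [leqRHS]addnC mulnn leq_add2l leq_addl.
    apply: (@le_trans _ _ (2%:E * (((D * tailB N0.-1) ^+ 2)%:E * (Kg * r ^+ 2)%:E) + 2%:E * ((sigma 0 ^+ 2)%:E * (4 * (Kg * (r ^+ 2 * Y ^- 2)))%:E))%E).
      apply: leeD; apply: lee_wpmul2l => //; apply: lee_wpmul2l; rewrite ?lee_fin ?sqr_ge0//.
      apply: (le_trans e2); rewrite lee_fin; apply: ler_wpM2l => //.
      by apply: ler_wpM2l => //; exact: ltW.
    rewrite -!EFinM -EFinD lee_fin tn /V eCV /S real_normK ?num_real//.
    have s20 := sqr_ge0 (sigma 0).
    set y2 := Y ^- 2 in rY Y20 *; set s2 := sigma 0 ^+ 2 in s20 *.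
    have -> : 2 * ((D * (16 * n%:R ^+ 2 * r)) ^+ 2 * (Kg * r ^+ 2)) + 2 * (s2 * (4 * (Kg * (r ^+ 2 * y2)))) =
      (2 * ((16 * D) ^+ 2 * Kg) * n%:R ^+ 4) * (r ^+ 2 * r ^+ 2) + (8 * (s2 * Kg) * (r ^+ 2 * y2)) * 1 by ring.
    have -> : r ^+ 2 * y2 * n%:R ^+ 4 * (2 * ((16 * D) ^+ 2 * Kg) + 8 * (s2 * Kg)) =
      (2 * ((16 * D) ^+ 2 * Kg) * n%:R ^+ 4) * (r ^+ 2 * y2) + (8 * (s2 * Kg) * (r ^+ 2 * y2)) * n%:R ^+ 4 by ring.
    have g0 := ltW k0; have y20 := ltW Y20; have r20' := ltW r20.
    apply: lerD.
      apply: ler_wpM2l; last by apply: ler_wpM2l.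
      apply: mulr_ge0; last by lra.
      by apply: mulr_ge0 => //; apply: mulr_ge0 => //; exact: sqr_ge0.
    apply: ler_wpM2l => //; apply: mulr_ge0; last exact: mulr_ge0.
    by apply: mulr_ge0 => //; exact: mulr_ge0.
  rewrite lee_fin; apply: ler_wpM2l => //; rewrite ler_expR lerN2.
  have e : a ^+ 2 / (24 * V) = (N3 * CV)^-1 * (Y ^+ 2 / (n%:R ^+ 4 * n.+1%:R ^+ 2)).
    rewrite /a /V -eN3; field; rewrite !gt_eqF//; lra.
  rewrite e /c invfM -mulrA; apply: ler_wpM2l; first by rewrite invr_ge0 ltW// mulr_gt0.
  have p1 : 0 < n%:R ^+ 4 * n.+1%:R ^+ 2 :> R by rewrite mulr_gt0 ?exprn_gt0//; lra.
  rewrite ler_pdivlMr//.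
  have h : n%:R ^+ 4 * n.+1%:R ^+ 2 <= F6 * Y.
    apply: le_trans (hF6 n); rewrite [leRHS](_ : _ = n.+1%:R ^+ 4 * n.+1%:R ^+ 2); last by ring.
    by apply: ler_wpM2r; [exact: sqr_ge0|apply: lerXn2r; rewrite ?nnegrE// ler_nat].
  apply: (@le_trans _ _ (F6^-1 * Y * (F6 * Y))).
    by apply: ler_wpM2l => //; apply: mulr_ge0; [rewrite invr_ge0|]; exact: ltW.
  by rewrite le_eqVlt; apply/orP; left; apply/eqP; field; rewrite gt_eqF.
have mU : measurable (\bigcup_(i in [set: I]) B i).
  by apply: fin_bigcup_measurable => //; exact: finite_finset.
exists (\bigcup_(i in [set: I]) B i); split => //.
- apply: (@le_trans _ _ (\sum_(i : I) P (B i))%E).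
    by apply: (finite_cover_prob _ ) => // w [p _ h]; exists p.
  apply: (@le_trans _ _ (\sum_(i : I) (2 * expR (- (c * Y)))%:E)%E).
    by apply: lee_sum => i _; exact: PB.
  rewrite sumEFin lee_fin sumr_const card_prod !card_ord -[leLHS]mulr_natr.
  have cnt : (((4 ^ (4 * n)).+1 * (4 ^ (2 * n)).+1)%:R : R) <= 4 * Y ^+ 6.
    rewrite /Y -exprM -natrX -natrM ler_nat (_ : n * 6 = 4 * n + 2 * n)%N; last by rewrite -mulnDl mulnC.
    by rewrite expnD; apply: succ_mul_le; rewrite expn_gt0.
  have cY0 : 0 < c * Y by rewrite mulr_gt0.
  have ex : expR (- (c * Y)) <= F7 / (c * Y) ^+ 7.
    rewrite ler_pdivlMr ?exprn_gt0//; apply: (le_trans (ler_wpM2l (expR_ge0 _) (hF7 _ (ltW cY0)))).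
    by rewrite mulrCA -expRD addNr expR0 mulr1.
  have h2 := hF2 n; rewrite -/Y in h2.
  apply: (@le_trans _ _ (2 * (F7 / (c * Y) ^+ 7) * (4 * Y ^+ 6))).
    apply: ler_pM => //.
    by apply: ler_wpM2l => //; exact: ex.
  have -> : 2 * (F7 / (c * Y) ^+ 7) * (4 * Y ^+ 6) = 8 * F7 / c ^+ 7 * Y^-1.
    by field; rewrite !gt_eqF.
  have -> : C / n.+1%:R ^+ 2 = 8 * F7 / c ^+ 7 * (F2 / n.+1%:R ^+ 2) by rewrite /C; ring.
  apply: ler_wpM2l.
    by apply: divr_ge0; [apply: mulr_ge0 => //; lra|apply: exprn_ge0; exact: ltW].
  rewrite ler_pdivlMr ?exprn_gt0// mulrC ler_pdivrMr//.
- move=> w Ew nU a' b' ha hb; rewrite leNgt; apply/negP => lt; apply: nU.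
  rewrite -ltnS in ha; rewrite -ltnS in hb.
  by exists (Ordinal ha, Ordinal hb) => //; split => //; exact: ltW.
Qed.

Lemma add_pow6 (x z : R) : 0 <= x -> 0 <= z -> (x + z) ^+ 6 <= 64 * (x ^+ 6 + z ^+ 6).
Proof.
move=> x0 z0; wlog xz : x z x0 z0 / x <= z.
  by move=> h; have [/h|/ltW/h] := leP x z; [exact|rewrite addrC [X in _ <= _ * X]addrC; exact].
apply: (@le_trans _ _ ((2 * z) ^+ 6)).
  by apply: lerXn2r; rewrite ?nnegrE ?addr_ge0 ?mulr_ge0//; lra.
have -> : (2 * z) ^+ 6 = 64 * (0 + z ^+ 6) by ring.
by apply: ler_wpM2l => //; apply: lerD => //; exact: exprn_ge0.
Qed.

(** The slab events occur for infinitely many n and the linearisation holds for all large n. Passing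
    from the grid of level n^2 + n to the whole box costs [tailB (n ^ 2 + n)], at most a constant
    times r / (n + 1). *)
Lemma upper_bound (T : R) (L : set Omega) : 0 < T <= 1 -> measurable L ->
  (forall w, L w -> bounded_on u T 1 w) ->
  exists C : R, 0 < C /\ {ae P, forall w, L w -> forall N, exists n, [/\ (N <= n)%N, 1 <= ln (n%:R : R) &
    forall s y, 0 <= s <= (4^-1) ^+ (4 * n ^ 2) -> 0 <= y <= (4^-1) ^+ (2 * n ^ 2) ->
      `|u s y w| ^+ 6 * ln (n%:R : R) <= C * ((4^-1) ^+ (n ^ 2)) ^+ 6]}.
Proof.
move=> T01 mL hL; have [C1 [C10 H1]] := cascade hW; have [C2 [C20 H2]] := linear_scale.
have [F3 [F30 hF3]] := @poly_geo R 3.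
have [G [mG PG hG]] := exists_good hW hu hcont.
pose S := `|sigma 0|; have S0 : 0 <= S by exact: normr_ge0.
exists (64 * (S ^+ 6 * C1 + (1 + 4 * F3) ^+ 6)); split.
  rewrite mulr_gt0// ltr_wpDl ?exprn_gt0//; last by lra.
  by rewrite mulr_ge0 ?exprn_ge0// ltW.
pose n1 := (Num.bound (expR (C1 + 1))).+1.
have ln1 n : (n1 <= n)%N -> C1 <= ln (n%:R : R) /\ 1 <= ln (n%:R : R).
  move=> h; have n0 : 0 < n%:R :> R by rewrite ltr0n; exact: leq_ltn_trans h.
  suff : C1 + 1 <= ln (n%:R : R) by lra.
  rewrite -[leLHS]expRK ler_ln ?posrE ?expR_gt0//.
  apply: ltW; apply: lt_le_trans (archi_boundP (expR_ge0 _)) _.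
  by rewrite ler_nat; exact: ltnW.
have ex1 n : exists x : (nat -> nat -> seq (R * set (R * R))) * set Omega * R, (n1 <= n)%N ->
  [/\ forall a b, (a <= 4 ^ (4 * (n ^ 2 + n)))%N -> (b <= 4 ^ (2 * (n ^ 2 + n)))%N ->
        rect_in ((4^-1) ^+ (4 * n.+1 ^ 2)) (tq (n ^ 2 + n) a) (x.1.1 a b) /\
        (l2d (late ((4^-1) ^+ (4 * n.+1 ^ 2)) (tq (n ^ 2 + n) a) (xq (n ^ 2 + n) b)) (stepf (x.1.1 a b))
          <= (Kg * (4^-1) ^+ (2 * n.+1 ^ 2))%:E)%E,
      noise_alg P W (slabn n) x.1.2, (((4 * n%:R)^-1)%:E <= P x.1.2)%E,
      0 <= x.2 /\ x.2 ^+ 6 * ln (n%:R : R) <= C1 * ((4^-1) ^+ (n ^ 2)) ^+ 6 &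
      forall w, x.1.2 w -> forall a b, (a <= 4 ^ (4 * n))%N -> (b <= 4 ^ (2 * n))%N -> `|wsum W (x.1.1 a b) w| <= x.2].
  have [h|h] := boolP (n1 <= n)%N; last by exists (fun _ _ => [::], set0, 0).
  by have [l [B [e [h1 h2 h3 h4 h5]]]] := H1 n (ln1 n h).1; exists (l, B, e).
have [x hx] := choice ex1.
pose E n := G `&` rat_bounded u ((4^-1) ^+ (4 * n ^ 2)) 1 (tailB (n ^ 2).-1).
have mE n : measurable (E n) by apply: measurableI => //; exact: (measurable_rat_bounded hu).
have hE n w : E n w -> bounded_on u ((4^-1) ^+ (4 * n ^ 2)) (tailB (n ^ 2).-1) w.
  move=> [Gw rw] s y hs hy; apply: (rat_bounded_all (q4_gt0 _) _ (hG w Gw).1 rw) => //.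
  by rewrite ltr01 lexx.
have ex2 n : exists F : set Omega, [/\ measurable F, (P F <= (C2 * n.+1%:R ^- 2)%:E)%E &
    (n1 <= n)%N -> forall w, E n w -> ~ F w -> forall a b, (a <= 4 ^ (4 * n))%N -> (b <= 4 ^ (2 * n))%N ->
      `|u (tq (n ^ 2 + n) a) (xq (n ^ 2 + n) b) w - sigma 0 * wsum W ((x n).1.1 a b) w| <= (4^-1) ^+ (n ^ 2) / n.+1%:R].
  have [h|h] := boolP (n1 <= n)%N.
    have [h1 _ _ _ _] := hx n h.
    by have [F [f1 f2 f3]] := H2 n (E n) (x n).1.1 (leq_ltn_trans (leq0n _) h) (mE n) (hE n) h1; exists F.
  exists set0; split => //.
  by rewrite measure0 lee_fin mulr_ge0// invr_ge0 sqr_ge0.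
have [F hF] := choice ex2.
have mF n : measurable (F n) by have [] := hF n.
have sF : (\sum_(0 <= n <oo) P (F n) < +oo)%E.
  apply: (@le_lt_trans _ _ (\sum_(0 <= n <oo) (C2 * n.+1%:R ^- 2)%:E)%E).
    by apply: lee_nneseries => // n _; have [] := hF n.
  apply: (@le_lt_trans _ _ (C2 * 2)%:E); last by rewrite ltry.
  apply: nneseries_bound => [k|n]; first by rewrite mulr_ge0// invr_ge0 sqr_ge0.
  by rewrite -mulr_sumr ler_wpM2l// sum_inv_sqr.
have z1 := lim_sup_set_cvg0 mF sF.
have z2 := modulus hW D0 hLip hu T01 mL hL.
have a1 : {ae P, forall w, ~ lim_sup_set F w}.
  exists (lim_sup_set F); split => //; last by move=> w /= /contrapT.
  by apply: bigcapT_measurable => n; apply: bigcup_measurable => j _.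
have a2 : {ae P, forall w, G w}.
  exists (~` G); split => //; first exact: measurableC.
  by rewrite probability_setC// [X in (1 - X)%E]PG subee.
have a3 : {ae P, forall w, forall N, exists n, (N <= n)%N /\ (x n).1.2 w}.
  by apply: (@borel_cantelli2 (fun n => (x n).1.2) n1) => n /(hx n)[].
have a12 : {ae P, forall w, ~ lim_sup_set F w /\ G w} by apply: filterS2 a1 a2 => w.
apply: filterS3 a12 a3 z2 => w [nl Gw] hB hl Lw N.
have [j0 lk] := hl Lw.
have [n3 hn3] : exists n3, forall n, (n3 <= n)%N -> ~ F n w.
  apply: contrapT => /forallNP h; apply: nl => n _.
  by have /existsNP[k /not_implyP[nk /contrapT Fk]] := h n; exists k.
have [n4 hn4] := @q4_small R T (andP T01).1.
have [n []] := hB (maxn (maxn N n1) (maxn n3 (maxn n4 j0.+1))).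
rewrite !geq_max => /andP[/andP[b1 b2] /andP[b3 /andP[b4 b5]]] Bw.
exists n; have [l1 l2] := ln1 n b2; split => //.
have n0 : (0 < n)%N by exact: leq_ltn_trans b5.
have [h1 _ _ [e0 h4] h5] := hx n b2; have [_ _ f3] := hF n.
set l := (x n).1.1 in h1 h5 f3; set e := (x n).2 in e0 h4 h5.
have nn : (n <= n ^ 2)%N by rewrite -mulnn leq_pmulr.
have N00 : (0 < n ^ 2)%N by rewrite expn_gt0 n0.
have qT k : (n <= k)%N -> (4^-1) ^+ k <= T by move=> nk; apply/ltW/hn4; exact: leq_trans nk.
have gw := hG w Gw.
have Ew : E n w.
  split => // q q' g1 g2.
  have b := @small_bound R d Omega u T j0 w (n ^ 2).-1 gw lk; rewrite (prednK N00) in b; apply: b => //.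
    by rewrite -ltnS (prednK N00); exact: leq_trans nn.
  by apply: qT; apply: (leq_trans nn); rewrite leq_pmull.
have lin := f3 b2 w Ew (hn3 n b3).
have W5 := h5 w Bw.
set r : R := (4^-1) ^+ (n ^ 2) in lin h4 *; have r0 : 0 < r by exact: q4_gt0.
have grid a b : (a < (4 ^ (4 * n)).+1)%N -> (b < (4 ^ (2 * n)).+1)%N -> (a <= 4 ^ (4 * (n ^ 2 + n)))%N -> (b <= 4 ^ (2 * (n ^ 2 + n)))%N ->
  `|u (tq (n ^ 2 + n) a) (xq (n ^ 2 + n) b) w| <= S * e + r / n.+1%:R.
  rewrite !ltnS => ha hb _ _; have g1 := lin a b ha hb; have g2 := W5 a b ha hb.
  set U := u _ _ w in g1 *.
  have := ler_normD (U - sigma 0 * wsum W (l a b) w) (sigma 0 * wsum W (l a b) w); rewrite subrK (normrM (sigma 0)) -/S.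
  move=> h; apply: (le_trans h); rewrite addrC; apply: lerD; [exact: ler_wpM2l|exact: g1].
have jN : (j0 <= n ^ 2 + n)%N by apply: leq_trans (leq_addl _ _); exact: ltnW b5.
have lq k : (4^-1 : R) ^+ (k * n ^ 2) < (4 ^ (k * n)).+1%:R * (4^-1) ^+ (k * (n ^ 2 + n)).
  rewrite -(natr1 (4 ^ (k * n))) mulrDl mul1r mulnDr exprD mulrCA expn4_q mulr1 ltrDl.
  by apply: mulr_gt0; exact: q4_gt0.
have H := @grid_sup R d Omega u T j0 w (n ^ 2 + n) (4 ^ (4 * n)).+1 (4 ^ (2 * n)).+1
  ((4^-1) ^+ (4 * n ^ 2)) ((4^-1) ^+ (2 * n ^ 2)) _ gw lk jN _ _ (lq 4) _ (lq 2) grid.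
have q1 k : (4^-1 : R) ^+ k <= 1 by rewrite exprn_ile1//; lra.
move=> s y hs hy.
have {}H : `|u s y w| <= S * e + r / n.+1%:R + tailB (n ^ 2 + n).
  apply: H => //; first by apply: qT; apply: (leq_trans nn); rewrite leq_pmull.
  by rewrite q1 ltW// q4_gt0.
have np : 0 < n.+1%:R :> R by rewrite ltr0n.
have tB : tailB (n ^ 2 + n) <= 4 * F3 * (r / n.+1%:R).
  have -> : tailB (n ^ 2 + n) = 4 * (r / n.+1%:R) * ((n ^ 2 + n).+1%:R * n.+1%:R * (4^-1) ^+ n).
    by rewrite /tailB exprD -/r; field; rewrite gt_eqF.
  rewrite [leRHS]mulrAC; apply: ler_wpM2l; first by rewrite mulr_ge0// divr_ge0// ltW.
  apply: (@le_trans _ _ (F3 * 4 ^+ n * (4^-1) ^+ n)); last by rewrite -mulrA -exprMn mulfV ?expr1n ?mulr1.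
  apply: ler_wpM2r; first by rewrite ltW// q4_gt0.
  apply: le_trans (hF3 n); rewrite exprSr; apply: ler_wpM2r => //.
  rewrite -natrX ler_nat -(mulnn n.+1) mulSn mulnS mulnn [(_ ^ 2 + n)%N]addnC addSn ltnS.
  by rewrite leq_add2l leq_addl.
pose z := (1 + 4 * F3) * (r / n.+1%:R).
have z0 : 0 <= z by rewrite mulr_ge0//; [lra|rewrite divr_ge0// ltW].
have Hz : `|u s y w| <= S * e + z by apply: (le_trans H); rewrite /z mulrDl mul1r addrA; exact: lerD.
have y0 : 0 <= ln (n%:R : R) by lra.
apply: (@le_trans _ _ (64 * ((S * e) ^+ 6 + z ^+ 6) * ln (n%:R : R))).
  apply: ler_wpM2r => //; apply: le_trans (add_pow6 _ z0); last exact: mulr_ge0.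
  by apply: lerXn2r; rewrite ?nnegrE ?addr_ge0// mulr_ge0.
rewrite -[leLHS]mulrA -[leRHS]mulrA; apply: ler_wpM2l => //.
rewrite [leLHS]mulrDl [leRHS]mulrDl; apply: lerD.
  by rewrite (exprMn 6 S) -[leLHS]mulrA -[leRHS]mulrA; apply: ler_wpM2l => //; exact: exprn_ge0.
rewrite /z (exprMn 6 (1 + 4 * F3)) -[leLHS]mulrA; apply: ler_wpM2l; first by apply: exprn_ge0; lra.
rewrite (exprMn 6 r) -[leLHS]mulrA -[leRHS]mulr1; apply: ler_wpM2l; first by apply: exprn_ge0; exact: ltW.
(* It remains that ln n <= (n + 1)^6: errors of relative size 1/(n + 1) are below the gauge. *)
rewrite exprVn mulrC ler_pdivrMr ?exprn_gt0// mul1r.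
have nR : 0 < n%:R :> R by rewrite ltr0n.
apply: (@le_trans _ _ n.+1%:R); last by rewrite exprS ler_peMr// exprn_ege1// ler1n.
apply: (@le_trans _ _ n%:R); last by rewrite ler_nat.
by have := expR_ge1Dx (ln (n%:R : R)); rewrite lnK//; lra.
Qed.

End upper_bound.

(** * The constant *)

Section gauge.
Context {R : realType}.
Implicit Types (r q : R).

Definition loglog r := ln (ln (1 / r)).
(** Below this radius ln(1/r) exceeds e, so the iterated logarithm exceeds 1 and the gauge is
    positive. *)
Definition rho0 : R := expR (- expR 1).

Lemma rho0_gt0 : 0 < rho0. Proof. exact: expR_gt0. Qed.

Lemma expR1_le4 : expR 1 <= 4 :> R.
Proof.
have := @expR_ge1Dx R (- 2^-1); rewrite expRN => h; have e0 := expR_gt0 (2^-1 : R).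
have h2 : expR 2^-1 <= 2 :> R by rewrite -[leRHS]invrK -[leLHS]invrK lef_pV2 ?posrE ?invr_gt0//; lra.
have -> : expR 1 = expR 2^-1 * expR 2^-1 :> R by rewrite -expRD; congr expR; field.
have -> : 4 = 2 * 2 :> R by ring.
by apply: ler_pM => //; exact: ltW.
Qed.

Lemma rho0_lt1 : rho0 < 1.
Proof. by rewrite /rho0 -expR0 ltr_expR oppr_lt0 expR_gt0. Qed.

Lemma ln_inv_gt r : 0 < r < rho0 -> expR 1 < ln (1 / r).
Proof.
move=> /andP[r0 rr]; rewrite div1r lnV ?posrE// ltrNr -(expRK (- expR 1)).
by rewrite ltr_ln ?posrE ?expR_gt0.
Qed.

Lemma loglog_gt1 r : 0 < r < rho0 -> 1 < loglog r.
Proof.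
move=> /ln_inv_gt h; rewrite /loglog -[ltLHS](expRK 1) ltr_ln ?posrE ?expR_gt0//.
exact: lt_trans h.
Qed.

Lemma gauge_gt0 r : 0 < r < rho0 -> 0 < chung_gauge r.
Proof.
move=> h; rewrite mulr_gt0//; first by case/andP: h.
by rewrite powR_gt0// -/(loglog r); have := loglog_gt1 h; lra.
Qed.

(** Removes the fractional power and connects the gauge with the probabilistic estimates, which are
    stated as sixth powers times a logarithm. *)
Lemma gauge_pow6 r : 0 < r < rho0 -> chung_gauge r ^+ 6 * loglog r = r ^+ 6.
Proof.
move=> h; have l0 : 0 < loglog r by have := loglog_gt1 h; lra.
rewrite /chung_gauge -/(loglog r) exprMn -(powR_mulrn 6 (powR_ge0 _ _)) -powRrM.
have -> : - (1 / 6) * 6%:R = -1 :> R by field.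
by rewrite powR_inv1 ?(ltW l0)// -mulrA mulVf ?mulr1// gt_eqF.
Qed.

Lemma gauge_continuous r : 0 < r < rho0 -> {for r, continuous (@chung_gauge R)}.
Proof.
move=> h; have [r0 _] := andP h; have l1 := ln_inv_gt h; have l2 := loglog_gt1 h.
have e0 := expR_gt0 (1 : R).
have c1 : (fun x : R => 1 / x) @ r --> 1 / r.
  by apply: cvgM; [exact: cvg_cst|apply: cvgV; [rewrite gt_eqF|exact: cvg_id]].
have c2 : (fun x : R => ln (1 / x)) @ r --> ln (1 / r).
  apply: (@cvg_comp _ _ _ (fun x : R => 1 / x) (@ln R)) c1 _.
  by apply: continuous_ln; rewrite divr_gt0.
have c3 : (fun x : R => loglog x) @ r --> loglog r.
  apply: (@cvg_comp _ _ _ (fun x : R => ln (1 / x)) (@ln R)) c2 _.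
  by apply: continuous_ln; apply: lt_trans l1.
have c4 : (fun x : R => loglog x `^ (- (1 / 6))) @ r --> loglog r `^ (- (1 / 6)).
  have cp : {for loglog r, continuous (fun y : R => y `^ (- (1 / 6)))}.
    apply: differentiable_continuous; apply/derivable1_diffP.
    by have [] := @is_derive1_powR R (- (1 / 6)) (loglog r) (lt_trans ltr01 l2).
  exact: (@cvg_comp _ _ _ (fun x : R => loglog x) (fun y => y `^ (- (1 / 6)))) c3 cp.
by apply: cvgM => //; exact: cvg_id.
Qed.

(** The rational is taken below [r], so that its box lies inside the box of [r]. *)
Lemma gauge_near r e : 0 < r < rho0 -> 0 < e -> exists q : rat, [/\ 0 < (rq q : R), rq q < r & `|chung_gauge r - chung_gauge (rq q : R)| < e].
Proof.
move=> h e0; have [r0 _] := andP h.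
have := gauge_continuous h => /cvgrPdist_lt/(_ _ e0)/nbhs_ballP[dl /= dl0 hd].
have lt : Num.max 0 (r - dl) < r by rewrite gt_max r0/=; lra.
have [q] := rat_in_itvoo lt; rewrite in_itv/= gt_max => /andP[/andP[q0 q1] q2].
exists q; split => //; apply: hd; rewrite /ball/= ger0_norm; first by rewrite /rq; lra.
by rewrite /rq; lra.
Qed.

Lemma ln4_bounds : 1 <= ln (4 : R) <= 2.
Proof.
have p4 : (0 : R) < 4 by [].
apply/andP; split.
  by rewrite -[leLHS](expRK 1) ler_ln ?posrE ?expR_gt0//; exact: expR1_le4.
rewrite -[leRHS](expRK 2) ler_ln ?posrE ?expR_gt0//.
have h := @expR_ge1Dx R 1; have -> : 2 = 1 + 1 :> R by ring.
rewrite expRD; have -> : 4 = (1 + 1) * (1 + 1) :> R by ring.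
by apply: ler_pM.
Qed.

Lemma ln_inv_q4 n : ln (1 / (4^-1) ^+ n) = n%:R * ln (4 : R).
Proof. by rewrite div1r exprVn invrK lnXn// mulr_natl. Qed.

Lemma rq_q4 n : rq ((4^-1) ^+ n) = (4^-1) ^+ n :> R.
Proof. by rewrite /rq rmorphXn/= fmorphV/= (_ : (4 : rat) = 4%:R)// ratr_nat. Qed.

End gauge.

(** * Germ events and identification of the constant *)

Section law.
Context {R : realType} {d : measure_display} {Omega : measurableType d}.
Context (P : probability Omega R) (W : set (R * R) -> Omega -> R).
Hypothesis hW : white_noise P W.
Variables (sigma : R -> R) (D : R).
Hypotheses (D0 : 0 <= D) (hLip : forall a b, `|sigma a - sigma b| <= D * `|a - b|).
Variable u : R -> R -> Omega -> R.
Hypothesis hu : mild_solution P W sigma (fun _ : R => 0) u.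
Hypothesis hcont : continuous_paths P u.
Hypothesis hs0 : sigma 0 != 0.

Definition small_at (c r : R) : set Omega := rat_bounded u (r ^+ 4) (r ^+ 2) (c * chung_gauge r).

(** Radii and points are rational, so this is a countable combination of conditions on u; the
    existential m makes it depend on arbitrarily small radii only. *)
Definition ev_large (c : R) : set Omega := [set w | exists m : nat, forall q : rat,
  0 < (rq q : R) -> rq q < m.+1%:R^-1 :> R -> ~ small_at c (rq q) w].

Lemma small_at_filtration c (r t : R) : 0 < r -> r < 1 -> r <= t -> noise_filtration P W t (small_at c r).
Proof.
move=> r0 r1 rt; rewrite noise_filtrationE; set DD := _ `*` _.
pose A n : set Omega := match unpickle n : option (rat * rat) with
  | Some q => if (0 <= (rq q.1 : R) <= r ^+ 4) && (0 <= (rq q.2 : R) <= r ^+ 2)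
     then [set w | `|u (rq q.1) (rq q.2) w| <= c * chung_gauge r] else setT
  | None => setT end.
rewrite (_ : small_at c r = \bigcap_n A n); last first.
  apply/seteqP; split => w.
    move=> h n _; rewrite /A; case: unpickle => // q; case: ifP => // /andP[h1 h2]; exact: h.
  move=> h q q' h1 h2; have := h (pickle (q, q')) Logic.I.
  by rewrite /A pickleK /= h1 h2.
apply: (@bigcapT_measurable _ (g_sigma_algebraType (noise_gen P W DD))) => n; rewrite /A.
case: unpickle => [q|]; last exact: (@measurableT _ (g_sigma_algebraType (noise_gen P W DD))).
case: ifP => [/andP[/andP[h1 h2] /andP[h3 h4]]|_]; last exact: (@measurableT _ (g_sigma_algebraType (noise_gen P W DD))).
have r41 : r ^+ 4 <= t by apply: le_trans rt; rewrite exprS ler_piMr ?(ltW r0)// exprn_ile1// ltW.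
have x1 : rq q.2 <= 1 :> R by apply: (le_trans h4); rewrite exprn_ile1// ltW.
have [ad _ _] := hu; have := ad (rq q.1) (rq q.2) h1; rewrite h3 x1 => /(_ isT) mw.
pose Bs : set R := [set x | `|x| <= c * chung_gauge r].
have mBs : measurable Bs.
  have : measurable_fun setT (fun x : R => `|x|) by [].
  move=> /(_ measurableT `]-oo, c * chung_gauge r]%classic (measurable_itv _)); rewrite setTI.
  by congr measurable; apply/seteqP; split => x /=; rewrite in_itv.
have := mw Bs mBs; rewrite noise_filtrationE; apply: noise_algS => z [/= z1 z2]; split => //=.
by move: z1; rewrite !in_itv/= => /andP[-> z1]; rewrite (le_trans z1)// (le_trans h2).
Qed.

(** Radii above [t] are discarded by enlarging m, and a radius r <= t with r < 1 involves u only up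
    to time r^4 <= t. *)
Lemma ev_large_filtration c (t : R) : 0 < t -> noise_filtration P W t (ev_large c).
Proof.
move=> t0.
have [M hM] : exists M : nat, M.+1%:R^-1 <= t :> R.
  exists (Num.bound t^-1); have h : t^-1 < (Num.bound t^-1)%:R by apply: archi_boundP; rewrite invr_ge0 ltW.
  rewrite -[leRHS]invrK lef_pV2 ?posrE ?invr_gt0//; apply: (le_trans (ltW h)); by rewrite ler_nat.
have mono (m m' : nat) : (m <= m')%N -> m'.+1%:R^-1 <= m.+1%:R^-1 :> R.
  by move=> h; rewrite lef_pV2 ?posrE// ler_nat.
pose ok m (q : rat) := (0 < (rq q : R)) && (rq q < (maxn m M).+1%:R^-1 :> R).
pose A (m n : nat) : set Omega := match unpickle n : option rat with
  | Some q => if ok m q then ~` small_at c (rq q) else setT | None => setT end.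
rewrite (_ : ev_large c = \bigcup_m \bigcap_n A m n); last first.
  apply/seteqP; split => w.
    move=> [m h]; exists m => // n _; rewrite /A; case: unpickle => // q; case: ifP => // /andP[q0 q1].
    by apply: h => //; apply: lt_le_trans q1 (mono _ _ (leq_maxl _ _)).
  move=> [m _ h]; exists (maxn m M) => q q0 q1; have := h (pickle q) Logic.I.
  by rewrite /A pickleK /ok q0 q1.
rewrite noise_filtrationE; set DD := _ `*` _.
apply: (@bigcupT_measurable _ (g_sigma_algebraType (noise_gen P W DD))) => m.
apply: (@bigcapT_measurable _ (g_sigma_algebraType (noise_gen P W DD))) => n; rewrite /A.
case: unpickle => [q|]; last exact: (@measurableT _ (g_sigma_algebraType (noise_gen P W DD))).
case: ifP => [/andP[q0 q1]|_]; last exact: (@measurableT _ (g_sigma_algebraType (noise_gen P W DD))).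
apply: (@measurableC _ (g_sigma_algebraType (noise_gen P W DD))).
have h1 := lt_le_trans q1 (mono _ _ (leq_maxr _ _)).
have := @small_at_filtration c (rq q) t q0 _ (ltW (lt_le_trans h1 hM)); rewrite noise_filtrationE; apply.
by apply: (lt_le_trans q1); rewrite invf_le1// ler1n.
Qed.

Lemma ev_large01 c : P (ev_large c) = 0%E \/ P (ev_large c) = 1%E.
Proof. by apply: (zero_one_law hW) => t; exact: ev_large_filtration. Qed.

Lemma measurable_ev_large c : measurable (ev_large c).
Proof. by have := ev_large_filtration c ltr01; rewrite noise_filtrationE; exact: noise_alg_measurable. Qed.

(** A radius between 4^-(n+1) and 4^-n inherits the lower bound of the smaller scale, its box being
    larger. As the probability is 0 or 1, reaching the event on the set [L] of positive probability
    is enough. *)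
Lemma chung_low : exists c : R, 0 < c /\ P (ev_large c) = 1%E.
Proof.
have [T [L [T01 mL PL hL]]] := exists_lambda hW hu hcont.
have hb w : L w -> bounded_on u T 1 w by move=> /hL[].
have [cA [cA0 hA]] := lower_bound hW D0 hLip hu hcont hs0 T01 mL hb.
(* 4^6 pays for r < 4 * 4^-(n+1); of the remaining 4, a factor 2 is for ln(n+1) <= 2 loglog r and a
   factor 2 for a strict contradiction. The minimum with 1 gives c^6 <= c. *)
pose c := Num.min 1 (cA / (4 * 4 ^+ 6)).
have c0 : 0 < c by rewrite lt_min ltr01 divr_gt0// mulr_gt0// exprn_gt0.
exists c; split => //; have [z|//] := ev_large01 c.
have sub : {ae P, forall w, L w -> ev_large c w}.
  apply: filterS hA => w h Lw; have [n0 hn0] := h Lw.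
  have [[cw _] _] := hL w Lw.
  pose e := Num.min (rho0 : R) ((4^-1) ^+ (n0 + 2)).
  have e0 : 0 < e by rewrite lt_min rho0_gt0 q4_gt0.
  have [m hm] : exists m : nat, m.+1%:R^-1 <= e.
    exists (Num.bound e^-1); have h' : e^-1 < (Num.bound e^-1)%:R by apply: archi_boundP; rewrite invr_ge0 ltW.
    rewrite -[leRHS]invrK lef_pV2 ?posrE ?invr_gt0//; apply: (le_trans (ltW h')); by rewrite ler_nat.
  exists m => q q0 qm; move: (rq q) q0 qm => r r0 rm sm.
  have := lt_le_trans rm hm; rewrite lt_min => /andP[rr rn].
  have rr' : 0 < r < rho0 by rewrite r0.
  have r1 : r < 1 by exact: lt_trans rho0_lt1.
  have ex : exists k : nat, (4^-1) ^+ k <= r by have [k hk] := q4_small r0; exists k; apply/ltW/hk.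
  case: (ex_minnP ex) => k hk mk.
  have k2 : (n0 + 2 < k)%N.
    rewrite ltnNge; apply/negP => kn; have := lt_le_trans rn (@q4_le R _ _ kn).
    by rewrite ltNge hk.
  case: k hk mk k2 => // n hk mk; rewrite ltnS => n2.
  have rn4 : r < (4^-1) ^+ n by rewrite ltNge; apply/negP => /mk; rewrite ltnn.
  have r2 : 0 < r ^+ 2 <= 1 by rewrite exprn_gt0// exprn_ile1// ltW.
  have all := rat_bounded_all (exprn_gt0 4 r0) r2 cw sm.
  have [t [x [t1 x1 lo]]] := hn0 n.+1 (leq_trans (leq_trans (leq_addr 2 n0) n2) (leqnSn n)).
  have up : `|u t x w| <= c * chung_gauge r.
    apply: all.
      have /andP[-> h1] := t1; apply: (le_trans h1); rewrite mulnC exprM; apply: lerXn2r => //; rewrite nnegrE.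
        by rewrite ltW// q4_gt0.
      exact: ltW.
    have /andP[-> h1] := x1; apply: (le_trans h1); rewrite mulnC exprM; apply: lerXn2r => //; rewrite nnegrE.
      by rewrite ltW// q4_gt0.
    exact: ltW.
  have g0 := gauge_gt0 rr'; have ll := loglog_gt1 rr'; have g6 := gauge_pow6 rr'.
  have nR : 2 <= n%:R :> R by rewrite (ler_nat R 2) (leq_trans _ n2)// leq_addl.
  have ln2 : ln (n.+1%:R : R) <= 2 * loglog r.
    have a1 : ln (n%:R : R) <= loglog r.
      rewrite /loglog ler_ln ?posrE; [|lra|by apply: lt_trans (ln_inv_gt rr'); exact: expR_gt0].
      apply: (@le_trans _ _ (ln (1 / (4^-1) ^+ n))).
        by rewrite ln_inv_q4; have /andP[h4 _] := @ln4_bounds R; rewrite ler_peMr//; lra.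
      rewrite ler_ln ?posrE ?divr_gt0 ?q4_gt0// !div1r lef_pV2 ?posrE ?q4_gt0//; exact: ltW.
    apply: (@le_trans _ _ (ln ((n%:R : R) ^+ 2))); last by rewrite lnXn ?mulr_natl//; [lra|lra].
    rewrite ler_ln ?posrE ?exprn_gt0//; last by lra.
    have n2' : 2 * n%:R <= n%:R * n%:R :> R by exact: ler_wpM2r.
    by rewrite -(natr1 n) expr2; lra.
  have u6 : `|u t x w| ^+ 6 <= c ^+ 6 * chung_gauge r ^+ 6.
    by rewrite -exprMn; apply: lerXn2r => //; rewrite nnegrE mulr_ge0// ltW.
  have c6 : c ^+ 6 <= cA / (4 * 4 ^+ 6).
    have c1 : c <= 1 by rewrite ge_min lexx.
    apply: (@le_trans _ _ c); last by rewrite ge_min lexx orbT.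
    by rewrite exprS ler_piMr ?(ltW c0)// exprn_ile1// ltW.
  have b1 : cA * ((4^-1) ^+ n.+1) ^+ 6 <= c ^+ 6 * chung_gauge r ^+ 6 * (2 * loglog r).
    apply: (le_trans lo); by apply: ler_pM => //; rewrite ln_ge0// ler1n.
  have b2 : c ^+ 6 * chung_gauge r ^+ 6 * (2 * loglog r) = 2 * c ^+ 6 * r ^+ 6 by rewrite -g6; ring.
  have b3 : r ^+ 6 <= ((4^-1) ^+ n) ^+ 6.
    apply: lerXn2r; [rewrite nnegrE; exact: ltW|rewrite nnegrE; apply: ltW; exact: q4_gt0|exact: ltW].
  have p6 : 0 < ((4^-1 : R) ^+ n) ^+ 6 by rewrite exprn_gt0// q4_gt0.
  rewrite b2 in b1.
  have b4 : 2 * c ^+ 6 * r ^+ 6 <= 2 * (cA / (4 * 4 ^+ 6)) * ((4^-1) ^+ n) ^+ 6.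
    apply: ler_pM => //; [by rewrite mulr_ge0// exprn_ge0// ltW|by rewrite exprn_ge0// ltW|by apply: ler_wpM2l].
  have b5 : cA * ((4^-1) ^+ n.+1) ^+ 6 = (cA / 4 ^+ 6) * ((4^-1) ^+ n) ^+ 6.
    have e46 : (4^-1 : R) ^+ 6 = (4 ^+ 6)^-1 by rewrite exprVn.
    by rewrite (exprS (4^-1) n) (exprMn 6) e46 mulrA.
  have b6 : 2 * (cA / (4 * 4 ^+ 6)) = 2^-1 * (cA / 4 ^+ 6) by field.
  have := le_trans b1 b4; rewrite b5 b6; have : 0 < cA / 4 ^+ 6 * ((4^-1) ^+ n) ^+ 6 by rewrite mulr_gt0// divr_gt0// exprn_gt0.
  rewrite -[2^-1 * _ * _]mulrA; move: (_ * _) => y y0; lra.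
have [N [mN PN hN]] := sub; move: PL; rewrite ltNge => /negP; case.
apply: (@le_trans _ _ (P (ev_large c `|` N))).
  apply: prob_le => //; first by apply: measurableU => //; exact: measurable_ev_large.
  move=> w Lw; have [|nw] := pselect (ev_large c w); [by left|right; apply: hN => /= h; exact/nw/h].
refine (le_trans (measureU2 P (measurable_ev_large c) mN) _).
by rewrite [X in (X + _)%E]z [X in (_ + X)%E]PN adde0.
Qed.

Lemma chung_high : exists c : R, 0 < c /\ P (ev_large c) = 0%E.
Proof.
have [T [L [T01 mL PL hL]]] := exists_lambda hW hu hcont.
have hb w : L w -> bounded_on u T 1 w by move=> /hL[].
have [C [C0 hC]] := upper_bound hW D0 hLip hu hcont hs0 T01 mL hb.
(* At r = 4^(-n^2) with n >= 2 one has loglog r <= 3 ln n; the added 1 gives c >= 1, hence c <=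
   c^6. *)
pose c := 3 * C + 1; have c1 : 1 <= c by rewrite /c; lra.
have c0 : 0 < c by lra.
exists c; split => //; have [//|o] := ev_large01 c.
have sub : {ae P, forall w, L w -> ~ ev_large c w}.
  apply: filterS hC => w h Lw [m hm].
  have e0 : 0 < Num.min (rho0 : R) m.+1%:R^-1 by rewrite lt_min rho0_gt0/= invr_gt0 ltr0n.
  have [M hM] := q4_small e0.
  have [n [nM ln1 bd]] := h Lw (maxn M 2).
  move: nM; rewrite geq_max => /andP[nM n2].
  have n0 : (0 < n)%N by exact: leq_trans n2.
  have nn : (M <= n ^ 2)%N by apply: (leq_trans nM); rewrite -mulnn leq_pmulr.
  have := hM _ nn; rewrite lt_min => /andP[rr rm].
  have r0 := @q4_gt0 R (n ^ 2).
  apply: (hm ((4^-1) ^+ (n ^ 2))); rewrite ?rq_q4//.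
  move: bd; rewrite mulnC exprM (mulnC 2) exprM; set r : R := (4^-1) ^+ (n ^ 2) in rr rm r0 *.
  have rr' : 0 < r < rho0 by rewrite r0.
  move=> bd q q' h1 h2; have b := bd _ _ h1 h2.
  have g0 := gauge_gt0 rr'; have ll := loglog_gt1 rr'; have g6 := gauge_pow6 rr'.
  have nR : 2 <= n%:R :> R by rewrite (ler_nat R 2).
  have l3 : loglog r <= 3 * ln (n%:R : R).
    have -> : 3 * ln (n%:R : R) = ln ((n%:R : R) ^+ 3) by rewrite lnXn ?mulr_natl//; lra.
    rewrite /loglog ler_ln ?posrE ?exprn_gt0//; [|by apply: lt_trans (ln_inv_gt rr'); exact: expR_gt0|lra].
    have -> : (n%:R : R) ^+ 3 = n%:R ^+ 2 * n%:R by ring.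
    rewrite /r ln_inv_q4 natrX; apply: ler_wpM2l; first exact: sqr_ge0.
    by have /andP[_ h4] := @ln4_bounds R; exact: le_trans h4 nR.
  have cg : 0 <= c * chung_gauge r by rewrite mulr_ge0// ltW.
  rewrite -(@ler_pXn2r R 6)// ?nnegrE//.
  have lp : 0 < ln (n%:R : R) by lra.
  rewrite -(ler_pM2r lp); apply: (le_trans b).
  have c6 : c <= c ^+ 6 by rewrite exprS ler_peMr ?exprn_ege1//; lra.
  have r6 : 0 <= r ^+ 6 by rewrite exprn_ge0// ltW.
  have g60 : 0 <= chung_gauge r ^+ 6 by rewrite exprn_ge0// ltW.
  have d1 : r ^+ 6 <= 3 * (chung_gauge r ^+ 6 * ln (n%:R : R)).
    by rewrite -g6 mulrCA; apply: ler_wpM2l.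
  rewrite exprMn -mulrA; move: (_ * ln _) d1 => y d1.
  have y0 : 0 <= y by lra.
  apply: (@le_trans _ _ (c * y)); last by apply: ler_wpM2r.
  have := ler_wpM2l (ltW C0) d1; rewrite /c mulrDl mul1r; lra.
have [N [mN PN hN]] := sub; move: PL; rewrite ltNge => /negP; case.
apply: (@le_trans _ _ (P (~` ev_large c `|` N))).
  apply: prob_le => //; first by apply: measurableU => //; apply: measurableC; exact: measurable_ev_large.
  move=> w Lw; have [nw|nw] := pselect (ev_large c w); [right; apply: hN => /= h; exact: h Lw nw|by left].
refine (le_trans (measureU2 P (measurableC (measurable_ev_large c)) mN) _).
have e1 : P (~` ev_large c) = 0%E.
  rewrite probability_setC; first by rewrite [X in (1 - X)%E]o subee.
  exact: measurable_ev_large.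
by rewrite [X in (X + _)%E]e1 [X in (_ + X)%E]PN adde0.
Qed.

Lemma ev_largeS (c c' : R) : c <= c' -> ev_large c' `<=` ev_large c.
Proof.
move=> cc w [m h].
have e0 : 0 < Num.min (rho0 : R) m.+1%:R^-1 by rewrite lt_min rho0_gt0/= invr_gt0 ltr0n.
have [k hk] : exists k : nat, k.+1%:R^-1 <= Num.min (rho0 : R) m.+1%:R^-1.
  set e := Num.min _ _ in e0 *.
  exists (Num.bound e^-1); have h' : e^-1 < (Num.bound e^-1)%:R by apply: archi_boundP; rewrite invr_ge0 ltW.
  rewrite -[leRHS]invrK lef_pV2 ?posrE ?invr_gt0//; apply: (le_trans (ltW h')); by rewrite ler_nat.
exists k => q q0 qk sm; have := lt_le_trans qk hk; rewrite lt_min => /andP[q1 q2].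
apply: (h q q0 q2) => a b ha hb; apply: (le_trans (sm a b ha hb)).
by apply: ler_wpM2r => //; apply/ltW/gauge_gt0; rewrite q0.
Qed.

(** Real radii are reached from rational ones just below: boxes grow with the radius and the gauge
    is continuous. *)
Lemma scaled_sup_ge (c r : R) w m : 0 < c -> 0 < r < rho0 -> r < m.+1%:R^-1 ->
  (forall q : rat, 0 < (rq q : R) -> rq q < m.+1%:R^-1 :> R -> ~ small_at c (rq q) w) ->
  (c%:E <= scaled_sup u w r)%E.
Proof.
move=> c0 rr rm h; have g0 := gauge_gt0 rr; apply/lee_addgt0Pr => e e0.
have [r0 _] := andP rr.
have e1 : 0 < e * chung_gauge r / c by rewrite divr_gt0// mulr_gt0.
have [q [q0 qr qe]] := gauge_near rr e1.
have := h q q0 (lt_trans qr rm) => /existsNP[a] /existsNP[b] /not_implyP[ha] /not_implyP[hb] /negP.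
rewrite -ltNge => lt.
apply: (@le_trans _ _ ((`|u (rq a) (rq b) w| / chung_gauge r)%:E + e%:E)%E).
  rewrite -EFinD lee_fin -(ler_pM2r g0) mulrDl divfK ?gt_eqF//.
  move: qe; rewrite ltr_pdivlMr// => qe.
  have := ler_wpM2r (ltW c0) (ler_norm (chung_gauge r - chung_gauge (rq q))).
  by rewrite mulrBl; lra.
apply: leeD => //; apply: ereal_sup_ubound; exists (rq a, rq b) => //; split; rewrite /= in_itv/=.
  have /andP[-> h1] := ha; apply: (le_trans h1); apply: lerXn2r; rewrite ?nnegrE ?(ltW q0) ?(ltW r0)//; exact: ltW.
have /andP[-> h1] := hb; apply: (le_trans h1); apply: lerXn2r; rewrite ?nnegrE ?(ltW q0) ?(ltW r0)//; exact: ltW.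
Qed.

Lemma scaled_sup_le (c r : R) w : good_path u w -> 0 < r < rho0 -> small_at c r w ->
  (scaled_sup u w r <= c%:E)%E.
Proof.
move=> [cw _] rr sm; have g0 := gauge_gt0 rr; have [r0 rr0] := andP rr.
have r1 : r < 1 by exact: lt_trans rr0 rho0_lt1.
have r2 : 0 < r ^+ 2 <= 1 by rewrite exprn_gt0// exprn_ile1// ltW.
have all := rat_bounded_all (exprn_gt0 4 r0) r2 cw sm.
apply: ub_ereal_sup => _ [[s y] [/= hs hy] <-]; rewrite lee_fin ler_pdivrMr//.
by apply: all; [move: hs|move: hy]; rewrite in_itv.
Qed.

Lemma ae_of_prob1 (E : set Omega) : measurable E -> P E = 1%E -> {ae P, forall w, E w}.
Proof.
move=> mE PE; exists (~` E); split => //; first exact: measurableC.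
by rewrite probability_setC// [X in (1 - X)%E]PE subee.
Qed.

Lemma ae_of_prob0 (E : set Omega) : measurable E -> P E = 0%E -> {ae P, forall w, ~ E w}.
Proof. by move=> mE PE; exists E; split => // w /= /contrapT. Qed.

Lemma inv_lt_ex (e : R) : 0 < e -> exists m : nat, m.+1%:R^-1 <= e.
Proof.
move=> e0; exists (Num.bound e^-1).
have h' : e^-1 < (Num.bound e^-1)%:R by apply: archi_boundP; rewrite invr_ge0 ltW.
by rewrite -[leRHS]invrK lef_pV2 ?posrE ?invr_gt0//; apply: (le_trans (ltW h')); rewrite ler_nat.
Qed.

Lemma liminf_le (c : R) w : good_path u w -> ~ ev_large c w ->
  (limf_einf (scaled_sup u w) (0 : R)^'+ <= c%:E)%E.
Proof.
move=> gw nE; rewrite limf_einfE; apply: ub_ereal_sup => _ [V FV <-].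
move: FV; rewrite /= => /nbhs_ballP[dl /= dl0 hV].
have e0 : 0 < Num.min (rho0 : R) dl by rewrite lt_min rho0_gt0/=.
have [m hm] := inv_lt_ex e0.
have := nE => /forallNP/(_ m)/existsNP[q] /not_implyP[q0] /not_implyP[qm] /contrapT sm.
have := lt_le_trans qm hm; rewrite lt_min => /andP[q1 q2].
have rr : 0 < (rq q : R) < rho0 by rewrite q0.
apply: le_trans (scaled_sup_le gw rr sm); apply: ereal_inf_lbound; exists (rq q) => //.
by apply: hV => //; rewrite /ball/= sub0r normrN gtr0_norm.
Qed.

Lemma liminf_ge (c : R) w : 0 < c -> ev_large c w ->
  (c%:E <= limf_einf (scaled_sup u w) (0 : R)^'+)%E.
Proof.
move=> c0 [m hm]; rewrite limf_einfE.
pose e : R := Num.min rho0 m.+1%:R^-1.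
have e0 : 0 < e by rewrite lt_min rho0_gt0/= invr_gt0 ltr0n.
pose V : set R := [set r | 0 < r < e].
apply: (@le_trans _ _ (ereal_inf [set scaled_sup u w x | x in V])); last first.
  apply: ereal_sup_ubound; exists V => //; apply/nbhs_ballP; exists e => //= y.
  by rewrite /ball/= sub0r normrN => h y0; rewrite /V/= y0/=; move: h; rewrite gtr0_norm.
apply: le_ereal_inf_tmp => _ [r /andP[r0 +] <-]; rewrite lt_min => /andP[r1 r2].
by apply: scaled_sup_ge r2 hm => //; rewrite r0.
Qed.

(** [kappa] is the supremum of the levels whose event has probability one. By monotonicity and the
    dichotomy 0 or 1 the events are almost sure below it and null above it, and countably many
    levels on each side pin down the liminf. *)
Lemma chung_law : exists kappa : R, 0 < kappa /\
  {ae P, forall w, limf_einf (scaled_sup u w) (0 : R)^'+ = kappa%:E}.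
Proof.
have [c1 [c10 p1]] := chung_low; have [c2 [c20 p2]] := chung_high.
pose A : set R := [set c | 0 < c /\ P (ev_large c) = 1%E].
have A1 : A c1 by [].
have ub : ubound A c2.
  move=> c [c0 pc]; rewrite leNgt; apply/negP => lt.
  have : (P (ev_large c) <= P (ev_large c2))%E.
    by apply: prob_le; [exact: measurable_ev_large|exact: measurable_ev_large|exact: ev_largeS (ltW lt)].
  by rewrite pc p2 lee_fin ler10.
have hs : has_sup A by split; [exists c1|exists c2].
pose kappa := sup A.
have k0 : 0 < kappa by apply: lt_le_trans c10 _; exact: (sup_upper_bound hs).
exists kappa; split => //.
(* Divisors from 2 on keep the level positive, as [liminf_ge] requires. *)
have low k : P (ev_large (kappa - kappa / k.+2%:R)) = 1%E.
  have e0 : 0 < kappa / k.+2%:R by rewrite divr_gt0.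
  have [c [c0 pc] lt] := sup_adherent e0 hs.
  have [z|//] := ev_large01 (kappa - kappa / k.+2%:R).
  have : (P (ev_large c) <= P (ev_large (kappa - kappa / k.+2%:R)))%E.
    by apply: prob_le; [exact: measurable_ev_large|exact: measurable_ev_large|exact: ev_largeS (ltW lt)].
  by rewrite pc z lee_fin ler10.
have high k : P (ev_large (kappa + k.+1%:R^-1)) = 0%E.
  have [//|o] := ev_large01 (kappa + k.+1%:R^-1).
  have i0 : 0 < k.+1%:R^-1 :> R by rewrite invr_gt0 ltr0n.
  have : kappa + k.+1%:R^-1 <= kappa by apply: (sup_upper_bound hs); split => //; exact: addr_gt0.
  by rewrite gerDl leNgt i0.
have [G [mG PG hG]] := exists_good hW hu hcont.
have a1 : {ae P, forall w, forall k, ev_large (kappa - kappa / k.+2%:R) w}.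
  by apply: ae_foralln => k; apply: ae_of_prob1 => //; exact: measurable_ev_large.
have a2 : {ae P, forall w, forall k, ~ ev_large (kappa + k.+1%:R^-1) w}.
  by apply: ae_foralln => k; apply: ae_of_prob0 => //; exact: measurable_ev_large.
apply: filterS3 (ae_of_prob1 mG PG) a1 a2 => w Gw h1 h2.
apply/eqP; rewrite eq_le; apply/andP; split; apply/lee_addgt0Pr => e e0.
  have [k hk] := inv_lt_ex e0.
  apply: (le_trans (liminf_le (hG w Gw) (h2 k))).
  by rewrite -EFinD lee_fin lerD2l.
have ek : 0 < e / kappa by rewrite divr_gt0.
have [k hk] := inv_lt_ex ek.
have h3 : kappa / k.+2%:R <= e.
  rewrite -ler_pdivlMl// mulrC; apply: le_trans hk.
  by rewrite lef_pV2 ?posrE// ler_nat.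
have lt : 0 < kappa - kappa / k.+2%:R.
  by rewrite subr_gt0 ltr_pdivrMr// ltr_pMr// (ltr_nat R 1).
apply: (@le_trans _ _ ((kappa - kappa / k.+2%:R)%:E + e%:E)%E).
  by rewrite -EFinD lee_fin -addrA lerDl addrC subr_ge0.
by apply: leeD => //; exact: liminf_ge (h1 k).
Qed.

End law.

Theorem theorem2p2 (R : realType) (d : measure_display)
    (Omega : measurableType d) (P : probability Omega R)
    (W : set (R * R) -> Omega -> R) (hW : white_noise P W)
    (sigma : R -> R)
    (hLip : exists D : R, 0 <= D /\
       forall a b : R, `|sigma a - sigma b| <= D * `|a - b|)
    (hsigma0 : sigma 0 <> 0)
    (u : R -> R -> Omega -> R)
    (hu : mild_solution P W sigma (fun _ : R => 0) u)
    (hcont : continuous_paths P u) :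
  exists kappa : R, 0 < kappa /\
    {ae P, forall w, limf_einf (scaled_sup u w) (0 : R)^'+ = kappa%:E}.
Proof.
have [D [D0 hD]] := hLip; have hs0 : sigma 0 != 0 by apply/eqP.
exact: (chung_law hW D0 hD hu hcont hs0).
Qed.
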